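(* Up to isomorphism and permutations of the factors, there are exactly $1,2,4,11,32$ minimal border rank $1_*$-generic tensors in $\mathbb{C}^m\otimes\mathbb{C}^m\otimes\mathbb{C}^m$ for $m=1,2,3,4,5$, respectively.
   Context: Let $A,B,C$ be copies of $\mathbb{C}^m$. The rank of $T\in A\otimes B\otimes C$ is the smallest $r$ such that $T=\sum_{i=1}^r a_i\otimes b_i\otimes c_i$; its border rank is the smallest $r$ such that $T$ is a limit of tensors of rank at most $r$. A tensor is concise if the three induced linear maps $T_A\colon A^\vee\to B\otimes C$, $T_B\colon B^\vee\to A\otimes C$, $T_C\colon C^\vee\to A\otimes B$ are injective. A tensor has minimal border rank if it is concise and has border rank $m$. A tensor is $1_A$-generic if the image of $T_A$ contains an element of rank $m$ (similarly $1_B$-, $1_C$-generic), and $1_*$-generic if it is at least one of $1_A$-, $1_B$-, $1_C$-generic. Two tensors are isomorphic up to permutations if they lie in the same orbit of $(\mathrm{GL}(A)\times\mathrm{GL}(B)\times\mathrm{GL}(C))\rtimes\Sigma_3$, where $\Sigma_3$ permutes the tensor factors. *)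

(* Defs.v *)
From HB Require Import structures.
From mathcomp Require Import all_boot all_order all_algebra all_fingroup.
From mathcomp Require Import complex.
From mathcomp Require Import all_classical all_reals all_analysis.

Set Implicit Arguments.
Unset Strict Implicit.
Unset Printing Implicit Defensive.

Import Order.TTheory GRing.Theory Num.Theory.
Import numFieldNormedType.Exports.
Local Open Scope classical_set_scope.
Local Open Scope ring_scope.

(* Vectors of K^m are columns, linear forms on K^m are rows, an element of
   K^m (x) K^m (x) K^m is its array of coordinates in the standard basis, and
   an element of K^m (x) K^m is an m x m matrix. *)
Definition tensor (K : numFieldType) (m : nat) :=
  {ffun 'I_m * 'I_m * 'I_m -> K}.

Definition simple_tensor (K : numFieldType) (m : nat) (a b c : 'cV[K]_m) :
    tensor K m :=
  [ffun x => a x.1.1 0 * b x.1.2 0 * c x.2 0].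

Definition sum_of_simple (K : numFieldType) (m r : nat) (T : tensor K m) :
    Prop :=
  exists a b c : 'I_r -> 'cV[K]_m,
    T = \sum_(i < r) (simple_tensor (a i) (b i) (c i) :
                        {ffun 'I_m * 'I_m * 'I_m -> K}).

Lemma sum_of_simple_ex (K : numFieldType) (m : nat) (T : tensor K m) :
  exists r, `[< sum_of_simple r T >].
Proof.
exists #|{: 'I_m * 'I_m * 'I_m}|; apply/asboolP.
exists (fun s => T (enum_val s) *: delta_mx (enum_val s).1.1 0),
       (fun s => delta_mx (enum_val s).1.2 0),
       (fun s => delta_mx (enum_val s).2 0).
apply/ffunP => x; rewrite sum_ffunE.
rewrite (bigD1 (enum_rank x)) //= big1 => [|s sx].
  by rewrite ffunE enum_rankK !mxE !eqxx !mulr1 addr0.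
have {sx} : enum_val s != x by apply: contraNneq sx => <-; rewrite enum_valK.
move: (enum_val s) => -[[i j] k]; case: x => -[i' j'] k' ne.
rewrite !ffunE !mxE /= !andbT.
case: (eqVneq i' i) => [ei|_]; last by rewrite !mulr0 !mul0r.
case: (eqVneq j' j) => [ej|_]; last by rewrite mulr0 mul0r.
case: (eqVneq k' k) => [ek|_]; last by rewrite mulr0.
by rewrite ei ej ek eqxx in ne.
Qed.

Definition tensor_rank (K : numFieldType) (m : nat) (T : tensor K m) : nat :=
  ex_minn (sum_of_simple_ex T).

Definition limit_of_rank_le (K : numFieldType) (m r : nat) (T : tensor K m) :
    Prop :=
  exists u : nat -> tensor K m,
    (forall n, (tensor_rank (u n) <= r)%N) /\
    (forall x, (fun n => u n x) @ \oo --> T x).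

Lemma limit_of_rank_le_ex (K : numFieldType) (m : nat) (T : tensor K m) :
  exists r, `[< limit_of_rank_le r T >].
Proof.
exists (tensor_rank T); apply/asboolP; exists (fun=> T).
by split=> // x; apply: cvg_cst.
Qed.

Definition border_rank (K : numFieldType) (m : nat) (T : tensor K m) : nat :=
  ex_minn (limit_of_rank_le_ex T).

Definition contractA (K : numFieldType) (m : nat) (T : tensor K m)
    (f : 'rV[K]_m) : 'M[K]_m :=
  \matrix_(j, k) \sum_(i < m) f 0 i * T (i, j, k).

Definition contractB (K : numFieldType) (m : nat) (T : tensor K m)
    (f : 'rV[K]_m) : 'M[K]_m :=
  \matrix_(i, k) \sum_(j < m) f 0 j * T (i, j, k).

Definition contractC (K : numFieldType) (m : nat) (T : tensor K m)
    (f : 'rV[K]_m) : 'M[K]_m :=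
  \matrix_(i, j) \sum_(k < m) f 0 k * T (i, j, k).

Definition concise (K : numFieldType) (m : nat) (T : tensor K m) : Prop :=
  [/\ injective (contractA T), injective (contractB T)
    & injective (contractC T)].

Definition minimal_border_rank (K : numFieldType) (m : nat) (T : tensor K m) :
    Prop :=
  concise T /\ border_rank T = m.

Definition oneA_generic (K : numFieldType) (m : nat) (T : tensor K m) : Prop :=
  exists f, \rank (contractA T f) = m.

Definition oneB_generic (K : numFieldType) (m : nat) (T : tensor K m) : Prop :=
  exists f, \rank (contractB T f) = m.

Definition oneC_generic (K : numFieldType) (m : nat) (T : tensor K m) : Prop :=
  exists f, \rank (contractC T f) = m.

Definition one_star_generic (K : numFieldType) (m : nat) (T : tensor K m) :
    Prop :=
  [\/ oneA_generic T, oneB_generic T | oneC_generic T].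

Definition gl_act (K : numFieldType) (m : nat) (g h k : 'M[K]_m)
    (T : tensor K m) : tensor K m :=
  [ffun x => \sum_(i < m) \sum_(j < m) \sum_(l < m)
               g x.1.1 i * h x.1.2 j * k x.2 l * T (i, j, l)].

Definition perm_factors (K : numFieldType) (m : nat) (s : 'S_3)
    (T : tensor K m) : tensor K m :=
  [ffun x => let y := [tuple x.1.1; x.1.2; x.2] in
             T (tnth y (s 0), tnth y (s 1), tnth y (s 2))].

(* Every element of (GL x GL x GL) ><| S_3 is a permutation of the factors
   followed by a triple of invertible matrices. *)
Definition tensor_orbit (K : numFieldType) (m : nat) (T : tensor K m) :
    set (tensor K m) :=
  [set T' | exists (s : 'S_3) (g h k : 'M[K]_m),
     [/\ g \in unitmx, h \in unitmx, k \in unitmx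
       & T' = gl_act g h k (perm_factors s T)]].

Definition min_br_one_star_orbits (K : numFieldType) (m : nat) :
    set (set (tensor K m)) :=
  [set tensor_orbit T | T in
     [set T : tensor K m | minimal_border_rank T /\ one_star_generic T]].

Arguments min_br_one_star_orbits : clear implicits.

(* Main.v *)
(* After a permutation of the factors a 1_*-generic tensor T of minimal border rank m is 1_A-
   generic: writing X_f = T_A(f), some X_g is invertible. Strassen's equations, obtained in the
   limit from diagonal tensors, say that the space V of all X_f X_g^-1 is an m-dimensional
   unital commutative algebra of m x m matrices, and T is determined up to isomorphism by the
   conjugacy class of V; transposing V exchanges the factors B and C. So one classifies these
   algebras up to conjugation and transposition: idempotents reduce to local algebras, and these
   are treated according to the nilpotency of their maximal ideal, using that V has a cyclic or
   cocyclic vector when its socle is small and Kronecker's pencils when the maximal ideal has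
   square zero. Conversely every model has border rank m by an explicit polynomial family of
   rank m tensors. Finally the models are told apart by the dimensions of g, g.g and g.g.g,
   where g is the annihilator of T in gl(A) x gl(B) x gl(C) and products are componentwise
   matrix products. *)
Require Import Defs.
From HB Require Import structures.
From mathcomp Require Import all_boot all_order all_algebra.
From mathcomp Require Import boolp.
From mathcomp Require Import zify ring.

Set Implicit Arguments.
Unset Strict Implicit.
Unset Printing Implicit Defensive.

Import Order.TTheory GRing.Theory Num.Theory.
Local Open Scope ring_scope.

(** * Models and spans *)

(** Matrix algebras with the same multiplication table need not be conjugate, so a table classifies
    V only when some vector is cyclic for V or for its transpose; the other models need a frame
    adapted to the action on row vectors. An idempotent cuts V into blocks, but a block of size r
    need not have dimension r: commuting matrices of size r can span more than r dimensions as soon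
    as r > 3. Hence the splitting uses idempotents of rank 1, or else blocks of sizes 2 + 2 and 3 +
    2, where a local block has dimension at most its size and the sum of the dimensions forces
    equality. The counts are then 1, 1 + 1, 2 + 2, 6 + 4 + 1 and 19 + 11 + 2, with the local
    algebras in front. The annihilator g separates orbits because the group acts on it by
    conjugation and by permuting its components, and both preserve componentwise products. All
    dimensions involved are ranks of integer vectors, found by an elimination that is run inside the
    proof. *)

(* A slice is the list of the nonzero entries (row, column, value) of a matrix,
   a model is a list of slices. *)
Definition slice := seq (nat * nat * int).
Definition model := seq slice.

(** Row j of the slice l, read as a matrix, times the column of vectors p. The module M is arbitrary
    because p is a list of matrices in a multiplication table and a list of row vectors in a
    frame. *)
Definition slice_act (K : pzRingType) (M : lmodType K) (l : slice) (p : seq M)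
    (j : nat) : M :=
  \sum_(e <- l | e.1.1 == j) e.2%:~R *: p`_e.1.2.

Section Lin.
Variables (K : fieldType) (vT : vectType K).
Implicit Types (s : seq vT) (V : {vspace vT}).

(** Coefficients are functions on [nat], so that a list whose size is known only through an equation
    can be summed over without casts between ordinals. *)
Lemma mem_spanP s x :
  reflect (exists a : nat -> K, x = \sum_(i < size s) a i *: s`_i)
          (x \in <<s>>%VS).
Proof.
apply: (iffP idP) => [xs|[a ->]].
  exists (fun i => if insub i is Some j then coord (in_tuple s) j x else 0).
  rewrite [LHS](@coord_span _ _ _ (in_tuple s) x xs); apply: eq_bigr => i _.
  by rewrite valK.
by apply: memv_suml => i _; rewrite memvZ // memv_span // mem_nth.
Qed.

Lemma freeNP s :
  (forall a : nat -> K, \sum_(i < size s) a i *: s`_i = 0 ->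
     forall i, (i < size s)%N -> a i = 0) -> free s.
Proof.
move=> H; apply/(@freeP _ _ _ (in_tuple s)) => k sk i.
have := H (fun i => if insub i is Some j then k j else 0).
move=> /(_ _ i (ltn_ord i)); rewrite valK; apply.
by rewrite -[RHS]sk; apply: eq_bigr => j _; rewrite valK.
Qed.

Lemma freeN0 s (a : nat -> K) : free s -> \sum_(i < size s) a i *: s`_i = 0 ->
   forall i, (i < size s)%N -> a i = 0.
Proof.
move=> /(@freeP _ _ _ (in_tuple s)) F sa i i_s.
exact: (F (fun j => a j) sa (Ordinal i_s)).
Qed.

Lemma exists_notin_span s V :
  (size s < \dim V)%N -> exists2 y, y \in V & y \notin <<s>>%VS.
Proof.
move=> sV; have /subvPn[y yV ys] : ~~ (V <= <<s>>)%VS.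
  by apply: contraL sV => /dimvS; rewrite -leqNgt => /leq_trans; apply; exact: dim_span.
by exists y.
Qed.

Lemma free_basis s V : free s -> {subset s <= V} -> size s = \dim V ->
  basis_of V s.
Proof.
move=> fs sV sd; rewrite basisEfree fs sd leqnn andbT /=.
by apply/span_subvP.
Qed.

Lemma basis_size s V : basis_of V s -> size s = \dim V.
Proof. by move=> b; rewrite -(span_basis b); apply/esym/eqP; exact: basis_free b. Qed.

End Lin.

(** * Nilpotent elements *)

Section Nil.
Variables (K : fieldType) (A : unitAlgType K).
Definition nilp (x : A) := exists k, x ^+ k = 0.

Lemma nilp0 : nilp 0.
Proof. by exists 1%N; rewrite expr1. Qed.

Lemma nilpZ a x : nilp x -> nilp (a *: x).
Proof. by case=> k xk; exists k; rewrite exprZn xk scaler0. Qed.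

Lemma nilpD x y : GRing.comm x y -> nilp x -> nilp y -> nilp (x + y).
Proof.
move=> xy [k xk] [l yl]; exists (k + l)%N; rewrite exprDn_comm //.
apply: big1 => i _; case: (leqP l i) => li.
  by rewrite -(subnK li) [y ^+ _]exprD yl !mulr0 mul0rn.
have ki : (k <= k + l - i)%N by rewrite -addnBA ?leq_addr // ltnW.
by rewrite -(subnK ki) [x ^+ _]exprD xk mulr0 mul0r mul0rn.
Qed.

Lemma nilpM x y : GRing.comm x y -> nilp x -> nilp (x * y).
Proof. by move=> xy [k xk]; exists k; rewrite exprMn_comm // xk mul0r. Qed.

(** By iteration x^j y = a^j y, and x^j = 0 for some j. *)
Lemma nilp_eig x y a : nilp x -> x * y = a *: y -> a != 0 -> y = 0.
Proof.
case=> k xk xy a0; have: forall j, x ^+ j * y = a ^+ j *: y.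
  elim=> [|j IH]; first by rewrite !expr0 mul1r scale1r.
  by rewrite exprSr -mulrA xy -scalerAr IH scalerA -exprS.
move=> /(_ k) /esym/eqP; rewrite xk mul0r scaler_eq0 expf_eq0 (negPf a0) andbF /=.
by move/eqP.
Qed.

(** Multiplying the relation by x^(k-i) kills the powers above i, and the coefficients below i
    vanish by induction, so only a_i x^k is left. *)
Lemma pow_coef0 (x : A) k (a : nat -> K) : x ^+ k != 0 -> x ^+ k.+1 = 0 ->
  \sum_(i < k.+1) a i *: x ^+ i = 0 -> forall i, (i <= k)%N -> a i = 0.
Proof.
move=> xk xk1 sa; elim/ltn_ind => i IH ik.
have := congr1 ( *%R (x ^+ (k - i))) sa.
rewrite mulr0 mulr_sumr (bigD1 (Ordinal (ik : (i < k.+1)%N))) //= big1.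
  by rewrite addr0 -scalerAr -exprD subnK // => /eqP; rewrite scaler_eq0 (negPf xk) orbF => /eqP.
move=> j; rewrite -val_eqE /= => ji; rewrite -scalerAr -exprD.
case: (ltngtP j i) => [lt|lt|]; first by rewrite IH ?scale0r // (leq_trans (ltnW lt)).
  have /subnK <- : (k.+1 <= k - i + j)%N by lia.
  by rewrite exprD xk1 mulr0 scaler0.
by move=> e; rewrite e eqxx in ji.
Qed.
End Nil.

(** * Commutative subalgebras and their models *)

Section CommAlg.
Variables (K : numClosedFieldType) (n : nat).
Implicit Types (V : {vspace 'M[K]_n.+1}) (X Y : 'M[K]_n.+1) (E : model).

Definition comm_subalg V :=
  [/\ 1 \in V, {in V &, forall X Y, X * Y \in V}
    & {in V &, forall X Y, X * Y = Y * X}].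

Definition local_alg V := forall X, X \in V -> exists a, nilp (X - a%:A).

(** Right multiplication by the i-th basis element has slice i as its matrix in the basis Y, so the
    model E is the regular representation of V. *)
Definition has_table V E := exists Y : seq 'M[K]_n.+1,
  [/\ size Y = n.+1, basis_of V Y &
   forall i j, (i < n.+1)%N -> (j < n.+1)%N ->
     Y`_j * Y`_i = slice_act (nth [::] E i) Y j].

(* V lies in the span of the slices of E, acting on row vectors in the frame p. *)
Definition fits V E := exists p : seq 'rV[K]_n.+1,
  [/\ size p = n.+1, free p &
   forall X, X \in V -> exists c : nat -> K, forall j, (j < n.+1)%N ->
     p`_j *m X = \sum_(i < n.+1) c i *: slice_act (nth [::] E i) p j].

Definition trV V := (linfun (@trmx K n.+1 n.+1) @: V)%VS.

Lemma trmx_one : (1 : 'M[K]_n.+1)^T = 1.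
Proof. exact: trmx1. Qed.

Lemma mem_trV V X : (X \in trV V) = (X^T \in V).
Proof.
apply/memv_imgP/idP => [[Y YV ->]|XV]; first by rewrite lfunE /= trmxK.
by exists X^T; rewrite // lfunE /= trmxK.
Qed.

Lemma dim_trV V : \dim (trV V) = \dim V.
Proof.
apply: limg_dim_eq; apply/eqP; rewrite -subv0; apply/subvP => X.
rewrite memv_cap memv_ker lfunE /= => /andP[_ /eqP]; rewrite memv0.
by move/(congr1 trmx); rewrite trmxK trmx0 => ->.
Qed.

Lemma comm_subalg_trV V : comm_subalg V -> comm_subalg (trV V).
Proof.
case=> V1 VM VC; split=> [|X Y|X Y]; rewrite ?mem_trV ?trmx_one //.
  by move=> XV YV; rewrite trmx_mul VM.
by move=> XV YV; apply: trmx_inj; rewrite !trmx_mul; exact: VC.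
Qed.

Lemma trmxX X k : (X ^+ k)^T = X^T ^+ k.
Proof. by elim: k => [|k IH]; rewrite ?trmx_one // exprS trmx_mul IH exprSr. Qed.

Lemma nilp_tr X : nilp X -> nilp X^T.
Proof. by case=> k Xk; exists k; rewrite -trmxX Xk trmx0. Qed.

Lemma local_trV V : local_alg V -> local_alg (trV V).
Proof.
move=> L X; rewrite mem_trV => /L[a na]; exists a; rewrite -[X]trmxK.
suff -> : X^T^T - a%:A = (X^T - a%:A)^T by apply: nilp_tr.
by apply/matrixP => i j; rewrite !mxE eq_sym.
Qed.

Lemma slice_act_mul (l : slice) (Y : seq 'M[K]_n.+1) (v : 'rV[K]_n.+1) j :
  v *m slice_act l Y j = slice_act l [seq v *m y | y <- Y] j.
Proof.
rewrite /slice_act mulmx_sumr; apply: eq_bigr => e _; rewrite -scalemxAr.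
case: (ltnP e.1.2 (size Y)) => h; first by rewrite (nth_map 0).
by rewrite !nth_default ?size_map // mulmx0.
Qed.

(** Stated as injectivity of X |-> v X; when [\dim V = n.+1] it says that v generates the whole row
    space over V. *)
Definition cyclic_vec V (v : 'rV[K]_n.+1) :=
  forall X, X \in V -> v *m X = 0 -> X = 0.

(** The map X |-> v X is an isomorphism of V-modules from V to the row space, so it turns the basis
    of the table into a frame. *)
Lemma fits_cyclic V E v : has_table V E -> cyclic_vec V v -> fits V E.
Proof.
case=> Y [sY bY tY] cv; exists [seq v *m y | y <- Y]; split.
- by rewrite size_map.
- apply: freeNP => a; rewrite size_map => sa.
  apply: (freeN0 (basis_free bY)); apply: cv.
    by apply: memv_suml => i _; rewrite memvZ // (basis_mem bY) // mem_nth.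
  rewrite mulmx_sumr -[RHS]sa; apply: eq_bigr => i _.
  by rewrite -scalemxAr (nth_map 0).
move=> X; rewrite -(span_basis bY) => /mem_spanP[c]; rewrite sY => cX.
exists c => j jn; rewrite (nth_map 0) ?sY // -mulmxA.
have -> : Y`_j *m X = \sum_(i < n.+1) c i *: (slice_act (nth [::] E i) Y j).
  by rewrite cX mulmx_sumr; apply: eq_bigr => i _; rewrite -scalemxAr -tY.
by rewrite mulmx_sumr; apply: eq_bigr => i _; rewrite -scalemxAr slice_act_mul.
Qed.

Lemma slice_act_lin (M N : lmodType K) (f : {linear M -> N}) (l : slice) (Y : seq M) j :
  f (slice_act l Y j) = slice_act l [seq f y | y <- Y] j.
Proof.
rewrite /slice_act linear_sum; apply: eq_bigr => e _; rewrite linearZ /=.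
case: (ltnP e.1.2 (size Y)) => h; first by rewrite (nth_map 0).
by rewrite !nth_default ?size_map // linear0.
Qed.

Lemma has_table_trV V E : comm_subalg V -> has_table V E -> has_table (trV V) E.
Proof.
case=> _ _ VC [Y [sY bY tY]]; exists [seq y^T | y <- Y].
have YV i : (i < n.+1)%N -> Y`_i \in V by move=> ?; rewrite (basis_mem bY) // mem_nth ?sY.
split; first by rewrite size_map.
  apply: free_basis; last by rewrite size_map dim_trV (basis_size bY).
    apply: freeNP => a; rewrite size_map => sa.
    apply: (freeN0 (basis_free bY)); apply: trmx_inj; rewrite trmx0 linear_sum -[RHS]sa.
    by apply: eq_bigr => i _; rewrite linearZ /= (nth_map 0).
  by move=> _ /mapP[y yY ->]; rewrite mem_trV trmxK (basis_mem bY).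
move=> i j i_n jn; rewrite !(nth_map 0) ?sY //.
transitivity (slice_act (nth [::] E i) Y j)^T; last exact: (slice_act_lin (@trmx K n.+1 n.+1)).
by rewrite -tY // (VC _ _ (YV _ jn) (YV _ i_n)); exact/esym/trmx_mul.
Qed.

(** The row condition polarized at e_i + e_j and the column condition polarized at e_k + e_l share
    the terms A_ik B_jl and A_jl B_ik, and their other two terms have opposite signs. The sum is
    twice the claim. *)
Lemma prop_minors (A B : 'M[K]_n.+1) :
  (forall (v : 'rV_n.+1) k l, (v *m A) 0 k * (v *m B) 0 l = (v *m A) 0 l * (v *m B) 0 k) ->
  (forall (u : 'cV_n.+1) k l, (A *m u) k 0 * (B *m u) l 0 = (A *m u) l 0 * (B *m u) k 0) ->
  forall i j k l, A i k * B j l = A j l * B i k.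
Proof.
move=> Hv Hu i j k l.
have rE (M : 'M[K]_n.+1) p q : ((delta_mx 0 p : 'rV_n.+1) *m M) 0 q = M p q.
  by rewrite -rowE mxE.
have cE (M : 'M[K]_n.+1) p q : (M *m (delta_mx q 0 : 'cV_n.+1)) p 0 = M p q.
  by rewrite -colE mxE.
have r2 (M : 'M[K]_n.+1) q : ((delta_mx 0 i + delta_mx 0 j : 'rV_n.+1) *m M) 0 q = M i q + M j q.
  by rewrite mulmxDl mxE !rE.
have c2 (M : 'M[K]_n.+1) p : (M *m (delta_mx k 0 + delta_mx l 0 : 'cV_n.+1)) p 0 = M p k + M p l.
  by rewrite mulmxDr mxE !cE.
have := Hv (delta_mx 0 i + delta_mx 0 j) k l; rewrite !r2.
have := Hv (delta_mx 0 i) k l; have := Hv (delta_mx 0 j) k l; rewrite !rE.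
have := Hu (delta_mx k 0 + delta_mx l 0) i j; rewrite !c2.
have := Hu (delta_mx k 0) i j; have := Hu (delta_mx l 0) i j; rewrite !cE.
move=> e1 e2 e3 e4 e5 e6.
have two0 : (2 : K) != 0 by rewrite pnatr_eq0.
apply: (mulfI two0); apply/eqP; rewrite -subr_eq0.
have -> : 2 * (A i k * B j l) - 2 * (A j l * B i k) =
  ((A i k + A j k) * (B i l + B j l) - (A i l + A j l) * (B i k + B j k))
  - (A i k * B i l - A i l * B i k) - (A j k * B j l - A j l * B j k)
  + ((A i k + A i l) * (B j k + B j l) - (A j k + A j l) * (B i k + B i l))
  - (A i k * B j k - A j k * B i k) - (A i l * B j l - A j l * B i l) by ring.
by rewrite e1 e2 e3 e4 e5 e6 !subrr !subr0 addr0.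
Qed.

(** If v X = 0 with X nonzero, then v kills a nonzero combination of s1 and s2; so any v with v s1
    and v s2 independent is cyclic. If no row vector and no column vector has this property,
    [prop_minors] makes s1 and s2 proportional. *)
Lemma soc2_cyclic V s1 s2 : comm_subalg V -> s1 \in V -> s2 \in V -> free [:: s1; s2] ->
  (forall X, X \in V -> X != 0 -> exists2 Y, Y \in V & exists a b,
     X * Y = a *: s1 + b *: s2 /\ X * Y != 0) ->
  (exists v, cyclic_vec V v) \/ (exists v, cyclic_vec (trV V) v).
Proof.
move=> VA s1V s2V fs soc.
have key (W : {vspace 'M[K]_n.+1}) (A B : 'M[K]_n.+1) (v : 'rV_n.+1) k l : comm_subalg W ->
    (forall X, X \in W -> X != 0 -> exists2 Y, Y \in W & exists a b,
      X * Y = a *: A + b *: B /\ X * Y != 0) ->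
    (v *m A) 0 k * (v *m B) 0 l != (v *m A) 0 l * (v *m B) 0 k -> cyclic_vec W v.
  move=> [_ _ WC] socW ne X XW vX; apply/eqP/negPn/negP => X0.
  have [Y YW [a [b [XY /negP]]]] := socW X XW X0; apply.
  have vXY : v *m (X * Y) = 0 by rewrite mulmxA vX mul0mx.
  have e q : a * (v *m A) 0 q + b * (v *m B) 0 q = 0.
    by move/rowP/(_ q): vXY; rewrite XY mulmxDr -!scalemxAr !mxE.
  have d0 : (v *m A) 0 k * (v *m B) 0 l - (v *m A) 0 l * (v *m B) 0 k != 0.
    by rewrite subr_eq0.
  have a0 : a = 0.
    apply: (mulIf d0); rewrite mul0r.
    have -> : a * ((v *m A) 0 k * (v *m B) 0 l - (v *m A) 0 l * (v *m B) 0 k) =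
      (a * (v *m A) 0 k + b * (v *m B) 0 k) * (v *m B) 0 l -
      (a * (v *m A) 0 l + b * (v *m B) 0 l) * (v *m B) 0 k by ring.
    by rewrite !e !mul0r subrr.
  have b0 : b = 0.
    apply: (mulIf d0); rewrite mul0r.
    have -> : b * ((v *m A) 0 k * (v *m B) 0 l - (v *m A) 0 l * (v *m B) 0 k) =
      (a * (v *m A) 0 l + b * (v *m B) 0 l) * (v *m A) 0 k -
      (a * (v *m A) 0 k + b * (v *m B) 0 k) * (v *m A) 0 l by ring.
    by rewrite !e !mul0r subrr.
  by rewrite XY a0 b0 !scale0r addr0.
case: (EM (exists (v : 'rV[K]_n.+1) k l, (v *m s1) 0 k * (v *m s2) 0 l != (v *m s1) 0 l * (v *m s2) 0 k)).
  by case=> v [k [l ne]]; left; exists v; exact: (key V s1 s2 v k l).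
move=> nv.
case: (EM (exists (v : 'rV[K]_n.+1) k l, (v *m s1^T) 0 k * (v *m s2^T) 0 l != (v *m s1^T) 0 l * (v *m s2^T) 0 k)).
  case=> v [k [l ne]]; right; exists v; apply: (key _ s1^T s2^T v k l) => //; first exact: comm_subalg_trV.
  move=> X; rewrite mem_trV => XV X0.
  have [|Y YV [a [b [XY XY0]]]] := soc _ XV.
    by apply: contraNneq X0 => /(congr1 trmx); rewrite trmxK trmx0 => ->.
  exists Y^T; first by rewrite mem_trV trmxK.
  have E : X * Y^T = (X^T * Y)^T.
    case: VA => _ _ VC; rewrite (VC _ _ XV YV).
    by apply: trmx_inj; rewrite trmxK [LHS]trmx_mul trmxK.
  exists a, b; rewrite E XY linearD !linearZ /=; split=> //.
  by apply: contraNneq XY0 => /(congr1 trmx); rewrite XY linearD !linearZ /= !trmxK trmx0 => ->.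
move=> nu; exfalso.
have tE (v : 'cV[K]_n.+1) (A : 'M[K]_n.+1) k : (v^T *m A^T) 0 k = (A *m v) k 0.
  by rewrite -trmx_mul mxE.
have P : forall i j k l, s1 i k * s2 j l = s1 j l * s2 i k.
  apply: prop_minors => v k l; apply/eqP/negPn/negP => ne; first by apply: nv; exists v, k, l.
  by apply: nu; exists v^T, k, l; rewrite !tE.
have [[i k] ik] : exists ik, s1 ik.1 ik.2 != 0.
  apply: contrapT => h; move: fs; rewrite free_cons => /andP[/negP+ _]; apply.
  have -> : s1 = 0; last exact: mem0v.
  by apply/matrixP => i k; rewrite mxE; apply/eqP/negPn/negP => ne; apply: h; exists (i, k).
have := freeN0 (a := fun q => if q == 0%N then s2 i k else - s1 i k) fs.
rewrite !big_ord_recl big_ord0 /= addr0 => /(_ _ 1%N isT) /=.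
move=> h; have /eqP : - s1 i k = 0.
  apply: h; apply/matrixP => j l; rewrite !mxE mulNr; apply/eqP; rewrite subr_eq0 eq_sym.
  by rewrite (P i j k l) mulrC.
by rewrite oppr_eq0; apply/negP.
Qed.

(** Every nonzero ideal contains s, so any v with v s != 0 is cyclic. *)
Lemma soc1_cyclic V s : comm_subalg V -> s != 0 ->
  (forall X, X \in V -> X != 0 -> exists2 Y, Y \in V & exists2 a, a != 0 & X * Y = a *: s) ->
  exists v, cyclic_vec V v.
Proof.
move=> VA s0 soc.
have [v vs] : exists v : 'rV_n.+1, v *m s != 0.
  apply: contrapT => h; move/eqP: s0; apply; apply/row_matrixP => i.
  by rewrite row0 rowE; apply/eqP/negPn/negP => ne; apply: h; exists (delta_mx 0 i).
exists v => X XV vX; apply/eqP/negPn/negP => /(soc _ XV)[Y YV [a a0 XY]].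
have : v *m (X * Y) = 0 by rewrite mulmxA vX mul0mx.
by rewrite XY -scalemxAr => /eqP; rewrite scaler_eq0 (negPf a0) (negPf vs).
Qed.
End CommAlg.

(** * The maximal ideal of a local algebra *)

Section Local.
Variables (K : numClosedFieldType) (n : nat) (V : {vspace 'M[K]_n.+1}).
Hypotheses (VA : comm_subalg V) (VL : local_alg V).
Implicit Types (x y z X Y : 'M[K]_n.+1).

Let V1 : 1 \in V. Proof. by case: VA. Qed.
Let VM : {in V &, forall X Y, X * Y \in V}. Proof. by case: VA. Qed.
Let VC : {in V &, forall X Y, X * Y = Y * X}. Proof. by case: VA. Qed.

(** The maximal ideal of the local algebra V, as a predicate. *)
Definition nn x := x \in V /\ nilp x.

Lemma nnV x : nn x -> x \in V. Proof. by case. Qed.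

Lemma nnC x y : nn x -> nn y -> x * y = y * x.
Proof. by case=> xV _ [yV _]; exact: VC. Qed.

Lemma nnZ a x : nn x -> nn (a *: x).
Proof. by case=> xV nx; split; [rewrite memvZ | exact: nilpZ]. Qed.

Lemma nnD x y : nn x -> nn y -> nn (x + y).
Proof.
move=> [xV nx] [yV ny]; split; first by rewrite memvD.
by apply: nilpD => //; exact: VC.
Qed.

Lemma nnN x : nn x -> nn (- x).
Proof. by rewrite -scaleN1r; exact: nnZ. Qed.

Lemma nnB x y : nn x -> nn y -> nn (x - y).
Proof. by move=> nx /nnN; exact: nnD. Qed.

Lemma nnM x y : nn x -> y \in V -> nn (x * y).
Proof. by move=> [xV nx] yV; split; [exact: VM | apply: nilpM => //; exact: VC]. Qed.

Lemma memVX x k : x \in V -> x ^+ k \in V.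
Proof. by move=> xV; elim: k => [|k IH]; rewrite ?expr0 // exprS VM. Qed.

Lemma nn_ext (s : seq 'M[K]_n.+1) : 1 \in <<s>>%VS -> (size s < \dim V)%N ->
  exists2 y, nn y & y \notin <<s>>%VS.
Proof.
move=> s1 /exists_notin_span[y yV ys]; have [a na] := VL yV.
exists (y - a%:A); first by split => //; rewrite memvB // memvZ.
by apply: contra ys => h; rewrite -(subrK a%:A y) memvD // memvZ.
Qed.

Lemma nn_scal x a : nn x -> nn (a%:A + x) -> a = 0.
Proof.
move=> nx /nnB/(_ nx); rewrite addrK => -[_ [k]].
rewrite exprZn expr1n => /eqP; rewrite scaler_eq0 oner_eq0 orbF expf_eq0.
by move=> /andP[_ /eqP].
Qed.

Definition pows x k : seq 'M[K]_n.+1 := [seq x ^+ i | i <- iota 0 k.+1].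

Lemma nth_pows x k i : (i <= k)%N -> (pows x k)`_i = x ^+ i.
Proof. by move=> ik; rewrite (nth_map 0%N) ?size_iota // nth_iota. Qed.

Lemma size_pows x k : size (pows x k) = k.+1.
Proof. by rewrite size_map size_iota. Qed.

Lemma mem_pows x k i : (i <= k)%N -> x ^+ i \in pows x k.
Proof. by move=> ik; rewrite -(nth_pows x ik) mem_nth // size_pows. Qed.

Lemma mem_powsP x k X :
  reflect (exists a : nat -> K, X = \sum_(i < k.+1) a i *: x ^+ i)
          (X \in <<pows x k>>%VS).
Proof.
apply: (iffP (mem_spanP _ _)); rewrite size_pows => -[a ->]; exists a;
  by apply: eq_bigr => i _; rewrite nth_pows // -ltnS.
Qed.

Lemma free_pows x k : x ^+ k != 0 -> x ^+ k.+1 = 0 -> free (pows x k).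
Proof.
move=> xk xk1; apply: freeNP => a; rewrite size_pows => sa i ik.
apply: (pow_coef0 xk xk1) => //; rewrite -[RHS]sa.
by apply: eq_bigr => j _; rewrite nth_pows // -ltnS.
Qed.

Lemma pows_sub x k : x \in V -> {subset pows x k <= V}.
Proof. by move=> xV _ /mapP[i _ ->]; exact: memVX. Qed.

(** The powers of x up to the last nonzero one are independent elements of V. *)
Lemma nn_pow_lt x k : nn x -> x ^+ k != 0 -> (k < \dim V)%N.
Proof.
move=> [xV nx] xk; have nx' : exists j, x ^+ j == 0 by case: nx => j /eqP; exists j.
case: (ex_minnP nx') => -[|l] /eqP xl lm.
  by move: xk; rewrite -[k]addn0 exprD xl mulr0 eqxx.
have kl : (k <= l)%N.
  by rewrite leqNgt; apply: contra xk => lk; rewrite -(subnK lk) exprD xl mulr0.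
have xl0 : x ^+ l != 0 by apply/negP => /lm; rewrite ltnn.
apply: leq_trans (_ : l.+1 <= _)%N => //.
have := free_pows xl0 xl; rewrite /free size_pows => /eqP <-.
by apply: dimvS; apply/span_subvP; exact: pows_sub.
Qed.

Lemma pows_basis x k : nn x -> \dim V = k.+1 -> x ^+ k != 0 -> basis_of V (pows x k).
Proof.
move=> nx dV xk; apply: free_basis; last by rewrite size_pows.
  by apply: free_pows => //; apply/eqP/negPn/negP => /(nn_pow_lt nx); rewrite dV ltnn.
by apply: pows_sub; exact: nnV.
Qed.

(** The powers of x span a hyperplane S of V, stable under x. As x acts nilpotently on V / S, the
    product x y0 lies in S for any y0; it has no constant term, so it is x q with q in S, and y = y0
    - q is killed by x. Then x (y y) = 0 leaves only the top power in y y. *)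
Lemma pows_ext x k : nn x -> \dim V = k.+3.+1 -> x ^+ k.+2 != 0 -> x ^+ k.+3 = 0 ->
  exists y c, [/\ nn y, basis_of V (rcons (pows x k.+2) y), x * y = 0 &
    y * y = c *: x ^+ k.+2].
Proof.
move=> nx dV xk xk1.
have xV := nnV nx.
have fS : free (pows x k.+2) by exact: free_pows.
have S1 : 1 \in <<(pows x k.+2)>>%VS by apply: memv_span; apply/mapP; exists 0%N; rewrite ?mem_iota.
have [y0 ny0 y0S] : exists2 y, nn y & y \notin <<(pows x k.+2)>>%VS.
  by apply: nn_ext => //; rewrite dV size_pows.
have bas y : nn y -> y \notin <<(pows x k.+2)>>%VS -> basis_of V (y :: (pows x k.+2)).
  move=> ny yS; apply: free_basis; first by rewrite free_cons yS.
    by move=> z; rewrite inE => /predU1P[->|]; [exact: nnV | exact: pows_sub].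
  by rewrite dV; exact: (congr1 succn (size_pows x k.+2)).
have xS z : z \in <<(pows x k.+2)>>%VS -> x * z \in <<(pows x k.+2)>>%VS.
  move=> /mem_powsP[a ->]; rewrite mulr_sumr; apply: memv_suml => i _.
  rewrite -scalerAr -exprS memvZ //; case: (ltnP i k.+2) => ik.
    by apply: memv_span; apply/mapP; exists i.+1; rewrite ?mem_iota.
  have -> : i.+1 = k.+3 :> nat by have := ltn_ord i; lia.
  by rewrite xk1 mem0v.
have dec y z : nn y -> y \notin <<(pows x k.+2)>>%VS -> z \in V -> exists d, z - d *: y \in <<(pows x k.+2)>>%VS.
  move=> ny yS; rewrite -(span_basis (bas y ny yS)) span_cons => /memv_addP[u /vlineP[d ->]].
  by case=> w wS ->; exists d; rewrite addrC addKr.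
have [d dxy] := dec y0 (x * y0) ny0 y0S (VM xV (nnV ny0)).
(* d is the eigenvalue of x on the line V / S, where S is the span of the powers. *)
have d0 : d = 0.
  have H j : x ^+ j * y0 - d ^+ j *: y0 \in <<(pows x k.+2)>>%VS.
    elim: j => [|j IH]; first by rewrite !expr0 mul1r scale1r subrr mem0v.
    have -> : x ^+ j.+1 * y0 - d ^+ j.+1 *: y0 =
        x * (x ^+ j * y0 - d ^+ j *: y0) + d ^+ j *: (x * y0 - d *: y0).
      by rewrite mulrBr mulrA -exprS -scalerAr scalerBr scalerA -exprSr addrA subrK.
    by rewrite memvD ?memvZ // xS.
  apply/eqP/negPn/negP => d0; have := H k.+3; rewrite xk1 mul0r sub0r memvN => h.
  move: y0S; rewrite -[y0](scalerK (expf_neq0 k.+3 d0)) => /negP; apply.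
  by rewrite memvZ.
move: dxy; rewrite d0 scale0r subr0 => /mem_powsP[a xy0].
have a0 : a 0%N = 0.
  have : x ^+ k.+2 * (x * y0) = 0 by rewrite mulrA -exprSr xk1 mul0r.
  rewrite xy0 big_ord_recl mulrDr expr0 -scalerAr mulr1 mulr_sumr big1 ?addr0.
    by move=> /eqP; rewrite scaler_eq0 (negPf xk) orbF => /eqP.
  move=> i _; rewrite -scalerAr -exprD (_ : (k.+2 + (lift ord0 i) = i + k.+3)%N).
    by rewrite exprD xk1 mulr0 scaler0.
  by rewrite lift0; lia.
pose q := \sum_(i < k.+2) a i.+1 *: x ^+ i.
have xq : x * y0 = x * q.
  rewrite xy0 big_ord_recl a0 scale0r add0r mulr_sumr.
  by apply: eq_bigr => i _; rewrite lift0 -scalerAr -exprS.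
have qS : q \in <<(pows x k.+2)>>%VS by apply/mem_powsP; exists (fun i => if (i < k.+2)%N then a i.+1 else 0);
  rewrite big_ord_recr /= ltnn scale0r addr0; apply: eq_bigr => i _; rewrite ltn_ord.
have qV : q \in V by move: qS; apply: subvP; apply/span_subvP; exact: pows_sub.
have [b nb] := VL qV; pose y := y0 - q.
have xy : x * y = 0 by rewrite mulrBr xq subrr.
have x0 : x != 0 by apply: contraNneq xk => ->; rewrite expr0n.
(* Only q - b is known to be nilpotent, hence y + b; it sends x to b x, so b = 0 and y itself is
   nilpotent. *)
have b0 : b = 0.
  have ny1 : nn (y + b%:A).
    have -> : y + b%:A = y0 - (q - b%:A) by rewrite opprB addrA addrAC.
    by apply: nnB => //; split=> //; rewrite memvB // memvZ.
  have e : (y + b%:A) * x = b *: x.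
    by rewrite mulrDl -scalerAl mul1r VC ?xy ?add0r // memvB // nnV.
  case: (eqVneq b 0) => // b0; have := nilp_eig ny1.2 e b0.
  by move=> x00; rewrite x00 eqxx in x0.
have ny : nn y by apply: nnB => //; split => //; move: nb; rewrite b0 scale0r subr0.
have yS : y \notin <<(pows x k.+2)>>%VS.
  by apply: contra y0S => h; rewrite -(subrK q y0) memvD.
clearbody y.
have [e dyy] := dec y (y * y) ny yS (VM (nnV ny) (nnV ny)).
have yx : y * x = 0 by rewrite VC // nnV.
move: dyy => /mem_powsP[c yy].
have c0 i : (i < k.+2)%N -> c i = 0.
  have : x * (y * y - e *: y) = 0 by rewrite mulrBr mulrA xy mul0r -scalerAr xy scaler0 subrr.
  rewrite yy mulr_sumr big_ord_recr /= -scalerAr -exprS xk1 scaler0 addr0 => h ik.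
  apply: (pow_coef0 (a := fun i => if i is j.+1 then c j else 0) xk xk1 _ (i := i.+1)) => //.
  rewrite big_ord_recl scale0r add0r -[RHS]h.
  by apply: eq_bigr => j _; rewrite lift0 /= -scalerAr -exprS.
have {c0}yy : y * y - e *: y = c k.+2 *: x ^+ k.+2.
  by rewrite yy big_ord_recr /= big1 ?add0r // => i _; rewrite c0 // scale0r.
(* y kills the top power of x, so y (y y) = e (y y). If e != 0 then y y = 0, and y would lie in the
   span of the powers. *)
have e0 : e = 0.
  case: (eqVneq e 0) => // e0.
  have y2 : y * (y * y) = e *: (y * y).
    apply/eqP; rewrite -subr_eq0.
    have -> : y * (y * y) - e *: (y * y) = y * (y * y - e *: y) by rewrite mulrBr -scalerAr.
    by rewrite yy -scalerAr exprS mulrA yx mul0r scaler0.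
  have y20 := nilp_eig ny.2 y2 e0; move: yS yy; rewrite y20 sub0r => yS yy.
  case/negP: yS; rewrite -[y](scalerK e0) memvZ // -memvN yy memvZ // memv_span //.
  exact: mem_pows.
exists y, (c k.+2); split => //; last by rewrite -yy e0 scale0r subr0.
have := bas y ny yS; rewrite (perm_basis (Y := rcons (pows x k.+2) y)) //.
by rewrite perm_sym perm_rcons.
Qed.

(** Polarization: the cubes of x + y and x - y give 6 x x y = 0, and then (x + y)^2 z = 0 gives 2 x
    y z = 0. *)
Lemma cube0_mul0 : (forall x, nn x -> x ^+ 3 = 0) -> forall x y z, nn x -> nn y -> nn z ->
  x * y * z = 0.
Proof.
move=> H.
have two0 : (2 : K) != 0 by rewrite pnatr_eq0.
have half X : X + X = 0 -> X = 0.
  by rewrite -mulr2n -scaler_nat => /eqP; rewrite scaler_eq0 (negPf two0) => /eqP.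
have H2 x y : nn x -> nn y -> x * x * y = 0.
  move=> nx ny; have e : x * y = y * x by exact: nnC.
  have cub u v : nn u -> nn v -> (u * u * v + u * v * v) *+ 3 = 0.
    move=> nu nv; have := H _ (nnD nu nv); rewrite exprDn_comm; last exact: nnC.
    rewrite !big_ord_recl big_ord0 /= /bump /= !add1n !subn0 expr0 mulr1 !bin0 mulr1n.
    rewrite (_ : 'C(3, 1) = 3)%N // (_ : 'C(3, 2) = 3)%N // binn !subSS !subn0.
    rewrite (H u) // (H v) // mulr0 mul0rn !addr0 add0r !expr1 !expr2 -mulrnDl.
    by rewrite mulrA.
  have c1 := cub x y nx ny; have := cub x (- y) nx (nnN ny).
  rewrite !mulrN mulNr opprK => c2.
  have : (x * x * y) *+ 6 = 0.
    have -> : (x * x * y) *+ 6 = (x * x * y + x * y * y) *+ 3 - (- (x * x * y) + x * y * y) *+ 3.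
      by rewrite !mulrnDl mulNrn opprD opprK addrACA subrr addr0 -mulrnDr.
    by rewrite c1 c2 subr0.
  rewrite -scaler_nat => /eqP; rewrite scaler_eq0 pnatr_eq0 /=.
  by move/eqP.
move=> x y z nx ny nz; apply: half.
have := H2 (x + y) z (nnD nx ny) nz.
rewrite !mulrDl !mulrDr !mulrDl !H2 // add0r addr0.
by rewrite -[y * x](nnC nx ny).
Qed.

Lemma sq0_mul0 : (forall x, nn x -> x * x = 0) -> forall x y, nn x -> nn y -> x * y = 0.
Proof.
move=> H x y nx ny; have := H _ (nnD nx ny).
rewrite !mulrDl !mulrDr !H // add0r addr0 -[y * x](nnC nx ny) -mulr2n -scaler_nat.
by move/eqP; rewrite scaler_eq0 pnatr_eq0 /= => /eqP.
Qed.
End Local.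

(** * Regular representations of local algebras *)

Definition ent (j k : nat) : nat * nat * int := (j, k, 1).
Definition diag_slice n : slice := [seq ent i i | i <- iota 0 n].

(** The algebra K[x]/(x^n) in the basis of powers. *)
Definition mod_pow n : model :=
  [seq [seq ent j (j + i) | j <- iota 0 (n - i)] | i <- iota 0 n].
(** Bases 1, x, ..., x^k, y with x y = 0. In the [gor] models y y = x^k, which makes the algebra
    Gorenstein; in the [hook] models y y = 0. *)
Definition mod_gor2 : model :=
  [:: diag_slice 4; [:: ent 0 1; ent 1 2]; [:: ent 0 2]; [:: ent 0 3; ent 3 2]].
Definition mod_hook2 : model :=
  [:: diag_slice 4; [:: ent 0 1; ent 1 2]; [:: ent 0 2]; [:: ent 0 3]].
Definition mod_gor3 : model :=
  [:: diag_slice 5; [:: ent 0 1; ent 1 2; ent 2 3]; [:: ent 0 2; ent 1 3]; [:: ent 0 3];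
      [:: ent 0 4; ent 4 3]].
Definition mod_hook3 : model :=
  [:: diag_slice 5; [:: ent 0 1; ent 1 2; ent 2 3]; [:: ent 0 2; ent 1 3]; [:: ent 0 3];
      [:: ent 0 4]].
(** [mod_xy] is K[x,y]/(xy, x^3, y^3) in the basis 1, x, x^2, y, y^2, and [mod_yy] is K[x,y]/(y^2,
    x^3, x^2 y) in the basis 1, x, x^2, y, xy. *)
Definition mod_xy : model :=
  [:: diag_slice 5; [:: ent 0 1; ent 1 2]; [:: ent 0 2]; [:: ent 0 3; ent 3 4]; [:: ent 0 4]].
Definition mod_yy : model :=
  [:: diag_slice 5; [:: ent 0 1; ent 1 2; ent 3 4]; [:: ent 0 2]; [:: ent 0 3; ent 1 4]; [:: ent 0 4]].
(** Basis 1, x, x^2, y, z; all products of x, y, z are multiples of x^2, through a quadratic form of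
    rank 3 here and of rank 2 in [mod_q2]. *)
Definition mod_q3 : model :=
  [:: diag_slice 5; [:: ent 0 1; ent 1 2]; [:: ent 0 2]; [:: ent 0 3; ent 3 2]; [:: ent 0 4; ent 4 2]].
Definition mod_q2 : model :=
  [:: diag_slice 5; [:: ent 0 1; ent 1 2]; [:: ent 0 2]; [:: ent 0 3; ent 3 2]; [:: ent 0 4]].

Lemma slice_actE (K : pzRingType) (M : lmodType K) (l : slice) (p : seq M) j :
  slice_act l p j = foldr (fun e r => if e.1.1 == j then e.2%:~R *: p`_e.1.2 + r else r) 0 l.
Proof.
rewrite /slice_act; elim: l => [|e l IH] /=; first by rewrite big_nil.
by rewrite big_cons IH.
Qed.

Section Misc.
Variables (K : fieldType) (vT : vectType K).
Lemma basis_change (V : {vspace vT}) s s' : basis_of V s -> size s' = size s ->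
  {subset s' <= V} -> {subset s <= <<s'>>%VS} -> basis_of V s'.
Proof.
move=> bs ss s'V ss'; rewrite basisEdim; apply/andP; split.
  by rewrite -(span_basis bs); apply/span_subvP.
by rewrite ss (basis_size bs).
Qed.

Lemma mem_span5 (a b c d e : vT) x : x \in <<[:: a; b; c; d; e]>>%VS ->
  exists k0 k1 k2 k3 k4, x = k0 *: a + (k1 *: b + (k2 *: c + (k3 *: d + k4 *: e))).
Proof.
move=> /mem_spanP[k ->]; exists (k 0%N), (k 1%N), (k 2%N), (k 3%N), (k 4%N).
by rewrite !big_ord_recl big_ord0 addr0.
Qed.

Lemma free5P (a b c d e : vT) :
  (forall k0 k1 k2 k3 k4, k0 *: a + (k1 *: b + (k2 *: c + (k3 *: d + k4 *: e))) = 0 ->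
     [/\ k0 = 0, k1 = 0, k2 = 0, k3 = 0 & k4 = 0]) -> free [:: a; b; c; d; e].
Proof.
move=> H; apply: freeNP => k; rewrite /= !big_ord_recl big_ord0 addr0 => /H[k0 k1 k2 k3 k4].
by case=> [|[|[|[|[|i]]]]].
Qed.
End Misc.

Lemma int1E (R : pzRingType) (M : lmodType R) (v : M) : (1%:~R : R) *: v = v.
Proof. exact: scale1r. Qed.

Lemma ltn_lit i m k : m = k -> (i < m.+1)%N -> (i < k.+1)%N.
Proof. by move=> ->. Qed.

Lemma expr_gt (R : pzRingType) (x : R) k l : x ^+ k = 0 -> (k <= l)%N -> x ^+ l = 0.
Proof. by move=> xk kl; rewrite -(subnK kl) exprD xk mulr0. Qed.

(** The size is a variable equal to a literal by the equation [n1], which has to be carried into the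
    bounds on i and j before these can be split into cases. *)
Ltac table n1 :=
  let i := fresh "i" in let j := fresh "j" in
  move=> i j /(ltn_lit n1) + /(ltn_lit n1);
  case: i => [|[|[|[|[|i]]]]] //; case: j => [|[|[|[|[|j]]]]] // _ _;
  rewrite slice_actE /= ?scale1r ?int1E ?addr0.

Ltac tab_close xk :=
  rewrite ?(mul0r, mulr0) // -?exprD // ?expr0 ?mul1r ?mulr1 //;
  try exact: (expr_gt xk).

Section Tables.
Variables (K : numClosedFieldType) (n : nat) (V : {vspace 'M[K]_n.+1}).
Hypotheses (VA : comm_subalg V) (VL : local_alg V).
Implicit Types (x y z X Y : 'M[K]_n.+1).
Let V1 : 1 \in V. Proof. by case: VA. Qed.
Let VM : {in V &, forall X Y, X * Y \in V}. Proof. by case: VA. Qed.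
Let VC : {in V &, forall X Y, X * Y = Y * X}. Proof. by case: VA. Qed.

Definition fitsD E := fits V E \/ fits (trV V) E.

Lemma table_fits E : has_table V E ->
  (exists v, cyclic_vec V v) \/ (exists v, cyclic_vec (trV V) v) -> fitsD E.
Proof.
move=> tE [[v cv]|[v cv]]; [left|right]; apply: (fits_cyclic (v := v)) => //.
exact: has_table_trV.
Qed.

(** Multiplication by a suitable power of x lifts the lowest term of X to the top degree and kills
    the rest; the second case is an X that is already of top degree. *)
Lemma pows_lead x k (c : nat -> K) : x ^+ k.+1 = 0 ->
  let X := \sum_(i < k.+1) c i *: x ^+ i in
  (exists i a, [/\ (i < k)%N, a != 0 & X * x ^+ (k - i) = a *: x ^+ k]) \/ X = c k *: x ^+ k.
Proof.
move=> xk; rewrite /=; case: (EM (exists i, (i < k)%N && (c i != 0))) => [h|h].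
  case: (ex_minnP h) => i /andP[ik ci] mi; left; exists i, (c i); split=> //.
  rewrite mulr_suml (bigD1 (Ordinal (ltnW ik : (i < k.+1)%N))) //= big1 ?addr0.
    by rewrite -scalerAl -exprD subnKC // ltnW.
  move=> j; rewrite -val_eqE /= => ji; rewrite -scalerAl -exprD.
  case: (ltnP j i) => lt.
    have -> : c j = 0; last by rewrite scale0r.
    apply/eqP/negPn/negP => cj; have := mi j; rewrite cj andbT => /(_ (ltn_trans lt ik)).
    by rewrite leqNgt lt.
  have /subnK <- : (k.+1 <= j + (k - i))%N by move: ik lt ji; lia.
  by rewrite exprD xk mulr0 scaler0.
right; rewrite big_ord_recr /= big1 ?add0r // => i _.
case: (eqVneq (c i) 0) => [->|ci]; first by rewrite scale0r.
by case: h; exists i; rewrite ltn_ord.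
Qed.

Lemma pows_cyclic x k : nn V x -> \dim V = k.+1 -> x ^+ k != 0 -> exists v, cyclic_vec V v.
Proof.
move=> nx dV xk; have bx := pows_basis VA nx dV xk.
have xk1 : x ^+ k.+1 = 0.
  by apply/eqP/negPn/negP => /(nn_pow_lt VA nx); rewrite dV ltnn.
apply: (soc1_cyclic VA xk) => X XV X0.
have /mem_powsP[c cX] : X \in <<pows x k>>%VS by rewrite (span_basis bx).
have [[i [a [ik a0 e]]]|e] := pows_lead c xk1; rewrite -cX in e.
  by exists (x ^+ (k - i)); [exact (memVX VA _ (nnV nx)) | exists a].
exists 1 => //; exists (c k); last by rewrite mulr1.
by apply: contraNneq X0 => ck; rewrite e ck scale0r.
Qed.

(** The plane spanned by the top power of x and y meets every nonzero ideal, also when c != 0 and y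
    is not in the socle. *)
Lemma ext_soc x y k c : nn V x -> nn V y -> basis_of V (rcons (pows x k.+1) y) ->
  x ^+ k.+1 != 0 -> x ^+ k.+2 = 0 -> x * y = 0 -> y * y = c *: x ^+ k.+1 ->
  (exists v, cyclic_vec V v) \/ (exists v, cyclic_vec (trV V) v).
Proof.
move=> nx ny bV xk xk1 xy yy; have xV := nnV nx; have yV := nnV ny.
have xyi i : y * x ^+ i.+1 = 0 by rewrite exprS mulrA (VC yV) // xy mul0r.
have dec X : X \in V -> exists (c : nat -> K) d, X = \sum_(i < k.+2) c i *: x ^+ i + d *: y.
  rewrite -(span_basis bV) -cats1 span_cat span_seq1 => /memv_addP[w /mem_powsP[b ->]].
  by case=> z /vlineP[d ->] ->; exists b, d.
have fr : free [:: x ^+ k.+1; y].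
  have := basis_free bV; rewrite (perm_free (permEl (perm_rcons y (pows x k.+1)))) free_cons => /andP[yp _].
  rewrite (perm_free (permEl (perm_catC [:: x ^+ k.+1] [:: y]))) /= free_cons seq1_free xk andbT.
  apply: contra yp; apply: subvP; apply: sub_span => z; rewrite inE => /eqP->.
  exact: mem_pows.
apply: (@soc2_cyclic _ _ _ (x ^+ k.+1) y) => //; first exact: (memVX VA).
move=> X XV X0; have [b [d eX]] := dec X XV.
have [[i [a [ik a0 e]]]|e] := pows_lead b xk1.
  exists (x ^+ (k.+1 - i)); first exact: (memVX VA).
  exists a, 0; have -> : X * x ^+ (k.+1 - i) = a *: x ^+ k.+1.
    have yk : y * x ^+ (k.+1 - i) = 0 by move: ik; rewrite ltnS => /subSn ->; rewrite xyi.
    by rewrite eX mulrDl e -scalerAl yk scaler0 addr0.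
  by rewrite scale0r addr0 scaler_eq0 negb_or a0.
by exists 1 => //; exists (b k.+1), d; rewrite mulr1 -e -eX.
Qed.

Lemma pow2_table x : n = 1%N -> basis_of V (pows x 1) -> x ^+ 2 = 0 -> has_table V (mod_pow 2).
Proof.
move=> n1 bV xk; exists (pows x 1); split; rewrite ?size_pows ?n1 //.
by table n1; tab_close xk.
Qed.

Lemma pow3_table x : n = 2%N -> basis_of V (pows x 2) -> x ^+ 3 = 0 -> has_table V (mod_pow 3).
Proof.
move=> n1 bV xk; exists (pows x 2); split; rewrite ?size_pows ?n1 //.
by table n1; tab_close xk.
Qed.

Lemma pow4_table x : n = 3%N -> basis_of V (pows x 3) -> x ^+ 4 = 0 -> has_table V (mod_pow 4).
Proof.
move=> n1 bV xk; exists (pows x 3); split; rewrite ?size_pows ?n1 //.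
by table n1; tab_close xk.
Qed.

Lemma pow5_table x : n = 4%N -> basis_of V (pows x 4) -> x ^+ 5 = 0 -> has_table V (mod_pow 5).
Proof.
move=> n1 bV xk; exists (pows x 4); split; rewrite ?size_pows ?n1 //.
by table n1; tab_close xk.
Qed.

Lemma mulXy x y i : x * y = 0 -> x ^+ i.+1 * y = 0.
Proof. by move=> xy; rewrite exprSr -mulrA xy mulr0. Qed.

Lemma mulyX x y i : x \in V -> y \in V -> x * y = 0 -> y * x ^+ i.+1 = 0.
Proof. by move=> xV yV xy; rewrite exprS mulrA (VC yV) // xy mul0r. Qed.

Lemma gor2_table x y : n = 3%N -> x \in V -> y \in V -> basis_of V (rcons (pows x 2) y) ->
  x ^+ 3 = 0 -> x * y = 0 -> y * y = x ^+ 2 -> has_table V mod_gor2.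
Proof.
move=> n1 xV yV bV xk xy yy; exists (rcons (pows x 2) y); split; rewrite ?size_rcons ?size_pows ?n1 //.
by table n1; tab_close xk; rewrite ?(mulXy _ xy) ?(mulyX _ xV yV xy).
Qed.

Lemma gor3_table x y : n = 4%N -> x \in V -> y \in V -> basis_of V (rcons (pows x 3) y) ->
  x ^+ 4 = 0 -> x * y = 0 -> y * y = x ^+ 3 -> has_table V mod_gor3.
Proof.
move=> n1 xV yV bV xk xy yy; exists (rcons (pows x 3) y); split; rewrite ?size_rcons ?size_pows ?n1 //.
by table n1; tab_close xk; rewrite ?(mulXy _ xy) ?(mulyX _ xV yV xy).
Qed.

Lemma hook2_table x y : n = 3%N -> x \in V -> y \in V -> basis_of V (rcons (pows x 2) y) ->
  x ^+ 3 = 0 -> x * y = 0 -> y * y = 0 -> has_table V mod_hook2.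
Proof.
move=> n1 xV yV bV xk xy yy; exists (rcons (pows x 2) y); split; rewrite ?size_rcons ?size_pows ?n1 //.
by table n1; tab_close xk; rewrite ?(mulXy _ xy) ?(mulyX _ xV yV xy).
Qed.

Lemma hook3_table x y : n = 4%N -> x \in V -> y \in V -> basis_of V (rcons (pows x 3) y) ->
  x ^+ 4 = 0 -> x * y = 0 -> y * y = 0 -> has_table V mod_hook3.
Proof.
move=> n1 xV yV bV xk xy yy; exists (rcons (pows x 3) y); split; rewrite ?size_rcons ?size_pows ?n1 //.
by table n1; tab_close xk; rewrite ?(mulXy _ xy) ?(mulyX _ xV yV xy).
Qed.

(* Rescaling y turns y^2 = c x^k into y^2 = x^k. *)
Lemma pows_ext_norm x k : nn V x -> \dim V = k.+3.+1 -> x ^+ k.+2 != 0 -> x ^+ k.+3 = 0 ->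
  exists y, [/\ nn V y, basis_of V (rcons (pows x k.+2) y), x * y = 0 &
    y * y = 0 \/ y * y = x ^+ k.+2].
Proof.
move=> nx dV xk xk1; have [y [c [ny bV xy yy]]] := pows_ext VA VL nx dV xk xk1.
case: (eqVneq c 0) => [c0|c0]; first by exists y; split => //; left; rewrite yy c0 scale0r.
have s0 : sqrtC c != 0 by rewrite sqrtC_eq0.
exists ((sqrtC c)^-1 *: y); split; first exact: nnZ.
- apply: (basis_change bV); first by rewrite !size_rcons.
    move=> z; rewrite mem_rcons inE => /predU1P[->|]; first by rewrite memvZ // nnV.
    by apply: (pows_sub VA); exact: nnV nx.
  move=> z; rewrite mem_rcons inE => /predU1P[->|zp].
    rewrite -[y](scalerKV s0) memvZ // memv_span // mem_rcons inE scalerA mulVf //.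
    by rewrite scale1r eqxx.
  by apply: memv_span; rewrite mem_rcons inE zp orbT.
- by rewrite -scalerAr xy scaler0.
by right; rewrite -scalerAl -scalerAr yy !scalerA -invfM -expr2 sqrtCK mulVf ?scale1r.
Qed.

End Tables.

(** * Five-dimensional local algebras with vanishing cubes *)

Section Cube0.
Variables (K : numClosedFieldType) (n : nat) (V : {vspace 'M[K]_n.+1}).
Hypotheses (VA : comm_subalg V) (VL : local_alg V) (n4 : n = 4%N) (dV : \dim V = 5%N).
Hypothesis cube0 : forall x, nn V x -> x ^+ 3 = 0.
Implicit Types (x y z X Y : 'M[K]_n.+1).
Let V1 : 1 \in V. Proof. by case: VA. Qed.
Let VM : {in V &, forall X Y, X * Y \in V}. Proof. by case: VA. Qed.
Let VC : {in V &, forall X Y, X * Y = Y * X}. Proof. by case: VA. Qed.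
Let c3 := cube0_mul0 VA cube0.

Let c3' x y z : nn V x -> nn V y -> nn V z -> x * (y * z) = 0.
Proof. by move=> nx ny nz; rewrite mulrA c3. Qed.

Let n1 := @nnM K n V VA.

Let coef1 k0 x : nn V x -> k0 *: 1 + x = 0 -> k0 = 0.
Proof.
move=> nx e; apply: (nn_scal VA nx); rewrite e.
by split; [rewrite mem0v | exact: nilp0].
Qed.

Let nnv x : nn V x -> x \in V. Proof. by case. Qed.

Let nM x y : nn V x -> nn V y -> nn V (x * y).
Proof. by move=> nx ny; apply: (nnM VA) => //; exact: nnv. Qed.

Ltac nns := repeat first [assumption | apply: (nnD VA) | apply: nnZ | apply: nM].

Ltac inV := repeat first [exact: V1 | apply: VM | by apply: nnv].

(** Triple products vanish, so multiplying a relation by x or y isolates its linear coefficients.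
    The two squares span the socle, and [soc2_cyclic] applies. *)
Lemma xy_table x y : nn V x -> nn V y -> x * y = 0 ->
  (forall a b, a *: (x * x) + b *: (y * y) = 0 -> a = 0 /\ b = 0) -> fitsD V mod_xy.
Proof.
move=> nx ny xy ind; have yx : y * x = 0 by rewrite (nnC VA ny nx).
have x20 a : a *: (x * x) = 0 -> a = 0.
  by move=> e; case: (ind a 0); rewrite // scale0r addr0.
have y20 a : a *: (y * y) = 0 -> a = 0.
  by move=> e; case: (ind 0 a); rewrite // scale0r add0r.
have fr : free [:: 1; x; x * x; y; y * y].
  apply: free5P => k0 k1 k2 k3 k4 e.
  have k00 : k0 = 0 by apply: coef1 e; nns.
  move: e; rewrite k00 scale0r add0r => e.
  have k10 : k1 = 0.
    apply: x20; have := congr1 ( *%R x) e; rewrite mulr0 !mulrDr -!scalerAr xy !c3' //.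
    by rewrite !scaler0 !addr0.
  have k30 : k3 = 0.
    apply: y20; have := congr1 ( *%R y) e; rewrite mulr0 !mulrDr -!scalerAr yx !c3' //.
    by rewrite !scaler0 !addr0 !add0r.
  move: e; rewrite k10 k30 !scale0r !add0r => /ind[-> ->]; split=> //.
have bV : basis_of V [:: 1; x; x * x; y; y * y].
  apply: free_basis; rewrite ?dV // => z; rewrite !inE.
  by case/orP => [/eqP->|/orP[/eqP->|/orP[/eqP->|/orP[/eqP->|/eqP->]]]]; inV.
apply: table_fits => //.
  exists [:: 1; x; x * x; y; y * y]; split; [by rewrite /= n4|exact: bV|].
  by table n4; rewrite ?mul1r ?mulr1 ?xy ?yx -?mulrA ?xy ?yx ?c3' ?mulr0 ?mul0r //; nns.
apply: (@soc2_cyclic _ _ _ (x * x) (y * y)); [by []|by inV|by inV| |].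
  apply: freeNP => k; rewrite !big_ord_recl big_ord0 addr0 => /ind[k0 k1].
  by case=> [|[|i]].
move=> X XV X0; have : X \in <<[:: 1; x; x * x; y; y * y]>>%VS by rewrite (span_basis bV).
move=> /mem_span5[k0 [k1 [k2 [k3 [k4 eX]]]]].
have [k00|k00] := eqVneq k0 0; last first.
  exists (x * x); first by inV.
  exists k0, 0; rewrite scale0r addr0.
  have -> : X * (x * x) = k0 *: (x * x).
    by rewrite eX !mulrDl -!scalerAl mul1r !c3' ?scaler0 ?addr0 //; nns.
  by split => //; apply: contraNneq k00 => /x20->.
have [k10|k10] := eqVneq k1 0; last first.
  exists x; first exact: nnv.
  exists k1, 0; rewrite scale0r addr0.
  have -> : X * x = k1 *: (x * x).
    by rewrite eX k00 !mulrDl -!scalerAl yx -!mulrA !c3' // scale0r ?mulr0 !scaler0 ?addr0 ?add0r.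
  by split => //; apply: contraNneq k10 => /x20->.
have [k30|k30] := eqVneq k3 0; last first.
  exists y; first exact: nnv.
  exists 0, k3; rewrite scale0r add0r.
  have -> : X * y = k3 *: (y * y).
    by rewrite eX k00 !mulrDl -!scalerAl xy -!mulrA !c3' // scale0r ?mulr0 !scaler0 ?addr0 ?add0r.
  by split => //; apply: contraNneq k30 => /y20->.
exists 1; rewrite ?V1 //; exists k2, k4; rewrite mulr1 X0; split=> //.
by rewrite eX k00 k10 k30 !scale0r !add0r.
Qed.

Lemma yy_table x y : nn V x -> nn V y -> y * y = 0 ->
  (forall a b, a *: (x * x) + b *: (x * y) = 0 -> a = 0 /\ b = 0) -> fitsD V mod_yy.
Proof.
move=> nx ny yy ind; have yx : y * x = x * y by rewrite (nnC VA ny nx).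
have x20 a : a *: (x * x) = 0 -> a = 0.
  by move=> e; case: (ind a 0); rewrite // scale0r addr0.
have xy0 a : a *: (x * y) = 0 -> a = 0.
  by move=> e; case: (ind 0 a); rewrite // scale0r add0r.
have fr : free [:: 1; x; x * x; y; x * y].
  apply: free5P => k0 k1 k2 k3 k4 e.
  have k00 : k0 = 0 by apply: coef1 e; nns.
  move: e; rewrite k00 scale0r add0r => e.
  have [k10 k30] : k1 = 0 /\ k3 = 0.
    apply: ind; have := congr1 ( *%R x) e; rewrite mulr0 !mulrDr -!scalerAr !c3' //.
    by rewrite !scaler0 !addr0 add0r.
  move: e; rewrite k10 k30 !scale0r !add0r => /ind[-> ->]; split=> //.
have bV : basis_of V [:: 1; x; x * x; y; x * y].
  apply: free_basis; rewrite ?dV // => z; rewrite !inE.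
  by case/orP => [/eqP->|/orP[/eqP->|/orP[/eqP->|/orP[/eqP->|/eqP->]]]]; inV.
apply: table_fits => //.
  exists [:: 1; x; x * x; y; x * y]; split; [by rewrite /= n4|exact: bV|].
  by table n4; rewrite ?mul1r ?mulr1 ?yy ?yx -?mulrA ?yy ?yx ?c3' ?mulr0 ?mul0r //; nns.
apply: (@soc2_cyclic _ _ _ (x * x) (x * y)); [by []|by inV|by inV| |].
  apply: freeNP => k; rewrite !big_ord_recl big_ord0 addr0 => /ind[k0 k1].
  by case=> [|[|i]].
move=> X XV X0; have : X \in <<[:: 1; x; x * x; y; x * y]>>%VS by rewrite (span_basis bV).
move=> /mem_span5[k0 [k1 [k2 [k3 [k4 eX]]]]].
have [k00|k00] := eqVneq k0 0; last first.
  exists (x * x); first by inV.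
  exists k0, 0; rewrite scale0r addr0.
  have -> : X * (x * x) = k0 *: (x * x).
    by rewrite eX !mulrDl -!scalerAl mul1r !c3' ?scaler0 ?addr0 //; nns.
  by split => //; apply: contraNneq k00 => /x20->.
have [/andP[/eqP k10 /eqP k30]|kn] := boolP ((k1 == 0) && (k3 == 0)); last first.
  exists x; first exact: nnv.
  exists k1, k3.
  have -> : X * x = k1 *: (x * x) + k3 *: (x * y).
    by rewrite eX k00 !mulrDl -!scalerAl yx -!mulrA !c3' // scale0r !scaler0 ?addr0 ?add0r.
  by split => //; apply: contraNneq kn => /ind[-> ->]; rewrite eqxx.
exists 1; rewrite ?V1 //; exists k2, k4; rewrite mulr1 X0; split=> //.
by rewrite eX k00 k10 k30 !scale0r !add0r.
Qed.

(* Two squares that are not proportional: the quadratic relation between x and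
   y splits into linear factors, which are distinct or equal. *)
Lemma two_squares x y : nn V x -> nn V y ->
  (forall a b, a *: (x * x) + b *: (y * y) = 0 -> a = 0 /\ b = 0) ->
  fitsD V mod_xy \/ fitsD V mod_yy.
Proof.
move=> nx ny ind; have yx : y * x = x * y by rewrite (nnC VA ny nx).
have x20 a : a *: (x * x) = 0 -> a = 0.
  by move=> e; case: (ind a 0); rewrite // scale0r addr0.
have lin k1 k3 : k1 *: (x * x) + k3 *: (x * y) = 0 -> k1 *: (x * y) + k3 *: (y * y) = 0 ->
    k1 = 0 /\ k3 = 0.
  move=> e1 e2; have [k30|k30] := eqVneq k3 0.
    by move: e1; rewrite k30 scale0r addr0 => /x20.
  have exy : x * y = (- (k3^-1 * k1)) *: (x * x).
    by apply: (scalerI k30); rewrite scalerA mulrN mulVKf // scaleNr; apply/eqP; rewrite -addr_eq0 addrC e1 eqxx.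
  move: e2; rewrite exy scalerA => /ind[_ k3e]; by rewrite k3e eqxx in k30.
have fr : free [:: 1; x; x * x; y; y * y].
  apply: free5P => k0 k1 k2 k3 k4 e.
  have k00 : k0 = 0 by apply: coef1 e; nns.
  move: e; rewrite k00 scale0r add0r => e.
  have [k10 k30] : k1 = 0 /\ k3 = 0.
    apply: lin; [have := congr1 ( *%R x) e | have := congr1 ( *%R y) e];
      by rewrite mulr0 !mulrDr -!scalerAr ?yx !c3' // !scaler0 !addr0 ?add0r.
  by move: e; rewrite k10 k30 !scale0r !add0r => /ind[-> ->].
have bV : basis_of V [:: 1; x; x * x; y; y * y].
  apply: free_basis; rewrite ?dV // => z; rewrite !inE.
  by case/orP => [/eqP->|/orP[/eqP->|/orP[/eqP->|/orP[/eqP->|/eqP->]]]]; inV.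
have : x * y \in <<[:: 1; x; x * x; y; y * y]>>%VS by rewrite (span_basis bV); inV.
move=> /mem_span5[k0 [k1 [c [k3 [d exy]]]]].
have k00 : k0 = 0.
  apply: (@coef1 _ (k1 *: x + (c *: (x * x) + (k3 *: y + d *: (y * y))) - x * y)).
    by apply: (nnB VA); nns.
  by rewrite addrA -exy subrr.
have [k10 k30] : k1 = 0 /\ k3 = 0.
  apply: lin; [have := congr1 ( *%R x) exy | have := congr1 ( *%R y) exy];
    by rewrite k00 scale0r add0r !mulrDr -!scalerAr ?yx !c3' // !scaler0 !addr0 ?add0r => /esym.
move: exy; rewrite k00 k10 k30 !scale0r !add0r => exy {lin fr bV k0 k1 k3 k00 k10 k30}.
(* Here x y = c x x + d y y. If d = 0, then y - c x has product zero with x. *)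
have [d0|d0] := eqVneq d 0.
  left; move: exy; rewrite d0 scale0r addr0 => exy.
  apply: (@xy_table x (y - c *: x)) => //; first by apply: (nnB VA); nns.
    by rewrite mulrBr -scalerAr exy subrr.
  have -> : (y - c *: x) * (y - c *: x) = y * y - c ^+ 2 *: (x * x).
    rewrite mulrBl !mulrBr -!scalerAl -!scalerAr yx exy.
    by move: (y * y) (x * x) => P S; apply/matrixP => i j; rewrite !mxE; ring.
  move=> a b; have -> : a *: (x * x) + b *: (y * y - c ^+ 2 *: (x * x)) =
      (a - b * c ^+ 2) *: (x * x) + b *: (y * y).
    by move: (y * y) (x * x) => P S; apply/matrixP => i j; rewrite !mxE; ring.
  by move=> /ind[+ b0]; rewrite b0 mul0r subr0.
(* r and t are the roots of d X^2 - X + c and s is their difference; the relation between x and y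
   becomes (y - r x)(y - t x) = 0. *)
have [s [r [t [es sr rt]]]] : exists s r t, [/\ r - t = s, r + t = d^-1 & r * t = d^-1 * c].
  pose s := sqrtC (1 - 4 * c * d).
  exists (d^-1 * s), ((1 + s) / (2 * d)), ((1 - s) / (2 * d)); split; [by field|by field|].
  have s2 : s * s = 1 - 4 * c * d by rewrite -expr2 sqrtCK.
  apply: (mulfI (_ : 4 * d ^+ 2 != 0)); first by rewrite mulf_neq0 ?expf_neq0 ?pnatr_eq0.
  have -> : 4 * d ^+ 2 * ((1 + s) / (2 * d) * ((1 - s) / (2 * d))) = 1 - s * s by field.
  by rewrite s2; field.
have fac a b : (y - a *: x) * (y - b *: x) = (y * y) - (a + b) *: (x * y) + (a * b) *: (x * x).
  rewrite mulrBl !mulrBr -!scalerAl -!scalerAr yx.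
  by move: (y * y) (x * y) (x * x) => P Q S; apply/matrixP => i j; rewrite !mxE; ring.
have l120 : (y - r *: x) * (y - t *: x) = 0.
  rewrite fac sr rt exy.
  by move: (y * y) (x * x) => P S; apply/matrixP => i j; rewrite !mxE; field.
have nl a : nn V (y - a *: x) by apply: (nnB VA); nns.
have cE : c = d * (r * t) by rewrite rt mulVKf.
have d1 : d * (r + t) = 1 by rewrite sr mulfV.
have sq a b : a + b = r + t -> a * b = r * t ->
    (y - a *: x) * (y - a *: x) = (d * (a - b)) *: (a ^+ 2 *: (x * x) - y * y).
  move=> ab1 ab2; rewrite fac exy cE -ab2.
  have {}d1 : d * (a + b) = 1 by rewrite ab1.
  move: (y * y) (x * x) => P S; apply/matrixP => i j; rewrite !mxE.
  apply/eqP; rewrite -subr_eq0; apply/eqP.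
  transitivity ((1 - d * (a + b)) * (P i j + a ^+ 2 * S i j)); first by ring.
  by rewrite d1 subrr mul0r.
(* A double root gives an element of square zero, hence [mod_yy]; distinct roots give two elements
   with product zero, hence [mod_xy]. *)
have [s0|s0] := eqVneq s 0.
  right; have rt' : r = t by apply/eqP; rewrite -subr_eq0 es s0.
  apply: (@yy_table x (y - r *: x)) => //; first by rewrite {2}rt'.
  move=> a b; rewrite mulrBr -scalerAr exy.
  have -> : a *: (x * x) + b *: (c *: (x * x) + d *: (y * y) - r *: (x * x)) =
      (a + b * (c - r)) *: (x * x) + (b * d) *: (y * y).
    by move: (y * y) (x * x) => P S; apply/matrixP => i j; rewrite !mxE; ring.
  move=> /ind[e /eqP]; rewrite mulf_eq0 (negPf d0) orbF => /eqP b0.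
  by move: e; rewrite b0 mul0r addr0.
left; apply: (@xy_table (y - r *: x) (y - t *: x)) => //.
move=> a b; rewrite (sq r t) // (sq t r) ?[t + r]addrC ?[t * r]mulrC //.
have -> : a *: ((d * (r - t)) *: (r ^+ 2 *: (x * x) - y * y)) +
   b *: ((d * (t - r)) *: (t ^+ 2 *: (x * x) - y * y)) =
   (d * s * (a * r ^+ 2 - b * t ^+ 2)) *: (x * x) + (d * s * (b - a)) *: (y * y).
  by rewrite -es; move: (y * y) (x * x) => P S; apply/matrixP => i j; rewrite !mxE; ring.
have ds0 : d * s != 0 by rewrite mulf_neq0.
move=> /ind[/eqP + /eqP]; rewrite !mulf_eq0 (negPf d0) (negPf s0) /= => + /eqP h.
have {h}-> : b = a by apply/eqP; rewrite -subr_eq0 h.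
rewrite -mulrBr subr_sqr es sr mulf_eq0 => /orP[/eqP->//|].
by rewrite mulf_eq0 invr_eq0 (negPf d0) (negPf s0).
Qed.

Let mem_sp z s : z \in s -> z \in <<s>>%VS. Proof. exact: memv_span. Qed.

(** The case where the square form has rank 1. The socle is spanned by x x, y, z, and is too large
    for a cyclic vector of V or of its transpose to be guaranteed, so the table does not determine V
    up to conjugation. *)
Definition square_soc x y z := [/\ nn V x, nn V y, nn V z,
  basis_of V [:: 1; x; x * x; y; z] & [/\ x * y = 0, x * z = 0, y * y = 0, y * z = 0 & z * z = 0]].

(* y is an eigenvector of the square form of norm 1 orthogonal to x and z. *)
Lemma unit_square x y z c : nn V x -> nn V y -> nn V z -> x * x != 0 ->
  basis_of V [:: 1; x; x * x; y; z] -> x * y = 0 -> x * z = 0 -> y * y = x * x -> y * z = 0 ->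
  z * z = c *: (x * x) -> fitsD V mod_q3 \/ fitsD V mod_q2.
Proof.
move=> nx ny nz x2 bV xy xz yy yz zz.
have x2K a : a *: (x * x) = 0 -> a = 0.
  by move=> /eqP; rewrite scaler_eq0 (negPf x2) orbF => /eqP.
(* If z z = 0, the socle is spanned by x x and z. Otherwise rescaling z makes the three squares
   equal, and the socle is the line of x x. *)
have [c0|c0] := eqVneq c 0.
  have yx : y * x = 0 by rewrite (nnC VA ny nx).
  have zx : z * x = 0 by rewrite (nnC VA nz nx).
  have zy : z * y = 0 by rewrite (nnC VA nz ny).
  move: zz; rewrite c0 scale0r => zz.
  right; apply: table_fits => //.
    exists [:: 1; x; x * x; y; z]; split; [by rewrite /= n4|exact: bV|].
    table n4; rewrite ?mul1r ?mulr1 ?xy ?yx ?xz ?zx ?zy ?yz ?yy ?zz -?mulrA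
       ?xy ?yx ?xz ?zx ?zy ?yz ?yy ?zz ?c3' ?mulr0 ?mul0r //; nns.
  apply: (@soc2_cyclic _ _ _ (x * x) z) => //; [by inV|by inV| |].
    have := basis_free bV; rewrite -[[:: _; _; _; _; _]]/([:: 1; x] ++ [:: x * x; y; z]).
    move=> /catr_free; rewrite -[[:: _; _; _]]/([:: x * x] ++ [:: y] ++ [:: z]).
    rewrite (perm_free (permEl (perm_catCA _ _ _))); exact: catr_free.
  move=> X XV X0; have : X \in <<[:: 1; x; x * x; y; z]>>%VS by rewrite (span_basis bV).
  move=> /mem_span5[k0 [k1 [k2 [k3 [k4 eX]]]]].
  have [k00|k00] := eqVneq k0 0; last first.
    exists (x * x); first by inV.
    exists k0, 0; rewrite scale0r addr0.
    have -> : X * (x * x) = k0 *: (x * x).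
      by rewrite eX !mulrDl -!scalerAl mul1r !c3' ?scaler0 ?addr0 //; nns.
    by split => //; apply: contraNneq k00 => /x2K->.
  have [k10|k10] := eqVneq k1 0; last first.
    exists x; first exact: nnv.
    exists k1, 0; rewrite scale0r addr0.
    have -> : X * x = k1 *: (x * x).
      by rewrite eX k00 !mulrDl -!scalerAl yx zx -!mulrA !c3' // scale0r ?mulr0 !scaler0 ?addr0 ?add0r.
    by split => //; apply: contraNneq k10 => /x2K->.
  have [k30|k30] := eqVneq k3 0; last first.
    exists y; first exact: nnv.
    exists k3, 0; rewrite scale0r addr0.
    have -> : X * y = k3 *: (x * x).
      by rewrite eX k00 !mulrDl -!scalerAl xy zy yy -!mulrA !c3' // scale0r ?mulr0 !scaler0 ?addr0 ?add0r.
    by split => //; apply: contraNneq k30 => /x2K->.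
  exists 1; rewrite ?V1 //; exists k2, k4; rewrite mulr1 X0; split=> //.
  by rewrite eX k00 k10 k30 !scale0r !add0r.
left; have s0 : sqrtC c != 0 by rewrite sqrtC_eq0.
pose w := (sqrtC c)^-1 *: z.
have nw : nn V w by exact: nnZ.
have xw : x * w = 0 by rewrite -scalerAr xz scaler0.
have yw : y * w = 0 by rewrite -scalerAr yz scaler0.
have ww : w * w = x * x.
  by rewrite -scalerAl -scalerAr zz !scalerA -invfM -expr2 sqrtCK mulVf ?scale1r.
have {}bV : basis_of V [:: 1; x; x * x; y; w].
  apply: (basis_change bV) => // u; rewrite !inE.
    by case/orP => [/eqP->|/orP[/eqP->|/orP[/eqP->|/orP[/eqP->|/eqP->]]]]; inV.
  case/orP => [/eqP->|/orP[/eqP->|/orP[/eqP->|/orP[/eqP->|/eqP->]]]];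
    try by apply: mem_sp; rewrite !inE eqxx ?orbT.
  by rewrite -[z](scalerKV s0) memvZ // mem_sp // !inE eqxx ?orbT.
clearbody w; clear z nz xz yz zz c c0 s0.
have yx : y * x = 0 by rewrite (nnC VA ny nx).
have wx : w * x = 0 by rewrite (nnC VA nw nx).
have wy : w * y = 0 by rewrite (nnC VA nw ny).
apply: table_fits => //.
  exists [:: 1; x; x * x; y; w]; split; [by rewrite /= n4|exact: bV|].
  table n4; rewrite ?mul1r ?mulr1 ?xy ?yx ?xw ?wx ?wy ?yw ?yy ?ww -?mulrA
       ?xy ?yx ?xw ?wx ?wy ?yw ?yy ?ww ?c3' ?mulr0 ?mul0r //; nns.
left; apply: (@soc1_cyclic _ _ _ (x * x)) => //.
move=> X XV X0; have : X \in <<[:: 1; x; x * x; y; w]>>%VS by rewrite (span_basis bV).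
move=> /mem_span5[k0 [k1 [k2 [k3 [k4 eX]]]]].
have [k00|k00] := eqVneq k0 0; last first.
  exists (x * x); first by inV.
  exists k0 => //; by rewrite eX !mulrDl -!scalerAl mul1r !c3' ?scaler0 ?addr0 //; nns.
have [k10|k10] := eqVneq k1 0; last first.
  exists x; first exact: nnv.
  by exists k1 => //; rewrite eX k00 !mulrDl -!scalerAl yx wx -!mulrA !c3' // scale0r ?mulr0 !scaler0 ?addr0 ?add0r.
have [k30|k30] := eqVneq k3 0; last first.
  exists y; first exact: nnv.
  by exists k3 => //; rewrite eX k00 !mulrDl -!scalerAl xy wy yy -!mulrA !c3' // scale0r ?mulr0 !scaler0 ?addr0 ?add0r.
have [k40|k40] := eqVneq k4 0; last first.
  exists w; first exact: nnv.
  by exists k4 => //; rewrite eX k00 !mulrDl -!scalerAl xw yw ww -!mulrA !c3' // scale0r ?mulr0 !scaler0 ?addr0 ?add0r.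
exists 1; rewrite ?V1 //; exists k2; last by rewrite mulr1 eX k00 k10 k30 k40 !scale0r !add0r addr0.
by apply: contraNneq X0 => k20; rewrite eX k00 k10 k20 k30 k40 !scale0r !addr0.
Qed.

(** All squares are multiples of x x, hence by polarization all products; the multiplication is a
    symmetric bilinear form, which is diagonalized starting from x. Its rank is 3, 2 or 1. *)
Lemma one_square x : nn V x -> x * x != 0 ->
  (forall y, nn V y -> exists c, y * y = c *: (x * x)) ->
  [\/ fitsD V mod_q3, fitsD V mod_q2 | exists x y z, square_soc x y z].
Proof.
move=> nx x2 sq.
have two0 : (2 : K) != 0 by rewrite pnatr_eq0.
have pol y z : nn V y -> nn V z -> exists c, y * z = c *: (x * x).
  move=> ny nz; have [a ea] := sq _ ny; have [b eb] := sq _ nz.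
  have [c] := sq _ (nnD VA ny nz).
  rewrite mulrDl !mulrDr ea eb (nnC VA nz ny) => e; exists ((c - a - b) / 2).
  apply: (scalerI two0); rewrite scalerA mulrCA mulfV // mulr1 !scalerBl -e.
  by move: (y * z) (x * x) => P S; apply/matrixP => i j; rewrite !mxE; ring.
have x2K a : a *: (x * x) = 0 -> a = 0.
  by move=> /eqP; rewrite scaler_eq0 (negPf x2) orbF => /eqP.
have proj y0 : nn V y0 -> exists2 y, nn V y /\ x * y = 0 & exists c, y0 = y + c *: x.
  move=> ny0; have [c e] := pol _ _ nx ny0; exists (y0 - c *: x); last by exists c; rewrite subrK.
  split; first by apply: (nnB VA); nns.
  by rewrite mulrBr -scalerAr e subrr.
have sub3 : (size [:: 1; x; x * x]%R < \dim V)%N by rewrite dV.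
have [|y0 ny0 y0s] := nn_ext VA VL _ sub3; first by apply: mem_sp; rewrite inE eqxx.
have [y [ny xy] [cy ey]] := proj _ ny0.
have ys : y \notin <<[:: 1; x; x * x]>>%VS.
  by apply: contra y0s => h; rewrite ey memvD // memvZ // mem_sp // !inE eqxx orbT.
have sub4 : (size [:: y; 1; x; x * x]%R < \dim V)%N by rewrite dV.
have [|z0 nz0 z0s] := nn_ext VA VL _ sub4; first by apply: mem_sp; rewrite !inE eqxx orbT.
have [z [nz xz] [cz ez]] := proj _ nz0.
have zs : z \notin <<[:: y; 1; x; x * x]>>%VS.
  by apply: contra z0s => h; rewrite ez memvD // memvZ // mem_sp // !inE eqxx !orbT.
have bV : basis_of V [:: 1; x; x * x; y; z].
  have fr : free [:: z; y; 1; x; x * x].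
    rewrite free_cons zs free_cons ys /=.
    exact: (@free_pows K n x 2 x2 (cube0 nx)).
  apply: free_basis; rewrite ?dV //.
    have := fr; rewrite -[[:: _; _; _; _; _]]/([:: z] ++ [:: y; 1; x; x * x]).
    rewrite (perm_free (permEl (perm_catC _ _))) /= -[[:: _; _; _; _; _]]/([:: y] ++ [:: 1; x; x * x; z]).
    rewrite (perm_free (permEl (perm_catC _ _))) /= -[[:: _; _; _; _; _]]/([:: 1; x; x * x] ++ [:: z] ++ [:: y]).
    move=> h; rewrite -[[:: _; _; _; _; _]]/([:: 1; x; x * x] ++ [:: y] ++ [:: z]).
    rewrite (perm_free (Y := [:: 1; x; x * x] ++ [:: z] ++ [:: y])) //.
    by rewrite perm_cat2l perm_catC.
  move=> u; rewrite !inE.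
  by case/orP => [/eqP->|/orP[/eqP->|/orP[/eqP->|/orP[/eqP->|/eqP->]]]]; inV.
clear y0 ny0 y0s ey ys sub3 sub4 z0 nz0 z0s ez zs proj.
have bc y' z' : nn V y' -> nn V z' -> y \in <<[:: 1; x; x * x; y'; z']>>%VS ->
    z \in <<[:: 1; x; x * x; y'; z']>>%VS -> basis_of V [:: 1; x; x * x; y'; z'].
  move=> ny' nz' ys zs; apply: (basis_change bV) => // u; rewrite !inE.
    by case/orP => [/eqP->|/orP[/eqP->|/orP[/eqP->|/orP[/eqP->|/eqP->]]]]; inV.
  case/orP => [/eqP->|/orP[/eqP->|/orP[/eqP->|/orP[/eqP->|/eqP->]]]] //;
    by apply: mem_sp; rewrite !inE eqxx ?orbT.
(* From a y' of nonzero square, orthogonal to x, rescale y' to have square x x and project z'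
   orthogonally to it. *)
have main y' z' a : nn V y' -> nn V z' -> basis_of V [:: 1; x; x * x; y'; z'] ->
    x * y' = 0 -> x * z' = 0 -> y' * y' = a *: (x * x) -> a != 0 ->
    fitsD V mod_q3 \/ fitsD V mod_q2.
  move=> ny' nz' b' xy' xz' yy' a0; have s0 : sqrtC a != 0 by rewrite sqrtC_eq0.
  have [c yz'] := pol _ _ ny' nz'.
  have [e ze] := pol _ _ (nnB VA nz' (nnZ (c / a) ny')) (nnB VA nz' (nnZ (c / a) ny')).
  have nu : nn V ((sqrtC a)^-1 *: y') by exact: nnZ.
  have nw := nnB VA nz' (nnZ (c / a) ny').
  apply: (unit_square nx nu nw x2 _ _ _ _ _ ze).
  - apply: (basis_change b') => // u; rewrite !inE.
      by case/orP => [/eqP->|/orP[/eqP->|/orP[/eqP->|/orP[/eqP->|/eqP->]]]]; inV.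
    have y's : y' \in <<[:: 1; x; x * x; (sqrtC a)^-1 *: y'; z' - (c / a) *: y']>>%VS.
      by rewrite -{1}[y'](scalerKV s0) memvZ // mem_sp // !inE eqxx ?orbT.
    case/orP => [/eqP->|/orP[/eqP->|/orP[/eqP->|/orP[/eqP->|/eqP->]]]] //;
      try by apply: mem_sp; rewrite !inE eqxx ?orbT.
    rewrite -{1}[z'](subrK ((c / a) *: y')) memvD ?memvZ //.
    by apply: mem_sp; rewrite !inE eqxx ?orbT.
  - by rewrite -scalerAr xy' scaler0.
  - by rewrite mulrBr -scalerAr xy' xz' scaler0 subrr.
  - by rewrite -scalerAl -scalerAr yy' !scalerA -invfM -expr2 sqrtCK mulVf ?scale1r.
  by rewrite -scalerAl mulrBr -scalerAr yz' yy' scalerA divfK // subrr scaler0.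
have [a ya] := sq _ ny; have [b zb] := sq _ nz; have [c yzc] := pol _ _ ny nz.
have [a0|a0] := eqVneq a 0; last by case: (main y z a) => // ?; [constructor 1|constructor 2].
have [b0|b0] := eqVneq b 0; last first.
  case: (main z y b) => // [|?|?]; [|by constructor 1|by constructor 2].
  by apply: bc => //; apply: mem_sp; rewrite !inE eqxx ?orbT.
(* If y and z have square zero but are not orthogonal, y + z has square 2 c x x. *)
have [c0|c0] := eqVneq c 0; last first.
  case: (main (y + z) z (2 * c)) => // [|||||?|?]; [| | | | |by constructor 1|by constructor 2].
  - exact: (nnD VA).
  - apply: bc => //; [exact: (nnD VA)| |by apply: mem_sp; rewrite !inE eqxx ?orbT].
    by rewrite -{1}[y](addrK z) memvB // mem_sp // !inE eqxx ?orbT.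
  - by rewrite mulrDr xy xz addr0.
  - rewrite mulrDl !mulrDr (nnC VA nz ny) ya zb yzc a0 b0 !scale0r add0r addr0.
    by rewrite -scalerDl mulr_natl mulr2n.
  - exact: mulf_neq0.
constructor 3; exists x, y, z; split => //; split=> //.
- by rewrite ya a0 scale0r.
- by rewrite yzc c0 scale0r.
- by rewrite zb b0 scale0r.
Qed.

Lemma cube0_cases x : nn V x -> x * x != 0 ->
  [\/ fitsD V mod_xy, fitsD V mod_yy, fitsD V mod_q3 | fitsD V mod_q2] \/
  exists x y z, square_soc x y z.
Proof.
move=> nx x2.
have [[y ny ysq]|nsq] := EM (exists2 y, nn V y & forall c, y * y != c *: (x * x)).
  have ind a b : a *: (x * x) + b *: (y * y) = 0 -> a = 0 /\ b = 0.
    move=> e; have [b0|b0] := eqVneq b 0.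
      split=> //; move: e; rewrite b0 scale0r addr0 => /eqP.
      by rewrite scaler_eq0 (negPf x2) orbF => /eqP.
    have /eqP[] := ysq (- (b^-1 * a)); apply: (scalerI b0).
    by rewrite scalerA mulrN mulVKf // scaleNr; apply/eqP; rewrite -addr_eq0 addrC e.
  by case: (two_squares nx ny ind) => ?; left; [constructor 1|constructor 2].
case: (one_square nx x2) => [y ny||?|?].
- by apply: contrapT => h; apply: nsq; exists y => // c; apply/eqP => e; apply: h; exists c.
- by left; constructor 3.
- by left; constructor 4.
- by right.
Qed.
End Cube0.

(** * Models with a three-dimensional socle *)

Definition mod_q1 : model :=
  [:: diag_slice 5; [:: ent 0 1; ent 1 2]; [:: ent 0 2]; [:: ent 0 3]; [:: ent 0 4]].
(** [mod_q1] is the regular representation of the algebra with basis 1, x, x x, g, h in which x x is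
    the only nonzero product of the last four. [mod_n1] to [mod_n4] are other faithful
    representations of the same algebra, without a cyclic vector. In [mod_n1] to [mod_n3] the Jordan
    type of x is (3,1,1), in [mod_n4] it is (3,2). *)
Definition mod_n1 : model :=
  [:: diag_slice 5; [:: ent 0 1; ent 1 2]; [:: ent 0 2]; [:: ent 0 3]; [:: ent 4 2]].
Definition mod_n2 : model :=
  [:: diag_slice 5; [:: ent 0 1; ent 1 2]; [:: ent 0 2]; [:: ent 4 2]; [:: ent 4 3]].
Definition mod_n3 : model :=
  [:: diag_slice 5; [:: ent 0 1; ent 1 2]; [:: ent 0 2]; [:: ent 4 2; ent 0 3]; [:: ent 4 3]].
Definition mod_n4 : model :=
  [:: diag_slice 5; [:: ent 0 1; ent 1 2; ent 3 4]; [:: ent 0 2]; [:: ent 3 2]; [:: ent 0 4]].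

Definition tr_slice (l : slice) : slice := [seq (e.1.2, e.1.1, e.2) | e <- l].
Definition tr_model (E : model) : model := [seq tr_slice l | l <- E].
Definition wf_model n (E : model) :=
  all (all (fun e : nat * nat * int => (e.1.1 < n)%N && (e.1.2 < n)%N)) E.

Section Frames.
Variables (K : numClosedFieldType) (n : nat).
Implicit Types (V : {vspace 'M[K]_n.+1}) (X : 'M[K]_n.+1) (p : seq 'rV[K]_n.+1).

Definition slice_mx (l : slice) : 'M[K]_n.+1 :=
  \matrix_(j, k) \sum_(e <- l | (e.1.1 == j) && (e.1.2 == k)) e.2%:~R.

Definition frame_mx p : 'M[K]_n.+1 := \matrix_(j < n.+1) p`_j.

Lemma frame_unit p : size p = n.+1 -> free p -> frame_mx p \in unitmx.
Proof.
move=> sp fp; rewrite -row_free_unit; apply/inj_row_free => u uP.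
apply/rowP => j; rewrite mxE.
pose a i : K := if insub i is Some k then u 0 k else 0.
have := freeN0 (a := a) fp; rewrite sp => /(_ _ j (ltn_ord j)).
rewrite /a valK; apply; rewrite -[RHS]uP mulmx_sum_row.
by apply: eq_bigr => i _; rewrite valK rowK.
Qed.

Lemma slice_mxE l p j : all (fun e : nat * nat * int => (e.1.1 < n.+1)%N && (e.1.2 < n.+1)%N) l ->
  slice_act l p (nat_of_ord j) = row j (slice_mx l *m frame_mx p).
Proof.
move=> wl; rewrite row_mul mulmx_sum_row slice_actE.
under eq_bigr do rewrite !mxE rowK.
elim: l wl => [_|e l IH] /=; first by rewrite big1 // => k _; rewrite big_nil scale0r.
case/andP=> /andP[e1 e2] /IH{}IH; rewrite IH.
under [RHS]eq_bigr do rewrite big_cons.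
case: (e.1.1 == j) => //=; rewrite (bigD1 (Ordinal e2)) //= [in RHS](bigD1 (Ordinal e2)) //= eqxx.
rewrite addrA -scalerDl; congr (_ + _); apply: eq_bigr => k /negPf.
by rewrite -val_eqE /= eq_sym => ->.
Qed.

Lemma fitsP V E : size E = n.+1 -> wf_model n.+1 E ->
  fits V E <-> exists2 P, P \in unitmx & forall X, X \in V -> exists c : nat -> K,
    P *m X = (\sum_(i < n.+1) c i *: slice_mx (nth [::] E i)) *m P.
Proof.
move=> sE /allP wE; have wEi (i : 'I_n.+1) : nth [::] E i \in E by rewrite mem_nth ?sE.
split=> [[p [sp fp H]]|[P PU H]].
  exists (frame_mx p); first exact: frame_unit.
  move=> X /H[c Hc]; exists c; apply/row_matrixP => j.
  rewrite row_mul rowK Hc // mulmx_suml linear_sum; apply: eq_bigr => i _.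
  by rewrite -scalemxAl linearZ /=; congr (_ *: _); apply: slice_mxE; rewrite wE.
pose p := [seq row j P | j <- enum 'I_n.+1].
have sp : size p = n.+1 by rewrite size_map size_enum_ord.
have pE (j : 'I_n.+1) : p`_j = row j P.
  by rewrite (nth_map j) ?size_enum_ord // nth_ord_enum.
have PE : P = frame_mx p by apply/row_matrixP => j; rewrite rowK pE.
exists p; split=> //.
  apply: freeNP => a; rewrite sp => sa i i_n.
  have : (\row_(j < n.+1) a j) *m P = 0.
    rewrite mulmx_sum_row -[RHS]sa; apply: eq_bigr => j _.
    by rewrite mxE pE.
  move/(congr1 (mulmx^~ (invmx P))); rewrite mulmxK // mul0mx => /rowP/(_ (Ordinal i_n)).
  by rewrite !mxE.
move=> X /H[c Hc]; exists c => j jn; rewrite -[j]/(nat_of_ord (Ordinal jn)) pE -row_mul Hc.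
rewrite mulmx_suml linear_sum; apply: eq_bigr => i _.
rewrite -scalemxAl linearZ /= PE; congr (_ *: _); apply/esym.
by apply: (slice_mxE p (Ordinal jn)); rewrite wE.
Qed.

Lemma slice_mx_tr l : slice_mx (tr_slice l) = (slice_mx l)^T.
Proof. by apply/matrixP => j k; rewrite !mxE big_map; apply: eq_bigl => e /=; rewrite andbC. Qed.

Lemma wf_tr m (E : model) : wf_model m E -> wf_model m (tr_model E).
Proof.
move=> wE; rewrite /wf_model /tr_model all_map; apply: sub_all wE => l /=.
by rewrite all_map; apply: sub_all => e /=; rewrite andbC.
Qed.

Lemma fits_tr V E : size E = n.+1 -> wf_model n.+1 E -> fits V (tr_model E) -> fits (trV V) E.
Proof.
move=> sE wE /fitsP; rewrite size_map => /(_ sE (wf_tr wE))[P PU H].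
apply/fitsP => //; exists (invmx P)^T; first by rewrite unitmx_tr unitmx_inv.
move=> X; rewrite mem_trV => /H[c Hc]; exists c.
apply: trmx_inj; rewrite !trmx_mul trmxK -[X^T](mulKmx PU) Hc -!mulmxA mulmxV // mulmx1.
congr (_ *m _); rewrite linear_sum; apply: eq_bigr => i _.
by rewrite linearZ /= (nth_map [::]) ?sE // slice_mx_tr.
Qed.

Lemma fits_frame V E p (Z : seq 'M[K]_n.+1) : size p = n.+1 -> free p -> size Z = n.+1 ->
  {subset V <= <<Z>>%VS} ->
  (forall i j, (i < n.+1)%N -> (j < n.+1)%N -> p`_j *m Z`_i = slice_act (nth [::] E i) p j) ->
  fits V E.
Proof.
move=> sp fp sZ VZ H; exists p; split => // X /VZ /mem_spanP[c]; rewrite sZ => ->.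
exists c => j jn; rewrite mulmx_sumr; apply: eq_bigr => i _.
by rewrite -scalemxAr H.
Qed.

Lemma frame_span p u : size p = n.+1 -> free p -> u \in <<p>>%VS.
Proof.
move=> sp fp; suff -> : <<p>>%VS = fullv by exact: memvf.
apply/eqP; rewrite eqEdim subvf /= dimvf /= /dim /= mul1n.
by move: fp; rewrite /free sp => /eqP->.
Qed.
End Frames.

Lemma free5K (K : fieldType) (vT : vectType K) (a b c d e : vT) k0 k1 k2 k3 k4 :
  free [:: a; b; c; d; e] -> k0 *: a + (k1 *: b + (k2 *: c + (k3 *: d + k4 *: e))) = 0 ->
  [/\ k0 = 0, k1 = 0, k2 = 0, k3 = 0 & k4 = 0].
Proof.
move=> /freeN0 H e0; have := H (fun i => nth 0 [:: k0; k1; k2; k3; k4] i).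
rewrite !big_ord_recl big_ord0 addr0 => /(_ e0) h.
by split; [exact: (h 0%N)|exact: (h 1%N)|exact: (h 2%N)|exact: (h 3%N)|exact: (h 4%N)].
Qed.

Lemma actM (K : fieldType) n (u : 'rV[K]_n.+1) (a b : 'M[K]_n.+1) : u *m (a * b) = u *m a *m b.
Proof. exact: mulmxA. Qed.

(** * Frames in which x has Jordan type (3,1,1) *)

Section Square.
Variables (K : numClosedFieldType) (n : nat) (V : {vspace 'M[K]_n.+1}).
Hypotheses (VA : comm_subalg V) (VL : local_alg V) (n4 : n = 4%N) (dV : \dim V = 5%N).
Implicit Types (x y z g h : 'M[K]_n.+1) (u v w : 'rV[K]_n.+1).

(** g and h complete x x to a basis of the socle and may be changed linearly. Products are listed in
    both orders, so that these changes are checked without appeal to commutativity. *)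
Definition soc_span x g h := [/\ basis_of V [:: 1; x; x * x; g; h],
  [/\ x * (x * x) = 0, x * g = 0, x * h = 0, g * x = 0 & h * x = 0] &
  [/\ g * g = 0, g * h = 0, h * g = 0 & h * h = 0]].

Lemma soc_change x g h g' h' : soc_span x g h ->
  (exists a b c, g' = a *: (x * x) + (b *: g + c *: h)) ->
  (exists a b c, h' = a *: (x * x) + (b *: g + c *: h)) ->
  g \in <<[:: 1; x; x * x; g'; h']>>%VS -> h \in <<[:: 1; x; x * x; g'; h']>>%VS ->
  soc_span x g' h'.
Proof.
case=> bV [x3 xg xh gx hx] [gg gh hg hh] [a [b [c ->]]] [d [e [f ->]]] gs hs.
have xx : (x * x) * x = 0 by rewrite -mulrA.
have xx2 : (x * x) * (x * x) = 0 by rewrite mulrA xx mul0r.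
have xxg : (x * x) * g = 0 by rewrite -mulrA xg mulr0.
have xxh : (x * x) * h = 0 by rewrite -mulrA xh mulr0.
have gxx : g * (x * x) = 0 by rewrite mulrA gx mul0r.
have hxx : h * (x * x) = 0 by rewrite mulrA hx mul0r.
split.
- apply: (basis_change bV) => // u; rewrite !inE.
    have sV s : s \in [:: 1; x; x * x; g; h] -> s \in V by exact: (basis_mem bV).
    have xxV : x * x \in V by apply: sV; rewrite !inE eqxx ?orbT.
    have gV : g \in V by apply: sV; rewrite !inE eqxx ?orbT.
    have hV : h \in V by apply: sV; rewrite !inE eqxx ?orbT.
    case/orP => [/eqP->|/orP[/eqP->|/orP[/eqP->|/orP[/eqP->|/eqP->]]]];
      by first [by apply: sV; rewrite !inE eqxx ?orbT | rewrite !memvD ?memvZ].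
  case/orP => [/eqP->|/orP[/eqP->|/orP[/eqP->|/orP[/eqP->|/eqP->]]]] //;
    by apply: memv_span; rewrite !inE eqxx ?orbT.
- by split; rewrite ?mulrDr ?mulrDl -?scalerAr -?scalerAl ?x3 ?xx ?xg ?xh ?gx ?hx ?scaler0 ?addr0.
split; rewrite !(mulrDr, mulrDl) -!scalerAr -!scalerAl;
  by rewrite xx2 xxg xxh gxx hxx gg gh hg hh !scaler0 !addr0.
Qed.

Lemma soc_swap x g h : soc_span x g h -> soc_span x h g.
Proof.
move=> H; apply: (soc_change H).
- by exists 0, 0, 1; rewrite !scale0r !add0r scale1r.
- by exists 0, 1, 0; rewrite !scale0r !add0r scale1r addr0.
- by apply: memv_span; rewrite !inE eqxx ?orbT.
by apply: memv_span; rewrite !inE eqxx ?orbT.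
Qed.

Lemma soc_shift x g h a b : soc_span x g h -> soc_span x (g + a *: (x * x) + b *: h) h.
Proof.
move=> H; apply: (soc_change H).
- by exists a, 1, b; rewrite scale1r addrA [_ + g]addrC.
- by exists 0, 0, 1; rewrite !scale0r !add0r scale1r.
- have e : g = (g + a *: (x * x) + b *: h) - b *: h - a *: (x * x) by rewrite !addrK.
  by rewrite [X in X \in _]e !memvB ?memvZ // memv_span // !inE eqxx ?orbT.
by apply: memv_span; rewrite !inE eqxx ?orbT.
Qed.

Lemma soc_scale x g h a : a != 0 -> soc_span x g h -> soc_span x (a *: g) h.
Proof.
move=> a0 H; apply: (soc_change H).
- by exists 0, a, 0; rewrite !scale0r add0r addr0.
- by exists 0, 0, 1; rewrite !scale0r !add0r scale1r.
- by rewrite -{1}[g](scalerK a0) memvZ // memv_span // !inE eqxx ?orbT.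
by apply: memv_span; rewrite !inE eqxx ?orbT.
Qed.

Lemma soc_subV x g h : soc_span x g h -> {subset V <= <<[:: 1; x; x * x; g; h]>>%VS}.
Proof. by case=> bV _ _ X; rewrite (span_basis bV). Qed.

Lemma soc_mem x g h X : soc_span x g h -> X \in V ->
  exists k0 k1 k2 k3 k4, X = k0 *: 1 + (k1 *: x + (k2 *: (x * x) + (k3 *: g + k4 *: h))).
Proof. by move=> H /(soc_subV H)/mem_span5. Qed.

Section Frame.
Variables (x : 'M[K]_n.+1) (v w1 w2 : 'rV[K]_n.+1).
(** Jordan type (3,1,1) of x: a chain starting at v and two vectors killed by x. *)
Definition chain_frame v w1 w2 := [/\ free [:: v; v *m x; v *m (x * x); w1; w2],
  w1 *m x = 0 & w2 *m x = 0].
End Frame.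

Lemma frame5 x v w1 w2 u : chain_frame x v w1 w2 -> exists k0 k1 k2 k3 k4,
  u = k0 *: v + (k1 *: (v *m x) + (k2 *: (v *m (x * x)) + (k3 *: w1 + k4 *: w2))).
Proof. by case=> fp _ _; apply: mem_span5; apply: frame_span => //; rewrite /= n4. Qed.

Lemma frame_ker x v w1 w2 u : x * (x * x) = 0 -> chain_frame x v w1 w2 -> u *m x = 0 ->
  exists a b c, u = a *: (v *m (x * x)) + (b *: w1 + c *: w2).
Proof.
move=> x3 cf ux; have [k0 [k1 [k2 [k3 [k4 uE]]]]] := frame5 u cf.
case: cf => fp w1x w2x; exists k2, k3, k4.
have xx : v *m (x * x) *m x = 0 by rewrite -actM -mulrA x3 mulmx0.
move: ux; rewrite uE !mulmxDl -!scalemxAl xx w1x w2x !scaler0 !addr0 -actM => e.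
have [k00 k10 _ _ _] : [/\ k0 = 0, k1 = 0, (0:K) = 0, (0:K) = 0 & (0:K) = 0].
  have := free5K (k0 := 0) (k1 := k0) (k2 := k1) (k3 := 0) (k4 := 0) fp.
  by rewrite !scale0r !addr0 add0r => /(_ e)[].
by rewrite k00 k10 !scale0r !add0r.
Qed.

(* Some socle element moves w out of the line v x^2: the nilpotent algebra acts
   on the last two frame vectors by a nonzero square-zero matrix. *)
Lemma frame_gamma x g h v w1 w2 w : soc_span x g h -> chain_frame x v w1 w2 ->
  w *m x = 0 -> (forall a, w *m g <> a *: (v *m (x * x))) ->
  [\/ fits V mod_n2, fits (trV V) mod_n2 | fits V mod_n3].
Proof.
move=> H cf wx wg; have [bV [x3 xg xh gx hx] [gg gh hg hh]] := H.
have [fp w1x w2x] := cf.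
pose w' := w *m g.
have w'x : w' *m x = 0 by rewrite -actM gx mulmx0.
have w'g : w' *m g = 0 by rewrite -actM gg mulmx0.
have w'h : w' *m h = 0 by rewrite -actM gh mulmx0.
have w'0 : w' != 0 by apply/eqP => e; apply: (wg 0); rewrite scale0r.
have xx : v *m (x * x) *m x = 0 by rewrite -actM -mulrA x3 mulmx0.
have vxx : v *m x *m x = v *m (x * x) by rewrite actM.
have v2 : v *m (x * x) != 0.
  by apply/eqP => e; have [] := free5K (k0 := 0) (k1 := 0) (k2 := 1) (k3 := 0) (k4 := 0) fp;
   rewrite ?e ?scaler0 ?scale0r ?addr0 // => _ _ /eqP; rewrite oner_eq0.
have vxg : v *m x *m g = 0 by rewrite -actM xg mulmx0.
have vxxg : v *m (x * x) *m g = 0 by rewrite -actM -mulrA xg mulr0 mulmx0.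
have cf' v' : v' *m x = v *m x -> chain_frame x v' w' w.
  move=> v'x; split=> //; apply: free5P => k0 k1 k2 k3 k4 e.
  have v'2 : v' *m (x * x) = v *m (x * x) by rewrite !actM v'x.
  rewrite v'x v'2 in e.
  have k00 : k0 = 0.
    have := congr1 (mulmx^~ (x * x)) e; rewrite mul0mx !mulmxDl -!scalemxAl v'2.
    rewrite (_ : v *m x *m (x * x) = 0); last by rewrite -actM x3 mulmx0.
    rewrite (_ : v *m (x * x) *m (x * x) = 0); last by rewrite [LHS]actM xx mul0mx.
    rewrite !actM w'x wx !mul0mx !scaler0 !addr0 -actM => /eqP.
    by rewrite scaler_eq0 (negPf v2) orbF => /eqP.
  have k10 : k1 = 0.
    have := congr1 (mulmx^~ x) e; rewrite mul0mx !mulmxDl -!scalemxAl k00 scale0r add0r vxx xx w'x wx.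
    by rewrite !scaler0 !addr0 => /eqP; rewrite scaler_eq0 (negPf v2) orbF => /eqP.
  move: e; rewrite k00 k10 !scale0r !add0r => e.
  have k40 : k4 = 0.
    have := congr1 (mulmx^~ g) e; rewrite mul0mx !mulmxDl -!scalemxAl vxxg w'g !scaler0 !add0r.
    by move=> /eqP; rewrite scaler_eq0 (negPf w'0) orbF => /eqP.
  move: e; rewrite k40 scale0r addr0 => e.
  have k30 : k3 = 0.
    apply/eqP/negPn/negP => k30; apply: (wg (- (k3^-1 * k2))); apply: (scalerI k30).
    rewrite scalerA mulrN mulVKf // scaleNr; apply/eqP.
    by rewrite -addr_eq0 addrC e.
  by move: e; rewrite k30 scale0r addr0 => /eqP; rewrite scaler_eq0 (negPf v2) orbF => /eqP->.
have [|a0 [a1 [a2 vg]]] := frame_ker x3 (cf' v erefl) (u := v *m g).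
  by rewrite -actM gx mulmx0.
have vxxh : v *m (x * x) *m h = 0 by rewrite -actM -mulrA xh mulr0 mulmx0.
(* g g = 0 while w g != 0, so v g has no component along w. *)
have a20 : a2 = 0.
  have : v *m g *m g = 0 by rewrite -actM gg mulmx0.
  rewrite vg !mulmxDl -!scalemxAl vxxg w'g !scaler0 !add0r => /eqP.
  by rewrite scaler_eq0 (negPf w'0) orbF => /eqP.
move: vg; rewrite a20 scale0r addr0 => vg.
(* Subtracting a1 w from v removes the component of v g along w g, and subtracting a0 x x from g
   removes the one along v x x; thus v' g' = 0. *)
pose v' := v - a1 *: w; pose g' := g + (- a0) *: (x * x) + 0 *: h.
have v'x : v' *m x = v *m x by rewrite mulmxBl -scalemxAl wx scaler0 subr0.
have v'2 : v' *m (x * x) = v *m (x * x) by rewrite !actM v'x.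
have Hg : soc_span x g' h by exact: soc_shift.
have w2' : w *m (x * x) = 0 by rewrite actM wx mul0mx.
have wg' : w *m g' = w'.
  by rewrite /g' scale0r addr0 mulmxDr -scalemxAr w2' scaler0 addr0.
have v'g' : v' *m g' = 0.
  rewrite /g' scale0r addr0 mulmxDr -scalemxAr v'2 mulmxBl vg -scalemxAl -/w'.
  by rewrite addrK scaleNr subrr.
have {}cf' := cf' v' v'x.
have [_ [_ xg' _ g'x _] [g'g' g'h hg' _]] := Hg.
move: v2 xx vxx vxxh; rewrite -v'2 -v'x => v2 xx vxx vxxh.
clearbody w' v' g'; clear v'2 v'x vg a0 a1 a2 a20 wg cf fp w1x w2x w1 w2 vxg vxxg w'g.
clear g H bV xg gx gg gh hg v; rename v' into v.
have w'g' : w' *m g' = 0 by rewrite -wg' -actM g'g' mulmx0.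
have [|b0 [b1 [b2 vh]]] := frame_ker x3 cf' (u := v *m h).
  by rewrite -actM hx mulmx0.
have [|c0 [c1 [c2 wh]]] := frame_ker x3 cf' (u := w *m h).
  by rewrite -actM hx mulmx0.
have vxxg' : v *m (x * x) *m g' = 0 by rewrite -actM -mulrA xg' mulr0 mulmx0.
have b20 : b2 = 0.
  have : v *m h *m g' = 0 by rewrite -actM hg' mulmx0.
  rewrite vh !mulmxDl -!scalemxAl vxxg' w'g' wg' !scaler0 !add0r => /eqP.
  by rewrite scaler_eq0 (negPf w'0) orbF => /eqP.
have c20 : c2 = 0.
  have : w *m h *m g' = 0 by rewrite -actM hg' mulmx0.
  rewrite wh !mulmxDl -!scalemxAl vxxg' w'g' wg' !scaler0 !add0r => /eqP.
  by rewrite scaler_eq0 (negPf w'0) orbF => /eqP.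
move: vh wh; rewrite b20 c20 !scale0r !addr0 => vh wh.
(* Multiples of x x and g' are used to clear the v x x component of v h and the w' component of w
   h. *)
pose h' := h + (- b0) *: (x * x) + (- c1) *: g'.
have Hh : soc_span x g' h' by apply: soc_swap; apply: soc_shift; exact: soc_swap.
have vh' : v *m h' = b1 *: w'.
  by rewrite /h' !mulmxDr -!scalemxAr vh v'g' scaler0 addr0 scaleNr addrAC subrr add0r.
have wh' : w *m h' = c0 *: (v *m (x * x)).
  by rewrite /h' !mulmxDr -!scalemxAr wh w2' wg' scaler0 addr0 scaleNr addrK.
have w'h' : w' *m h' = 0.
  by rewrite -wg' -actM; have [_ _ [_ ->]] := Hh; rewrite mulmx0.
have [_ [_ _ xh' _ h'x] _] := Hh.
clearbody h'; clear h xh hx hh w'h Hg g'h hg' vh wh b0 b2 c1 c2 b20 c20 vxxh.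
have [_ [_ _ _ _ _] [_ g'h' h'g' h'h']] := Hh.
have [fp w'x0 wx0] := cf'.
have xxh' : v *m (x * x) *m h' = 0 by rewrite -actM -mulrA xh' mulr0 mulmx0.
have vxh' : v *m x *m h' = 0 by rewrite -actM xh' mulmx0.
have vxg' : v *m x *m g' = 0 by rewrite -actM xg' mulmx0.
have xx2 : v *m (x * x) *m (x * x) = 0 by rewrite actM xx mul0mx.
have vx2 : v *m x *m (x * x) = 0 by rewrite -actM x3 mulmx0.
have w'2 : w' *m (x * x) = 0 by rewrite actM w'x mul0mx.
have Hs := soc_swap Hh.
have fr (u0 u1 u2 u3 u4 : 'rV[K]_n.+1) : (forall k0 k1 k2 k3 k4,
    k0 *: u0 + (k1 *: u1 + (k2 *: u2 + (k3 *: u3 + k4 *: u4))) = 0 -> exists l0 l1 l2 l3 l4,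
    l0 *: v + (l1 *: (v *m x) + (l2 *: (v *m (x * x)) + (l3 *: w' + l4 *: w))) = 0 /\
    ([/\ l0 = 0, l1 = 0, l2 = 0, l3 = 0 & l4 = 0] ->
     [/\ k0 = 0, k1 = 0, k2 = 0, k3 = 0 & k4 = 0])) -> free [:: u0; u1; u2; u3; u4].
  move=> h; apply: free5P => k0 k1 k2 k3 k4 /h[l0 [l1 [l2 [l3 [l4 [e]]]]]]; apply.
  exact: free5K fp e.
(* Only v h' = b1 w' and w h' = c0 v x x are left, not both zero. For c0 = 0 the model is reached
   after transposition, for b1 = 0 directly. *)
have [c00|c00] := eqVneq c0 0.
  constructor 2; apply: fits_tr; [by rewrite /= n4|by rewrite n4|].
  have b10 : b1 != 0.
    apply/eqP => b10; have : h' = 0.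
      have vh0 : v *m h' = 0 by rewrite vh' b10 scale0r.
      have wh0 : w *m h' = 0 by rewrite wh' c00 scale0r.
      apply/row_matrixP => i; rewrite row0 rowE.
      have [k0 [k1 [k2 [k3 [k4 ->]]]]] := frame5 (delta_mx 0 i) cf'.
      by rewrite !mulmxDl -!scalemxAl vh0 vxh' xxh' w'h' wh0 !scaler0 !addr0.
    have [bV _ _] := Hh; have := basis_free bV; move=> /[swap] ->.
    by move=> /free5K/(_ (_ : 0 *: 1 + (0 *: x + (0 *: (x * x) + (0 *: g' + 1 *: 0))) = 0))[|_ _ _ _ /eqP];
       rewrite ?scaler0 ?scale0r ?addr0 // oner_eq0.
  have Hb := soc_scale (invr_neq0 b10) Hs.
  apply: (@fits_frame _ _ _ _ [:: v *m (x * x); v *m x; v; w; w'] [:: 1; x; x * x; b1^-1 *: h'; g']).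
  - by rewrite /= n4.
  - apply: fr => k0 k1 k2 k3 k4 e; exists k2, k1, k0, k4, k3; split; last by case.
    by rewrite -[RHS]e; apply/rowP => j; rewrite !mxE; ring.
  - by rewrite /= n4.
  - exact: soc_subV Hb.
  table n4; rewrite ?mulmx1 -?scalemxAr ?actM ?vxx ?xx ?w'x ?wx ?mul0mx ?vh' ?wh' ?c00 ?scale0r ?vxh'
    ?xxh' ?w'h' ?v'g' ?vxg' ?vxxg' ?w'g' ?wg' ?scalerA ?mulVf ?scale1r ?scaler0 //.
have c0V := invr_neq0 c00.
have [b10|b10] := eqVneq b1 0.
  constructor 1; have Hc := soc_scale c0V Hs.
  apply: (@fits_frame _ _ _ _ [:: v; v *m x; v *m (x * x); w'; w] [:: 1; x; x * x; c0^-1 *: h'; g']).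
  - by rewrite /= n4.
  - exact: fp.
  - by rewrite /= n4.
  - exact: soc_subV Hc.
  table n4; rewrite ?mulmx1 -?scalemxAr ?actM ?vxx ?xx ?w'x ?wx ?mul0mx ?vh' ?wh' ?b10 ?scale0r ?vxh'
    ?xxh' ?w'h' ?v'g' ?vxg' ?vxxg' ?w'g' ?wg' ?scalerA ?mulVf ?scale1r ?scaler0 //.
(* With w and w' scaled by s and h' by 1 / (s c0), both coefficients become 1 exactly when s^2 = b1
   / c0. *)
constructor 3; pose s := sqrtC (b1 / c0).
have s0 : s != 0 by rewrite sqrtC_eq0 mulf_neq0.
have s2 : s * s = b1 / c0 by rewrite -expr2 sqrtCK.
have sc0 : s * c0 != 0 by rewrite mulf_neq0.
have Hc := soc_scale (invr_neq0 sc0) Hs.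
apply: (@fits_frame _ _ _ _ [:: v; v *m x; v *m (x * x); s *: w'; s *: w]
  [:: 1; x; x * x; (s * c0)^-1 *: h'; g']).
- by rewrite /= n4.
- apply: fr => k0 k1 k2 k3 k4 e; exists k0, k1, k2, (k3 * s), (k4 * s); split.
    by rewrite -[RHS]e; apply/rowP => j; rewrite !mxE; ring.
  by case=> -> -> -> /eqP + /eqP; rewrite !mulf_eq0 (negPf s0) !orbF => /eqP-> /eqP->.
- by rewrite /= n4.
- exact: soc_subV Hc.
have e1 : (s * c0)^-1 * b1 = s.
  by apply: (mulfI sc0); rewrite mulVKf // mulrAC s2 divfK.
have e2 : (s * c0)^-1 * (s * c0) = 1 by rewrite mulVf.
table n4; rewrite ?mulmx1 -?scalemxAr -?scalemxAl ?actM ?vxx ?xx ?w'x ?wx ?mul0mx ?vh' ?wh' ?vxh'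
    ?xxh' ?w'h' ?v'g' ?vxg' ?vxxg' ?w'g' ?wg' ?scalerA ?e1 ?mulVf ?scale1r ?scaler0 //.
by rewrite -mulrA e2 scale1r.
Qed.

Lemma has_table_q1 x g h : soc_span x g h -> has_table V mod_q1.
Proof.
case=> bV [x3 xg xh gx hx] [gg gh hg hh].
have xx2 : x * x * x = 0 by rewrite -mulrA.
exists [:: 1; x; x * x; g; h]; split; [by rewrite /= n4|exact: bV|].
by table n4; rewrite ?mul1r ?mulr1 ?gg ?gh ?hg ?hh ?xg ?xh ?gx ?hx ?x3 ?mulrA ?xx2 ?gx ?hx -?mulrA ?xg ?xh ?mulr0 ?mul0r.
Qed.

Lemma dep2 (b1 b2 c1 c2 : K) : b1 * c2 = b2 * c1 -> exists a b,
  [/\ (a != 0) || (b != 0), a * b1 + b * c1 = 0 & a * b2 + b * c2 = 0].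
Proof.
move=> e; have [h|] := boolP ((c1 != 0) || (b1 != 0)).
  exists c1, (- b1); rewrite oppr_eq0; split=> //; first by ring.
  by rewrite mulNr e; ring.
rewrite negb_or !negbK => /andP[/eqP-> /eqP->].
have [h|] := boolP ((c2 != 0) || (b2 != 0)).
  by exists c2, (- b2); rewrite oppr_eq0; split=> //; ring.
rewrite negb_or !negbK => /andP[/eqP-> /eqP->].
by exists 1, 0; rewrite oner_eq0; split=> //; ring.
Qed.

Lemma frame_dual (p : seq 'rV[K]_n.+1) : size p = n.+1 -> free p -> forall k, (k < n.+1)%N ->
  exists phi : 'cV[K]_n.+1, forall j, (j < n.+1)%N -> p`_j *m phi = (j == k)%:R%:M.
Proof.
move=> sp fp k kn; have PU := frame_unit sp fp.
exists (col (Ordinal kn) (invmx (frame_mx p))) => j jn.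
have -> : p`_j = row (Ordinal jn) (frame_mx p) by rewrite rowK.
apply/rowP => i; rewrite ord1 !mxE eqxx mulr1n.
have := mulmxV PU => /matrixP/(_ (Ordinal jn) (Ordinal kn)); rewrite !mxE -val_eqE /= => <-.
by apply: eq_bigr => l _; rewrite !mxE.
Qed.

Lemma soc_free x g h k0 k1 k2 k3 k4 : soc_span x g h ->
  k0 *: 1 + (k1 *: x + (k2 *: (x * x) + (k3 *: g + k4 *: h))) = 0 ->
  [/\ k0 = 0, k1 = 0, k2 = 0, k3 = 0 & k4 = 0].
Proof. by case=> bV _ _; exact: free5K (basis_free bV). Qed.

Lemma frame_zero x v w1 w2 s : chain_frame x v w1 w2 -> v *m s = 0 -> x * s = 0 ->
  w1 *m s = 0 -> w2 *m s = 0 -> s = 0.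
Proof.
move=> cf vs xs w1s w2s; apply/row_matrixP => i; rewrite row0 rowE.
have [k0 [k1 [k2 [k3 [k4 ->]]]]] := frame5 (delta_mx 0 i) cf.
have vxs : v *m x *m s = 0 by rewrite -actM xs mulmx0.
have vxxs : v *m (x * x) *m s = 0 by rewrite -actM -mulrA xs mulr0 mulmx0.
by rewrite !mulmxDl -!scalemxAl vs vxs vxxs w1s w2s !scaler0 !addr0.
Qed.

(** Two 2 x 2 matrices, (b, c) and (a, d), record the action of g and h out of v and into v x x. If
    the first is invertible, v is cyclic; if the second is, the coordinate form of v x x is cyclic
    for the transpose. If both are singular, some combination s of g and h kills v and another one,
    t, kills w1 and w2; these two give [mod_n1]. *)
Lemma frame_nogamma_norm x g h v w1 w2 b1 b2 c1 c2 a1 a2 d1 d2 :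
  soc_span x g h -> chain_frame x v w1 w2 ->
  v *m g = b1 *: w1 + b2 *: w2 -> v *m h = c1 *: w1 + c2 *: w2 ->
  w1 *m g = a1 *: (v *m (x * x)) -> w2 *m g = a2 *: (v *m (x * x)) ->
  w1 *m h = d1 *: (v *m (x * x)) -> w2 *m h = d2 *: (v *m (x * x)) ->
  [\/ fits V mod_q1, fits (trV V) mod_q1 | fits V mod_n1].
Proof.
move=> H cf vg vh w1g w2g w1h w2h; have [fp w1x w2x] := cf.
have [bV [x3 xg xh gx hx] [gg gh hg hh]] := H.
have tq := has_table_q1 H.
have vxx : v *m x *m x = v *m (x * x) by rewrite actM.
have xx : v *m (x * x) *m x = 0 by rewrite -actM -mulrA x3 mulmx0.
have xx2 : v *m (x * x) *m (x * x) = 0 by rewrite [LHS]actM xx mul0mx.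
have vx2 : v *m x *m (x * x) = 0 by rewrite -actM x3 mulmx0.
have xg0 u s : x * s = 0 -> u *m x *m s = 0 by move=> e; rewrite -actM e mulmx0.
have xxg0 u s : x * s = 0 -> u *m (x * x) *m s = 0 by move=> e; rewrite -actM -mulrA e mulr0 mulmx0.
have [D0|D] := eqVneq (b1 * c2) (b2 * c1); last first.
  constructor 1; apply: (fits_cyclic (v := v)) => // X XV vX.
  have [k0 [k1 [k2 [k3 [k4 XE]]]]] := soc_mem H XV.
  have e : k0 *: v + (k1 *: (v *m x) + (k2 *: (v *m (x * x)) + ((k3 * b1 + k4 * c1) *: w1 + (k3 * b2 + k4 * c2) *: w2))) = 0.
    rewrite -[RHS]vX XE !mulmxDr -!scalemxAr vg vh [v *m 1]mulmx1.
    by apply/rowP => j; rewrite !mxE; ring.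
  have [k00 k10 k20 e1 e2] := free5K fp e; rewrite XE k00 k10 k20.
  have D0 : b1 * c2 - b2 * c1 != 0 by rewrite subr_eq0.
  have -> : k3 = 0.
    apply: (mulIf D0); rewrite mul0r.
    have -> : k3 * (b1 * c2 - b2 * c1) = (k3 * b1 + k4 * c1) * c2 - (k3 * b2 + k4 * c2) * c1 by ring.
    by rewrite e1 e2 !mul0r subrr.
  have -> : k4 = 0.
    apply: (mulIf D0); rewrite mul0r.
    have -> : k4 * (b1 * c2 - b2 * c1) = (k3 * b2 + k4 * c2) * b1 - (k3 * b1 + k4 * c1) * b2 by ring.
    by rewrite e1 e2 !mul0r subrr.
  by rewrite !scale0r !addr0.
have [D1|D1] := eqVneq (a1 * d2) (a2 * d1); last first.
  constructor 2; have lt5 k : (k < 5)%N -> (k < n.+1)%N by rewrite n4.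
  have sp5 : size [:: v; v *m x; (v *m (x * x))%R; w1; w2] = n.+1 by rewrite /= n4.
  have [phi Hphi] := frame_dual sp5 fp (lt5 2%N isT).
  have VAt := VA; apply: (fits_cyclic (v := phi^T)); first exact: has_table_trV.
  have P0 : v *m phi = 0 by rewrite (Hphi 0%N (lt5 0%N isT)) /=; apply/matrixP => i j; rewrite !mxE mul0rn.
  have P1 : v *m x *m phi = 0 by rewrite (Hphi 1%N (lt5 1%N isT)) /=; apply/matrixP => i j; rewrite !mxE mul0rn.
  have P2 : v *m (x * x) *m phi = 1%:M by rewrite (Hphi 2%N (lt5 2%N isT)).
  have P3 : w1 *m phi = 0 by rewrite (Hphi 3%N (lt5 3%N isT)) /=; apply/matrixP => i j; rewrite !mxE mul0rn.
  have P4 : w2 *m phi = 0 by rewrite (Hphi 4%N (lt5 4%N isT)) /=; apply/matrixP => i j; rewrite !mxE mul0rn.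
  move=> X; rewrite mem_trV => XV vX; apply: trmx_inj; rewrite trmx0.
  have {}vX : X^T *m phi = 0 by apply: trmx_inj; rewrite trmx_mul trmxK trmx0.
  have [k0 [k1 [k2 [k3 [k4 XE]]]]] := soc_mem H XV.
  have one0 k : k *: (1%:M : 'M[K]_1) = 0 -> k = 0.
    by move/matrixP/(_ 0 0); rewrite !mxE mulr1.
  have E0 u : u *m X^T *m phi = 0 by rewrite -mulmxA vX mulmx0.
  have k00 : k0 = 0.
    apply: one0; rewrite -(E0 (v *m (x * x))) XE !mulmxDr -!scalemxAr [_ *m 1]mulmx1 xx xx2 !xxg0 //.
    by rewrite !scaler0 !addr0 -scalemxAl P2.
  have k10 : k1 = 0.
    apply: one0; rewrite -(E0 (v *m x)) XE k00 scale0r add0r !mulmxDr -!scalemxAr vxx vx2 !xg0 //.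
    by rewrite !scaler0 !addr0 -scalemxAl P2.
  have k20 : k2 = 0.
    apply: one0; rewrite -(E0 v) XE k00 k10 !scale0r !add0r !mulmxDr -!scalemxAr vg vh.
    rewrite !mulmxDl -!scalemxAl !mulmxDl -!scalemxAl P2 P3 P4.
    by rewrite !scaler0 !addr0 !scaler0 !addr0.
  have w1xx : w1 *m (x * x) = 0 by rewrite actM w1x mul0mx.
  have w2xx : w2 *m (x * x) = 0 by rewrite actM w2x mul0mx.
  have e1 : k3 * a1 + k4 * d1 = 0.
    apply: one0; rewrite -(E0 w1) XE k00 k10 k20 !scale0r !add0r !mulmxDr -!scalemxAr w1g w1h.
    by rewrite !scalerA -scalerDl -scalemxAl P2.
  have e2 : k3 * a2 + k4 * d2 = 0.
    apply: one0; rewrite -(E0 w2) XE k00 k10 k20 !scale0r !add0r !mulmxDr -!scalemxAr w2g w2h.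
    by rewrite !scalerA -scalerDl -scalemxAl P2.
  rewrite XE k00 k10 k20.
  have D2 : a1 * d2 - a2 * d1 != 0 by rewrite subr_eq0.
  have -> : k3 = 0.
    apply: (mulIf D2); rewrite mul0r.
    have -> : k3 * (a1 * d2 - a2 * d1) = (k3 * a1 + k4 * d1) * d2 - (k3 * a2 + k4 * d2) * d1 by ring.
    by rewrite e1 e2 !mul0r subrr.
  have -> : k4 = 0.
    apply: (mulIf D2); rewrite mul0r.
    have -> : k4 * (a1 * d2 - a2 * d1) = (k3 * a2 + k4 * d2) * a1 - (k3 * a1 + k4 * d1) * a2 by ring.
    by rewrite e1 e2 !mul0r subrr.
  by rewrite !scale0r !addr0.
constructor 3.
have [a [b [ab0 e1 e2]]] := dep2 D0; have [c [d [cd0 f1 f2]]] := dep2 D1.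
pose s := a *: g + b *: h; pose t := c *: g + d *: h.
have vs : v *m s = 0.
  rewrite mulmxDr -!scalemxAr vg vh.
  have -> : a *: (b1 *: w1 + b2 *: w2) + b *: (c1 *: w1 + c2 *: w2) =
    (a * b1 + b * c1) *: w1 + (a * b2 + b * c2) *: w2 by apply/rowP => j; rewrite !mxE; ring.
  by rewrite e1 e2 !scale0r addr0.
have w1t : w1 *m t = 0 by rewrite mulmxDr -!scalemxAr w1g w1h !scalerA -scalerDl f1 scale0r.
have w2t : w2 *m t = 0 by rewrite mulmxDr -!scalemxAr w2g w2h !scalerA -scalerDl f2 scale0r.
have xs : x * s = 0 by rewrite mulrDr -!scalerAr xg xh !scaler0 addr0.
have xt : x * t = 0 by rewrite mulrDr -!scalerAr xg xh !scaler0 addr0.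
have comb0 k l : k *: g + l *: h = 0 -> k = 0 /\ l = 0.
  by move=> e; have [] := soc_free (k0 := 0) (k1 := 0) (k2 := 0) (k3 := k) (k4 := l) H;
   rewrite ?e ?scale0r ?addr0.
have s0 : s != 0 by apply: contraTneq ab0 => /comb0[-> ->]; rewrite eqxx.
have t0 : t != 0 by apply: contraTneq cd0 => /comb0[-> ->]; rewrite eqxx.
have vt0 : v *m t != 0 by apply: contraNneq t0 => vt0; apply/eqP; exact: frame_zero cf _ _ _ _.
(* If s and t were proportional, v s = 0 and v t != 0 would force a = b = 0. *)
have det0 : a * d - b * c != 0.
  apply/eqP => det0; have : d *: s - b *: t = 0.
    have -> : d *: s - b *: t = (a * d - b * c) *: g by apply/matrixP => i j; rewrite !mxE; ring.
    by rewrite det0 scale0r.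
  move/(congr1 (mulmx v)); rewrite mulmxBr -!scalemxAr vs scaler0 sub0r mulmx0 => /eqP.
  rewrite oppr_eq0 scaler_eq0 (negPf vt0) orbF => /eqP b0.
  have : a *: t - c *: s = 0.
    have -> : a *: t - c *: s = (a * d - b * c) *: h by apply/matrixP => i j; rewrite !mxE; ring.
    by rewrite det0 scale0r.
  move/(congr1 (mulmx v)); rewrite mulmxBr -!scalemxAr vs scaler0 subr0 mulmx0 => /eqP.
  rewrite scaler_eq0 (negPf vt0) orbF => a0; by rewrite a0 b0 eqxx in ab0.
have Ht : soc_span x t s.
  apply: (soc_change H).
  - by exists 0, c, d; rewrite scale0r add0r.
  - by exists 0, a, b; rewrite scale0r add0r.
  - have e : g = (a * d - b * c)^-1 *: (d *: s - b *: t).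
      by apply: (scalerI det0); rewrite scalerA mulfV // scale1r; apply/matrixP => i j; rewrite !mxE; ring.
    by rewrite [X in X \in _]e memvZ // memvB ?memvZ // memv_span // !inE eqxx ?orbT.
  have e : h = (a * d - b * c)^-1 *: (a *: t - c *: s).
    by apply: (scalerI det0); rewrite scalerA mulfV // scale1r; apply/matrixP => i j; rewrite !mxE; ring.
  by rewrite [X in X \in _]e memvZ // memvB ?memvZ // memv_span // !inE eqxx ?orbT.
pose s1 := a * a1 + b * d1; pose s2 := a * a2 + b * d2.
have w1s : w1 *m s = s1 *: (v *m (x * x)) by rewrite mulmxDr -!scalemxAr w1g w1h !scalerA -scalerDl.
have w2s : w2 *m s = s2 *: (v *m (x * x)) by rewrite mulmxDr -!scalemxAr w2g w2h !scalerA -scalerDl.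
have [w [wx ws wt]] : exists w, [/\ w *m x = 0, w *m s = v *m (x * x) & w *m t = 0].
  have [s10|s10] := eqVneq s1 0; last first.
    by exists (s1^-1 *: w1); rewrite -!scalemxAl w1x w1s w1t !scaler0 scalerK.
  exists (s2^-1 *: w2); rewrite -!scalemxAl w2x w2s w2t !scaler0 scalerK //.
  apply: contraNneq s0 => s20; apply/eqP; apply: (frame_zero cf vs xs).
    by rewrite w1s s10 scale0r.
  by rewrite w2s s20 scale0r.
have [_ [_ _ _ tx sx] [tt ts st ss]] := Ht.
have vtx : v *m t *m x = 0 by rewrite -actM tx mulmx0.
have vts : v *m t *m s = 0 by rewrite -actM ts mulmx0.
have vtt : v *m t *m t = 0 by rewrite -actM tt mulmx0.
have wxx : w *m (x * x) = 0 by rewrite actM wx mul0mx.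
have vtxx : v *m t *m (x * x) = 0 by rewrite actM vtx mul0mx.
have v2 : v *m (x * x) != 0.
  apply/eqP => e; have [] := free5K (k0 := 0) (k1 := 0) (k2 := 1) (k3 := 0) (k4 := 0) fp;
   by rewrite ?e ?scaler0 ?scale0r ?addr0 // => _ _ /eqP; rewrite oner_eq0.
apply: (@fits_frame _ _ _ _ [:: v; v *m x; v *m (x * x); v *m t; w] [:: 1; x; x * x; t; s]).
- by rewrite /= n4.
- apply: free5P => k0 k1 k2 k3 k4 e.
  have k00 : k0 = 0.
    have := congr1 (mulmx^~ (x * x)) e; rewrite mul0mx !mulmxDl -!scalemxAl vx2 xx2 wxx vtxx.
    by rewrite !scaler0 !addr0 => /eqP; rewrite scaler_eq0 (negPf v2) orbF => /eqP.
  have k10 : k1 = 0.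
    have := congr1 (mulmx^~ x) e; rewrite mul0mx !mulmxDl -!scalemxAl k00 scale0r add0r vxx xx wx vtx.
    by rewrite !scaler0 !addr0 => /eqP; rewrite scaler_eq0 (negPf v2) orbF => /eqP.
  move: e; rewrite k00 k10 !scale0r !add0r => e.
  have k40 : k4 = 0.
    have := congr1 (mulmx^~ s) e; rewrite mul0mx !mulmxDl -!scalemxAl xxg0 // vts ws !scaler0 !add0r.
    by move=> /eqP; rewrite scaler_eq0 (negPf v2) orbF => /eqP.
  move: e; rewrite k40 scale0r addr0 => e.
  have e' : 0 *: v + (0 *: (v *m x) + (k2 *: (v *m (x * x)) + ((k3 * (c * b1 + d * c1)) *: w1 + (k3 * (c * b2 + d * c2)) *: w2))) = 0.
    rewrite -[RHS]e /t mulmxDr -!scalemxAr vg vh; apply/rowP => j; rewrite !mxE; ring.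
  have [_ _ k20 _ _] := free5K fp e'; split=> //.
  by move: e; rewrite k20 scale0r add0r => /eqP; rewrite scaler_eq0 (negPf vt0) orbF => /eqP.
- by rewrite /= n4.
- exact: soc_subV Ht.
table n4; rewrite ?mulmx1 ?xx2 ?vx2 ?wxx ?vtxx ?vxx ?xx ?wx ?vtx ?vs ?ws ?wt ?vts ?vtt ?xg0 ?xxg0 //.
Qed.

(** Subtracting multiples of x x from g and h clears the v x x component of v g and v h without
    changing the action on w1 and w2. *)
Lemma frame_nogamma x g h v w1 w2 : soc_span x g h -> chain_frame x v w1 w2 ->
  (forall w s, (s = g \/ s = h) -> w *m x = 0 -> exists a, w *m s = a *: (v *m (x * x))) ->
  [\/ fits V mod_q1, fits (trV V) mod_q1 | fits V mod_n1].
Proof.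
move=> H cf ng; have [fp w1x w2x] := cf.
have [bV [x3 xg xh gx hx] [gg gh hg hh]] := H.
have [|a0 [b1 [b2 vg]]] := frame_ker x3 cf (u := v *m g); first by rewrite -actM gx mulmx0.
have [|d0 [c1 [c2 vh]]] := frame_ker x3 cf (u := v *m h); first by rewrite -actM hx mulmx0.
have [a1 w1g] := ng w1 g (or_introl erefl) w1x; have [a2 w2g] := ng w2 g (or_introl erefl) w2x.
have [d1 w1h] := ng w1 h (or_intror erefl) w1x; have [d2 w2h] := ng w2 h (or_intror erefl) w2x.
have w1xx : w1 *m (x * x) = 0 by rewrite actM w1x mul0mx.
have w2xx : w2 *m (x * x) = 0 by rewrite actM w2x mul0mx.
have H1 : soc_span x (g + (- a0) *: (x * x) + 0 *: h) h by exact: soc_shift.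
have H2 := soc_swap (soc_shift (- d0) 0 (soc_swap H1)).
apply: (frame_nogamma_norm (b1 := b1) (b2 := b2) (c1 := c1) (c2 := c2) (a1 := a1) (a2 := a2) (d1 := d1) (d2 := d2) H2 cf);
  rewrite scale0r addr0 mulmxDr -scalemxAr ?vg ?vh ?w1xx ?w2xx ?scaler0 ?addr0 //;
  by rewrite scaleNr addrAC subrr add0r.
Qed.

End Square.

(** * Jordan type (3,2) and the choice of a frame *)

Section Square2.
Variables (K : numClosedFieldType) (n : nat) (V : {vspace 'M[K]_n.+1}).
Hypotheses (VA : comm_subalg V) (VL : local_alg V) (n4 : n = 4%N) (dV : \dim V = 5%N).
Implicit Types (x y z g h : 'M[K]_n.+1) (u v w : 'rV[K]_n.+1).

(** Jordan type (3,2) of x: chains starting at v and at w. *)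
Definition chain2_frame x v w :=
  free [:: v; v *m x; v *m (x * x); w; w *m x] /\ w *m (x * x) = 0.

(** The Jordan form of x, by hand. Choose v and phi with v x x phi = 1; the row vectors orthogonal
    to phi, x phi and x x phi form a complement W, stable under x, of the chain of v. On W either x
    vanishes or it has a block of size 2. *)
Lemma exists_frame x : x * (x * x) = 0 -> x * x != 0 ->
  (exists v w1 w2, chain_frame x v w1 w2) \/ exists v w, chain2_frame x v w.
Proof.
move=> x3 x2.
have [i [j ij]] : exists i j, (x * x) i j != 0.
  apply: contrapT => h; case/eqP: x2; apply/matrixP => i j; rewrite [RHS]mxE.
  by apply/eqP/negPn/negP => ne; apply: h; exists i, j.
pose v : 'rV[K]_n.+1 := delta_mx 0 i; pose phi : 'cV[K]_n.+1 := ((x * x) i j)^-1 *: delta_mx j 0.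
have vphi : v *m (x * x) *m phi = 1%:M.
  rewrite /v /phi; move: (x * x) ij => M ij; rewrite -rowE -scalemxAr -colE.
  by apply/matrixP => a b; rewrite !ord1 !mxE mulVf.
clearbody v phi; clear i j ij.
have xx : (x * x) * x = 0 by rewrite -mulrA.
have xx2 : (x * x) * (x * x) = 0 by rewrite mulrA xx mul0r.
pose A := row_mx phi (row_mx (x *m phi) ((x * x) *m phi)).
pose W := lker (linfun (mulmxr A : 'rV_n.+1 -> _)).
have memW u : reflect [/\ u *m phi = 0, u *m x *m phi = 0 & u *m (x * x) *m phi = 0] (u \in W).
  rewrite memv_ker lfunE /= !mul_mx_row !mulmxA.
  apply: (iffP eqP) => [|[-> -> ->]]; last by rewrite !row_mx0.
  rewrite -[0]row_mx0 => /eq_row_mx[e1]; rewrite -[0]row_mx0 => /eq_row_mx[e2 e3].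
  by split.
have one0 k : k *: (1%:M : 'M[K]_1) = 0 -> k = 0.
  by move/matrixP/(_ 0 0); rewrite !mxE mulr1.
have Wx u : u \in W -> u *m x \in W.
  move=> /memW[e1 e2 e3]; apply/memW; rewrite -!actM x3 mulmx0 mul0mx actM; split=> //.
  by rewrite -actM.
have vphi1 : v *m x *m x *m phi = 1%:M by rewrite -actM.
have coefW k0 k1 k2 u : u \in W -> k0 *: v + (k1 *: (v *m x) + (k2 *: (v *m (x * x)) + u)) \in W ->
    [/\ k0 = 0, k1 = 0 & k2 = 0].
  move=> /memW[u1 u2 u3] /memW[e1 e2 e3].
  have k00 : k0 = 0.
    apply: one0; rewrite -e3 !mulmxDl -!scalemxAl u3 vphi -[v *m x *m _]actM -[v *m (x * x) *m _]actM.
    by rewrite x3 xx2 !mulmx0 !mul0mx !scaler0 !addr0.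
  have k10 : k1 = 0.
    apply: one0; rewrite -e2 k00 scale0r add0r !mulmxDl -!scalemxAl u2 -actM vphi.
    by rewrite -[v *m (x * x) *m _]actM xx mulmx0 mul0mx scaler0 !addr0.
  split=> //; apply: one0; rewrite -e1 k00 k10 !scale0r !add0r mulmxDl -scalemxAl vphi u1.
  by rewrite addr0.
have fr w1 w2 : w1 \in W -> w2 \in W -> free [:: w1; w2] ->
    free [:: v; v *m x; v *m (x * x); w1; w2].
  move=> w1W w2W f2; apply: free5P => k0 k1 k2 k3 k4 e.
  have uW : k3 *: w1 + k4 *: w2 \in W by rewrite memvD ?memvZ.
  have [|k00 k10 k20] := coefW k0 k1 k2 _ uW; first by rewrite e mem0v.
  move: e; rewrite k00 k10 k20 !scale0r !add0r => e.
  have h := freeN0 (a := fun i => nth 0 [:: k3; k4] i) f2.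
  rewrite !big_ord_recl big_ord0 addr0 in h.
  by split=> //; [exact: (h e 0%N)|exact: (h e 1%N)].
have [w1 [w2 [w1W w2W f2]]] : exists w1 w2, [/\ w1 \in W, w2 \in W & free [:: w1; w2]].
  have dW : (1 < \dim W)%N.
    have := limg_ker_dim (linfun (mulmxr A : 'rV_n.+1 -> _)) fullv.
    rewrite capfv -/W => e; have : (\dim (linfun (mulmxr A : 'rV_n.+1 -> _) @: fullv) <= 3)%N.
      by apply: leq_trans (dimvS (subvf _)) _; rewrite dimvf /dim /=.
    by move: e; rewrite dimvf /dim /=; move: (\dim W) (\dim (limg _)) => p q; rewrite n4; lia.
  have [w1 w1W] := exists_notin_span (s := [::]) (ltnW dW : (size [::] < _)%N).
  rewrite span_nil memv0 => w10.
  have [w2 w2W w2n] := exists_notin_span (s := [:: w1]) dW.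
  exists w2, w1; split=> //; rewrite free_cons w2n /=.
  by rewrite seq1_free.
have key w : w \in W -> w *m x != 0 -> exists v w, chain2_frame x v w.
  move=> wW wx; exists v, w.
  have wxW := Wx _ wW; have wxxW := Wx _ wxW.
  (* Otherwise w x and w x x would complete the chain of v to a frame; then w would be a combination
     of them, and x^3 = 0 gives w x x = 0. *)
  have wxx0 : w *m x *m x = 0.
    apply/eqP/negPn/negP => wxx.
    have f3 : free [:: w *m x; w *m x *m x].
      apply: freeNP => a; rewrite !big_ord_recl big_ord0 addr0 /= => e.
      have a0 : a 0%N = 0.
        have := congr1 (mulmx^~ x) e; rewrite mul0mx mulmxDl -!scalemxAl -!actM -mulrA x3 mulmx0.
        by rewrite scaler0 addr0 actM => /eqP; rewrite scaler_eq0 (negPf wxx) orbF => /eqP.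
      move: e; rewrite a0 scale0r add0r => /eqP; rewrite scaler_eq0 (negPf wxx) orbF => /eqP.
      by move=> a1; case=> [|[|]].
    have fp := fr _ _ wxW wxxW f3.
    have sp : size [:: v; v *m x; (v *m (x * x))%R; w *m x; w *m x *m x] = n.+1 by rewrite /= n4.
    have /mem_span5[k0 [k1 [k2 [k3 [k4 wE]]]]] := frame_span w sp fp.
    have [||k00 k10 k20] := coefW k0 k1 k2 (k3 *: (w *m x) + k4 *: (w *m x *m x)).
    - by rewrite memvD ?memvZ.
    - by rewrite -wE.
    move: wxx; rewrite wE k00 k10 k20 !scale0r !add0r !mulmxDl -!scalemxAl -!actM -!mulrA x3.
    by rewrite mulr0 !mulmx0 !scaler0 addr0 eqxx.
  split; last by rewrite actM.
  apply: fr => //; apply: freeNP => a; rewrite !big_ord_recl big_ord0 addr0 /= => e.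
  have a0 : a 0%N = 0.
    have := congr1 (mulmx^~ x) e; rewrite mul0mx mulmxDl -!scalemxAl wxx0 scaler0 addr0.
    by move=> /eqP; rewrite scaler_eq0 (negPf wx) orbF => /eqP.
  move: e; rewrite a0 scale0r add0r => /eqP; rewrite scaler_eq0 (negPf wx) orbF => /eqP.
  by move=> a1; case=> [|[|]].
have [w1x|w1x] := eqVneq (w1 *m x) 0; last by right; apply: key w1x.
have [w2x|w2x] := eqVneq (w2 *m x) 0; last by right; apply: key w2x.
by left; exists v, w1, w2; split=> //; exact: fr.
Qed.

(** Replacing x by x - f^-1 g keeps its square, as x g = g x = g g = 0, and destroys the Jordan
    block of size 2. This brings the case back to Jordan type (3,1,1). *)
Lemma frame2_gamma x g h v w b a0 a f : soc_span V x g h -> chain2_frame x v w ->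
  v *m g = a0 *: (v *m (x * x)) + b *: (w *m x) -> w *m g = a *: (v *m (x * x)) + f *: (w *m x) ->
  f != 0 -> exists x' v w1 w2, soc_span V x' g h /\ chain_frame x' v w1 w2.
Proof.
move=> H [fp wxx] vg wg f0; have [bV [x3 xg xh gx hx] [gg gh hg hh]] := H.
pose x' := x - f^-1 *: g.
have x'x' : x' * x' = x * x.
  by rewrite /x' mulrBl !mulrBr -!scalerAl -!scalerAr xg gx gg !scaler0 !subr0.
have xx : (x * x) * x = 0 by rewrite -mulrA.
exists x', v, (w + (a / f) *: (v *m x)), (w *m x); split.
  split; rewrite ?x'x'.
  - apply: (basis_change bV) => // u; rewrite !inE.
      have sV s : s \in [:: 1; x; x * x; g; h] -> s \in V by exact: (basis_mem bV).
      have gV : g \in V by apply: sV; rewrite !inE eqxx ?orbT.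
      have xV : x \in V by apply: sV; rewrite !inE eqxx ?orbT.
      case/orP => [/eqP->|/orP[/eqP->|/orP[/eqP->|/orP[/eqP->|/eqP->]]]];
        by first [by apply: sV; rewrite !inE eqxx ?orbT | rewrite memvB ?memvZ].
    case/orP => [/eqP->|/orP[/eqP->|/orP[/eqP->|/orP[/eqP->|/eqP->]]]];
      try by apply: memv_span; rewrite !inE eqxx ?orbT.
    by rewrite -{1}[x](subrK (f^-1 *: g)) memvD ?memvZ // memv_span // !inE eqxx ?orbT.
  - have gxx : g * (x * x) = 0 by rewrite mulrA gx mul0r.
    by split; rewrite ?mulrBl ?mulrBr -?scalerAl -?scalerAr ?gxx ?xg ?xh ?gx ?hx ?gg ?gh ?hg ?x3 ?scaler0 ?subr0.
  by split.
have vxg : v *m x *m g = 0 by rewrite -actM xg mulmx0.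
have wxg : w *m x *m g = 0 by rewrite -actM xg mulmx0.
have vxx : v *m x *m x = v *m (x * x) by rewrite actM.
have wxx' : w *m x *m x = 0 by rewrite -actM.
split.
- rewrite x'x'; apply: free5P => k0 k1 k2 k3 k4 e.
  have e' : k0 *: v + ((k1 + k3 * (a / f)) *: (v *m x) + ((k2 - k1 * (a0 / f)) *: (v *m (x * x)) +
     (k3 *: w + (k4 - k1 * (b / f)) *: (w *m x)))) = 0.
    rewrite -[RHS]e /x' mulmxBr -scalemxAr vg.
    by apply/rowP => j; rewrite !mxE; ring.
  have [-> h1 h2 k30 h4] := free5K fp e'; move: h1 h2 h4; rewrite k30 mul0r addr0 => ->.
  by rewrite !mul0r !subr0.
- rewrite /x' mulmxBr mulmxDl -!scalemxAr mulmxDl -!scalemxAl vxx vxg wg.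
  by apply/rowP => j; rewrite !mxE; field.
by rewrite /x' mulmxBr -scalemxAr wxg wxx' scaler0 subr0.
Qed.

(** A matrix s with x s = 0 that kills v and w is zero, so the 2 x 2 matrix of coefficients of g and
    h is invertible. Its inverse gives y and z with w y = v x x, v z = w x, v y = 0 and w z = 0. *)
Lemma frame2_fits x g h v w b a d c : soc_span V x g h -> chain2_frame x v w ->
  v *m g = b *: (w *m x) -> w *m g = a *: (v *m (x * x)) ->
  v *m h = d *: (w *m x) -> w *m h = c *: (v *m (x * x)) -> fits V mod_n4.
Proof.
move=> H [fp wxx] vg wg vh wh; have [bV [x3 xg xh gx hx] [gg gh hg hh]] := H.
have vxx : v *m x *m x = v *m (x * x) by rewrite actM.
have wxx' : w *m x *m x = 0 by rewrite -actM.
have xx : v *m (x * x) *m x = 0 by rewrite -actM -mulrA x3 mulmx0.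
have xx2 : v *m (x * x) *m (x * x) = 0 by rewrite [LHS]actM xx mul0mx.
have vx2 : v *m x *m (x * x) = 0 by rewrite -actM x3 mulmx0.
have wx2 : w *m x *m (x * x) = 0 by rewrite -actM x3 mulmx0.
have xg0 u s : x * s = 0 -> u *m x *m s = 0 by move=> e; rewrite -actM e mulmx0.
have xxg0 u s : x * s = 0 -> u *m (x * x) *m s = 0 by move=> e; rewrite -actM -mulrA e mulr0 mulmx0.
have sp : size [:: v; v *m x; (v *m (x * x))%R; w; w *m x] = n.+1 by rewrite /= n4.
have zero s : x * s = 0 -> v *m s = 0 -> w *m s = 0 -> s = 0.
  move=> xs vs ws; apply/row_matrixP => i; rewrite row0 rowE.
  have /mem_span5[k0 [k1 [k2 [k3 [k4 ->]]]]] := frame_span (delta_mx 0 i) sp fp.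
  by rewrite !mulmxDl -!scalemxAl vs ws !xg0 // xxg0 // !scaler0 !addr0.
have comb0 k l : k *: g + l *: h = 0 -> k = 0 /\ l = 0.
  by move=> e; have [] := soc_free (k0 := 0) (k1 := 0) (k2 := 0) (k3 := k) (k4 := l) H;
   rewrite ?e ?scale0r ?addr0.
have det0 : a * d - b * c != 0.
  apply/eqP => D0; have [k [l [kl0 e1 e2]]] : exists k l,
      [/\ (k != 0) || (l != 0), k * b + l * d = 0 & k * a + l * c = 0].
    by apply: dep2; apply/eqP; rewrite -subr_eq0 -oppr_eq0 opprB D0.
  have /comb0[k0 l0] : k *: g + l *: h = 0.
    apply: zero; first by rewrite mulrDr -!scalerAr xg xh !scaler0 addr0.
      by rewrite mulmxDr -!scalemxAr vg vh !scalerA -scalerDl e1 scale0r.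
    by rewrite mulmxDr -!scalemxAr wg wh !scalerA -scalerDl e2 scale0r.
  by rewrite k0 l0 eqxx in kl0.
pose D := a * d - b * c; rewrite -/D in det0.
pose y := (d / D) *: g - (b / D) *: h; pose z := (a / D) *: h - (c / D) *: g.
have vy : v *m y = 0.
  by rewrite mulmxBr -!scalemxAr vg vh; apply/rowP => j; rewrite !mxE; ring.
have wy : w *m y = v *m (x * x).
  by rewrite mulmxBr -!scalemxAr wg wh; apply/rowP => j; rewrite !mxE /D; field.
have vz : v *m z = w *m x.
  by rewrite mulmxBr -!scalemxAr vg vh; apply/rowP => j; rewrite !mxE /D; field.
have wz : w *m z = 0.
  by rewrite mulmxBr -!scalemxAr wg wh; apply/rowP => j; rewrite !mxE; ring.
have xy : x * y = 0 by rewrite mulrBr -!scalerAr xg xh !scaler0 subrr.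
have xz : x * z = 0 by rewrite mulrBr -!scalerAr xg xh !scaler0 subrr.
have Hy : soc_span V x y z.
  apply: (soc_change H).
  - by exists 0, (d / D), (- (b / D)); rewrite scale0r add0r scaleNr.
  - by exists 0, (- (c / D)), (a / D); rewrite scale0r add0r scaleNr addrC.
  - have e : g = a *: y + b *: z by apply/matrixP => i j; rewrite !mxE /D; field.
    by rewrite [X in X \in _]e memvD ?memvZ // memv_span // !inE eqxx ?orbT.
  have e : h = c *: y + d *: z by apply/matrixP => i j; rewrite !mxE /D; field.
  by rewrite [X in X \in _]e memvD ?memvZ // memv_span // !inE eqxx ?orbT.
apply: (fits_frame sp fp (Z := [:: 1; x; x * x; y; z])).
- by rewrite /= n4.
- exact: soc_subV Hy.
table n4; rewrite ?mulmx1 ?xx2 ?vx2 ?wx2 ?vxx ?xx ?wxx ?wxx' ?vy ?wy ?vz ?wz ?xg0 ?xxg0 //.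
Qed.

Lemma frame2_cases x g h v w : soc_span V x g h -> chain2_frame x v w ->
  fits V mod_n4 \/ exists x' v w1 w2 g h, soc_span V x' g h /\ chain_frame x' v w1 w2.
Proof.
move=> H cf; have [fp wxx] := cf; have [bV [x3 xg xh gx hx] [gg gh hg hh]] := H.
have sp : size [:: v; v *m x; (v *m (x * x))%R; w; w *m x] = n.+1 by rewrite /= n4.
have xx : v *m (x * x) *m x = 0 by rewrite -actM -mulrA x3 mulmx0.
have ker u : u *m x = 0 -> exists a b, u = a *: (v *m (x * x)) + b *: (w *m x).
  have /mem_span5[k0 [k1 [k2 [k3 [k4 ->]]]]] := frame_span u sp fp.
  rewrite !mulmxDl -!scalemxAl xx -[w *m x *m x]actM wxx !scaler0 !addr0 add0r -actM => e.
  have e' : 0 *: v + (k0 *: (v *m x) + (k1 *: (v *m (x * x)) + (0 *: w + k3 *: (w *m x)))) = 0.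
    by rewrite !scale0r !add0r.
  have [_ -> -> _ ->] := free5K fp e'; exists k2, k4; by rewrite !scale0r !add0r.
have [|a0 [b vg]] := ker (v *m g); first by rewrite -actM gx mulmx0.
have [|a [f wg]] := ker (w *m g); first by rewrite -actM gx mulmx0.
have [|d0 [d vh]] := ker (v *m h); first by rewrite -actM hx mulmx0.
have [|c [f' wh]] := ker (w *m h); first by rewrite -actM hx mulmx0.
have [f0|f0] := eqVneq f 0; last first.
  by have [x' [v' [w1 [w2 [h1 h2]]]]] := frame2_gamma H cf vg wg f0; right; exists x', v', w1, w2, g, h.
have [f0'|f0'] := eqVneq f' 0; last first.
  by have [x' [v' [w1 [w2 [h1 h2]]]]] := frame2_gamma (soc_swap H) cf vh wh f0'; right; exists x', v', w1, w2, h, g.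
move: wg wh; rewrite f0 f0' !scale0r !addr0 => wg wh; left.
have H1 := soc_shift (- a0) 0 H.
have H2 := soc_swap (soc_shift (- d0) 0 (soc_swap H1)).
apply: (frame2_fits (b := b) (a := a) (d := d) (c := c) H2 cf);
  rewrite scale0r addr0 mulmxDr -scalemxAr ?vg ?wg ?vh ?wh ?wxx ?scaler0 ?addr0 //;
  by rewrite scaleNr addrAC subrr add0r.
Qed.

Lemma soc_span_fits x g h : soc_span V x g h -> x * x != 0 ->
  [\/ fitsD V mod_q1, fitsD V mod_n1, fitsD V mod_n2 | fitsD V mod_n3] \/ fitsD V mod_n4.
Proof.
move=> H x2.
have chain y g' h' v w1 w2 : soc_span V y g' h' -> chain_frame y v w1 w2 ->
    [\/ fitsD V mod_q1, fitsD V mod_n1, fitsD V mod_n2 | fitsD V mod_n3].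
  move=> {}H cf.
  have [[w [s [sgh wx ws]]]|ng] := EM (exists w s, [/\ s = g' \/ s = h', w *m y = 0 &
      forall a, w *m s <> a *: (v *m (y * y))]).
    have [s' Hs] : exists s', soc_span V y s s'.
      by case: sgh => ->; [exists h' | exists g'; exact: soc_swap].
    case: (frame_gamma n4 Hs cf wx ws) => F.
    - by constructor 3; left.
    - by constructor 3; right.
    by constructor 4; left.
  case: (frame_nogamma VA n4 H cf) => [w s sgh wx|F|F|F].
  - apply: contrapT => h0; apply: ng; exists w, s; split=> // a e; apply: h0; by exists a.
  - by constructor 1; left.
  - by constructor 1; right.
  by constructor 2; left.
have [_ [x3 _ _ _ _] _] := H.
case: (exists_frame x3 x2) => [[v [w1 [w2 cf]]]|[v [w cf]]]; first by left; exact: (chain _ _ _ _ _ _ H cf).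
case: (frame2_cases H cf) => [F|[x' [v' [w1 [w2 [g' [h' [H' cf']]]]]]]]; first by right; left.
by left; exact: (chain _ _ _ _ _ _ H' cf').
Qed.
End Square2.

(** * Local algebras with vanishing squares *)

(** The regular representation of the algebra with an n-dimensional maximal ideal of square zero. *)
Definition mod_sq n : model := diag_slice n.+1 :: [seq [:: ent 0 i.+1] | i <- iota 0 n].

Section Null.
Variables (K : numClosedFieldType) (n d : nat) (V : {vspace 'M[K]_n.+1}).
Hypotheses (VA : comm_subalg V) (VL : local_alg V) (dV : \dim V = d.+1).
Hypothesis sq0 : forall x, nn V x -> x * x = 0.
Implicit Types (x y z g h : 'M[K]_n.+1) (u v w : 'rV[K]_n.+1).
Let mul0 x y : nn V x -> nn V y -> x * y = 0. Proof. by apply: sq0_mul0. Qed.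

Lemma nn_dec X : X \in V -> exists a x, nn V x /\ X = a *: 1 + x.
Proof.
move=> XV; have [a na] := VL XV; exists a, (X - a%:A); split; last by rewrite addrC subrK.
by split=> //; rewrite memvB // memvZ //; case: VA.
Qed.

Lemma nn_basis : exists xs, [/\ size xs = d, forall x, x \in xs -> nn V x & basis_of V (1 :: xs)].
Proof.
have one0 : (1 : 'M[K]_n.+1) != 0 by exact: oner_neq0.
have H j : (j <= d)%N -> exists xs : seq 'M[K]_n.+1,
    [/\ size xs = j, forall x, x \in xs -> nn V x & free (1 :: xs)]; last first.
  have [xs [sx nx fx]] := H d (leqnn d).
  exists xs; split=> //; apply: free_basis => //=; last by rewrite sx dV.
  by move=> x; rewrite inE => /predU1P[->|/nx[]//]; case: VA.
elim: j => [|j IH] jn.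
  by exists [::]; split=> //; rewrite seq1_free.
have [xs [sx nx fx]] := IH (ltnW jn).
have [||y ny ys] := @nn_ext _ _ _ VA VL (1 :: xs).
- by apply: memv_span; rewrite inE eqxx.
- by rewrite /= sx dV ltnS.
exists (y :: xs); split; rewrite /= ?sx //.
  by move=> x; rewrite inE => /predU1P[->//|/nx].
have pe : perm_eq (1 :: y :: xs) (y :: 1 :: xs).
  by apply/permP => P /=; rewrite addnCA.
by rewrite (perm_free pe) free_cons ys.
Qed.

Lemma diag_act (M : lmodType K) m (Y : seq M) j : (j < m)%N ->
  slice_act (diag_slice m) Y j = Y`_j.
Proof.
move=> jm; rewrite /slice_act big_map -big_filter.
rewrite (eq_filter (a2 := pred1 j)) // filter_pred1_uniq ?iota_uniq ?mem_iota //.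
by rewrite big_seq1 int1E.
Qed.

(** W is a basis of the common kernel of the maximal ideal, and U spans a complement. As products of
    nilpotents vanish, all images lie in the span of W, so in this frame the ideal is a space of
    blocks. The dimension d + 1 of V is kept apart from the size n + 1 because [sq0_dim] has to
    bound it. *)
Lemma null_frame : exists U W : seq 'rV[K]_n.+1,
  [/\ size (U ++ W) = n.+1, free (U ++ W),
      forall w x, w \in W -> nn V x -> w *m x = 0 &
      forall u x, nn V x -> u *m x \in <<W>>%VS].
Proof.
have [xs [sx nx bV]] := nn_basis.
pose Ker := (\bigcap_(x <- xs) lker (linfun (mulmxr x : 'rV_n.+1 -> _)))%VS.
have memK u : reflect (forall x, x \in xs -> u *m x = 0) (u \in Ker).
  rewrite /Ker; elim: (xs) => [|x s IH]; first by rewrite big_nil memvf; apply: ReflectT.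
  rewrite big_cons memv_cap memv_ker lfunE /=; apply: (iffP andP).
    by move=> [/eqP ux /IH h] y; rewrite inE => /predU1P[->//|/h].
  move=> h; split; first by apply/eqP/h; rewrite inE eqxx.
  by apply/IH => y ys; apply: h; rewrite inE ys orbT.
have Kall u x : u \in Ker -> nn V x -> u *m x = 0.
  move=> /memK uK nx'; have : x \in <<1 :: xs>>%VS by rewrite (span_basis bV) // nnV.
  rewrite span_cons => /memv_addP[y /vlineP[a ->]] [z zs xE].
  have nz : nn V z /\ u *m z = 0.
    move: zs => /mem_spanP[c ->]; split.
      elim/big_ind: _ => [|? ? ? ?|i _]; first by split; [rewrite mem0v|exact: nilp0].
        exact: (nnD VA).
      by apply: nnZ; apply: nx; rewrite mem_nth.
    rewrite mulmx_sumr big1 // => i _; rewrite -scalemxAr uK ?scaler0 //.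
    by rewrite mem_nth.
  have a0 : a = 0 by apply: (nn_scal VA nz.1); rewrite -xE.
  by rewrite xE a0 scale0r add0r nz.2.
exists (vbasis Ker^C), (vbasis Ker); split.
- rewrite size_cat !size_tuple dimv_compl addnC subnKC //.
    by rewrite dimvf /dim /= mul1n.
  by rewrite dimvS // subvf.
- have := @cat_basis _ _ _ _ _ _ _ (vbasisP Ker^C) (vbasisP Ker).
  by move=> h; apply: (basis_free (h _)); apply/directv_addP; rewrite capvC; exact: capv_compl.
- by move=> w x wK; apply: Kall; apply: vbasis_mem.
move=> u x nx'; rewrite (span_basis (vbasisP Ker)); apply/memK => y /nx ny.
by rewrite -mulmxA [x *m y]mul0 ?mulmx0.
Qed.
End Null.

Section SqTable.
Variables (K : numClosedFieldType) (n : nat).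
Lemma sq_table (V : {vspace 'M[K]_n.+1}) : comm_subalg V -> local_alg V -> \dim V = n.+1 ->
  (forall x, nn V x -> x * x = 0) -> has_table V (mod_sq n).
Proof.
move=> VA VL dV sq0; have [xs [sx nx bV]] := nn_basis VA VL dV; exists (1 :: xs); split; rewrite /= ?sx // => i j im jm.
case: i im => [|i] im /=; first by rewrite mulr1 diag_act.
rewrite (nth_map 0%N) ?size_iota // nth_iota // add0n slice_actE /=.
have nxi k : (k < n)%N -> nn V xs`_k by move=> kn; apply: nx; rewrite mem_nth ?sx.
case: j jm => [|j] jm /=; first by rewrite mul1r int1E addr0.
by rewrite (sq0_mul0 VA sq0) //; apply: nxi.
Qed.

End SqTable.

(** * Pencils of 3 x 2 matrices *)

From mathcomp Require Import fingroup perm.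

Section Pencil.
Variable K : numClosedFieldType.
(** The number of rows is written [2 + 1] so that a matrix splits by [col_mx] into a square part and
    a last row. *)
Notation M32 := 'M[K]_(2 + 1, 2).

Definition pen (Z1 Z2 N1 N2 : M32) := exists (P : 'M[K]_(2 + 1)) (Q : 'M[K]_2) a b c d,
  [/\ P \in unitmx, Q \in unitmx, P *m (a *: Z1 + b *: Z2) *m Q = N1
    & P *m (c *: Z1 + d *: Z2) *m Q = N2].

Lemma pen_trans Z1 Z2 Y1 Y2 N1 N2 : pen Z1 Z2 Y1 Y2 -> pen Y1 Y2 N1 N2 -> pen Z1 Z2 N1 N2.
Proof.
move=> [P [Q [a [b [c [d [PU QU <- <-]]]]]]] [P' [Q' [a' [b' [c' [d' [PU' QU' <- <-]]]]]]].
have key k l : P' *m (k *: (P *m (a *: Z1 + b *: Z2) *m Q) + l *: (P *m (c *: Z1 + d *: Z2) *m Q)) *m Q' =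
  (P' *m P) *m ((k * a + l * c) *: Z1 + (k * b + l * d) *: Z2) *m (Q *m Q').
  rewrite !(mulmxDr, mulmxDl) -!(scalemxAr, scalemxAl) !(mulmxDr, mulmxDl) -!(scalemxAr, scalemxAl) !mulmxA.
  move: (P' *m P *m Z1 *m Q *m Q') (P' *m P *m Z2 *m Q *m Q') => A B.
  by apply/matrixP => i j; rewrite !mxE; ring.
exists (P' *m P), (Q *m Q'), (a' * a + b' * c), (a' * b + b' * d), (c' * a + d' * c), (c' * b + d' * d).
by rewrite !unitmx_mul PU PU' QU QU' !key.
Qed.

Definition JJ : M32 := col_mx 1%:M 0.

Lemma unit22 (a b c d : K) : a * d - b * c != 0 ->
  (\matrix_(i < 2, j < 2) (if i == 0 then if j == 0 then a else b else if j == 0 then c else d)) \in unitmx.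
Proof.
move=> h; rewrite unitmxE unitfE; rewrite (expand_det_row _ 0) !big_ord_recl big_ord0 /cofactor.
rewrite !det_mx11 !mxE /= /bump /= addr0 !expr0 !expr1 mul1r mulN1r.
by rewrite mulrN.
Qed.

Lemma penJ_sub A (c : 'rV[K]_2) a : pen JJ (col_mx A c) JJ (col_mx (A - a%:M) c).
Proof.
exists 1%:M, 1%:M, 1, 0, (- a), 1; split; rewrite ?unitmx1 // mul1mx mulmx1.
  by rewrite scale1r scale0r addr0.
rewrite scale1r /JJ scale_col_mx add_col_mx scaler0 add0r.
by rewrite scalemx1 raddfN /= addrC.
Qed.

(** Row and column operations that fix [JJ]: conjugation of the square part, adding multiples of the
    last row to it, and scaling of the last row. *)
Lemma penJ_conj A (c : 'rV[K]_2) (Q Q' : 'M[K]_2) (s : 'cV[K]_2) l : Q' *m Q = 1%:M -> l != 0 ->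
  pen JJ (col_mx A c) JJ (col_mx (Q' *m A *m Q + s *m c *m Q) (l *: (c *m Q))).
Proof.
move=> QQ l0; have [QU' QU] := mulmx1_unit QQ.
exists (block_mx Q' s 0 l%:M), Q, 1, 0, 0, 1; split=> //.
- rewrite unitmxE det_ublock unitrM -unitmxE QU' det_mx11 mxE eqxx.
  by rewrite unitfE.
- rewrite scale1r scale0r addr0 /JJ mul_block_col !mulmx0 !addr0 mulmx1 mulmx1 mul_col_mx.
  by rewrite QQ mul0mx.
rewrite scale1r scale0r add0r mul_block_col mul_col_mx mul0mx add0r mulmxDl.
by rewrite mul_scalar_mx scalemxAl.
Qed.

Definition d32 i j : M32 := delta_mx i j.

Lemma ord2 (i : 'I_2) : i = 0 \/ i = 1.
Proof. by case: i => [[|[|i]] hi] //; [left|right]; exact/val_inj. Qed.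

Lemma lift01 : lift (0 : 'I_2) 0 = 1. Proof. exact/val_inj. Qed.

Lemma row2E_c (v : 'rV[K]_2) (w : 'cV[K]_2) : (v *m w) 0 0 = v 0 0 * w 0 0 + v 0 1 * w 1 0.
Proof. by rewrite mxE !big_ord_recl big_ord0 addr0 lift01. Qed.

Lemma row2E (m p : nat) (A : 'M[K]_(m, 2)) (B : 'M[K]_(2, p)) i j :
  (A *m B) i j = A i 0 * B 0 j + A i 1 * B 1 j.
Proof. by rewrite mxE !big_ord_recl big_ord0 addr0 lift01. Qed.

(** The last row is moved to (0, 1) and then clears the second column of the square part, and a
    scalar shift clears the remaining diagonal entry. One entry below the diagonal is left, which is
    zero or can be scaled to 1. *)
Lemma penJ_c A (c : 'rV[K]_2) : c != 0 ->
  pen JJ (col_mx A c) JJ (d32 2 1) \/ pen JJ (col_mx A c) JJ (d32 1 0 + d32 2 1).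
Proof.
move=> c0.
have [Q QU cQ] : exists2 Q : 'M[K]_2, Q \in unitmx & c *m Q = delta_mx 0 1.
  have [c1|c1] := eqVneq (c 0 1) 0; last first.
    exists (\matrix_(i < 2, j < 2) (if i == 0 then if j == 0 then 1 else 0 else
        if j == 0 then - (c 0 0 / c 0 1) else (c 0 1)^-1)).
      by apply: unit22; rewrite mul1r mul0r subr0 invr_neq0.
    by apply/rowP => j; case: (ord2 j) => ->; rewrite row2E !mxE /=; field.
  have c00 : c 0 0 != 0.
    apply: contraNneq c0 => c00; by apply/eqP/rowP => j; case: (ord2 j) => ->; rewrite [RHS]mxE.
  exists (\matrix_(i < 2, j < 2) (if i == 0 then if j == 0 then 0 else (c 0 0)^-1 else
      if j == 0 then 1 else 0)).
    by apply: unit22; rewrite mul0r mulr1 sub0r oppr_eq0 invr_neq0.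
  by apply/rowP => j; case: (ord2 j) => ->; rewrite row2E !mxE /= c1; field.
pose e1 : 'rV[K]_2 := delta_mx 0 1.
pose A1 := invmx Q *m A *m Q.
have p1 : pen JJ (col_mx A c) JJ (col_mx A1 e1).
  have := penJ_conj A c 0 (mulVmx QU) (oner_neq0 K).
  by rewrite !mul0mx addr0 scale1r cQ.
clearbody A1.
have clear1 B : pen JJ (col_mx B e1) JJ (col_mx (B - col 1 B *m e1) e1).
  have := penJ_conj B e1 (- col 1 B) (mul1mx 1%:M) (oner_neq0 K).
  by rewrite !mulmx1 mul1mx mulNmx scale1r.
have p2 := pen_trans (pen_trans (pen_trans p1 (clear1 _)) (penJ_sub _ _ (A1 0 0))) (clear1 _).
set B := (X in pen _ _ _ (col_mx X _)) in p2.
have BE : B = A1 1 0 *: delta_mx 1 0.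
  apply/matrixP => i j; rewrite /B !mxE !big_ord_recl !big_ord0 !mxE !big_ord_recl !big_ord0 !mxE /=.
  by case: (ord2 i) => ->; case: (ord2 j) => -> /=; ring.
move: p2; rewrite BE; move: (A1 1 0) => d p2.
have [d0|d0] := eqVneq d 0.
  left; suff <- : col_mx (d *: delta_mx 1 0) e1 = d32 2 1 by [].
  rewrite d0 scale0r /e1 /d32; apply/matrixP => i j; rewrite !mxE.
  case: splitP => k ik; rewrite !mxE -!val_eqE /= ik; last by rewrite ord1.
  by case: (ord2 k) => ->; rewrite ?mulr0n.
right.
pose D (x : K) : 'M[K]_2 := \matrix_(i, j) (if i == j then if i == 0 then 1 else x else 0).
have DD : D d^-1 *m D d = 1%:M.
  by apply/matrixP => i j; rewrite row2E !mxE; case: (ord2 i) => ->; case: (ord2 j) => -> /=; field.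
apply: (pen_trans p2); have := penJ_conj (d *: delta_mx 1 0) e1 0 DD (invr_neq0 d0).
rewrite !mul0mx addr0; set N := (X in pen _ _ _ X); suff -> : N = d32 1 0 + d32 2 1 by [].
rewrite /N /D; apply/matrixP => i j; rewrite !mxE.
case: splitP => k ik; rewrite !(mxE, big_ord_recl, big_ord0) ?lift01 -!val_eqE /= ik.
  by case: (ord2 k) => ->; case: (ord2 j) => -> /=; field.
by rewrite ord1; case: (ord2 j) => -> /=; field.
Qed.

(** Subtracting an eigenvalue leaves a matrix u v of rank 1. Its trace t = v u decides between the
    diagonalizable and the nilpotent normal form. *)
Lemma penJ_0 A : (forall a, A != a%:M) ->
  pen JJ (col_mx A 0) JJ (d32 0 0) \/ pen JJ (col_mx A 0) JJ (d32 0 1).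
Proof.
move=> nA.
have [l ul] : exists l, A - l%:M \notin unitmx.
  have [l H] := @eigenvalue_closed K 2 A isT; exists l; move: H; rewrite /eigenvalue /eigenspace.
  by apply: contra => U; rewrite kermx_eq0 row_free_unit.
set A0 := A - l%:M in ul; have A00 : A0 != 0 by rewrite subr_eq0.
have [u [v [u0 v0 uv]]] : exists (u : 'cV[K]_2) (v : 'rV[K]_2), [/\ u != 0, v != 0 & A0 = u *m v].
  have r1 : \rank A0 = 1%N.
    have := rank_leq_row A0; have : \rank A0 != 0%N by rewrite mxrank_eq0.
    have : \rank A0 != 2%N by apply: contra ul => r2; rewrite -row_free_unit.
    by case: (\rank A0) => [|[|[|]]].
  have := mulmx_base A0; move: (col_base A0) (row_base A0); rewrite r1 => u v uv.
  exists u, v; split=> //; apply: contraNneq A00 => e; rewrite -uv e ?mul0mx ?mulmx0 //.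
have p0 := penJ_sub A 0 l; rewrite -/A0 uv in p0.
have fin i j : pen JJ (col_mx (delta_mx i j) 0) JJ (d32 (lshift 1 i) j).
  exists 1%:M, 1%:M, 1, 0, 0, 1; rewrite !unitmx1 !mul1mx !mulmx1 !scale1r !scale0r addr0 add0r.
  split=> //; apply/matrixP => a b; rewrite !mxE -!val_eqE /=.
  case: splitP => k ->; rewrite !mxE -?val_eqE //.
  by rewrite (gtn_eqF (ltn_addr k (ltn_ord i))).
have v2E (w : 'cV[K]_2) : (v *m w) 0 0 = v 0 0 * w 0 0 + v 0 1 * w 1 0 by rewrite row2E_c.
pose t := v 0 0 * u 0 0 + v 0 1 * u 1 0.
pose mk (q00 q01 q10 q11 : K) : 'M[K]_2 :=
  \matrix_(i, j) (if i == 0 then if j == 0 then q00 else q01 else if j == 0 then q10 else q11).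
have [t0|t0] := eqVneq t 0.
  (* The conjugating matrix has columns u and w with v w = 1; since v u = 0, it turns u v into the
     unit matrix at (0, 1). *)
  right; have [w0 [w1 [vw d0]]] : exists w0 w1, v 0 0 * w0 + v 0 1 * w1 = 1 /\
      u 0 0 * w1 - u 1 0 * w0 != 0.
    have [v00|v00] := eqVneq (v 0 0) 0; last first.
      exists (v 0 0)^-1, 0; split; first by rewrite mulr0 addr0 mulfV.
      rewrite mulr0 sub0r oppr_eq0 mulf_neq0 ?invr_neq0 //.
      apply: contraNneq u0 => u10; move: t0; rewrite /t u10 mulr0 addr0 => /eqP.
      rewrite mulf_eq0 (negPf v00) /= => /eqP u00.
      by apply/eqP/colP => j; case: (ord2 j) => ->; rewrite [RHS]mxE.
    have v10 : v 0 1 != 0.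
      apply: contraNneq v0 => v10; apply/eqP/rowP => j; case: (ord2 j) => ->; by rewrite [RHS]mxE.
    exists 0, (v 0 1)^-1; split; first by rewrite mulr0 add0r mulfV.
    rewrite mulr0 subr0 mulf_neq0 ?invr_neq0 //.
    apply: contraNneq u0 => u00; move: t0; rewrite /t v00 mul0r add0r => /eqP.
    rewrite mulf_eq0 (negPf v10) /= => /eqP u10.
    by apply/eqP/colP => j; case: (ord2 j) => ->; rewrite [RHS]mxE.
  pose d := u 0 0 * w1 - u 1 0 * w0; rewrite -/d in d0.
  pose Q := mk (u 0 0) w0 (u 1 0) w1; pose Q' := mk (w1 / d) (- w0 / d) (- u 1 0 / d) (u 0 0 / d).
  have QQ : Q' *m Q = 1%:M.
    by apply/matrixP => i j; rewrite row2E !mxE; case: (ord2 i) => ->; case: (ord2 j) => -> /=;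
      rewrite /d; field.
  have p1 := penJ_conj (u *m v) 0 0 QQ (oner_neq0 K).
  apply: pen_trans (fin 0 1); apply: (pen_trans p0); move: p1; rewrite !mul0mx addr0 scaler0.
  suff -> : Q' *m (u *m v) *m Q = delta_mx 0 1 by [].
  rewrite mulmxA -mulmxA.
  have -> : Q' *m u = delta_mx 0 0.
    by apply/colP => i; rewrite row2E !mxE; case: (ord2 i) => -> /=; rewrite /d; field.
  have -> : v *m Q = delta_mx 0 1.
    apply/rowP => i; rewrite row2E !mxE; case: (ord2 i) => -> /=; first by rewrite -[RHS]t0.
    by rewrite -[RHS]vw.
  by rewrite mul_delta_mx.
(* The columns of Q are u and a vector killed by v. *)
left; pose Q := mk (u 0 0) (v 0 1) (u 1 0) (- v 0 0).
pose Q' := mk (v 0 0 / t) (v 0 1 / t) (u 1 0 / t) (- u 0 0 / t).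
have QQ : Q' *m Q = 1%:M.
  by apply/matrixP => i j; rewrite row2E !mxE; case: (ord2 i) => ->; case: (ord2 j) => -> /=;
    rewrite /t; field.
have p1 := penJ_conj (u *m v) 0 0 QQ (oner_neq0 K).
apply: pen_trans (fin 0 0); apply: (pen_trans p0); move: p1; rewrite !mul0mx addr0 scaler0.
have -> : Q' *m (u *m v) *m Q = t *: delta_mx 0 0.
  rewrite mulmxA -mulmxA.
  have -> : Q' *m u = delta_mx 0 0.
    by apply/colP => i; rewrite row2E !mxE; case: (ord2 i) => -> /=; rewrite /t; field.
  have -> : v *m Q = t *: delta_mx 0 0.
    by apply/rowP => i; rewrite row2E !mxE; case: (ord2 i) => -> /=; rewrite /t; ring.
  by rewrite -scalemxAr mul_delta_mx.
move=> p1; apply: (pen_trans p1).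
exists 1%:M, 1%:M, 1, 0, 0, t^-1; rewrite !unitmx1 !mul1mx !mulmx1 !scale1r !scale0r addr0 add0r.
by split=> //; rewrite scale_col_mx scaler0 scalerK.
Qed.

Lemma pen_rank2 Z1 Z2 a b : free [:: Z1; Z2] -> \rank (a *: Z1 + b *: Z2)%R = 2%N ->
  [\/ pen Z1 Z2 JJ (d32 0 0), pen Z1 Z2 JJ (d32 0 1), pen Z1 Z2 JJ (d32 2 1)
    | pen Z1 Z2 JJ (d32 1 0 + d32 2 1)].
Proof.
move=> fZ; have [Z ZE] : exists Z, Z = a *: Z1 + b *: Z2 by exists (a *: Z1 + b *: Z2).
rewrite -ZE => r2.
have [c [d cd]] : exists c d, forall k, c *: Z1 + d *: Z2 != k *: Z.
  have ind k l : k *: Z1 + l *: Z2 = 0 -> k = 0 /\ l = 0.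
    move=> e; have h := freeN0 (a := fun i => nth 0 [:: k; l] i) fZ.
    rewrite !big_ord_recl big_ord0 addr0 in h.
    by split; [exact: (h e 0%N)|exact: (h e 1%N)].
  have [b0|b0] := eqVneq b 0.
    exists 0, 1 => k; apply/eqP => e; have [_ /eqP] : - (k * a) = 0 /\ (1 : K) = 0.
      apply: ind; move: e; rewrite ZE b0 !scale0r addr0 add0r => ->.
      by rewrite scalerA scaleNr addNr.
    by rewrite oner_eq0.
  exists 1, 0 => k; apply/eqP => e; have [h1 h2] : 1 - k * a = 0 /\ - (k * b) = 0.
    apply: ind; move/eqP: e; rewrite -subr_eq0 ZE => /eqP <-.
    by apply/matrixP => i j; rewrite !mxE; ring.
  move/eqP: h2; rewrite oppr_eq0 mulf_eq0 (negPf b0) orbF => /eqP k0.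
  by move/eqP: h1; rewrite k0 mul0r subr0 oner_eq0.
pose P := invmx (col_ebase Z); pose Q := invmx (row_ebase Z).
have PU : P \in unitmx by rewrite unitmx_inv col_ebase_unit.
have QU : Q \in unitmx by rewrite unitmx_inv row_ebase_unit.
have PZQ : P *m Z *m Q = JJ.
  have E := mulmx_ebase Z; rewrite r2 in E; rewrite -[X in P *m X]E /P /Q -!mulmxA mulKmx ?col_ebase_unit //.
  by rewrite mulmxV ?row_ebase_unit // mulmx1 pid_mx_col.
pose Y := P *m (c *: Z1 + d *: Z2) *m Q.
have p0 : pen Z1 Z2 JJ (col_mx (usubmx Y) (dsubmx Y)).
  by rewrite vsubmxK; exists P, Q, a, b, c, d; rewrite -ZE.
have [D0|D0] := eqVneq (dsubmx Y) 0; last first.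
  by case: (penJ_c (usubmx Y) D0) => p; [constructor 3|constructor 4]; exact: pen_trans p0 p.
rewrite D0 in p0; have nA k : usubmx Y != k%:M.
  apply: contraNneq (cd k) => e; apply/eqP.
  have YE : Y = k *: JJ by rewrite -[Y]vsubmxK D0 e /JJ scale_col_mx scalemx1 scaler0.
  apply: (can_inj (mulmxK QU)); apply: (can_inj (mulKmx PU)); rewrite !mulmxA -/Y YE -PZQ.
  by rewrite -scalemxAr -scalemxAl.
by case: (penJ_0 nA) => p; [constructor 1|constructor 2]; exact: pen_trans p0 p.
Qed.

(** A space of matrices of rank at most 1 has a common row line or a common column line. With Z1
    moved to the corner unit matrix and the corner of the second matrix X cleared, the minors of X
    and of [d32 0 0 + X] confine X to the first row or to the first column. *)
Lemma pen_rank1 Z1 Z2 : free [:: Z1; Z2] ->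
  (forall a b, (\rank (a *: Z1 + b *: Z2)%R <= 1)%N) ->
  pen Z1 Z2 (d32 0 0) (d32 0 1) \/ pen Z1 Z2 (d32 0 0) (d32 1 0).
Proof.
move=> fZ rZ.
have ind k l : k *: Z1 + l *: Z2 = 0 -> k = 0 /\ l = 0.
  move=> e; have h := freeN0 (a := fun i => nth 0 [:: k; l] i) fZ.
  rewrite !big_ord_recl big_ord0 addr0 in h.
  by split; [exact: (h e 0%N)|exact: (h e 1%N)].
have r1 : \rank Z1 = 1%N.
  have := rZ 1 0; rewrite scale1r scale0r addr0 => h; apply/eqP; rewrite eqn_leq h lt0n mxrank_eq0.
  apply/eqP => Z10; have [/eqP + _] : (1 : K) = 0 /\ (0 : K) = 0.
    by apply: ind; rewrite Z10 scaler0 scale0r addr0.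
  by rewrite oner_eq0.
pose P := invmx (col_ebase Z1); pose Q := invmx (row_ebase Z1).
have PU : P \in unitmx by rewrite unitmx_inv col_ebase_unit.
have QU : Q \in unitmx by rewrite unitmx_inv row_ebase_unit.
have PZQ : P *m Z1 *m Q = d32 0 0.
  have E := mulmx_ebase Z1; rewrite r1 in E; rewrite -[X in P *m X]E /P /Q -!mulmxA mulKmx ?col_ebase_unit //.
  rewrite mulmxV ?row_ebase_unit // mulmx1; apply/matrixP => i j; rewrite !mxE -!val_eqE /=.
  by case: (nat_of_ord i) => [|i']; rewrite ?ltnS ?ltn0 ?andbF //; case: (nat_of_ord j).
pose Y := P *m Z2 *m Q; pose z := Y 0 0; pose X := Y - z *: d32 0 0.
have X00 : X 0 0 = 0.
  have subE (A B : M32) i j : (A - z *: B) i j = A i j - z * B i j by rewrite !mxE.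
  by rewrite /X subE [d32 _ _ _ _]mxE mulr1 subrr.
have X0 : X != 0.
  apply/eqP => e; have [_ /eqP] : - z = 0 /\ (1 : K) = 0; last by rewrite oner_eq0.
  apply: ind; apply: (can_inj (mulmxK QU)); apply: (can_inj (mulKmx PU)); rewrite mul0mx mulmx0 -[RHS]e.
  by rewrite /X /Y -PZQ scale1r mulmxA !mulmxDr !mulmxDl -scalemxAr -scalemxAl scaleNr addrC.
have p0 : pen Z1 Z2 (d32 0 0) X.
  exists P, Q, 1, 0, (- z), 1; rewrite !scale1r scale0r addr0; split=> //.
  by rewrite /X /Y -PZQ !mulmxDr !mulmxDl -scalemxAr -scalemxAl scaleNr addrC.
have rX a : (\rank (a *: d32 0 0 + X)%R <= 1)%N.
  have -> : a *: d32 0 0 + X = P *m ((a - z) *: Z1 + Z2) *m Q.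
    rewrite /X /Y -PZQ mulmxDr mulmxDl -scalemxAr -scalemxAl.
    by move: (P *m Z1 *m Q) (P *m Z2 *m Q) => A B; apply/matrixP => i j; rewrite !mxE; ring.
  have := rZ (a - z) 1; rewrite scale1r; apply: leq_trans.
  exact: leq_trans (mxrankM_maxl _ _) (mxrankM_maxr _ _).
have minor a i j k l : (a *: d32 0 0 + X) i k * (a *: d32 0 0 + X) j l =
    (a *: d32 0 0 + X) i l * (a *: d32 0 0 + X) j k.
  have [u [v ->]] : exists (u : 'cV[K]_3) (v : 'rV[K]_2), a *: d32 0 0 + X = u *m v.
    move: (rX a); move: (_ + X) => M; have := mulmx_base M.
    case: (\rank M) (col_base M) (row_base M) => [|[|]] // A B <- _; last by exists A, B.
    by exists 0, 0; rewrite mulmx0 thinmx0 mul0mx.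
  by rewrite !mxE !big_ord1; ring.
clearbody X.
have addE a i j : (a *: d32 0 0 + X) i j = a * ((i == 0) && (j == 0))%:R + X i j by rewrite !mxE.
have X01 i : X 0 1 * X i 0 = 0.
  by have := minor 0 0 i 0 1; rewrite !addE !mul0r !add0r X00 mul0r => ->.
have X11 i : i != 0 -> X i 1 = 0.
  move=> i0; have := minor 1 0 i 0 1; rewrite !addE X00 (negPf i0) /= !mulr0 !add0r addr0 !mul1r X01.
  by [].
have [x0|x0] := eqVneq (X 0 1) 0; last first.
  left; have XE : X = X 0 1 *: d32 0 1.
    apply/matrixP => i j; rewrite [RHS]mxE [d32 _ _ _ _]mxE.
    case: (ord2 j) => -> /=; rewrite ?andbF ?andbT ?mulr0.
      by move/eqP: (X01 i); rewrite mulf_eq0 (negPf x0) => /eqP.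
    by have [->|/X11->] := eqVneq i 0; rewrite ?mulr1 ?mulr0.
  apply: (pen_trans p0); exists 1%:M, 1%:M, 1, 0, 0, (X 0 1)^-1; rewrite !unitmx1 !mul1mx !mulmx1.
  by rewrite scale1r !scale0r addr0 add0r; split=> //; rewrite {2}XE scalerK.
right; have Xj i : X i 1 = 0 by have [->|/X11] := eqVneq i 0.
have XE : X = X 1 0 *: d32 1 0 + X 2 0 *: d32 2 0.
  have comE (A B : M32) a b i j : (a *: A + b *: B) i j = a * A i j + b * B i j by rewrite !mxE.
  apply/matrixP => i j; rewrite comE ![d32 _ _ _ _]mxE.
  case: (ord2 j) => -> /=; rewrite ?andbF ?andbT ?mulr0 ?addr0 ?Xj //.
  have [->|i0] := eqVneq i 0; first by rewrite X00 !mulr0 addr0.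
  have [->|i1] := eqVneq i 1; first by rewrite mulr1 mulr0 addr0.
  have -> : i = 2; last by rewrite mulr0 mulr1 add0r.
  by apply/val_inj; case: i i0 i1 => [[|[|[|]]]].
have [x1|x1] := eqVneq (X 1 0) 0.
  have x2 : X 2 0 != 0 by apply: contraNneq X0 => x2; rewrite XE x1 x2 !scale0r addr0.
  apply: (pen_trans p0); exists (tperm_mx 1 2), 1%:M, 1, 0, 0, (X 2 0)^-1.
  rewrite !mulmx1 scale1r !scale0r addr0 add0r unitmx_perm unitmx1; split=> //.
    by apply/matrixP => i j; rewrite -xrowE !mxE permE; case: i => [[|[|[|]]]].
  rewrite {2}XE x1 scale0r add0r scalerK //.
  by apply/matrixP => i j; rewrite -xrowE !mxE permE; case: i => [[|[|[|]]]].
pose c := X 2 0 / X 1 0.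
have dd : (delta_mx 2 1 : 'M[K]_(2 + 1)) *m (delta_mx 2 1 : 'M[K]_(2 + 1)) = 0 by rewrite mul_delta_mx_0.
have PP : ((1%:M - c *: delta_mx 2 1) : 'M[K]_(2 + 1)) *m ((1%:M + c *: delta_mx 2 1) : 'M[K]_(2 + 1)) = 1%:M.
  by rewrite mulmxDr mulmx1 mulmxBl mul1mx -scalemxAl -scalemxAr dd !scaler0 subr0 subrK.
apply: (pen_trans p0); exists (1%:M - c *: (delta_mx 2 1 : 'M[K]_(2 + 1))), 1%:M, 1, 0, 0, (X 1 0)^-1.
rewrite !mulmx1 scale1r !scale0r addr0 add0r unitmx1; split=> //.
- by have [] := mulmx1_unit PP.
- by rewrite /d32 mulmxBl mul1mx -scalemxAl mul_delta_mx_0 // scaler0 subr0.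
rewrite {2}XE /d32 scalerDr !scalerA mulVf // scale1r mulmxBl mul1mx mulmxDr -!scalemxAr -!scalemxAl.
rewrite mul_delta_mx mul_delta_mx_0 // !scaler0 addr0 /c mulrC.
by rewrite addrK.
Qed.
End Pencil.

Section Rows.
Variables (K : fieldType) (N : nat).

Lemma free_rows m (s : seq 'rV[K]_N) (M : 'M[K]_(m, N)) : size s = m ->
  (forall i : 'I_m, s`_i = row i M) -> free s = row_free M.
Proof.
move=> sm sM; apply/idP/idP => H.
  apply/inj_row_free => u uM; apply/rowP => j; rewrite mxE.
  pose a i : K := if insub i is Some k then u 0 k else 0.
  have := freeN0 (a := a) H; rewrite sm => /(_ _ j (ltn_ord j)).
  rewrite /a valK; apply; rewrite -[RHS]uM mulmx_sum_row.
  by apply: eq_bigr => i _; rewrite valK sM.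
apply: freeNP => a; rewrite sm => sa i im.
have : (\row_(j < m) a j) *m M = 0.
  rewrite mulmx_sum_row -[RHS]sa; apply: eq_bigr => j _.
  by rewrite mxE sM.
move/eqP; rewrite mulmx_free_eq0 // => /eqP/rowP/(_ (Ordinal im)).
by rewrite !mxE.
Qed.

Lemma span_row_sub m (s : seq 'rV[K]_N) (M : 'M[K]_(m, N)) u : size s = m ->
  (forall i : 'I_m, s`_i = row i M) -> u \in <<s>>%VS -> (u <= M)%MS.
Proof.
move=> sm sM /mem_spanP[a ->]; rewrite sm.
have -> : \sum_(i < m) a i *: s`_i = (\row_i a i) *m M.
  by rewrite mulmx_sum_row; apply: eq_bigr => i _; rewrite mxE sM.
exact: submxMl.
Qed.
End Rows.

(** * Blocks of a maximal ideal of square zero *)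

Section Blocks.
Variables (K : numClosedFieldType) (n : nat) (V : {vspace 'M[K]_n.+1}).
Implicit Types (x y z g h : 'M[K]_n.+1) (u v w : 'rV[K]_n.+1) (U W : seq 'rV[K]_n.+1).

Definition null_blocks U W :=
  [/\ size (U ++ W) = n.+1, free (U ++ W),
      forall w x, w \in W -> nn V x -> w *m x = 0 &
      forall u x, nn V x -> u *m x \in <<W>>%VS].

Hypotheses (VA : comm_subalg V) (VL : local_alg V) (dV : \dim V = n.+1).
Hypothesis sq0 : forall x, nn V x -> x * x = 0.

Lemma frame_eq0 U x : size U = n.+1 -> free U -> (forall u, u \in U -> u *m x = 0) -> x = 0.
Proof.
move=> sU fU H; apply/row_matrixP => i; rewrite row0 rowE.
have /mem_spanP[a ->] := frame_span (delta_mx 0 i) sU fU.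
by rewrite mulmx_suml big1 // => j _; rewrite -scalemxAl H ?scaler0 // mem_nth.
Qed.

Lemma nn_neq0 : (0 < n)%N -> exists2 x, nn V x & x != 0.
Proof.
move=> n0; have [xs [sx nx bV]] := nn_basis VA VL dV.
case: xs sx nx bV => [|x xs] sx nx bV; first by rewrite -sx in n0.
exists x; first by apply: nx; rewrite inE eqxx.
have := basis_free bV; rewrite !free_cons => /andP[_ /andP[h _]].
by apply: contraNneq h => ->; exact: mem0v.
Qed.

Lemma null_blocks_pos U W : null_blocks U W -> (0 < n)%N -> (0 < size U)%N && (0 < size W)%N.
Proof.
move=> [sUW fUW WK UW] /nn_neq0[x nx x0]; apply/andP; split; rewrite lt0n size_eq0.
  apply: contra_neqN x0 => /eqP U0; apply: (frame_eq0 sUW fUW) => u.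
  by rewrite U0 => /WK; apply.
apply: contra_neqN x0 => /eqP W0; apply: (frame_eq0 sUW fUW) => u _.
by have := UW u x nx; rewrite W0 span_nil memv0 => /eqP.
Qed.

(** The rest of the frame is killed by the maximal ideal, so a nilpotent x is determined by u x. *)
Lemma null_blocks1 U W : null_blocks U W -> size U = 1%N -> exists v, cyclic_vec V v.
Proof.
case: U => [|u [|]] // [sUW fUW WK UW] _; exists u => X XV uX.
have [a [x [nx XE]]] := nn_dec VA VL XV.
have a0 : a = 0.
  apply/eqP; apply: contraTT fUW => a0; rewrite /= free_cons negb_and negbK.
  apply/orP; left; have -> : u = - a^-1 *: (u *m x).
    apply: (scalerI a0); rewrite scalerA mulrN mulfV // scaleN1r.
    move/eqP: uX; rewrite XE mulmxDr -scalemxAr mulmx1 addr_eq0 => /eqP->.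
    by [].
  by rewrite memvZ // UW.
rewrite XE a0 scale0r add0r; rewrite XE a0 scale0r add0r in uX.
by apply: (frame_eq0 sUW fUW) => w; rewrite inE => /predU1P[->//|/WK]; apply.
Qed.

Definition blocks p k (Pu : 'M[K]_(p, n.+1)) (Pw : 'M[K]_(k, n.+1)) :=
  [/\ (p + k = n.+1)%N, row_free (col_mx Pu Pw) &
      forall x, nn V x -> Pw *m x = 0 /\ exists B, Pu *m x = B *m Pw].

Lemma blocks_of_null U W p k : null_blocks U W -> size U = p -> size W = k ->
  exists Pu Pw, @blocks p k Pu Pw.
Proof.
move=> [sUW fUW WK UW] sU sW.
pose Pu : 'M[K]_(p, n.+1) := \matrix_(i < p) U`_i; pose Pw : 'M[K]_(k, n.+1) := \matrix_(i < k) W`_i.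
exists Pu, Pw; split; first by rewrite -sUW size_cat sU sW.
  rewrite -(@free_rows _ _ _ (U ++ W)) ?size_cat ?sU ?sW // => i.
  case: (splitP i) => j ij; rewrite nth_cat ij sU.
    have -> : i = lshift k j by exact/val_inj.
    by rewrite (ltn_ord j) rowKu rowK.
  have -> : i = rshift p j by exact/val_inj.
  by rewrite ltnNge leq_addr /= addKn rowKd rowK.
move=> x nx; split.
  by apply/row_matrixP => i; rewrite row_mul rowK row0 WK // mem_nth ?sW.
apply/submxP; apply/row_subP => i; rewrite row_mul.
by apply: (span_row_sub sW) (UW _ _ nx) => j; rewrite rowK.
Qed.

Lemma blocks_change p k (Pu : 'M[K]_(p, n.+1)) (Pw : 'M[K]_(k, n.+1)) Q P :
  blocks Pu Pw -> Q \in unitmx -> P \in unitmx -> blocks (Q *m Pu) (P *m Pw).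
Proof.
move=> [pk fr H] QU PU; split=> //.
  have -> : col_mx (Q *m Pu) (P *m Pw) = block_mx Q 0 0 P *m col_mx Pu Pw.
    by rewrite mul_block_col !mul0mx addr0 add0r.
  rewrite -row_leq_rank mxrankMfree //; apply: (leq_trans _ (leqnn _)).
  by rewrite row_leq_rank row_free_unit unitmxE det_ublock unitrM -!unitmxE QU PU.
move=> x nx; have [w0 [B e]] := H x nx; split; first by rewrite -mulmxA w0 mulmx0.
by exists (Q *m B *m invmx P); rewrite -!mulmxA e mulKmx.
Qed.

(** The orthogonal, for the trace form, of an n-dimensional space of p x k blocks has dimension at
    least p k - n; a basis of it is cut to exactly this length. *)
Lemma blocks_null p k (Pu : 'M[K]_(p, n.+1)) (Pw : 'M[K]_(k, n.+1)) : blocks Pu Pw ->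
  exists Zs : seq 'M[K]_(k, p), [/\ size Zs = (p * k - n)%N, free Zs &
    forall x B Z, nn V x -> Pu *m x = B *m Pw -> Z \in Zs -> \tr (B *m Z) = 0].
Proof.
move=> [pk fr H]; have [xs [sx nx bV]] := nn_basis VA VL dV.
have fw : row_free Pw.
  apply/inj_row_free => u uP; have := mulmx_free_eq0 (row_mx 0 u : 'rV_(p + k)) fr.
  by rewrite mul_row_col mul0mx uP addr0 eqxx row_mx_eq0 eqxx => /esym/eqP.
pose Bf (x : 'M[K]_n.+1) : 'M[K]_(p, k) := Pu *m x *m pinvmx Pw.
have BfE x B : Pu *m x = B *m Pw -> B = Bf x.
  by move=> e; rewrite /Bf e mulmxKp.
pose f (Z : 'M[K]_(k, p)) : 'rV[K]_n := \row_i \tr (Bf xs`_i *m Z).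
have lf : linear f.
  by move=> a Z Z'; apply/rowP => i; rewrite !mxE mulmxDr -scalemxAr mxtraceD mxtraceZ.
pose fl : {linear _ -> _} := HB.pack f (GRing.isLinear.Build _ _ _ _ f lf).
pose Kr := lker (linfun fl).
have dK : (p * k - n <= \dim Kr)%N.
  have := limg_ker_dim (linfun fl) fullv; rewrite capfv -/Kr dimvf /dim /=.
  have : (\dim (linfun fl @: fullv) <= n)%N.
    by apply: (leq_trans (dimvS (subvf _))); rewrite dimvf /dim /= mul1n.
  by move=> h1 h2; rewrite mulnC -h2 leq_subLR addnC leq_add2r.
exists (take (p * k - n) (vbasis Kr)); split.
- by rewrite size_takel // size_tuple.
- have := basis_free (vbasisP Kr); rewrite -{1}(cat_take_drop (p * k - n) (vbasis Kr)).
  exact: catl_free.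
move=> x B Z nx' /BfE-> /mem_take/vbasis_mem; rewrite memv_ker lfunE /= => /eqP fZ.
have : x \in <<1 :: xs>>%VS by rewrite (span_basis bV) // nnV.
rewrite span_cons => /memv_addP[y /vlineP[a ->]] [z zs xE].
move: zs => /mem_spanP[c zE].
have nz : nn V z.
  rewrite zE; elim/big_ind: _ => [|? ? ? ?|i _]; first by split; [rewrite mem0v|exact: nilp0].
    exact: (nnD VA).
  by apply: nnZ; apply: nx; rewrite mem_nth.
have a0 : a = 0 by apply: (nn_scal VA nz); rewrite -xE.
rewrite xE a0 scale0r add0r zE /Bf mulmx_sumr !mulmx_suml raddf_sum big1 // => i _.
rewrite -scalemxAr -!scalemxAl /= mxtraceZ.
have i_n : (i < n)%N by apply: (leq_trans (ltn_ord i)); rewrite sx leqnn.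
by move/rowP/(_ (Ordinal i_n)): fZ; rewrite !mxE => ->; rewrite mulr0.
Qed.
End Blocks.

Section Tr.
Variables (K : numClosedFieldType) (n : nat) (V : {vspace 'M[K]_n.+1}).
Implicit Types (U W : seq 'rV[K]_n.+1).
Lemma nn_tr x : nn (trV V) x -> nn V x^T.
Proof. by move=> []; rewrite mem_trV => xV nx; split=> //; exact: nilp_tr. Qed.

(** The dual frame, in which the vectors dual to W play the part of U and conversely. *)
Lemma null_blocks_tr U W : null_blocks V U W ->
  exists U' W', [/\ null_blocks (trV V) U' W', size U' = size W & size W' = size U].
Proof.
move=> [sUW fUW WK UW].
have PU := frame_unit sUW fUW; set P := frame_mx (U ++ W) in PU.
pose q := [seq row i (invmx P)^T | i <- enum 'I_n.+1].
have sq : size q = n.+1 by rewrite size_map size_enum_ord.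
have qE (i : 'I_n.+1) : q`_i = row i (invmx P)^T.
  by rewrite (nth_map i) ?size_enum_ord // nth_ord_enum.
have fq : free q by rewrite (free_rows sq qE) row_free_unit unitmx_tr unitmx_inv.
have dual (i j : 'I_n.+1) : q`_i *m ((U ++ W)`_j)^T = (i == j)%:R%:M.
  have -> : (U ++ W)`_j = row j P by rewrite rowK.
  rewrite qE tr_row -row_mul; apply/matrixP => a b; rewrite !ord1 !mxE eqxx mulr1n.
  have := mulmxV PU => /matrixP/(_ j i); rewrite !mxE eq_sym => <-.
  by apply: eq_bigr => l _; rewrite !mxE mulrC.
have sUW' : (size U + size W)%N = n.+1 by rewrite -size_cat.
have sU : (size U <= n.+1)%N by apply: (leq_trans (leq_addr (size W) _)); rewrite sUW'.
exists (drop (size U) q), (take (size U) q); split; last 2 first.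
- by rewrite size_drop sq -[n.+1]/(n.+1 : nat) -(addKn (size U) (size W)) sUW'.
- by rewrite size_takel // sq.
have pe : perm_eq (drop (size U) q ++ take (size U) q) q.
  by rewrite perm_catC cat_take_drop.
have orth y (i : 'I_n.+1) : (i < size U)%N -> y \in <<W>>%VS -> q`_i *m y^T = 0.
  move=> iU /mem_spanP[a ->]; rewrite linear_sum mulmx_sumr big1 // => j _.
  rewrite linearZ -scalemxAr.
  have jn : (size U + j < n.+1)%N by apply: leq_trans (_ : _ <= size U + size W)%N _; rewrite ?ltn_add2l ?sUW'.
  have := dual i (Ordinal jn); rewrite /= nth_cat ltnNge leq_addr /= addKn => ->.
  by rewrite -val_eqE /= eqn_leq [(_ + _ <= _)%N]leqNgt (leq_trans iU (leq_addr _ _)) andbF raddf0 scaler0.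
have xyT (x : 'M[K]_n.+1) (y : 'rV[K]_n.+1) : x *m y^T = (y *m x^T)^T by rewrite trmx_mul trmxK.
have frame0 (y : 'rV[K]_n.+1) : (forall j : 'I_n.+1, y *m ((U ++ W)`_j)^T = 0) -> y = 0.
  move=> H; apply: (can_inj (mulmxK (_ : P^T \in unitmx))); first by rewrite unitmx_tr.
  rewrite mul0mx; apply/rowP => j; rewrite [RHS]mxE.
  have := H j; have -> : (U ++ W)`_j = row j P by rewrite rowK.
  by move=> /matrixP/(_ 0 0); rewrite !mxE => h; rewrite -[RHS]h; apply: eq_bigr => l _; rewrite !mxE.
split.
- by rewrite (perm_size pe).
- by rewrite (perm_free pe).
- move=> w x /(nthP 0)[i]; rewrite size_takel ?sq // => iU <- /nn_tr nx.
  rewrite nth_take //; apply: frame0 => j.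
  have iN : (i < n.+1)%N by exact: leq_trans sU.
  by rewrite -mulmxA xyT (orth _ (Ordinal iN)) // UW.
move=> u x /nn_tr nx.
have /mem_spanP[a uE] : u *m x \in <<q>>%VS by exact: frame_span.
rewrite sq in uE.
have a0 (j : 'I_n.+1) : (size U <= j)%N -> a j = 0.
  move=> Uj; have : u *m x *m ((U ++ W)`_j)^T = 0.
    rewrite -mulmxA xyT nth_cat ltnNge Uj /= WK ?trmx0 ?mulmx0 //.
    by rewrite mem_nth // ltn_subLR // sUW'.
  rewrite uE mulmx_suml (bigD1 j) //= big1 => [|i ij].
    rewrite -scalemxAl dual eqxx addr0 => /matrixP/(_ 0 0).
    by rewrite !mxE eqxx mulr1.
  by rewrite -scalemxAl dual (negPf ij) raddf0 scaler0.
rewrite uE; apply: memv_suml => i _; case: (leqP (size U) i) => iU.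
  by rewrite a0 // scale0r mem0v.
rewrite memvZ // memv_span // -(nth_take 0 iU q) mem_nth // size_takel // sq //.
Qed.
End Tr.

Definition nent (j k : nat) : nat * nat * int := (j, k, -1).
(** In the frame U followed by W, the blocks B run over the orthogonal of a normal form: one matrix
    of rank 1 or 2 for [mod_4a] and [mod_4b], the six pencils of [pen_rank1] and [pen_rank2] for
    [mod_p1] to [mod_p6]. The entries -1 come from B_11 = - B_00, orthogonality to the identity or
    to [JJ]. *)
Definition mod_4a : model :=
  [:: diag_slice 4; [:: ent 0 3]; [:: ent 1 2]; [:: ent 1 3]].
Definition mod_4b : model :=
  [:: diag_slice 4; [:: ent 0 2; nent 1 3]; [:: ent 0 3]; [:: ent 1 2]].
Definition mod_p1 : model :=
  [:: diag_slice 5; [:: ent 0 3]; [:: ent 0 4]; [:: ent 1 3]; [:: ent 1 4]].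
Definition mod_p2 : model :=
  [:: diag_slice 5; [:: ent 0 4]; [:: ent 1 2]; [:: ent 1 3]; [:: ent 1 4]].
Definition mod_p3 : model :=
  [:: diag_slice 5; [:: ent 0 3]; [:: ent 0 4]; [:: ent 1 2]; [:: ent 1 4]].
Definition mod_p4 : model :=
  [:: diag_slice 5; [:: ent 0 2; nent 1 3]; [:: ent 0 3]; [:: ent 0 4]; [:: ent 1 4]].
Definition mod_p5 : model :=
  [:: diag_slice 5; [:: ent 0 2; nent 1 3]; [:: ent 0 3]; [:: ent 0 4]; [:: ent 1 2]].
Definition mod_p6 : model :=
  [:: diag_slice 5; [:: ent 0 2; nent 1 3]; [:: ent 0 3; nent 1 4]; [:: ent 0 4]; [:: ent 1 2]].

Section SumLit.
Variables (K : pzRingType) (M : lmodType K) (n : nat) (F : nat -> M).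
Lemma big_ord4 : n = 3%N -> \sum_(i < n.+1) F i = F 0%N + (F 1%N + (F 2%N + F 3%N)).
Proof. by move=> ->; rewrite !big_ord_recl big_ord0 addr0. Qed.
Lemma big_ord5 : n = 4%N -> \sum_(i < n.+1) F i = F 0%N + (F 1%N + (F 2%N + (F 3%N + F 4%N))).
Proof. by move=> ->; rewrite !big_ord_recl big_ord0 addr0. Qed.
End SumLit.

Ltac block_close h1 h2 :=
  split; [by [] | | |
    let i := fresh "i" in let j := fresh "j" in
    move=> i j; case: i => [|[|[|[|[|i]]]]] //; case: j => [|[|[|[|[|j]]]]] // _ _; by rewrite slice_actE];
  rewrite !slice_actE /= ?h1 ?h2;
  let t := fresh "t" in apply/rowP => t; rewrite !mxE; ring.

Section SqZero.
Variables (K : numClosedFieldType) (n : nat) (V : {vspace 'M[K]_n.+1}).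
Hypotheses (VA : comm_subalg V) (VL : local_alg V) (dV : \dim V = n.+1).
Hypothesis sq0 : forall x, nn V x -> x * x = 0.

Lemma ord3 (i : 'I_(2 + 1)) : [\/ i = 0, i = 1 | i = 2].
Proof. by case: i => [[|[|[|i]]] hi] //; [constructor 1|constructor 2|constructor 3]; exact/val_inj. Qed.

Lemma row_mul2 m (B : 'M[K]_(m, 2)) (P : 'M[K]_(2, n.+1)) i :
  row i (B *m P) = B i 0 *: row 0 P + B i 1 *: row 1 P.
Proof. by rewrite row_mul mulmx_sum_row !big_ord_recl big_ord0 addr0 !mxE lift01. Qed.

Lemma row_mul3 m (B : 'M[K]_(m, 2 + 1)) (P : 'M[K]_(2 + 1, n.+1)) i :
  row i (B *m P) = B i 0 *: row 0 P + (B i 1 *: row 1 P + B i 2 *: row 2 P).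
Proof.
have e1 : lift ord0 (ord0 : 'I_2) = 1 :> 'I_(2 + 1) by exact/val_inj.
have e2 : lift ord0 (lift ord0 (ord0 : 'I_1) : 'I_2) = 2 :> 'I_(2 + 1) by exact/val_inj.
by rewrite row_mul mulmx_sum_row !big_ord_recl big_ord0 addr0 !mxE e1 e2.
Qed.

Ltac lit_cases j jn n4 :=
  case: j jn => [|[|[|[|[|j]]]]] jn; try (by exfalso; move: jn; rewrite n4).

Lemma fits_blocks23 E (Pu : 'M[K]_(2, n.+1)) (Pw : 'M[K]_(2 + 1, n.+1)) : n = 4%N -> blocks V Pu Pw ->
  (forall x B, nn V x -> Pu *m x = B *m Pw -> exists c : nat -> K,
     let p := [:: row 0 Pu; row 1 Pu; row 0 Pw; row 1 Pw; row 2 Pw] in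
     [/\ nth [::] E 0 = diag_slice 5,
       B 0 0 *: row 0 Pw + (B 0 1 *: row 1 Pw + B 0 2 *: row 2 Pw) =
        c 1%N *: slice_act (nth [::] E 1) p 0 + (c 2%N *: slice_act (nth [::] E 2) p 0 +
        (c 3%N *: slice_act (nth [::] E 3) p 0 + c 4%N *: slice_act (nth [::] E 4) p 0)),
       B 1 0 *: row 0 Pw + (B 1 1 *: row 1 Pw + B 1 2 *: row 2 Pw) =
        c 1%N *: slice_act (nth [::] E 1) p 1 + (c 2%N *: slice_act (nth [::] E 2) p 1 +
        (c 3%N *: slice_act (nth [::] E 3) p 1 + c 4%N *: slice_act (nth [::] E 4) p 1)) &
       forall i j, (0 < i < 5)%N -> (1 < j < 5)%N -> slice_act (nth [::] E i) p j = 0]) ->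
  fits V E.
Proof.
move=> n4 [_ fr H] HE.
pose p := [:: row 0 Pu; row 1 Pu; row 0 Pw; row 1 Pw; row 2 Pw].
have fp : free p.
  rewrite (@free_rows _ _ _ p (col_mx Pu Pw)) // => i.
  case: (splitP i) => j ij.
    have -> : i = lshift _ j by exact/val_inj.
    by rewrite rowKu; case: (ord2 j) => ->.
  have -> : i = rshift _ j by exact/val_inj.
  by rewrite rowKd; case: (ord3 j) => ->.
exists p; split; rewrite /= ?n4 // => X XV.
have [a [x [nx ->]]] := nn_dec VA VL XV.
have [w0 [B uB]] := H x nx.
have [c /= [E0 e0 e1 e2]] := HE x B nx uB.
exists (fun i => if i is 0 then a else c i) => j jn.
rewrite mulmxDr -scalemxAr mulmx1.
rewrite (big_ord5 (fun i => (if i is 0 then a else c i) *: slice_act (nth [::] E i) p j) n4) /=.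
rewrite E0 diag_act; last by move: jn; rewrite n4.
congr (_ + _); lit_cases j jn n4 => /=.
- by rewrite -e0 -row_mul uB row_mul3.
- by rewrite -e1 -row_mul uB row_mul3.
- by rewrite !e2 // !scaler0 !addr0 -row_mul w0 row0.
- by rewrite !e2 // !scaler0 !addr0 -row_mul w0 row0.
- by rewrite !e2 // !scaler0 !addr0 -row_mul w0 row0.
Qed.

Lemma fits_blocks22 E (Pu Pw : 'M[K]_(2, n.+1)) : n = 3%N -> blocks V Pu Pw ->
  (forall x B, nn V x -> Pu *m x = B *m Pw -> exists c : nat -> K,
     let p := [:: row 0 Pu; row 1 Pu; row 0 Pw; row 1 Pw] in
     [/\ nth [::] E 0 = diag_slice 4,
       B 0 0 *: row 0 Pw + B 0 1 *: row 1 Pw =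
        c 1%N *: slice_act (nth [::] E 1) p 0 + (c 2%N *: slice_act (nth [::] E 2) p 0 +
        c 3%N *: slice_act (nth [::] E 3) p 0),
       B 1 0 *: row 0 Pw + B 1 1 *: row 1 Pw =
        c 1%N *: slice_act (nth [::] E 1) p 1 + (c 2%N *: slice_act (nth [::] E 2) p 1 +
        c 3%N *: slice_act (nth [::] E 3) p 1) &
       forall i j, (0 < i < 4)%N -> (1 < j < 4)%N -> slice_act (nth [::] E i) p j = 0]) ->
  fits V E.
Proof.
move=> n3 [_ fr H] HE.
pose p := [:: row 0 Pu; row 1 Pu; row 0 Pw; row 1 Pw].
have fp : free p.
  rewrite (@free_rows _ _ _ p (col_mx Pu Pw)) // => i.
  case: (splitP i) => j ij.
    have -> : i = lshift _ j by exact/val_inj.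
    by rewrite rowKu; case: (ord2 j) => ->.
  have -> : i = rshift _ j by exact/val_inj.
  by rewrite rowKd; case: (ord2 j) => ->.
exists p; split; rewrite /= ?n3 // => X XV.
have [a [x [nx ->]]] := nn_dec VA VL XV.
have [w0 [B uB]] := H x nx.
have [c /= [E0 e0 e1 e2]] := HE x B nx uB.
exists (fun i => if i is 0 then a else c i) => j jn.
rewrite mulmxDr -scalemxAr mulmx1.
rewrite (big_ord4 (fun i => (if i is 0 then a else c i) *: slice_act (nth [::] E i) p j) n3) /=.
rewrite E0 diag_act; last by move: jn; rewrite n3.
congr (_ + _); lit_cases j jn n3 => /=.
- by rewrite -e0 -row_mul uB row_mul2.
- by rewrite -e1 -row_mul uB row_mul2.
- by rewrite !e2 // !scaler0 !addr0 -row_mul w0 row0.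
- by rewrite !e2 // !scaler0 !addr0 -row_mul w0 row0.
Qed.

Lemma trace_d32 (B : 'M[K]_(2, 2 + 1)) i j : \tr (B *m d32 K i j) = B j i.
Proof.
rewrite /mxtrace (bigD1 j) //= big1 => [|k kj]; last first.
  by rewrite !mxE big1 // => l _; rewrite !mxE (negPf kj) andbF mulr0.
rewrite addr0 !mxE (bigD1 i) //= big1 => [|l li].
  by rewrite !mxE !eqxx mulr1 addr0.
by rewrite !mxE (negPf li) mulr0.
Qed.

Lemma trace_JJ (B : 'M[K]_(2, 2 + 1)) : \tr (B *m JJ K) = B 0 0 + B 1 1.
Proof.
suff -> : JJ K = d32 K 0 0 + d32 K 1 1 by rewrite mulmxDr mxtraceD !trace_d32.
apply/matrixP => i j; rewrite !mxE; case: splitP => k ik; rewrite !mxE -!val_eqE /= ik.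
  by case: (ord2 k) => ->; case: (ord2 j) => -> /=; rewrite ?addr0 ?add0r.
by rewrite !add0r.
Qed.

Lemma sq_blocks23 (Pu : 'M[K]_(2, n.+1)) (Pw : 'M[K]_(2 + 1, n.+1)) : n = 4%N -> blocks V Pu Pw ->
  [\/ fits V mod_p1, fits V mod_p2, fits V mod_p3 | fits V mod_p4] \/ fits V mod_p5 \/ fits V mod_p6.
Proof.
move=> n4 bl; have [Zs [sZ fZ tZ]] := blocks_null VA VL dV bl.
have {}sZ : size Zs = 2%N by rewrite sZ n4.
case: Zs sZ fZ tZ => [|Z1 [|Z2 [|]]] // _ fZ tZ.
have change N1 N2 : pen Z1 Z2 N1 N2 -> exists Pu' Pw', blocks V Pu' Pw' /\
    forall x B, nn V x -> Pu' *m x = B *m Pw' -> \tr (B *m N1) = 0 /\ \tr (B *m N2) = 0.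
  move=> [P [Q [a [b [c [d [PU QU e1 e2]]]]]]].
  have QU' : invmx Q \in unitmx by rewrite unitmx_inv.
  exists (invmx Q *m Pu), (P *m Pw); split; first exact: blocks_change.
  move=> x B nx e; have e' : Pu *m x = (Q *m B *m P) *m Pw.
    by rewrite -2!mulmxA -e -mulmxA mulKVmx.
  have t1 : \tr ((Q *m B *m P) *m Z1) = 0 by apply: (tZ x) => //; rewrite inE eqxx.
  have t2 : \tr ((Q *m B *m P) *m Z2) = 0 by apply: (tZ x) => //; rewrite !inE eqxx orbT.
  have key k l : \tr (B *m (P *m (k *: Z1 + l *: Z2) *m Q)) = 0.
    rewrite !mulmxA mxtrace_mulC !mulmxA mulmxDr -!scalemxAr mxtraceD !mxtraceZ.
    by rewrite t1 t2 !mulr0 addr0.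
  by rewrite -e1 -e2 !key.
have [[a [b r2]]|nr2] := EM (exists a b, \rank (a *: Z1 + b *: Z2)%R = 2%N); last first.
  have r1 a b : (\rank (a *: Z1 + b *: Z2)%R <= 1)%N.
    have := rank_leq_col (a *: Z1 + b *: Z2); rewrite leq_eqVlt => /predU1P[e|//].
    by case: nr2; exists a, b.
  case: (pen_rank1 fZ r1) => /change[Pu' [Pw' [bl' H]]]; left; [constructor 1|constructor 2];
    apply: (fits_blocks23 n4 bl') => x B nx /(H x B nx)[]; rewrite !trace_d32 => h1 h2.
    exists (nth 0 [:: 0; B 0 1; B 0 2; B 1 1; B 1 2]); block_close h1 h2.
  exists (nth 0 [:: 0; B 0 2; B 1 0; B 1 1; B 1 2]); block_close h1 h2.
have trJ B : \tr (B *m JJ K) = 0 -> B 1 1 = - B 0 0.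
  by rewrite trace_JJ => /eqP; rewrite addrC addr_eq0 => /eqP.
case: (pen_rank2 fZ r2) => /change[Pu' [Pw' [bl' H]]].
- left; constructor 3; apply: (fits_blocks23 n4 bl') => x B nx /(H x B nx)[] /trJ; rewrite !trace_d32 => h1 h2.
  rewrite h2 oppr0 in h1; exists (nth 0 [:: 0; B 0 1; B 0 2; B 1 0; B 1 2]); block_close h1 h2.
- left; constructor 4; apply: (fits_blocks23 n4 bl') => x B nx /(H x B nx)[] /trJ; rewrite !trace_d32 => h1 h2.
  exists (nth 0 [:: 0; B 0 0; B 0 1; B 0 2; B 1 2]); block_close h1 h2.
- right; left; apply: (fits_blocks23 n4 bl') => x B nx /(H x B nx)[] /trJ; rewrite !trace_d32 => h1 h2.
  exists (nth 0 [:: 0; B 0 0; B 0 1; B 0 2; B 1 0]); block_close h1 h2.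
right; right; apply: (fits_blocks23 n4 bl') => x B nx /(H x B nx)[] /trJ h1.
rewrite mulmxDr mxtraceD !trace_d32 addrC => /eqP; rewrite addr_eq0 => /eqP h2.
exists (nth 0 [:: 0; B 0 0; B 0 1; B 0 2; B 1 0]); block_close h1 h2.
Qed.

(** Here the ideal is a hyperplane in the 2 x 2 blocks, so only the rank of one matrix Z matters. *)
Lemma sq_blocks22 (Pu Pw : 'M[K]_(2, n.+1)) : n = 3%N -> blocks V Pu Pw ->
  fits V mod_4a \/ fits V mod_4b.
Proof.
move=> n3 bl; have [Zs [sZ fZ tZ]] := blocks_null VA VL dV bl.
have {}sZ : size Zs = 1%N by rewrite sZ n3.
case: Zs sZ fZ tZ => [|Z [|]] // _; rewrite seq1_free => Z0 tZ.
set L := col_ebase Z; set R := row_ebase Z; set r := \rank Z.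
have LU : L \in unitmx by exact: col_ebase_unit.
have RU : R \in unitmx by exact: row_ebase_unit.
have ZE : L *m pid_mx r *m R = Z by exact: mulmx_ebase.
have [bl' H] : blocks V (R *m Pu) (invmx L *m Pw) /\
    forall x B, nn V x -> (R *m Pu) *m x = B *m (invmx L *m Pw) -> \tr (B *m pid_mx r) = 0.
  split; first by apply: blocks_change; rewrite ?unitmx_inv.
  move=> x B nx e; have e' : Pu *m x = (invmx R *m B *m invmx L) *m Pw.
    by rewrite -2!mulmxA -e -mulmxA mulKmx.
  have := tZ x _ Z nx e'; rewrite inE eqxx => /(_ isT); rewrite -ZE.
  by rewrite !mulmxA mulmxKV // -!mulmxA mxtrace_mulC -!mulmxA mulmxV // mulmx1.
have r0 : (0 < r)%N by rewrite lt0n mxrank_eq0.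
have r2 : (r <= 2)%N by exact: rank_leq_row.
case: (r) r0 r2 H => [|[|[|]]] // _ _ H; [left|right];
  apply: (fits_blocks22 n3 bl') => x B nx /(H x B nx); rewrite /mxtrace !big_ord_recl big_ord0 addr0 lift01 !row2E !mxE /=.
  rewrite !mulr1 !mulr0 !addr0 => h; exists (nth 0 [:: 0; B 0 1; B 1 0; B 1 1]); block_close h h.
rewrite !mulr1 !mulr0 !addr0 add0r addrC => /eqP; rewrite addr_eq0 => /eqP h.
exists (nth 0 [:: 0; B 0 0; B 0 1; B 1 0]); block_close h h.
Qed.
End SqZero.

(** * Local algebras of sizes 1 to 5 *)

Definition loc3 : seq model := [:: mod_pow 3; mod_sq 2].
Definition loc4 : seq model := [:: mod_pow 4; mod_gor2; mod_hook2; mod_sq 3; mod_4a; mod_4b].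
Definition loc5 : seq model :=
  [:: mod_pow 5; mod_gor3; mod_hook3; mod_xy; mod_yy; mod_q3; mod_q2; mod_q1; mod_n1; mod_n2;
      mod_n3; mod_n4; mod_sq 4; mod_p1; mod_p2; mod_p3; mod_p4; mod_p5; mod_p6].

Section LocalClass.
Variables (K : numClosedFieldType) (n : nat).
Implicit Types (V : {vspace 'M[K]_n.+1}).

Definition fits_one V (T : seq model) := exists2 E, E \in T & fitsD V E.

Lemma sq_cases V : comm_subalg V -> local_alg V -> \dim V = n.+1 -> (0 < n)%N ->
  (forall x, nn V x -> x * x = 0) -> fitsD V (mod_sq n) \/
  exists U W, [/\ null_blocks V U W, (size U + size W)%N = n.+1, (1 < size U)%N & (1 < size W)%N].
Proof.
move=> VA VL dV n0 sq0; have [U [W UW]] := null_frame VA VL dV sq0.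
have /andP[U0 W0] := null_blocks_pos VA VL dV UW n0.
have sUW : (size U + size W)%N = n.+1 by case: UW => s _ _ _; rewrite -size_cat.
have [U1|U1] := eqVneq (size U) 1%N.
  left; left; have [v cv] := null_blocks1 VA VL UW U1.
  exact: fits_cyclic (sq_table VA VL dV sq0) cv.
have [W1|W1] := eqVneq (size W) 1%N.
  left; right; have [U' [W' [UW' sU' _]]] := null_blocks_tr UW.
  have [v cv] := null_blocks1 (comm_subalg_trV VA) (local_trV VL) UW' (etrans sU' W1).
  apply: fits_cyclic cv; apply: has_table_trV => //; exact: sq_table.
right; exists U, W; split=> //.
  by rewrite ltn_neqAle eq_sym U1.
by rewrite ltn_neqAle eq_sym W1.
Qed.

Lemma powx V x k : comm_subalg V -> \dim V = n.+1 -> n = k -> nn V x -> x ^+ k != 0 ->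
  [/\ basis_of V (pows x k), x ^+ k.+1 = 0 & exists v, cyclic_vec V v].
Proof.
move=> VA dV nk nx xk; have dk : \dim V = k.+1 by rewrite dV nk.
split; first exact: pows_basis.
  by apply/eqP/negPn/negP => /(nn_pow_lt VA nx); rewrite dk ltnn.
exact: pows_cyclic xk.
Qed.

Lemma local1 V : comm_subalg V -> local_alg V -> \dim V = n.+1 -> n = 0%N ->
  fits V (mod_pow 1).
Proof.
move=> VA VL dV n0.
have one0 : (1 : 'M[K]_n.+1) != 0 by exact: oner_neq0.
have VE : V == <[1 : 'M[K]_n.+1]>%VS.
  have d1 : \dim V = 1%N by rewrite dV n0.
  by rewrite eq_sym eqEdim dim_vline one0 d1 leqnn andbT -memvE; case: VA.
exists [:: const_mx 1]; split; first by rewrite n0.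
  rewrite seq1_free; apply/eqP => /rowP/(_ 0); rewrite !mxE => /eqP.
  by rewrite oner_eq0.
move=> X; rewrite (eqP VE) => /vlineP[a ->]; exists (fun=> a) => j jn.
have j0 : j = 0%N by move: jn; rewrite n0; case: j.
rewrite j0 (bigD1 0) //= big1 => [|[[|i] hi]] //; last by move=> _; exfalso; move: hi; rewrite n0.
by rewrite slice_actE /= int1E !addr0 -scalemxAr mulmx1.
Qed.

Lemma local2 V : comm_subalg V -> local_alg V -> \dim V = n.+1 -> n = 1%N ->
  fits V (mod_pow 2).
Proof.
move=> VA VL dV n1.
have n0 : (0 < n)%N by rewrite n1.
have [x nx x0] := nn_neq0 VA VL dV n0.
have [|bV x2 [v cv]] := powx VA dV n1 nx; first by rewrite expr1.
by apply: fits_cyclic cv; exact: pow2_table bV _.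
Qed.

Lemma local3 V : comm_subalg V -> local_alg V -> \dim V = n.+1 -> n = 2%N ->
  fits_one V loc3.
Proof.
move=> VA VL dV n2.
have [[x nx x2]|h] := EM (exists2 x, nn V x & x ^+ 2 != 0).
  have [bV x3 cV] := powx VA dV n2 nx x2.
  exists (mod_pow 3); rewrite ?inE //.
  by apply: (table_fits VA _ (or_introl cV)); exact: pow3_table bV _.
have sq0 x : nn V x -> x * x = 0.
  by move=> nx; apply/eqP; apply: contrapT => /negP x2; apply: h; exists x.
have n0 : (0 < n)%N by rewrite n2.
have [f|[U [W [_ e U1 W1]]]] := sq_cases VA VL dV n0 sq0.
  by exists (mod_sq 2); rewrite ?inE //; suff -> : mod_sq 2 = mod_sq n by []; rewrite n2.
by exfalso; move: (size U) (size W) e U1 W1 => a b; rewrite n2; lia.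
Qed.

Lemma local4 V : comm_subalg V -> local_alg V -> \dim V = n.+1 -> n = 3%N ->
  fits_one V loc4.
Proof.
move=> VA VL dV n3.
have [[x nx x3]|h3] := EM (exists2 x, nn V x & x ^+ 3 != 0).
  have [bV x4 cV] := powx VA dV n3 nx x3.
  exists (mod_pow 4); rewrite ?inE //.
  by apply: (table_fits VA _ (or_introl cV)); exact: pow4_table bV _.
have [[x nx x2]|h2] := EM (exists2 x, nn V x & x ^+ 2 != 0).
  have x3 : x ^+ 3 = 0 by apply/eqP; apply: contrapT => /negP ne; apply: h3; exists x.
  have dV4 : \dim V = 4%N by rewrite dV n3.
  have [y [ny bV xy yy]] := pows_ext_norm VA VL nx dV4 x2 x3.
  have cv : (exists v, cyclic_vec V v) \/ (exists v, cyclic_vec (trV V) v).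
    case: yy => yy; [apply: (ext_soc (c := 0) VA nx ny bV) => // | apply: (ext_soc (c := 1) VA nx ny bV) => //].
      by rewrite scale0r.
    by rewrite scale1r.
  have xV := nnV nx; have yV := nnV ny.
  case: yy => yy.
    exists mod_hook2; rewrite ?inE //; apply: (table_fits VA _ cv).
    exact: hook2_table bV _ _ _.
  exists mod_gor2; rewrite ?inE //; apply: (table_fits VA _ cv).
  exact: gor2_table bV _ _ _.
have sq0 x : nn V x -> x * x = 0.
  by move=> nx; apply/eqP; apply: contrapT => /negP x2; apply: h2; exists x.
have n0 : (0 < n)%N by rewrite n3.
have [f|[U [W [UW e U1 W1]]]] := sq_cases VA VL dV n0 sq0.
  by exists (mod_sq 3); rewrite ?inE //; suff -> : mod_sq 3 = mod_sq n by []; rewrite n3.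
have sU : size U = 2%N by move: (size U) (size W) e U1 W1 => a b; rewrite n3; lia.
have sW : size W = 2%N by move: (size U) (size W) e U1 W1 => a b; rewrite n3; lia.
have [Pu [Pw bl]] := blocks_of_null UW sU sW.
by case: (sq_blocks22 VA VL dV n3 bl) => f; [exists mod_4a|exists mod_4b]; rewrite ?inE //; left.
Qed.

Lemma local5 V : comm_subalg V -> local_alg V -> \dim V = n.+1 -> n = 4%N ->
  fits_one V loc5.
Proof.
move=> VA VL dV n4; have dV5 : \dim V = 5%N by rewrite dV n4.
have use E : E \in loc5 -> fitsD V E -> fits_one V loc5 by exists E.
have [[x nx x4]|h4] := EM (exists2 x, nn V x & x ^+ 4 != 0).
  have [bV x5 cV] := powx VA dV n4 nx x4.
  apply: (use (mod_pow 5)) => //.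
  by apply: (table_fits VA _ (or_introl cV)); exact: pow5_table bV _.
have [[x nx x3]|h3] := EM (exists2 x, nn V x & x ^+ 3 != 0).
  have x4 : x ^+ 4 = 0 by apply/eqP; apply: contrapT => /negP ne; apply: h4; exists x.
  have [y [ny bV xy yy]] := pows_ext_norm VA VL nx dV5 x3 x4.
  have cv : (exists v, cyclic_vec V v) \/ (exists v, cyclic_vec (trV V) v).
    case: yy => yy; [apply: (ext_soc (c := 0) VA nx ny bV) => // | apply: (ext_soc (c := 1) VA nx ny bV) => //].
      by rewrite scale0r.
    by rewrite scale1r.
  have xV := nnV nx; have yV := nnV ny.
  case: yy => yy.
    apply: (use mod_hook3) => //; apply: (table_fits VA _ cv).
    exact: hook3_table bV _ _ _.
  apply: (use mod_gor3) => //; apply: (table_fits VA _ cv).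
  exact: gor3_table bV _ _ _.
have cube0 x : nn V x -> x ^+ 3 = 0.
  by move=> nx; apply/eqP; apply: contrapT => /negP x3; apply: h3; exists x.
have [[x nx x2]|h2] := EM (exists2 x, nn V x & x * x != 0).
  have [|[x' [y [z [nx' ny nz bV [xy xz yy yz zz]]]]]] := cube0_cases VA VL n4 dV5 cube0 nx x2.
    by case; apply: use.
  have c a b : nn V a -> nn V b -> a * b = 0 -> b * a = 0.
    by move=> na nb ab; rewrite (nnC VA nb na).
  have ss : soc_span V x' y z.
    split=> //; split=> //; rewrite ?(c _ _ _ _ xy) ?(c _ _ _ _ xz) ?(c _ _ _ _ yz) //.
    by rewrite -expr2 -exprS cube0.
  have x2' : x' * x' != 0.
    by have := basis_free bV; rewrite !free_cons => /and4P[_ _ h _]; apply: contraNneq h => ->; exact: mem0v.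
  case: (soc_span_fits VA n4 dV5 ss x2'); last by apply: use.
  by case; apply: use.
have sq0 x : nn V x -> x * x = 0.
  by move=> nx; apply/eqP; apply: contrapT => /negP x2; apply: h2; exists x.
have n0 : (0 < n)%N by rewrite n4.
have P (W : {vspace 'M[K]_n.+1}) (f : [\/ fits W mod_p1, fits W mod_p2, fits W mod_p3 | fits W mod_p4] \/
   fits W mod_p5 \/ fits W mod_p6) : exists2 E, E \in loc5 & fits W E.
  by case: f => [[f|f|f|f]|[f|f]];
    [exists mod_p1|exists mod_p2|exists mod_p3|exists mod_p4|exists mod_p5|exists mod_p6].
have [f|[U [W [UW e U1 W1]]]] := sq_cases VA VL dV n0 sq0.
  by apply: (use (mod_sq 4)) => //; suff -> : mod_sq 4 = mod_sq n by []; rewrite n4.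
(* The blocks are 2 x 3, or 3 x 2 and become 2 x 3 after transposition. *)
have [sU|sU] := eqVneq (size U) 2%N.
  have sW : size W = 3%N by move: (size U) (size W) e sU => a b; rewrite n4; lia.
  have [Pu [Pw bl]] := blocks_of_null UW sU (sW : _ = (2 + 1)%N).
  by have [E ET f] := P _ (sq_blocks23 VA VL dV n4 bl); exists E => //; left.
have sW : size W = 2%N by move: (size U) (size W) e U1 W1 sU => a b; rewrite n4; lia.
have {}sU : size U = 3%N by move: (size U) (size W) e sW => a b; rewrite n4; lia.
have [U' [W' [UW' sU' sW']]] := null_blocks_tr UW.
have [Pu [Pw bl]] := blocks_of_null UW' (etrans sU' sW) (etrans sW' sU : _ = (2 + 1)%N).
have [|E ET f] := P _ (sq_blocks23 (comm_subalg_trV VA) (local_trV VL) _ n4 bl).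
  by rewrite dim_trV.
by exists E => //; right.
Qed.
End LocalClass.

(** * Splitting along idempotents *)

Lemma dim_inj_le (K : fieldType) (vT wT : vectType K) (f : {linear vT -> wT}) (W : {vspace vT}) :
  (forall x, x \in W -> f x = 0 -> x = 0) -> (\dim W <= \dim {: wT})%N.
Proof.
move=> H; rewrite -(@limg_dim_eq _ _ _ (linfun f)) ?dimvS ?subvf //.
apply/eqP; rewrite -subv0; apply/subvP => x; rewrite memv_cap memv_ker lfunE /= memv0.
by move=> /andP[/H h /eqP/h ->].
Qed.

(** * Dimension of a local algebra of small matrices *)

Section Bounds.
Variables (K : numClosedFieldType) (n : nat) (V : {vspace 'M[K]_n.+1}).
Hypotheses (VA : comm_subalg V) (VL : local_alg V).
Implicit Types (x y : 'M[K]_n.+1).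

Lemma cyclic_dim v : cyclic_vec V v -> (\dim V <= n.+1)%N.
Proof.
move=> cv; have := @dim_inj_le _ _ _ (mulmx v) V cv.
by rewrite dimvf /dim /= mul1n.
Qed.

Lemma row_pows x k (v : 'rV[K]_n.+1) (a : nat -> K) : v *m x ^+ k != 0 -> x ^+ k.+1 = 0 ->
  \sum_(i < k.+1) a i *: (v *m x ^+ i) = 0 -> forall i, (i <= k)%N -> a i = 0.
Proof.
move=> vk xk sa; elim/ltn_ind => i IH ik.
have := congr1 (mulmx^~ (x ^+ (k - i))) sa.
rewrite mul0mx mulmx_suml (bigD1 (Ordinal (ik : (i < k.+1)%N))) //= big1.
  rewrite addr0 -scalemxAl -mulmxA -[x ^+ i *m _]exprD subnKC // => /eqP.
  by rewrite scaler_eq0 (negPf vk) orbF => /eqP.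
move=> j ij; have [ji|ji] := ltnP j i.
  by rewrite IH ?scale0r ?mul0mx // (leq_trans (ltnW ji)).
have {ij}ji : (i < j)%N by rewrite ltn_neqAle ji andbT eq_sym.
rewrite -scalemxAl -mulmxA -[x ^+ j *m _]exprD.
have -> : (j + (k - i) = (j - i.+1) + k.+1)%N by move: ji ik; lia.
by rewrite exprD xk mulr0 mulmx0 scaler0.
Qed.

Lemma row_pows_free x k (v : 'rV[K]_n.+1) : v *m x ^+ k != 0 -> x ^+ k.+1 = 0 ->
  free [seq v *m x ^+ i | i <- iota 0 k.+1].
Proof.
move=> vk xk; apply: freeNP => a; rewrite size_map size_iota => sa i ik.
apply: (row_pows vk xk (a := a)) => //; rewrite -[RHS]sa; apply: eq_bigr => j _.
by rewrite (nth_map 0%N) ?size_iota ?nth_iota.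
Qed.

Lemma row_neq0 x : x != 0 -> exists v : 'rV[K]_n.+1, v *m x != 0.
Proof.
move=> x0; apply: contrapT => h; move/eqP: x0; apply; apply/row_matrixP => i.
by rewrite row0 rowE; apply/eqP/negPn/negP => ne; apply: h; exists (delta_mx 0 i).
Qed.

Lemma nilp_max x k : nilp x -> x ^+ k != 0 -> exists l, [/\ (k <= l)%N, x ^+ l != 0 & x ^+ l.+1 = 0].
Proof.
move=> nx xk; have nx' : exists j, x ^+ j == 0 by case: nx => j /eqP; exists j.
case: (ex_minnP nx') => -[|l] /eqP xl lm.
  by move: xk; rewrite -[k]addn0 exprD xl mulr0 eqxx.
exists l; split=> //; last by apply/negP => /lm; rewrite ltnn.
by rewrite leqNgt; apply: contra xk => lk; rewrite -(subnK lk) exprD xl mulr0.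
Qed.

Lemma nilp_pow_le x k : nilp x -> x ^+ k != 0 -> (k <= n)%N.
Proof.
move=> nx /(nilp_max nx)[l [kl xl xl1]]; have [v vl] := row_neq0 xl.
have := row_pows_free vl xl1; rewrite /free size_map size_iota => /eqP e.
have := dimvS (subvf <<[seq v *m x ^+ i | i <- iota 0 l.+1]>>); rewrite e dimvf /dim /= mul1n ltnS.
exact: leq_trans.
Qed.

(** x is a single Jordan block, so v, v x, ..., v x^n is a frame; a matrix that commutes with x and
    kills v kills this frame. *)
Lemma pow_top_dim x : nn V x -> x ^+ n != 0 -> (\dim V <= n.+1)%N.
Proof.
move=> [xV nx] xn; have [v vn] := row_neq0 xn.
have xn1 : x ^+ n.+1 = 0.
  by apply/eqP/negPn/negP => /(nilp_pow_le nx); rewrite ltnn.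
apply: (@cyclic_dim v) => Y YV vY.
have sx : size [seq v *m x ^+ i | i <- iota 0 n.+1] = n.+1 by rewrite size_map size_iota.
apply: (frame_eq0 sx); first exact: row_pows_free.
move=> u /mapP[i _ ->]; rewrite -mulmxA.
have -> : x ^+ i *m Y = Y *m x ^+ i.
  case: VA => V1 VM VC; apply: VC => //; elim: i => [|i IH]; first by rewrite expr0.
  by rewrite exprS VM.
by rewrite mulmxA vY mul0mx.
Qed.

(** An element of the maximal ideal is determined by its block, so the ideal embeds in the p x k
    matrices. *)
Lemma sq0_dim : (forall x, nn V x -> x * x = 0) -> exists p k, [/\ (p + k)%N = n.+1 & (\dim V <= (p * k).+1)%N].
Proof.
move=> sq0; case dV : (\dim V) => [|d]; first by exists n.+1, 0%N; rewrite addn0.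
have [U [W UW]] := null_frame VA VL dV sq0.
have [Pu [Pw [pk fr H]]] := blocks_of_null UW erefl erefl.
exists (size U), (size W); split=> //; rewrite ltnS.
have [xs [sx nx bV]] := nn_basis VA VL dV.
have nspan x : x \in <<xs>>%VS -> nn V x.
  move=> /mem_spanP[c ->]; elim/big_ind: _ => [|? ? ? ?|i _].
  - by split; [rewrite mem0v|exact: nilp0].
  - exact: (nnD VA).
  - by apply: nnZ; apply: nx; rewrite mem_nth.
have fx : free xs by have := basis_free bV; rewrite free_cons => /andP[].
have <- : \dim <<xs>> = d by rewrite -[d]sx; apply/eqP.
pose f (x : 'M[K]_n.+1) : 'M[K]_(size U, size W) := Pu *m x *m pinvmx Pw.
have lf : linear f.
  by move=> a x y; rewrite /f mulmxDr -scalemxAr mulmxDl -scalemxAl.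
pose fl : {linear _ -> _} := HB.pack f (GRing.isLinear.Build _ _ _ _ f lf).
have := @dim_inj_le _ _ _ fl <<xs>>; rewrite dimvf /dim /=; apply=> x /nspan nx' fx0.
have fw : row_free Pw.
  apply/inj_row_free => u uP; have := mulmx_free_eq0 (row_mx 0 u : 'rV_(size U + size W)) fr.
  by rewrite mul_row_col mul0mx uP addr0 eqxx row_mx_eq0 eqxx => /esym/eqP.
have [w0 [B uB]] := H x nx'.
have B0 : B = 0 by move: fx0; rewrite /fl /= /f uB mulmxKp.
have full : row_full (col_mx Pu Pw).
  by rewrite /row_full; move/eqP: fr => ->; apply/eqP.
apply: (row_full_inj full); rewrite mul_col_mx w0 uB B0 mul0mx mulmx0.
exact: col_mx0.
Qed.

(** In size at most 3, either some nilpotent element is a single Jordan block, or all squares of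
    nilpotents vanish and p k <= n for p + k = n + 1. The bound on the size matters: 2 x 2 blocks
    already give dimension 5 in size 4. *)
Lemma local_dim : (n < 3)%N -> (\dim V <= n.+1)%N.
Proof.
move=> n3; have [[x nx xn]|h] := EM (exists2 x, nn V x & x ^+ n != 0); first exact: pow_top_dim xn.
case: (posnP n) => n0.
  by apply: (leq_trans (dimvS (subvf V))); rewrite dimvf /dim /= n0.
have sq0 x : nn V x -> x * x = 0.
  move=> nx; apply/eqP; apply: contrapT => /negP x2; apply: h; exists x => //.
  have [e|e] : n = 1%N \/ n = 2%N by move: n0 n3; lia.
    by rewrite [X in x ^+ X]e; apply: contraNneq x2 => e1; rewrite -[x]expr1 e1 mul0r.
  by rewrite [X in x ^+ X]e.
have [p [k [pk]]] := sq0_dim sq0 => /leq_trans; apply; rewrite ltnS.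
by move: n3 n0 pk; move: (n) => -[|[|[|m]]] // _ _; case: p k => [|[|[|[|p]]]] [|[|[|[|k]]]] //=; lia.
Qed.
End Bounds.

Definition shift_slice (r : nat) (l : slice) : slice := [seq ((e.1.1 + r)%N, (e.1.2 + r)%N, e.2) | e <- l].
Definition dsum (r : nat) (E1 E2 : model) : model := E1 ++ [seq shift_slice r l | l <- E2].

Lemma sum_split (M : nmodType) (F : nat -> M) N a b : (a + b)%N = N ->
  \sum_(i < N) F i = \sum_(i < a) F i + \sum_(i < b) F (a + i)%N.
Proof. by move=> <-; rewrite big_split_ord. Qed.

Section Idem.
Variables (K : numClosedFieldType) (n : nat) (V : {vspace 'M[K]_n.+1}).
Hypothesis VA : comm_subalg V.

Lemma stationary (f : nat -> nat) : (forall k, f k.+1 <= f k)%N -> exists k, f k.+1 = f k.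
Proof.
move=> fd; have H m : forall k, (f k <= m)%N -> exists k, f k.+1 = f k.
  elim: m => [|m IH] k fk; first by exists k; move: (fd k) fk; lia.
  have [e|ne] := eqVneq (f k.+1) (f k); first by exists k.
  by apply: (IH k.+1); move: (fd k) ne fk; lia.
exact: (H _ 0%N (leqnn _)).
Qed.

(** Fitting decomposition inside V. If no X - a is nilpotent, take an eigenvalue a and Y = X - a.
    The ideals Y^k V become stationary, so Y^k = Y^(2k) Z for some k and Z in V, and e = Y^k Z is
    idempotent. It is not 0 as Y is not nilpotent, and not 1 as Y kills an eigenvector. *)
Lemma idem_of_nonlocal : ~ local_alg V -> exists e, [/\ e \in V, e * e = e, e != 0 & e != 1].
Proof.
case: VA => V1 VM VC nL.
have [X XV nX] : exists2 X, X \in V & forall a, ~ nilp (X - a%:A).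
  by apply: contrapT => h; apply: nL => X XV; apply: contrapT => h'; apply: h; exists X => // a na; apply: h'; exists a.
have [a /eigenvalueP[v Xv v0]] := @eigenvalue_closed K n.+1 X isT.
have YV : X - a%:A \in V by rewrite memvB // memvZ.
have vY : v *m (X - a%:A) = 0 by rewrite mulmxBr Xv -scalemxAr mulmx1 subrr.
have nY := nX a; move: (X - a%:A) YV vY nY => Y YV vY nY {X XV nX Xv}.
pose L := linfun (mulmx Y : 'M[K]_n.+1 -> 'M[K]_n.+1).
have LE U : L U = Y * U by rewrite lfunE.
pose W k := iter k (fun U => (L @: U)%VS) V.
have WS k : (W k.+1 <= W k)%VS.
  elim: k => [|k IH] /=; last exact: limgS.
  by apply/subvP => _ /memv_imgP[Z ZV ->]; rewrite LE VM.
have WE k Z : reflect (exists2 U, U \in V & Z = Y ^+ k * U) (Z \in W k).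
  elim: k Z => [|k IH] Z /=.
    by apply: (iffP idP) => [ZV|[U UV ->]]; [exists Z|]; rewrite ?expr0 ?mul1r.
  apply: (iffP memv_imgP) => [[U /IH[U' U'V ->] ->]|[U UV ->]].
    by exists U' => //; rewrite LE exprS mulrA.
  by exists (Y ^+ k * U); [apply/IH; exists U|rewrite LE exprS mulrA].
have [k dk] : exists k, \dim (W k.+2) = \dim (W k.+1).
  by apply: (@stationary (fun k => \dim (W k.+1))) => k; apply: dimvS.
have Wk : W k.+2 = W k.+1 by apply/eqP; rewrite eqEdim WS dk leqnn.
have Wj j : W (k.+1 + j)%N = W k.+1.
  elim: j => [|j IH]; rewrite ?addn0 // addnS.
  by rewrite -[W (k.+1 + j).+1]/(L @: W (k.+1 + j)%N)%VS IH.
have YkV j : Y ^+ j \in V by elim: j => [|j IH]; rewrite ?expr0 // exprS VM.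
have [Z ZV YZ] : exists2 Z, Z \in V & Y ^+ k.+1 = Y ^+ (k.+1 + k.+1) * Z.
  by apply/WE; rewrite Wj; apply/WE; exists 1; rewrite ?mulr1.
have ZY := VC _ _ ZV (YkV k.+1).
exists (Y ^+ k.+1 * Z); split; first exact: VM.
- by rewrite mulrA -[Y ^+ k.+1 * Z * _]mulrA ZY mulrA -exprD -YZ.
- apply/eqP => e0; apply: nY; exists k.+1.
  by rewrite YZ exprD -mulrA e0 mulr0.
apply: contra_neqN v0 => /eqP e1; rewrite -[v]mulmx1 -[1%:M]/(1 : 'M_n.+1) -e1.
by rewrite exprS -mulrA -[Y * _]/(Y *m _) mulmxA vY mul0mx.
Qed.

Lemma idem_factor N (e : 'M[K]_N) r : e *m e = e -> \rank e = r ->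
  exists (A : 'M[K]_(r, N)) (A' : 'M[K]_(N, r)), e = A' *m A /\ A *m A' = 1%:M.
Proof.
move=> ee <-; exists (row_base e), (col_base e); rewrite mulmx_base; split=> //.
have := mulmx_base e; move: (row_base e) (col_base e) (row_base_free e) (col_base_full e) => A A' fA fA' eE.
apply: (row_full_inj fA'); apply: (row_free_inj fA).
by rewrite /= mulmx1 !mulmxA eE -mulmxA eE.
Qed.
End Idem.

Section Split.
Variables (K : numClosedFieldType) (n r s : nat).
Implicit Types (V : {vspace 'M[K]_n.+1}).

(** A and B are the two halves of a change of basis, A' and B' those of its inverse. The sizes are
    successors so that each block lives in a nonzero matrix ring. *)
Definition split V (V1 : {vspace 'M[K]_r.+1}) (V2 : {vspace 'M[K]_s.+1}) := exists (A : 'M[K]_(r.+1, n.+1)) (B : 'M[K]_(s.+1, n.+1)) A' B',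
  [/\ A *m A' = 1%:M, B *m B' = 1%:M, A *m B' = 0, B *m A' = 0 & A' *m A + B' *m B = 1%:M] /\
  [/\ forall X, X \in V -> exists X1 X2, [/\ X1 \in V1, X2 \in V2 & X = A' *m X1 *m A + B' *m X2 *m B],
      forall X1, X1 \in V1 -> A' *m X1 *m A \in V & forall X2, X2 \in V2 -> B' *m X2 *m B \in V].

Lemma split_dims V (V1 : {vspace 'M[K]_r.+1}) (V2 : {vspace 'M[K]_s.+1}) : split V V1 V2 -> (r.+1 + s.+1)%N = n.+1.
Proof.
move=> [A [B [A' [B' [[AA BB AB BA e] _]]]]].
have h1 : col_mx A B *m row_mx A' B' = 1%:M.
  by rewrite mul_col_row AA BB AB BA -scalar_mx_block.
have h2 : row_mx A' B' *m col_mx A B = 1%:M by rewrite mul_row_col.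
by apply/eqP; rewrite eqn_leq (mulmx1_min h1) (mulmx1_min h2).
Qed.

Lemma slice_act_catl (N a : nat) (l : slice) (p1 : seq 'rV[K]_a) (p2 : seq 'rV[K]_N) (A : 'M[K]_(a, N)) R j :
  size p1 = R -> all (fun e : nat * nat * int => (e.1.1 < R)%N && (e.1.2 < R)%N) l ->
  slice_act l ([seq u *m A | u <- p1] ++ p2) j =
    if (j < R)%N then slice_act l p1 j *m A else 0.
Proof.
move=> sp /allP wl; rewrite /slice_act; case: ifP => jR; last first.
  rewrite big_seq_cond big1 // => e /andP[/wl/andP[e1 _] /eqP ej].
  by rewrite ej jR in e1.
rewrite mulmx_suml big_seq_cond [RHS]big_seq_cond; apply: eq_bigr => e /andP[/wl/andP[_ e2] _].
by rewrite nth_cat size_map sp e2 -scalemxAl (nth_map 0) ?sp.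
Qed.

Lemma slice_act_catr (N a : nat) (l : slice) (p2 : seq 'rV[K]_a) (p1 : seq 'rV[K]_N) (A : 'M[K]_(a, N)) R j :
  size p1 = R ->
  slice_act (shift_slice R l) (p1 ++ [seq u *m A | u <- p2]) j =
    if (j < R)%N then 0 else slice_act l p2 (j - R) *m A.
Proof.
move=> sp; rewrite /slice_act big_map /=; case: ltnP => jR.
  by rewrite big1 // => e /eqP ej; move: jR; rewrite -ej; lia.
rewrite mulmx_suml; apply: eq_big => [e|e _].
  by apply/eqP/eqP => h; move: h jR; lia.
rewrite nth_cat sp ltnNge leq_addl /= addnK -scalemxAl; congr (_ *: _).
have [h|h] := ltnP e.1.2 (size p2); first by rewrite (nth_map 0).
by rewrite !nth_default ?size_map ?mul0mx.
Qed.

Lemma split_fits V (V1 : {vspace 'M[K]_r.+1}) (V2 : {vspace 'M[K]_s.+1}) E1 E2 : split V V1 V2 -> fits V1 E1 -> fits V2 E2 ->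
  size E1 = r.+1 -> wf_model r.+1 E1 -> size E2 = s.+1 -> fits V (dsum r.+1 E1 E2).
Proof.
move=> sV [p1 [sp1 fp1 H1]] [p2 [sp2 fp2 H2]] sE1 /allP wE1 sE2.
have rs := split_dims sV; move: sV => [A [B [A' [B' [[AA BB AB BA e] [H _ _]]]]]].
pose p := [seq u *m A | u <- p1] ++ [seq u *m B | u <- p2].
have pl i : (i < r.+1)%N -> p`_i = p1`_i *m A.
  by move=> ir; rewrite nth_cat size_map sp1 ir (nth_map 0) ?sp1.
have pr i : (i < s.+1)%N -> p`_(r.+1 + i) = p2`_i *m B.
  by move=> is'; rewrite nth_cat size_map sp1 ltnNge leq_addr /= addKn (nth_map 0) ?sp2.
exists p; split.
- by rewrite size_cat !size_map sp1 sp2.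
- apply: freeNP => a; have -> : size p = (r.+1 + s.+1)%N by rewrite size_cat !size_map sp1 sp2.
  rewrite (sum_split (fun i => a i *: p`_i) erefl) => sa.
  have eA : \sum_(i < r.+1) a i *: p`_i = (\sum_(i < r.+1) a i *: p1`_i) *m A.
    by rewrite mulmx_suml; apply: eq_bigr => i _; rewrite pl // scalemxAl.
  have eB : \sum_(i < s.+1) a (r.+1 + i)%N *: p`_(r.+1 + i) = (\sum_(i < s.+1) a (r.+1 + i)%N *: p2`_i) *m B.
    by rewrite mulmx_suml; apply: eq_bigr => i _; rewrite pr // scalemxAl.
  rewrite eA eB in sa.
  have a1 : forall i, (i < size p1)%N -> a i = 0.
    apply: (freeN0 fp1); rewrite sp1; have := congr1 (mulmx^~ A') sa.
    by rewrite mul0mx mulmxDl -!mulmxA AA BA mulmx1 mulmx0 addr0.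
  have a2 : forall i, (i < size p2)%N -> a (r.+1 + i)%N = 0.
    apply: (freeN0 (a := fun i => a (r.+1 + i)%N) fp2); rewrite sp2; have := congr1 (mulmx^~ B') sa.
    by rewrite mul0mx mulmxDl -!mulmxA BB AB mulmx1 mulmx0 add0r.
  move=> i ir; have [h|h] := ltnP i r.+1; first by apply: a1; rewrite sp1.
  by rewrite -(subnKC h); apply: a2; rewrite sp2 ltn_subLR.
move=> X /H[X1 [X2 [/H1[c1 e1] /H2[c2 e2] XE]]].
exists (fun i => if (i < r.+1)%N then c1 i else c2 (i - r.+1)%N) => j jn.
rewrite (sum_split (fun i => (if (i < r.+1)%N then c1 i else c2 (i - r.+1)%N) *: slice_act (nth [::] (dsum r.+1 E1 E2) i) p j) rs).
have s1 (i : 'I_r.+1) : (if (i < r.+1)%N then c1 i else c2 (i - r.+1)%N) *: slice_act (nth [::] (dsum r.+1 E1 E2) i) p j =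
    if (j < r.+1)%N then (c1 i *: slice_act (nth [::] E1 i) p1 j) *m A else 0.
  rewrite ltn_ord nth_cat sE1 ltn_ord (slice_act_catl _ _ _ sp1) ?wE1 ?mem_nth ?sE1 //.
  by case: ifP => _; rewrite ?scalemxAl ?scaler0.
have s2 (i : 'I_s.+1) : (if (r.+1 + i < r.+1)%N then c1 (r.+1 + i)%N else c2 (r.+1 + i - r.+1)%N) *:
    slice_act (nth [::] (dsum r.+1 E1 E2) (r.+1 + i)) p j =
    if (j < r.+1)%N then 0 else (c2 i *: slice_act (nth [::] E2 i) p2 (j - r.+1)%N) *m B.
  rewrite ltnNge leq_addr /= addKn nth_cat sE1 ltnNge leq_addr /= addKn (nth_map [::]) ?sE2 //.
  rewrite slice_act_catr ?size_map //.
  by case: ifP => _; rewrite ?scalemxAl ?scaler0.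
rewrite (eq_bigr _ (fun i _ => s1 i)) (eq_bigr _ (fun i _ => s2 i)).
have [jr|jr] := ltnP j r.+1.
  rewrite [X in _ + X]big1 // addr0 -mulmx_suml -e1 // pl // XE mulmxDr !mulmxA.
  rewrite -[p1`_j *m A *m A']mulmxA AA mulmx1 -[p1`_j *m A *m B']mulmxA AB mulmx0.
  by rewrite !mul0mx addr0.
have js : (j - r.+1 < s.+1)%N by rewrite ltn_subLR // rs.
rewrite big1 // add0r -mulmx_suml -e2 // -{1}(subnKC jr) pr // XE mulmxDr !mulmxA.
rewrite -[p2`__ *m B *m A']mulmxA BA mulmx0 -[p2`__ *m B *m B']mulmxA BB mulmx1.
by rewrite !mul0mx add0r.
Qed.

Lemma split_tr V (V1 : {vspace 'M[K]_r.+1}) (V2 : {vspace 'M[K]_s.+1}) : split V V1 V2 -> split (trV V) (trV V1) (trV V2).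
Proof.
move=> [A [B [A' [B' [[AA BB AB BA e] [H HA HB]]]]]].
have eT := congr1 trmx e; rewrite raddfD /= !trmx_mul trmx1 in eT.
exists A'^T, B'^T, A^T, B^T; rewrite eT -!trmx_mul AA BB AB BA !trmx1 !trmx0.
split=> //; split=> [X|X|X]; rewrite !mem_trV.
- move=> /H[X1 [X2 [h1 h2 XE]]]; exists X1^T, X2^T; rewrite !mem_trV !trmxK; split=> //.
  by rewrite -[X]trmxK XE raddfD /= !trmx_mul !mulmxA.
- by rewrite !trmx_mul !trmxK mulmxA; exact: HA.
by rewrite !trmx_mul !trmxK mulmxA; exact: HB.
Qed.

(** e commutes with V, so V is the direct sum of e V and (1 - e) V. The rank factorizations of e and
    1 - e identify these with algebras of matrices of sizes r + 1 and s + 1. *)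
Lemma split_exists V e : comm_subalg V -> e \in V -> e * e = e -> \rank e = r.+1 -> \rank (1 - e)%R = s.+1 ->
  exists (V1 : {vspace 'M[K]_r.+1}) (V2 : {vspace 'M[K]_s.+1}), [/\ split V V1 V2, comm_subalg V1, comm_subalg V2 & (\dim V1 + \dim V2)%N = \dim V].
Proof.
case=> V_1 VM VC eV ee re rf.
have [A [A' [eE AA]]] := idem_factor ee re.
have ff : (1 - e) *m (1 - e) = 1 - e.
  rewrite mulmxBl mulmxBr mulmxBr -[1]/(1%:M : 'M_n.+1) mulmx1 mul1mx mulmx1.
  by have -> : e *m e = e; [exact: ee | rewrite subrr subr0].
have [B [B' [fE BB]]] := idem_factor ff rf.
have sum1 : A' *m A + B' *m B = 1%:M by rewrite -eE -fE addrC subrK.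
have eA : A *m e = A by rewrite eE mulmxA AA mul1mx.
have eA' : e *m A' = A' by rewrite eE -mulmxA AA mulmx1.
have fB : B *m e = 0.
  have : B *m (1 - e) = B by rewrite fE mulmxA BB mul1mx.
  by rewrite mulmxBr mulmx1 => /eqP; rewrite -subr_eq0 addrC addKr oppr_eq0 => /eqP.
have fB' : e *m B' = 0.
  have : (1 - e) *m B' = B' by rewrite fE -mulmxA BB mulmx1.
  by rewrite mulmxBl mul1mx => /eqP; rewrite -subr_eq0 addrC addKr oppr_eq0 => /eqP.
have AB : A *m B' = 0 by rewrite -eA -mulmxA fB' mulmx0.
have BA : B *m A' = 0 by rewrite -eA' mulmxA fB mul0mx.
have fV : 1 - e \in V by rewrite memvB.
have comp k (C : 'M[K]_(k.+1, n.+1)) (C' : 'M[K]_(n.+1, k.+1)) : C *m C' = 1%:M -> C' *m C \in V ->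
  exists W : {vspace 'M[K]_k.+1}, [/\ comm_subalg W, forall X, X \in V -> C *m X *m C' \in W &
    forall Y, Y \in W -> C' *m Y *m C \in V].
  move=> CC CV; pose f (X : 'M[K]_n.+1) : 'M[K]_k.+1 := C *m X *m C'.
  have lf : linear f.
    by move=> a X Y; rewrite /f mulmxDr -scalemxAr mulmxDl -scalemxAl.
  pose fl : {linear _ -> _} := HB.pack f (GRing.isLinear.Build _ _ _ _ f lf).
  have fE' X : linfun fl X = C *m X *m C' by rewrite lfunE.
  have prod X Y : (C *m X *m C') *m (C *m Y *m C') = C *m (X *m (C' *m C) *m Y) *m C'.
    by rewrite !mulmxA.
  exists (linfun fl @: V)%VS; split=> [|X XV|Y].
  - split.
    + by apply/memv_imgP; exists 1 => //; rewrite fE' mulmx1 CC.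
    + move=> _ _ /memv_imgP[X XV ->] /memv_imgP[Y YV ->]; apply/memv_imgP.
      exists (X *m (C' *m C) *m Y); first by apply: (VM _ _ (VM _ _ _ _)).
      by rewrite !fE' -prod.
    move=> _ _ /memv_imgP[X XV ->] /memv_imgP[Y YV ->]; rewrite !fE'.
    rewrite -[_ * _]/(_ *m _) -[RHS]/(_ *m _) !prod; congr (_ *m _ *m _).
    have eY : (C' *m C) *m Y = Y *m (C' *m C) by apply: VC.
    by rewrite -mulmxA eY; apply: VC => //; apply: VM.
  - by apply/memv_imgP; exists X; rewrite ?fE'.
  move=> /memv_imgP[X XV ->]; rewrite fE'.
  have -> : C' *m (C *m X *m C') *m C = (C' *m C) *m X *m (C' *m C) by rewrite !mulmxA.
  by apply: (VM _ _ (VM _ _ _ _)).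
have [V1 [V1A V1i V1o]] := comp _ A A' AA (eq_ind _ (fun Z => Z \in V) eV _ eE).
have [V2 [V2A V2i V2o]] := comp _ B B' BB (eq_ind _ (fun Z => Z \in V) fV _ fE).
have dec X : X \in V -> X = A' *m (A *m X *m A') *m A + B' *m (B *m X *m B') *m B.
  move=> XV; rewrite !mulmxA -[A' *m A]eE -[B' *m B]fE -[_ *m A' *m A]mulmxA -[_ *m B' *m B]mulmxA -eE -fE.
  have -> : e *m X *m e = X *m e.
    have -> : e *m X = X *m e by apply: VC.
    by rewrite -mulmxA; congr (_ *m _); exact: ee.
  have -> : (1 - e) *m X *m (1 - e) = X *m (1 - e).
    have -> : (1 - e) *m X = X *m (1 - e) by apply: VC.
    by rewrite -mulmxA ff.
  by rewrite -mulmxDr addrC subrK mulmx1.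
exists V1, V2; split=> //.
  exists A, B, A', B'; split=> //; split=> // X XV; exists (A *m X *m A'), (B *m X *m B').
  by split; [exact: V1i|exact: V2i|exact: dec].
have lin k (C : 'M[K]_(k.+1, n.+1)) (C' : 'M[K]_(n.+1, k.+1)) (W : {vspace 'M[K]_k.+1}) : C *m C' = 1%:M ->
  exists U : {vspace 'M[K]_n.+1}, \dim U = \dim W /\ forall X : 'M[K]_n.+1, (X \in U) <-> exists2 Y : 'M[K]_k.+1, Y \in W & X = C' *m Y *m C.
  move=> CC; pose f (X : 'M[K]_k.+1) : 'M[K]_n.+1 := C' *m X *m C.
  have lf : linear f.
    by move=> a X Y; rewrite /f mulmxDr -scalemxAr mulmxDl -scalemxAl.
  pose fl : {linear _ -> _} := HB.pack f (GRing.isLinear.Build _ _ _ _ f lf).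
  have fE' X : linfun fl X = C' *m X *m C by rewrite lfunE.
  exists (linfun fl @: W)%VS; split.
    apply: limg_dim_eq; apply/eqP; rewrite -subv0; apply/subvP => X.
    rewrite memv_cap memv_ker fE' memv0 => /andP[_ /eqP h].
    have := congr1 (fun Z => C *m Z *m C') h.
    by rewrite !mulmxA CC mul1mx -mulmxA CC mulmx1 mulmx0 mul0mx => ->.
  move=> X; split=> [/memv_imgP[Y YW ->]|[Y YW ->]]; first by exists Y; rewrite ?fE'.
  by apply/memv_imgP; exists Y; rewrite ?fE'.
have [U1 [<- U1P]] := lin _ A A' V1 AA; have [U2 [<- U2P]] := lin _ B B' V2 BB.
rewrite -dimv_disjoint_sum; last first.
  apply/eqP; rewrite -subv0; apply/subvP => X; rewrite memv_cap memv0 => /andP[/U1P[Y _ e1] /U2P[Z _ e2]].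
  have h1 : A *m X = Y *m A by rewrite e1 !mulmxA AA mul1mx.
  have h2 : A *m X = 0 by rewrite e2 !mulmxA AB !mul0mx.
  by rewrite e1 -mulmxA -h1 h2 mulmx0.
congr (\dim _); apply/eqP; rewrite eqEsubv; apply/andP; split; apply/subvP => X.
  by move=> /memv_addP[_ /U1P[Y YV ->] [_ /U2P[Z ZV ->] ->]]; rewrite memvD ?V1o ?V2o.
move=> XV; rewrite [X in X \in _](dec X XV); apply: memv_add.
  by apply/U1P; exists (A *m X *m A') => //; exact: V1i.
by apply/U2P; exists (B *m X *m B') => //; exact: V2i.
Qed.
End Split.

(** * The full lists of models and their completeness *)

Definition models1 : seq model := [:: mod_pow 1].
Definition models2 : seq model := mod_pow 2 :: [seq dsum 1 E (mod_pow 1) | E <- models1].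
Definition models3 : seq model := loc3 ++ [seq dsum 2 E (mod_pow 1) | E <- models2].
(** If V is not local and no block of size 1 can be split off, both blocks are local, of sizes 2 + 2
    here and 3 + 2 for [models5]. *)
Definition models4 : seq model :=
  loc4 ++ [seq dsum 3 E (mod_pow 1) | E <- models3] ++ [:: dsum 2 (mod_pow 2) (mod_pow 2)].
Definition models5 : seq model :=
  loc5 ++ [seq dsum 4 E (mod_pow 1) | E <- models4] ++ [seq dsum 3 E (mod_pow 2) | E <- loc3].

Definition wf_models m (T : seq model) := all (fun E => (size E == m) && wf_model m E) T.

Lemma wf_loc3 : wf_models 3 loc3. Proof. by []. Qed.
Lemma wf_models1 : wf_models 1 models1. Proof. by []. Qed.
Lemma wf_models2 : wf_models 2 models2. Proof. by []. Qed.
Lemma wf_models3 : wf_models 3 models3. Proof. by []. Qed.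
Lemma wf_models4 : wf_models 4 models4. Proof. by []. Qed.
Lemma wf_models5 : wf_models 5 models5. Proof. by []. Qed.

Section Classify.
Variable K : numClosedFieldType.

Lemma fits_one_sub n (V : {vspace 'M[K]_n.+1}) T T' : {subset T <= T'} -> fits_one V T -> fits_one V T'.
Proof. by move=> sT [E /sT ET f]; exists E. Qed.

Lemma fits_one_split n r s (V : {vspace 'M[K]_n.+1}) (V1 : {vspace 'M[K]_r.+1}) (V2 : {vspace 'M[K]_s.+1}) T E2 :
  split V V1 V2 -> fits_one V1 T -> wf_models r.+1 T -> fits V2 E2 -> fits (trV V2) E2 -> size E2 = s.+1 ->
  fits_one V [seq dsum r.+1 E E2 | E <- T].
Proof.
move=> sV [E ET f] /allP/(_ E ET)/andP[/eqP sE wE] f2 f2' sE2.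
exists (dsum r.+1 E E2); first exact: map_f.
by case: f => f; [left; apply: split_fits sV _ _ _ _ _|right; apply: split_fits (split_tr sV) _ _ _ _ _].
Qed.

Lemma idem_rank n (e : 'M[K]_n.+1) : e * e = e -> (\rank e + \rank (1 - e)%R)%N = n.+1.
Proof.
move=> ee; apply/eqP; rewrite eqn_leq; apply/andP; split.
  by apply: mulmx0_rank_max; rewrite -[_ *m _]/(_ * _) mulrBr mulr1 ee subrr.
rewrite -[X in (X <= _)%N](@mxrank1 K n.+1); have -> : 1%:M = e + (1 - e) :> 'M[K]_n.+1 by rewrite addrC subrK.
exact: mxrank_add.
Qed.

Lemma idem_compl n (e : 'M[K]_n.+1) : e * e = e -> (1 - e) * (1 - e) = 1 - e.
Proof. by move=> ee; rewrite mulrBl mul1r mulrBr mulr1 ee subrr subr0. Qed.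

Definition rank1_idem n (V : {vspace 'M[K]_n.+1}) := exists e, [/\ e \in V, e * e = e & \rank e = 1%N].

Lemma comm_subalg_pos n (V : {vspace 'M[K]_n.+1}) : comm_subalg V -> (0 < \dim V)%N.
Proof.
case=> V1 _ _; rewrite lt0n dimv_eq0; apply: contraTneq V1 => ->.
by rewrite memv0 oner_neq0.
Qed.

Lemma local_size1 (V : {vspace 'M[K]_1}) : local_alg V.
Proof.
move=> X _; exists (X 0 0); exists 1%N; rewrite expr1; apply/matrixP => i j.
by rewrite !ord1 !mxE /= mulr1 subrr.
Qed.

Lemma trV_size1 (V : {vspace 'M[K]_1}) : trV V = V.
Proof.
apply/vspaceP => X; rewrite mem_trV; suff -> : X^T = X by [].
by apply/matrixP => i j; rewrite !mxE !ord1.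
Qed.

(** A block of size 1 has dimension exactly 1, so the complementary block has dimension equal to its
    size and the induction applies to it, whether or not it is local. *)
Lemma class_rank1 n (V : {vspace 'M[K]_n.+2}) T : comm_subalg V -> \dim V = n.+2 -> rank1_idem V ->
  (forall V1 : {vspace 'M[K]_n.+1}, comm_subalg V1 -> \dim V1 = n.+1 -> fits_one V1 T) ->
  wf_models n.+1 T -> fits_one V [seq dsum n.+1 E (mod_pow 1) | E <- T].
Proof.
move=> VA dV [e [eV ee re]] IH wT.
have rf : \rank (1 - e)%R = n.+1 by have := idem_rank ee; rewrite re => -[].
have fV : 1 - e \in V by case: VA => V1 _ _; rewrite memvB.
have re' : \rank (1 - (1 - e))%R = 1%N by rewrite opprB addrC subrK.
have [V1 [V2 [sV V1A V2A dd]]] := split_exists VA fV (idem_compl ee) rf re'.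
have d2 : \dim V2 = 1%N.
  apply/eqP; rewrite eqn_leq comm_subalg_pos // andbT.
  by apply: (leq_trans (dimvS (subvf V2))); rewrite dimvf /dim.
have d1 : \dim V1 = n.+1 by move: dd; rewrite d2 dV addn1 => -[].
have f2 : fits V2 (mod_pow 1) by apply: local1 => //; exact: local_size1.
by apply: (fits_one_split sV (IH _ V1A d1) wT f2) => //; rewrite trV_size1.
Qed.

Lemma split_swap n r s (V : {vspace 'M[K]_n.+1}) (V1 : {vspace 'M[K]_r.+1}) (V2 : {vspace 'M[K]_s.+1}) :
  split V V1 V2 -> split V V2 V1.
Proof.
move=> [A [B [A' [B' [[AA BB AB BA e] [H HA HB]]]]]]; exists B, A, B', A'.
split; first by split=> //; rewrite addrC.
split=> // X /H[X1 [X2 [h1 h2 ->]]]; exists X2, X1; split=> //; exact: addrC.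
Qed.

(** In a block of size at most 3, a nontrivial idempotent or its complement has rank 1, and it keeps
    this rank when embedded in V. *)
Lemma split_local n r s (V : {vspace 'M[K]_n.+1}) (V1 : {vspace 'M[K]_r.+1}) (V2 : {vspace 'M[K]_s.+1}) :
  split V V1 V2 -> comm_subalg V1 -> ~ rank1_idem V -> (r < 3)%N -> local_alg V1.
Proof.
move=> [A [B [A' [B' [[AA BB AB BA _] [_ HA _]]]]]] V1A nV r3; apply: contrapT => nL.
have [e [eV ee e0 e1]] := idem_of_nonlocal V1A nL.
have [f [fV ff f1]] : rank1_idem V1.
  have := idem_rank ee; have r1 : (0 < \rank e)%N by rewrite lt0n mxrank_eq0.
  have r2 : (0 < \rank (1 - e)%R)%N by rewrite lt0n mxrank_eq0 subr_eq0 eq_sym.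
  have [h _|h h'] := eqVneq (\rank e) 1%N; first by exists e.
  exists (1 - e); split; [by case: V1A => ? _ _; rewrite memvB | exact: idem_compl | ].
  by move: h h' r1 r2 r3; move: (\rank e) (\rank (1 - e)%R) => a b; lia.
apply: nV; exists (A' *m f *m A); split; first exact: HA.
  rewrite -[_ * _]/(_ *m _) !mulmxA -[A' *m f *m A *m A']mulmxA AA mulmx1.
  by rewrite -[A' *m f *m f]mulmxA; congr (_ *m _ *m _); exact: ff.
apply/eqP; rewrite eqn_leq -{1}f1; apply/andP; split.
  by apply: (leq_trans (mxrankM_maxl _ _)); exact: mxrankM_maxr.
rewrite -f1; have {1}-> : f = A *m (A' *m f *m A) *m A'.
  by rewrite !mulmxA AA mul1mx -mulmxA AA mulmx1.
by apply: (leq_trans (mxrankM_maxl _ _)); exact: mxrankM_maxr.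
Qed.

(** Without idempotents of rank 1, a nontrivial one cuts a size of at most 5 as 2 + 2 or 3 + 2. Both
    blocks are local, so [local_dim] bounds each dimension by the size; since the dimensions add up
    to [\dim V], the bounds are equalities. *)
Lemma no_rank1_split n (V : {vspace 'M[K]_n.+1}) : comm_subalg V -> \dim V = n.+1 -> (n < 5)%N ->
  ~ rank1_idem V -> ~ local_alg V ->
  exists (k : nat) (V1 : {vspace 'M[K]_k.+2}) (V2 : {vspace 'M[K]_2}),
    [/\ split V V1 V2, comm_subalg V1 /\ comm_subalg V2, local_alg V1 /\ local_alg V2 &
        [/\ n = (k + 3)%N, \dim V1 = k.+2 & \dim V2 = 2%N]].
Proof.
move=> VA dV n5 nV nL; have [e0 [e0V ee0 e00 e01]] := idem_of_nonlocal VA nL.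
have [e [eV ee r1 r2]] : exists e, [/\ e \in V, e * e = e, (1 < \rank e)%N & \rank (1 - e)%R = 2%N].
  have h := idem_rank ee0; have a0 : (0 < \rank e0)%N by rewrite lt0n mxrank_eq0.
  have b0 : (0 < \rank (1 - e0)%R)%N by rewrite lt0n mxrank_eq0 subr_eq0 eq_sym.
  have f0V : 1 - e0 \in V by case: VA => ? _ _; rewrite memvB.
  have a1 : \rank e0 != 1%N by apply/eqP => e1; apply: nV; exists e0.
  have b1 : \rank (1 - e0)%R != 1%N.
    by apply/eqP => e1; apply: nV; exists (1 - e0); split=> //; exact: idem_compl.
  have [c|c] := eqVneq (\rank (1 - e0)%R) 2%N.
    by exists e0; split=> //; move: a0 a1; move: (\rank e0) => a; lia.
  have ff : 1 - (1 - e0) = e0 by rewrite opprB addrC subrK.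
  exists (1 - e0); rewrite ff; split=> //; first exact: idem_compl.
    by move: b0 b1; move: (\rank (1 - e0)%R) => b; lia.
  by move: h a0 b0 a1 b1 c n5; move: (\rank e0) (\rank (1 - e0)%R) => a b; lia.
have h := idem_rank ee; rewrite r2 in h.
have [k rk] : exists k, \rank e = k.+2.
  by exists (\rank e - 2)%N; move: r1; move: (\rank e) => a; lia.
have [V1 [V2 [sV V1A V2A dd]]] := split_exists VA eV ee rk r2.
have nk : n = (k + 3)%N by move: h; rewrite rk; lia.
have V1L : local_alg V1 by apply: (split_local sV) => //; lia.
have V2L : local_alg V2 by apply: (split_local (split_swap sV)).
exists k, V1, V2; split=> //.
have l1 : (\dim V1 <= k.+2)%N by apply: local_dim => //; lia.
have l2 : (\dim V2 <= 2)%N by apply: local_dim.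
have d : (\dim V1 + \dim V2)%N = (k + 4)%N by rewrite dd dV nk; lia.
by split=> //; lia.
Qed.

Lemma size2_fits (V : {vspace 'M[K]_2}) : comm_subalg V -> local_alg V -> \dim V = 2%N ->
  fits V (mod_pow 2) /\ fits (trV V) (mod_pow 2).
Proof.
move=> VA VL dV; split; apply: local2 => //; rewrite ?dim_trV //.
  exact: comm_subalg_trV.
exact: local_trV.
Qed.

Lemma class1 (V : {vspace 'M[K]_1}) : comm_subalg V -> \dim V = 1%N -> fits_one V models1.
Proof. by move=> VA dV; exists (mod_pow 1) => //; left; apply: local1 => //; exact: local_size1. Qed.

Lemma class2 (V : {vspace 'M[K]_2}) : comm_subalg V -> \dim V = 2%N -> fits_one V models2.
Proof.
move=> VA dV; have [r1|r1] := EM (rank1_idem V).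
  apply: fits_one_sub (class_rank1 VA dV r1 class1 wf_models1).
  by move=> E h; rewrite inE h orbT.
have [VL|nL] := EM (local_alg V).
  by exists (mod_pow 2) => //; left; case: (size2_fits VA VL dV).
have [k [? [? [_ _ _ [nk _ _]]]]] := no_rank1_split VA dV isT r1 nL.
by move: nk; rewrite addn3.
Qed.

Lemma class3 (V : {vspace 'M[K]_3}) : comm_subalg V -> \dim V = 3%N -> fits_one V models3.
Proof.
move=> VA dV; have [r1|r1] := EM (rank1_idem V).
  apply: fits_one_sub (class_rank1 VA dV r1 class2 wf_models2).
  by move=> E h; rewrite mem_cat h orbT.
have [VL|nL] := EM (local_alg V).
  by apply: fits_one_sub (local3 VA VL dV erefl) => E h; rewrite mem_cat h.
have [k [? [? [_ _ _ [nk _ _]]]]] := no_rank1_split VA dV isT r1 nL.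
by move: nk; rewrite addn3.
Qed.

Lemma class4 (V : {vspace 'M[K]_4}) : comm_subalg V -> \dim V = 4%N -> fits_one V models4.
Proof.
move=> VA dV; have [r1|r1] := EM (rank1_idem V).
  apply: fits_one_sub (class_rank1 VA dV r1 class3 wf_models3).
  by move=> E h; rewrite !mem_cat h orbT.
have [VL|nL] := EM (local_alg V).
  by apply: fits_one_sub (local4 VA VL dV erefl) => E h; rewrite mem_cat h.
have [k [V1 [V2 [sV [A1 A2] [L1 L2] [nk d1 d2]]]]] := no_rank1_split VA dV isT r1 nL.
have k0 : k = 0%N by move: nk; lia.
move: V1 sV A1 L1 d1; rewrite {}k0 => V1 sV A1 L1 d1.
have [f1 _] := size2_fits A1 L1 d1; have [f2 f2'] := size2_fits A2 L2 d2.
have F1 : fits_one V1 [:: mod_pow 2] by exists (mod_pow 2); rewrite ?inE //; left.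
apply: fits_one_sub (fits_one_split sV F1 _ f2 f2' _) => //.
by move=> E h; rewrite !mem_cat [X in _ || (_ || X)]h !orbT.
Qed.

Lemma class5 (V : {vspace 'M[K]_5}) : comm_subalg V -> \dim V = 5%N -> fits_one V models5.
Proof.
move=> VA dV; have [r1|r1] := EM (rank1_idem V).
  apply: fits_one_sub (class_rank1 VA dV r1 class4 wf_models4).
  by move=> E h; rewrite !mem_cat h orbT.
have [VL|nL] := EM (local_alg V).
  by apply: fits_one_sub (local5 VA VL dV erefl) => E h; rewrite mem_cat h.
have [k [V1 [V2 [sV [A1 A2] [L1 L2] [nk d1 d2]]]]] := no_rank1_split VA dV isT r1 nL.
have k0 : k = 1%N by move: nk; lia.
move: V1 sV A1 L1 d1; rewrite {}k0 => V1 sV A1 L1 d1.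
have [f2 f2'] := size2_fits A2 L2 d2.
apply: fits_one_sub (fits_one_split sV (local3 A1 L1 d1 erefl) wf_loc3 f2 f2' _) => //.
by move=> E h; rewrite !mem_cat h !orbT.
Qed.
End Classify.


From mathcomp Require Import all_fingroup complex.
From mathcomp Require Import all_classical all_reals all_analysis.
From mathcomp Require Import ssrZ.
From Stdlib Require BinInt.

Import Order.TTheory GRing.Theory Num.Theory.
Import numFieldNormedType.Exports.
Local Open Scope classical_set_scope.
Local Open Scope card_scope.
Local Open Scope ring_scope.

(** * Tensors, orbits and limits *)

Section Actions.
Variables (K : numFieldType) (m : nat).
Implicit Types (T : tensor K m) (g h k : 'M[K]_m) (f : 'rV[K]_m) (s t : 'S_3).

Lemma contractA_delta T (i j k : 'I_m) : contractA T (delta_mx 0 i) j k = T (i, j, k).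
Proof.
rewrite mxE (bigD1 i) //= big1 ?addr0 => [|l /negPf li]; first by rewrite mxE !eqxx mul1r.
by rewrite mxE li andbF mul0r.
Qed.

Lemma contractA_inj T T' : (forall f, contractA T f = contractA T' f) -> T = T'.
Proof.
by move=> H; apply/ffunP => -[[i j] k]; rewrite -!contractA_delta H.
Qed.

Lemma contractA_lin T a f f' : contractA T (a *: f + f') = a *: contractA T f + contractA T f'.
Proof.
apply/matrixP => j k; rewrite !mxE mulr_sumr -big_split; apply: eq_bigr => i _ /=.
by rewrite !mxE mulrDl mulrA.
Qed.
HB.instance Definition _ T := GRing.isLinear.Build K _ _ _ (contractA T) (contractA_lin T).


Lemma contractA_sum T f : contractA T f = \sum_i f 0 i *: contractA T (delta_mx 0 i).
Proof. by rewrite {1}[f]row_sum_delta linear_sum; apply: eq_bigr => i _; rewrite linearZ. Qed.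

Lemma contractA_act g h k T f :
  contractA (gl_act g h k T) f = h *m contractA T (f *m g) *m k^T.
Proof.
have sl i : contractA (gl_act g h k T) (delta_mx 0 i) =
    \sum_p g i p *: (h *m contractA T (delta_mx 0 p) *m k^T).
  apply/matrixP => a b; rewrite contractA_delta ffunE /= summxE; apply: eq_bigr => p _.
  rewrite !mxE mulr_sumr exchange_big; apply: eq_bigr => l _ /=.
  rewrite !mxE mulr_suml mulr_sumr; apply: eq_bigr => j _.
  by rewrite contractA_delta; ring.
rewrite contractA_sum; under eq_bigr do rewrite sl scaler_sumr.
rewrite exchange_big [contractA T _]contractA_sum mulmx_sumr mulmx_suml; apply: eq_bigr => p _ /=.
rewrite -scalemxAr -scalemxAl mxE scaler_suml; apply: eq_bigr => i _.
by rewrite scalerA.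
Qed.

Lemma gl_act_comp g h k g' h' k' T :
  gl_act g h k (gl_act g' h' k' T) = gl_act (g *m g') (h *m h') (k *m k') T.
Proof. by apply: contractA_inj => f; rewrite !contractA_act trmx_mul !mulmxA. Qed.

Lemma gl_act1 T : gl_act 1%:M 1%:M 1%:M T = T.
Proof. by apply: contractA_inj => f; rewrite contractA_act trmx1 !mulmx1 mul1mx. Qed.

Lemma perm_factors_comp s t T : perm_factors s (perm_factors t T) = perm_factors (t * s)%g T.
Proof.
apply/ffunP => x; rewrite !ffunE /= ?ffunE !permM /=.
have e (F : 'I_3 -> 'I_m) i : tnth [tuple F 0; F 1; F 2] i = F i.
  by case: i => -[|[|[|i]]] hi //=; congr F; exact/val_inj.
by congr (T (_, _, _)); exact: (e (fun i => tnth [tuple x.1.1; x.1.2; x.2] (s i))).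
Qed.

Lemma perm_factors1 T : perm_factors 1%g T = T.
Proof. by apply/ffunP => -[[i j] k]; rewrite ffunE !perm1. Qed.

Lemma S3_cases s : [\/ [/\ s 0 = 0, s 1 = 1 & s 2 = 2], [/\ s 0 = 0, s 1 = 2 & s 2 = 1]
   | [/\ s 0 = 1, s 1 = 0 & s 2 = 2]] \/
  [\/ [/\ s 0 = 1, s 1 = 2 & s 2 = 0], [/\ s 0 = 2, s 1 = 0 & s 2 = 1]
   | [/\ s 0 = 2, s 1 = 1 & s 2 = 0]].
Proof.
have ord3 (i : 'I_3) : [\/ i = 0, i = 1 | i = 2].
  by case: i => [[|[|[|i]]] hi] //; [constructor 1|constructor 2|constructor 3]; exact/val_inj.
have n01 : s 0 <> s 1 by move/perm_inj. have n02 : s 0 <> s 2 by move/perm_inj.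
have n12 : s 1 <> s 2 by move/perm_inj.
case: (ord3 (s 0)) n01 n02 => ->; case: (ord3 (s 1)) n12 => ->; case: (ord3 (s 2)) => -> // _ _ _.
- by left; constructor 1. - by left; constructor 2. - by left; constructor 3.
- by right; constructor 1. - by right; constructor 2. - by right; constructor 3.
Qed.

Lemma perm_factors_val s T (i j k : 'I_m) : perm_factors s T (i, j, k) =
  T (tnth [tuple i; j; k] (s 0), tnth [tuple i; j; k] (s 1), tnth [tuple i; j; k] (s 2)).
Proof. by rewrite ffunE. Qed.

Lemma perm_gl_act s g h k T : g \in unitmx -> h \in unitmx -> k \in unitmx ->
  exists g' h' k', [/\ g' \in unitmx, h' \in unitmx, k' \in unitmx &
    perm_factors s (gl_act g h k T) = gl_act g' h' k' (perm_factors s T)].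
Proof.
move=> gU hU kU; case: (S3_cases s) => -[] [e0 e1 e2].
- exists g, h, k; split=> //; apply/ffunP => -[[a b] c].
  rewrite perm_factors_val !ffunE e0 e1 e2 /=; do 3 apply: eq_bigr => ? _.
  by rewrite perm_factors_val e0 e1 e2.
- exists g, k, h; split=> //; apply/ffunP => -[[a b] c].
  rewrite perm_factors_val !ffunE e0 e1 e2 /=; apply: eq_bigr => ? _; rewrite exchange_big.
  do 2 apply: eq_bigr => ? _.
  by rewrite perm_factors_val e0 e1 e2 /=; ring.
- exists h, g, k; split=> //; apply/ffunP => -[[a b] c].
  rewrite perm_factors_val !ffunE e0 e1 e2 /= exchange_big.
  do 3 apply: eq_bigr => ? _.
  by rewrite perm_factors_val e0 e1 e2 /=; ring.
- exists k, g, h; split=> //; apply/ffunP => -[[a b] c].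
  rewrite perm_factors_val !ffunE e0 e1 e2 /=.
  under eq_bigr do rewrite exchange_big; rewrite exchange_big /=.
  do 3 apply: eq_bigr => ? _.
  by rewrite perm_factors_val e0 e1 e2 /=; ring.
- exists h, k, g; split=> //; apply/ffunP => -[[a b] c].
  rewrite perm_factors_val !ffunE e0 e1 e2 /=.
  rewrite exchange_big; under eq_bigr do rewrite exchange_big.
  do 3 apply: eq_bigr => ? _.
  by rewrite perm_factors_val e0 e1 e2 /=; ring.
exists k, h, g; split=> //; apply/ffunP => -[[a b] c].
rewrite perm_factors_val !ffunE e0 e1 e2 /=.
rewrite exchange_big; under eq_bigr do rewrite exchange_big; rewrite exchange_big /=.
do 3 apply: eq_bigr => ? _.
by rewrite perm_factors_val e0 e1 e2 /=; ring.
Qed.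

Lemma orbit_refl T : tensor_orbit T T.
Proof. by exists 1%g, 1%:M, 1%:M, 1%:M; rewrite !unitmx1 perm_factors1 gl_act1. Qed.

Lemma orbit_trans T T' T'' : tensor_orbit T T' -> tensor_orbit T' T'' -> tensor_orbit T T''.
Proof.
move=> [s [g [h [k [gU hU kU ->]]]]] [s' [g' [h' [k' [gU' hU' kU' ->]]]]].
have [g1 [h1 [k1 [gU1 hU1 kU1 ->]]]] := perm_gl_act s' (perm_factors s T) gU hU kU.
rewrite perm_factors_comp gl_act_comp; exists (s * s')%g, (g' *m g1), (h' *m h1), (k' *m k1).
by rewrite !unitmx_mul gU' hU' kU' gU1 hU1 kU1.
Qed.

Lemma orbit_sym T T' : tensor_orbit T T' -> tensor_orbit T' T.
Proof.
move=> [s [g [h [k [gU hU kU ->]]]]].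
have [g1 [h1 [k1 [gU1 hU1 kU1 e]]]] := perm_gl_act s^-1%g (perm_factors s T) gU hU kU.
exists s^-1%g, (invmx g1), (invmx h1), (invmx k1); rewrite !unitmx_inv; split=> //.
by rewrite e gl_act_comp !mulVmx // gl_act1 perm_factors_comp mulgV perm_factors1.
Qed.

Lemma orbit_eq T T' : tensor_orbit T T' -> tensor_orbit T = tensor_orbit T'.
Proof.
move=> TT'; apply/seteqP; split=> S; last exact: orbit_trans TT'.
exact: orbit_trans (orbit_sym TT').
Qed.

Lemma orbit_perm s T : tensor_orbit T (perm_factors s T).
Proof. by exists s, 1%:M, 1%:M, 1%:M; rewrite !unitmx1 gl_act1. Qed.

Lemma orbit_gl g h k T : g \in unitmx -> h \in unitmx -> k \in unitmx -> tensor_orbit T (gl_act g h k T).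
Proof. by move=> gU hU kU; exists 1%g, g, h, k; rewrite perm_factors1. Qed.
End Actions.

(** * Limits of matrices *)

Section Limits.
Variable K : numFieldType.

Lemma cvg_bigsum (I : Type) (r : seq I) (P : pred I) (F : I -> nat -> K) (l : I -> K) :
  (forall i, P i -> F i @ \oo --> l i) ->
  (fun n => \sum_(i <- r | P i) F i n) @ \oo --> \sum_(i <- r | P i) l i.
Proof.
move=> H; elim: r => [|i r IH].
  by rewrite big_nil; under eq_fun do rewrite big_nil; exact: cvg_cst.
rewrite big_cons; under eq_fun do rewrite big_cons.
by case: ifP => // Pi; apply: cvgD => //; exact: H.
Qed.

Lemma cvg_bigprod (I : Type) (r : seq I) (F : I -> nat -> K) (l : I -> K) :
  (forall i, F i @ \oo --> l i) ->
  (fun n => \prod_(i <- r) F i n) @ \oo --> \prod_(i <- r) l i.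
Proof.
move=> H; elim: r => [|i r IH].
  by rewrite big_nil; under eq_fun do rewrite big_nil; exact: cvg_cst.
by rewrite big_cons; under eq_fun do rewrite big_cons; apply: cvgM.
Qed.

Definition cvgm p q (M : nat -> 'M[K]_(p, q)) (L : 'M[K]_(p, q)) :=
  forall i j, (fun n => M n i j) @ \oo --> L i j.

Lemma cvgm_cst p q (L : 'M[K]_(p, q)) : cvgm (fun=> L) L.
Proof. by move=> i j; exact: cvg_cst. Qed.

Lemma cvgm_mul p q r (M : nat -> 'M[K]_(p, q)) L (N : nat -> 'M[K]_(q, r)) L' :
  cvgm M L -> cvgm N L' -> cvgm (fun n => M n *m N n) (L *m L').
Proof.
move=> ML NL i j; rewrite mxE; under eq_fun do rewrite mxE.
by apply: cvg_bigsum => k _; apply: cvgM.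
Qed.

Lemma cvgm_det p (M : nat -> 'M[K]_p) L : cvgm M L -> (fun n => \det (M n)) @ \oo --> \det L.
Proof.
move=> ML; rewrite /determinant; apply: cvg_bigsum => s _; apply: cvgM; first exact: cvg_cst.
by apply: cvg_bigprod.
Qed.

Lemma cvgm_adj p (M : nat -> 'M[K]_p) L : cvgm M L -> cvgm (fun n => \adj (M n)) (\adj L).
Proof.
move=> ML i j; rewrite mxE; under eq_fun do rewrite mxE.
apply: cvgM; first exact: cvg_cst.
apply: cvgm_det => a b; rewrite !mxE; under eq_fun do rewrite !mxE; exact: ML.
Qed.

Lemma cvg_near0 (u : nat -> K) l : u @ \oo --> l -> (\forall n \near \oo, u n = 0) -> l = 0.
Proof.
move=> ul u0; apply: (@cvg_unique _ (@norm_hausdorff K K) _ _ _ _ ul).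
by apply: cvg_near_cst.
Qed.

Lemma cvgm_near_eq p q (M N : nat -> 'M[K]_(p, q)) L L' : cvgm M L -> cvgm N L' ->
  (\forall n \near \oo, M n = N n) -> L = L'.
Proof.
move=> ML NL MN; apply/matrixP => i j; apply/eqP; rewrite -subr_eq0; apply/eqP.
apply: (@cvg_near0 (fun n => M n i j - N n i j)); first exact: cvgB.
by near=> n; rewrite (near MN n) // subrr.
Unshelve. all: by end_near. Qed.

(** If L had a right inverse, the determinants of [M n *m pinvmx L] would tend to 1, although they
    vanish as soon as M n has rank less than p. *)
Lemma rank_limit p q k (M : nat -> 'M[K]_(p, q)) L : cvgm M L ->
  (\forall n \near \oo, (\rank (M n) <= k)%N) -> (k < p)%N -> ~~ row_free L.
Proof.
move=> ML rM kp; apply/negP => fL.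
have LQ : L *m pinvmx L = 1%:M by rewrite mulmxVp.
have d := cvgm_det (cvgm_mul ML (@cvgm_cst _ _ (pinvmx L))).
have := cvg_near0 d; rewrite LQ det1 => H.
suff /eqP : (1 : K) = 0 by rewrite oner_eq0.
apply: H; near=> n; apply/eqP/negPn/negP => dn.
have U : M n *m pinvmx L \in unitmx by rewrite unitmxE unitfE.
have := mxrankM_maxl (M n) (pinvmx L); rewrite mxrank_unit //.
have rn : (\rank (M n) <= k)%N by near: n.
by move=> /leq_trans/(_ rn); rewrite leqNgt kp.
Unshelve. all: by end_near. Qed.
End Limits.

(** * Border rank and the equations of Strassen *)

Section Border.
Variables (K : numFieldType) (m : nat).
Implicit Types (T : tensor K m).

Lemma contractA_simple (a b c : 'cV[K]_m) f :
  contractA (simple_tensor a b c) f = (f *m a) 0 0 *: (b *m c^T).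
Proof.
apply/matrixP => j k; rewrite !mxE big_ord1 !mxE mulr_suml; apply: eq_bigr => i _.
by rewrite ffunE /=; ring.
Qed.

Lemma contractA_raddf T T' f : contractA (T + T' : {ffun _ -> K}) f = contractA T f + contractA T' f.
Proof.
by apply/matrixP => j k; rewrite !mxE -big_split; apply: eq_bigr => i _; rewrite ffunE mulrDr.
Qed.

Lemma contractA_sum_simple r (a b c : 'I_r -> 'cV[K]_m) f :
  contractA (\sum_(s < r) (simple_tensor (a s) (b s) (c s) : {ffun _ -> K})) f =
  \sum_(s < r) (f *m a s) 0 0 *: (b s *m (c s)^T).
Proof.
under [RHS]eq_bigr do rewrite -contractA_simple.
elim/big_rec2: _ => [|s X Y _ <-]; last by rewrite contractA_raddf.
by apply/matrixP => j k; rewrite !mxE big1 // => i _; rewrite ffunE mulr0.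
Qed.

Lemma sum_of_simple_le r r' T : (r <= r')%N -> sum_of_simple r T -> sum_of_simple r' T.
Proof.
move=> rr [a [b [c ->]]].
pose ext (x : 'I_r -> 'cV[K]_m) (i : 'I_r') := if insub (val i) is Some j then x j else 0.
exists (ext a), (ext b), (ext c).
apply: contractA_inj => f; rewrite !contractA_sum_simple.
pose G (s : nat) : 'M[K]_m := if insub s is Some j then (f *m a j) 0 0 *: (b j *m (c j)^T) else 0.
transitivity (\sum_(s < r) G s); first by apply: eq_bigr => s _; rewrite /G valK.
rewrite (big_ord_widen r' G) // big_mkcond; apply: eq_bigr => i _; rewrite /ext /G.
by case: insubP => [j -> ij|/negPf->] //=; rewrite mulmx0 mxE scale0r.
Qed.

Lemma tensor_rank_sum r T : (tensor_rank T <= r)%N -> sum_of_simple r T.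
Proof.
rewrite /tensor_rank; case: ex_minnP => k /asboolP Tk _ kr; exact: sum_of_simple_le Tk.
Qed.

Lemma sum_tensor_rank r T : sum_of_simple r T -> (tensor_rank T <= r)%N.
Proof. by move=> Tr; rewrite /tensor_rank; case: ex_minnP => k _; apply; apply/asboolP. Qed.

Definition border_le r T := exists u : nat -> tensor K m,
  (forall n, sum_of_simple r (u n)) /\ (forall x, (fun n => u n x) @ \oo --> T x).

Lemma border_leP r T : border_le r T <-> limit_of_rank_le r T.
Proof.
split=> -[u [ur uT]]; exists u; split=> // n; first exact: sum_tensor_rank.
exact: tensor_rank_sum.
Qed.

Lemma border_rankP r T : border_rank T = r <-> border_le r T /\ forall k, border_le k T -> (r <= k)%N.
Proof.
rewrite /border_rank; case: ex_minnP => k /asboolP Tk km; split=> [<-|[Tr rm]].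
  by split=> [|j Tj]; [exact/border_leP|apply: km; apply/asboolP/border_leP].
apply/eqP; rewrite eqn_leq rm ?andbT; last exact/border_leP.
by apply: km; apply/asboolP/border_leP.
Qed.

Lemma cvgm_contractA (u : nat -> tensor K m) T f : (forall x, (fun n => u n x) @ \oo --> T x) ->
  cvgm (fun n => contractA (u n) f) (contractA T f).
Proof.
move=> uT j k; rewrite mxE; under eq_fun do rewrite mxE.
by apply: cvg_bigsum => i _; apply: cvgM; [exact: cvg_cst|exact: uT].
Qed.

(** The map T_A as a matrix, so that conciseness and membership in its image become conditions on
    ranks, which pass to limits. *)
Definition flat T : 'M[K]_(m, m * m) := \matrix_i mxvec (contractA T (delta_mx 0 i)).

Lemma flat_mul T f : f *m flat T = mxvec (contractA T f).
Proof.
rewrite contractA_sum linear_sum mulmx_sum_row; apply: eq_bigr => i _.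
by rewrite rowK linearZ.
Qed.

Lemma flat_free T : injective (contractA T) -> row_free (flat T).
Proof.
move=> iT; apply/inj_row_free => f; rewrite flat_mul => /(canRL mxvecK); rewrite linear0 => e.
by apply: iT; rewrite e linear0.
Qed.

Lemma flat_simple r (a b c : 'I_r -> 'cV[K]_m) (T := \sum_(s < r) (simple_tensor (a s) (b s) (c s) : {ffun _ -> K})) :
  flat T = (\matrix_(i, s) a s i 0) *m (\matrix_s mxvec (b s *m (c s)^T)).
Proof.
apply/row_matrixP => i; rewrite rowK row_mul mulmx_sum_row contractA_sum_simple linear_sum.
apply: eq_bigr => s _; rewrite linearZ rowK /=; congr (_ *: _).
by rewrite -rowE !mxE.
Qed.

Lemma border_le_concise r T : injective (contractA T) -> border_le r T -> (m <= r)%N.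
Proof.
move=> iT [u [ur uT]]; rewrite leqNgt; apply/negP => rm.
have cf : cvgm (fun n => flat (u n)) (flat T).
  move=> i j; case/mxvec_indexP: j => j k; rewrite mxE mxvecE; under eq_fun do rewrite mxE mxvecE.
  exact: cvgm_contractA.
suff : ~~ row_free (flat T) by rewrite flat_free.
apply: (rank_limit cf _ rm); apply: nearW => n; have [a [b [c ->]]] := ur n.
by rewrite flat_simple; apply: (leq_trans (mxrankM_maxl _ _)); exact: rank_leq_col.
Qed.

(** The slices of a sum of m simple tensors are B D_f C with D_f diagonal. Hence X_f X_g^-1 X_h is B
    D_f D_g^-1 D_h C, symmetric in f and h and still in the span of the m matrices b_s c_s^T. The
    adjugate replaces the inverse because it is polynomial, hence continuous everywhere. *)
Lemma strassen (a b c : 'I_m -> 'cV[K]_m) (T := \sum_(s < m) (simple_tensor (a s) (b s) (c s) : {ffun _ -> K})) f g h :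
  contractA T g \in unitmx ->
  let P := contractA T f *m \adj (contractA T g) *m contractA T h in
  P = contractA T h *m \adj (contractA T g) *m contractA T f /\
  (\rank (col_mx (flat T) (mxvec P)) <= m)%N.
Proof.
move=> gU; pose B : 'M[K]_m := \matrix_(j, s) b s j 0; pose C : 'M[K]_m := \matrix_(s, j) c s j 0.
have [v vE] : exists v : 'rV[K]_m -> 'I_m -> K, forall f s, (f *m a s) 0 0 = v f s by eexists.
pose D (f : 'rV[K]_m) := diag_mx (\row_s v f s).
have XE f' : contractA T f' = B *m D f' *m C.
  rewrite contractA_sum_simple; apply/matrixP => j k; rewrite summxE mul_mx_diag !mxE.
  by apply: eq_bigr => s _; rewrite vE !mxE big_ord1 !mxE; ring.
have [BU [DU CU]] : B \in unitmx /\ D g \in unitmx /\ C \in unitmx.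
  by move: gU; rewrite XE !unitmx_mul => /andP[/andP[]].
have adjE : \adj (contractA T g) = \det (contractA T g) *: (invmx C *m invmx (D g) *m invmx B).
  have -> : invmx C *m invmx (D g) *m invmx B = invmx (contractA T g).
    apply: (can_inj (mulmxK gU)); rewrite mulVmx // XE.
    by rewrite -!mulmxA mulKmx // mulKmx // mulVmx.
  by rewrite /invmx gU scalerA mulfV ?scale1r // -unitfE -unitmxE.
have [d dE] : exists d, invmx (D g) = diag_mx d.
  exists (\row_s (v g s)^-1).
  apply: (can_inj (mulmxK DU)); rewrite mulVmx // mulmx_diag; apply/matrixP => i j; rewrite !mxE.
  have [->|//] := eqVneq i j; rewrite mulVf //.
  move: DU; rewrite unitmxE det_diag unitfE => /prodf_neq0/(_ j isT).
  by rewrite mxE.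
have PE f' h' : contractA T f' *m \adj (contractA T g) *m contractA T h' =
    \det (contractA T g) *: (B *m (D f' *m diag_mx d *m D h') *m C).
  rewrite adjE -scalemxAr -scalemxAl; congr (_ *: _); rewrite (XE f') (XE h') dE !mulmxA.
  by rewrite (mulmxK CU) (mulmxKV BU).
split.
  rewrite /= !PE; congr (_ *: (_ *m _ *m _)); rewrite !mulmx_diag; congr diag_mx.
  by apply/rowP => i; rewrite !mxE mulrAC [RHS]mulrAC; congr (_ * _); rewrite mulrC.
pose W : 'M[K]_(m, m * m) := \matrix_s mxvec (b s *m (c s)^T).
have [z zE] : exists z : 'rV[K]_m, mxvec (contractA T f *m \adj (contractA T g) *m contractA T h) = z *m W.
  exists (\row_s (\det (contractA T g) * (v f s * d 0 s * v h s))).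
  rewrite PE !mulmx_diag mul_mx_diag mulmx_sum_row; rewrite -[RHS]vec_mxK; congr mxvec; rewrite linear_sum /=.
  apply/matrixP => j k; rewrite !mxE summxE mulr_sumr; apply: eq_bigr => s _.
  rewrite rowK linearZ /= mxvecK !mxE big_ord1 !mxE.
  by ring.
rewrite /= zE flat_simple -mul_col_mx; apply: (leq_trans (mxrankM_maxr _ _)).
exact: rank_leq_row.
Qed.

Lemma strassen_limit T g : border_le m T -> contractA T g \in unitmx ->
  forall f h, let P := contractA T f *m \adj (contractA T g) *m contractA T h in
  P = contractA T h *m \adj (contractA T g) *m contractA T f /\
  ~~ row_free (col_mx (flat T) (mxvec P)).
Proof.
move=> [u [ur uT]] gU f h.
have cX f' := @cvgm_contractA u T f' uT; have cA := cvgm_adj (cX g).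
have dn : \forall n \near \oo, contractA (u n) g \in unitmx.
  have d0 : \det (contractA T g) != 0 by rewrite -unitfE -unitmxE.
  have := cvgr_neq0 _ (cvgm_det (cX g)) d0.
  by move=> dn; near=> n; rewrite unitmxE unitfE; near: n; exact: dn.
have cP f' h' := cvgm_mul (cvgm_mul (cX f') cA) (cX h').
have S n f' h' : contractA (u n) g \in unitmx -> let P := contractA (u n) f' *m \adj (contractA (u n) g) *m contractA (u n) h' in
  P = contractA (u n) h' *m \adj (contractA (u n) g) *m contractA (u n) f' /\
  (\rank (col_mx (flat (u n)) (mxvec P)) <= m)%N.
  by have [a [b [c ->]]] := ur n; exact: strassen.
split; first by apply: (cvgm_near_eq (cP f h) (cP h f)); near=> n; have [] := S n f h (near dn n _).
apply: (@rank_limit _ _ _ m (fun n => col_mx (flat (u n)) (mxvec (contractA (u n) f *m \adj (contractA (u n) g) *m contractA (u n) h)))).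
- move=> i j; case/mxvec_indexP: j => j k; case: (split_ordP i) => l ->.
    rewrite col_mxEu mxE mxvecE; under eq_fun do rewrite col_mxEu mxE mxvecE.
    exact: cX.
  rewrite col_mxEd ord1 mxvecE; under eq_fun do rewrite col_mxEd mxvecE.
  exact: cP.
- by near=> n; have [] := S n f h (near dn n _).
by rewrite addn1.
Unshelve. all: by end_near. Qed.
End Border.

Section PermBorder.
Variables (K : numFieldType) (m : nat).
Implicit Types (T : tensor K m).

Definition swapAB : {perm 'I_3} := tperm (0 : 'I_3) (1 : 'I_3).
Definition swapBC : {perm 'I_3} := tperm (1 : 'I_3) (2 : 'I_3).
Definition cycleABC : {perm 'I_3} := (tperm (0%R : 'I_3) 1%R * tperm (0%R : 'I_3) 2%R)%g.

Lemma swapABE T (i j k : 'I_m) : perm_factors swapAB T (i, j, k) = T (j, i, k).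
Proof.
have e2 : swapAB 2 = 2 by rewrite tpermD.
by rewrite perm_factors_val e2 /swapAB tpermL tpermR.
Qed.

Lemma swapBCE T (i j k : 'I_m) : perm_factors swapBC T (i, j, k) = T (i, k, j).
Proof.
have e0 : swapBC 0 = 0 by rewrite tpermD.
have e1 : swapBC 1 = 2 by exact: tpermL.
have e2 : swapBC 2 = 1 by exact: tpermR.
by rewrite perm_factors_val e0 e1 e2.
Qed.

Lemma cycleABCE T (i j k : 'I_m) : perm_factors cycleABC T (i, j, k) = T (j, k, i).
Proof.
have e0 : cycleABC 0 = 1 by exact: etrans (permM _ _ _) (etrans (congr1 _ (tpermL _ _)) (tpermD _ _)).
have e1 : cycleABC 1 = 2 by exact: etrans (permM _ _ _) (etrans (congr1 _ (tpermR _ _)) (tpermL _ _)).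
have e2 : cycleABC 2 = 0 by exact: etrans (permM _ _ _) (etrans (congr1 _ (tpermD _ _)) (tpermR _ _)).
by rewrite perm_factors_val e0 e1 e2.
Qed.

Lemma contractA_swapAB T f : contractA (perm_factors swapAB T) f = contractB T f.
Proof. by apply/matrixP => j k; rewrite !mxE; apply: eq_bigr => i _; rewrite swapABE. Qed.

Lemma contractA_swapBC T f : contractA (perm_factors swapBC T) f = (contractA T f)^T.
Proof. by apply/matrixP => j k; rewrite !mxE; apply: eq_bigr => i _; rewrite swapBCE. Qed.

Lemma contractA_cycle T f : contractA (perm_factors cycleABC T) f = contractC T f.
Proof. by apply/matrixP => j k; rewrite !mxE; apply: eq_bigr => i _; rewrite cycleABCE. Qed.

Lemma border_perm s r T : (forall T', sum_of_simple r T' -> sum_of_simple r (perm_factors s T')) ->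
  border_le r T -> border_le r (perm_factors s T).
Proof.
move=> H [u [ur uT]]; exists (fun n => perm_factors s (u n)); split=> [n|x]; first exact: H.
by rewrite ffunE; under eq_fun do rewrite ffunE; exact: uT.
Qed.

Lemma border_swapAB r T : border_le r T -> border_le r (perm_factors swapAB T).
Proof.
apply: border_perm => T' [a [b [c ->]]]; exists b, a, c; apply/ffunP => -[[i j] k].
rewrite swapABE !sum_ffunE; apply: eq_bigr => s _.
by rewrite !ffunE /= [a _ _ _ * _]mulrC.
Qed.

Lemma border_cycle r T : border_le r T -> border_le r (perm_factors cycleABC T).
Proof.
apply: border_perm => T' [a [b [c ->]]]; exists c, a, b; apply/ffunP => -[[i j] k].
rewrite cycleABCE !sum_ffunE; apply: eq_bigr => s _.
by rewrite !ffunE /=; ring.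
Qed.
End PermBorder.

(** * From tensors to matrix algebras *)

Section Bridge.
Variables (K : numClosedFieldType) (n : nat).
Implicit Types (T : tensor K n.+1) (E : model) (V : {vspace 'M[K]_n.+1}).

Definition tens E : tensor K n.+1 := [ffun x : 'I_n.+1 * 'I_n.+1 * 'I_n.+1 => slice_mx K n (nth [::] E x.1.1) x.1.2 x.2].

Lemma contractA_tens E f :
  contractA (tens E) f = \sum_(i < n.+1) f 0 i *: slice_mx K n (nth [::] E i).
Proof.
by apply/matrixP => j k; rewrite mxE summxE; apply: eq_bigr => i _; rewrite ffunE !mxE.
Qed.

(** [fits] only puts P V P^-1 inside the span of the slices of E. By injectivity of T_A this space
    has dimension n + 1, so the span is equal to it and the slices are independent; writing them as
    images of linear forms gives the change of basis G on the first factor. *)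
Lemma fits_gl_act T E V L R : injective (contractA T) -> L \in unitmx -> R \in unitmx ->
  (forall X, X \in V <-> exists f, X = L *m contractA T f *m R) ->
  size E = n.+1 -> wf_model n.+1 E -> fits V E ->
  exists g h k, [/\ g \in unitmx, h \in unitmx, k \in unitmx & gl_act g h k T = tens E].
Proof.
move=> iT LU RU VP sE wE /(fitsP _ sE wE)[P PU H].
pose phi (f : 'rV[K]_n.+1) := P *m (L *m contractA T f *m R) *m invmx P.
have lphi : linear phi.
  move=> a f f'; rewrite /phi contractA_lin mulmxDr mulmxDl mulmxDr mulmxDl.
  by rewrite -scalemxAr -scalemxAl -scalemxAr -scalemxAl.
pose phil : {linear _ -> _} := HB.pack phi (GRing.isLinear.Build _ _ _ _ phi lphi).
pose S (i : 'I_n.+1) : 'M[K]_n.+1 := slice_mx K n (nth [::] E i).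
pose Ss := [seq S i | i <- enum 'I_n.+1].
have sS : size Ss = n.+1 by rewrite size_map size_enum_ord.
pose W := (linfun phil @: fullv)%VS.
have dW : \dim W = n.+1.
  rewrite limg_dim_eq; first by rewrite dimvf /dim /= mul1n.
  apply/eqP; rewrite -subv0; apply/subvP => f; rewrite memv_cap memv_ker lfunE /= memv0 => /andP[_ /eqP e].
  apply/eqP/iT; rewrite linear0; move: e; rewrite /phi => e.
  have PU' : invmx P \in unitmx by rewrite unitmx_inv.
  apply: (can_inj (mulKmx LU)); apply: (can_inj (mulmxK RU)).
  apply: (can_inj (mulKmx PU)); apply: (can_inj (mulmxK PU')).
  by rewrite e !(mulmx0, mul0mx).
have WS : (W <= <<Ss>>)%VS.
  apply/subvP => _ /memv_imgP[f _ ->]; rewrite lfunE /= /phi.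
  have [c ->] : exists c : nat -> K, P *m (L *m contractA T f *m R) = (\sum_(i < n.+1) c i *: S i) *m P.
    by apply: H; apply/VP; exists f.
  rewrite mulmxK //; apply: memv_suml => i _; rewrite memvZ // memv_span //.
  by apply: map_f; rewrite mem_enum.
have dS : \dim <<Ss>> = n.+1.
  apply/eqP; rewrite eqn_leq; apply/andP; split.
    by apply: (leq_trans (dim_span _)); rewrite sS leqnn.
  by apply: leq_trans (dimvS WS); rewrite dW leqnn.
have fS : free Ss by rewrite /free dS sS.
have WE : W = <<Ss>>%VS by apply/eqP; rewrite eqEdim WS dW dS leqnn.
have ex i : exists f, phi f = S i.
  have : S i \in W by rewrite WE memv_span // map_f // mem_enum.
  by move=> /memv_imgP[f _ ->]; exists f; rewrite lfunE.
have [F FE] := fin_all_exists ex.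
pose G : 'M[K]_n.+1 := \matrix_i F i.
have phiG f : phi (f *m G) = contractA (tens E) f.
  rewrite contractA_tens mulmx_sum_row -[phi _]/(phil _) linear_sum; apply: eq_bigr => i _.
  by rewrite linearZ rowK /= FE.
have GU : G \in unitmx.
  rewrite -row_free_unit; apply/inj_row_free => f fG.
  have := phiG f; rewrite fG -[phi _]/(phil _) linear0 contractA_tens => /esym e.
  apply/rowP => j; rewrite mxE.
  pose a i : K := if insub i is Some k then f 0 k else 0.
  have := freeN0 (a := a) fS; rewrite sS => /(_ _ j (ltn_ord j)).
  rewrite /a valK; apply; rewrite -[RHS]e; apply: eq_bigr => i _.
  by rewrite valK (nth_map i) ?size_enum_ord // nth_ord_enum.
exists G, (P *m L), (R *m invmx P)^T; split=> //.
- by rewrite unitmx_mul PU.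
- by rewrite unitmx_tr unitmx_mul RU unitmx_inv.
by apply: contractA_inj => f; rewrite contractA_act trmxK -phiG /phi !mulmxA.
Qed.

Lemma oneA_orbit T (Ts : seq model) : injective (contractA T) -> border_le n.+1 T -> oneA_generic T ->
  (forall V, comm_subalg V -> \dim V = n.+1 -> fits_one V Ts) -> wf_models n.+1 Ts ->
  exists2 E, E \in Ts & tensor_orbit T (tens E).
Proof.
move=> iT bT [g /eqP gr] cls /allP wT.
have YU : contractA T g \in unitmx by rewrite -row_free_unit.
have str := strassen_limit bT YU; set Y := contractA T g in gr YU str.
have YU' : invmx Y \in unitmx by rewrite unitmx_inv.
have adjY : \adj Y = \det Y *: invmx Y.
  by rewrite /invmx YU scalerA mulfV ?scale1r // -unitfE -unitmxE.
have dY : \det Y != 0 by rewrite -unitfE -unitmxE.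
have comm f h : contractA T f *m invmx Y *m contractA T h = contractA T h *m invmx Y *m contractA T f.
  have [e _] := str f h; move: e; rewrite adjY -!scalemxAr -!scalemxAl => /(scalerI dY).
  exact.
(* The rows of [flat T] are independent, so a relation between them and the row of the product must
   involve that row, which is therefore a slice of T. *)
have clos f h : exists f', contractA T f *m invmx Y *m contractA T h = contractA T f'.
  apply: contrapT => nex; have [_] := str f h; rewrite adjY -scalemxAr -scalemxAl; apply/negP/negPn.
  apply/inj_row_free => u; rewrite -[u]hsubmxK; move: (lsubmx u) (rsubmx u) => v c.
  rewrite mul_row_col [c]mx11_scalar mul_scalar_mx flat_mul -linearZ -linearD => /(canRL mxvecK).
  rewrite linear0 scalerA => e; have [c0|c0] := eqVneq (c 0 0) 0.
    rewrite c0 mul0r scale0r addr0 in e; have -> : v = 0 by apply: iT; rewrite e linear0.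
    by rewrite c0 raddf0 row_mx0.
  exfalso; apply: nex; exists (- (c 0 0 * \det Y)^-1 *: v).
  have cd : c 0 0 * \det Y != 0 by rewrite mulf_neq0.
  apply: (scalerI cd); move/eqP: e; rewrite addrC addr_eq0 => /eqP->.
  by rewrite linearZ /= scalerA mulrN mulfV // scaleN1r.
pose psi (f : 'rV[K]_n.+1) := contractA T f *m invmx Y.
have lpsi : linear psi by move=> a f f'; rewrite /psi contractA_lin mulmxDl scalemxAl.
pose psil : {linear _ -> _} := HB.pack psi (GRing.isLinear.Build _ _ _ _ psi lpsi).
pose V := (linfun psil @: fullv)%VS.
have VP X : X \in V <-> exists f, X = contractA T f *m invmx Y.
  split=> [/memv_imgP[f _ ->]|[f ->]]; first by exists f; rewrite lfunE.
  by apply/memv_imgP; exists f; rewrite ?memvf ?lfunE.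
have VA : comm_subalg V.
  split.
  - by apply/VP; exists g; rewrite mulmxV.
  - move=> _ _ /VP[f ->] /VP[h ->]; apply/VP; have [f' e] := clos f h; exists f'.
    by rewrite -[_ * _]/(_ *m _) mulmxA e.
  move=> _ _ /VP[f ->] /VP[h ->]; rewrite -[_ * _]/(_ *m _) -[RHS]/(_ *m _) !mulmxA.
  by rewrite comm.
have dV : \dim V = n.+1.
  rewrite limg_dim_eq; first by rewrite dimvf /dim /= mul1n.
  apply/eqP; rewrite -subv0; apply/subvP => f; rewrite memv_cap memv_ker lfunE /= memv0 => /andP[_ /eqP e].
  apply/eqP/iT; rewrite linear0; apply: (can_inj (mulmxK YU')).
  by rewrite mul0mx.
have [E ET [f|f]] := cls V VA dV; exists E => //; have /andP[/eqP sE wE] := wT E ET.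
  have [|g' [h' [k' [gU hU kU <-]]]] := fits_gl_act iT (unitmx1 _ _) YU' _ sE wE f.
    by move=> X; split=> [/VP[f' ->]|[f' ->]]; [exists f'|apply/VP; exists f']; rewrite mul1mx.
  exact: orbit_gl.
(* The transpose of V is built in the same way from the transposed slices, which are those of T with
   the factors B and C exchanged. *)
have iT' : injective (contractA (perm_factors swapBC T)).
  by move=> f1 f2; rewrite !contractA_swapBC => /trmx_inj/iT.
have YT : (invmx Y)^T \in unitmx by rewrite unitmx_tr.
have [|g' [h' [k' [gU hU kU <-]]]] := fits_gl_act iT' YT (unitmx1 _ _) _ sE wE f.
  move=> X; rewrite mem_trV; split=> [/VP[f' e]|[f' ->]].
    by exists f'; rewrite contractA_swapBC mulmx1 -trmx_mul -e trmxK.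
  by apply/VP; exists f'; rewrite contractA_swapBC mulmx1 trmx_mul !trmxK.
exact: orbit_trans (orbit_perm swapBC T) (orbit_gl _ gU hU kU).
Qed.

Lemma minimal_border_orbit T (Ts : seq model) : minimal_border_rank T -> one_star_generic T ->
  (forall V, comm_subalg V -> \dim V = n.+1 -> fits_one V Ts) -> wf_models n.+1 Ts ->
  exists2 E, E \in Ts & tensor_orbit T (tens E).
Proof.
move=> [[iA iB iC] /border_rankP[bT _]] gen cls wT.
case: gen => gen; first exact: oneA_orbit gen cls wT.
  have [||E ET o] := @oneA_orbit (perm_factors swapAB T) Ts _ (border_swapAB bT) _ cls wT.
  - by move=> f f'; rewrite !contractA_swapAB => /iB.
  - by case: gen => f fr; exists f; rewrite contractA_swapAB.
  by exists E => //; exact: orbit_trans (orbit_perm _ _) o.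
have [||E ET o] := @oneA_orbit (perm_factors cycleABC T) Ts _ (border_cycle bT) _ cls wT.
- by move=> f f'; rewrite !contractA_cycle => /iC.
- by case: gen => f fr; exists f; rewrite contractA_cycle.
by exists E => //; exact: orbit_trans (orbit_perm _ _) o.
Qed.
End Bridge.

(** * Degenerations to the models *)

(** The checks below are run by computation, for which binary integers are used in place of
    [int]. *)
Notation Z := BinNums.Z.
Definition zpoly := seq Z.
Definition slice_coef (l : slice) (j k : nat) : Z :=
  foldr (fun e r => if (e.1.1 == j) && (e.1.2 == k) then BinInt.Z.add (Z_of_int e.2) r else r) BinNums.Z0 l.

Fixpoint zadd (p q : zpoly) : zpoly := match p, q with
  | [::], _ => q | _, [::] => p
  | a :: p', b :: q' => BinInt.Z.add a b :: zadd p' q' end.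
Fixpoint zmul (p q : zpoly) : zpoly := match p with
  | [::] => [::]
  | a :: p' => zadd [seq BinInt.Z.mul a b | b <- q] (BinNums.Z0 :: zmul p' q) end.

(* (k, c, s) encodes a family of sums of simple tensors, whose vectors have polynomial entries in t
   (coefficients listed from degree 0), with value c t^k T + O(t^(k+1)). *)
Definition border_dec := (nat * int * seq (seq (seq int) * seq (seq int) * seq (seq int)))%type.

Section Eval.
Variable K : numClosedFieldType.

Definition zK (z : Z) : K := (int_of_Z z)%:~R.
Lemma zKD a b : zK (BinInt.Z.add a b) = zK a + zK b.
Proof. by rewrite /zK -rmorphD -rmorphD. Qed.
Lemma zKM a b : zK (BinInt.Z.mul a b) = zK a * zK b.
Proof. by rewrite /zK -rmorphM -rmorphM. Qed.
Lemma zK0 : zK BinNums.Z0 = 0. Proof. by []. Qed.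
Lemma zK_int (i : int) : zK (Z_of_int i) = i%:~R.
Proof. by rewrite /zK Z_of_intK. Qed.
Lemma zK_eq0 z : (zK z == 0) = (z == BinNums.Z0).
Proof.
rewrite /zK intr_eq0; apply/eqP/eqP => [e|-> //].
by rewrite -[z]int_of_ZK e.
Qed.

Lemma slice_mx_coef n (l : slice) (j k : 'I_n.+1) : slice_mx K n l j k = zK (slice_coef l j k).
Proof.
rewrite mxE; elim: l => [|e l IH] /=; first by rewrite big_nil.
by rewrite big_cons IH; case: ifP => // _; rewrite zKD zK_int.
Qed.

Fixpoint peval (p : zpoly) (t : K) : K := if p is a :: p' then zK a + t * peval p' t else 0.

Lemma peval_add p q t : peval (zadd p q) t = peval p t + peval q t.
Proof.
elim: p q => [|a p IH] [|b q] /=; rewrite ?add0r ?addr0 // IH zKD mulrDr.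
by rewrite addrACA.
Qed.

Lemma peval_scale a q t : peval [seq BinInt.Z.mul a b | b <- q] t = zK a * peval q t.
Proof. by elim: q => [|b q IH] /=; rewrite ?mulr0 // IH zKM mulrDr mulrCA. Qed.

Lemma peval_mul p q t : peval (zmul p q) t = peval p t * peval q t.
Proof.
elim: p => [|a p IH] /=; first by rewrite mul0r.
by rewrite peval_add peval_scale /= IH zK0 add0r mulrDl mulrA.
Qed.

Lemma peval_drop k p t : all (pred1 BinNums.Z0) (take k p) -> peval p t = t ^+ k * peval (drop k p) t.
Proof.
elim: k p => [|k IH] [|a p] /=; rewrite ?expr0 ?mul1r ?mulr0 // => /andP[/eqP-> /IH->].
by rewrite zK0 add0r exprS mulrA.
Qed.

Lemma peval_nth k p t : peval (drop k p) t = zK (nth BinNums.Z0 p k) + t * peval (drop k.+1 p) t.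
Proof.
have [kp|kp] := ltnP k (size p); first by rewrite (drop_nth BinNums.Z0 kp).
by rewrite !drop_oversize ?nth_default ?(leq_trans kp) //= mulr0 addr0.
Qed.

Lemma cvg_peval p (t : nat -> K) : t @ \oo --> 0 -> exists l : K, (fun n => peval p (t n)) @ \oo --> l.
Proof.
move=> t0; elim: p => [|a p [l IH]] /=; first by exists 0; exact: cvg_cst.
by exists (zK a + 0 * l); apply: cvgD; [exact: cvg_cst|exact: cvgM].
Qed.

Definition zvec (v : seq (seq int)) : seq zpoly := [seq [seq Z_of_int x | x <- p] | p <- v].

Definition dec_entry (D : seq (seq zpoly * seq zpoly * seq zpoly)) (i j l : nat) : zpoly :=
  foldr (fun d r => zadd (zmul (zmul (nth [::] d.1.1 i) (nth [::] d.1.2 j)) (nth [::] d.2 l)) r) [::] D.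

Definition check_dec (m : nat) (E : model) (d : border_dec) : bool :=
  let D := [seq (zvec x.1.1, zvec x.1.2, zvec x.2) | x <- d.2] in
  let c := Z_of_int d.1.2 in
  [&& size D == m, c != BinNums.Z0 &
   all (fun i => all (fun j => all (fun l =>
     let q := dec_entry D i j l in
     all (pred1 BinNums.Z0) (take d.1.1 q) &&
     (nth BinNums.Z0 q d.1.1 == BinInt.Z.mul c (slice_coef (nth [::] E i) j l)))
   (iota 0 m)) (iota 0 m)) (iota 0 m)].

Lemma border_le_dec n (E : model) (d : border_dec) (t : nat -> K) : (forall k, t k != 0) ->
  t @ \oo --> 0 -> check_dec n.+1 E d -> border_le n.+1 (tens K n E).
Proof.
move=> tn t0; rewrite /check_dec; cbv zeta; set e := d.1.1; set c := d.1.2; set D := [seq _ | x <- d.2].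
case/and3P=> /eqP sD c0 chk; have {}c0 : zK (Z_of_int c) != 0 by rewrite zK_eq0.
have entry i j l : (i < n.+1)%N -> (j < n.+1)%N -> (l < n.+1)%N ->
    all (pred1 BinNums.Z0) (take e (dec_entry D i j l)) /\
    nth BinNums.Z0 (dec_entry D i j l) e = BinInt.Z.mul (Z_of_int c) (slice_coef (nth [::] E i) j l).
  move=> i_n jn ln; have mi k : (k < n.+1)%N -> k \in iota 0 n.+1 by rewrite mem_iota.
  by have /andP[? /eqP ?] := allP (allP (allP chk i (mi _ i_n)) j (mi _ jn)) l (mi _ ln).
(* The factor 1 / (c t^e) is absorbed in the first vector of each term. *)
pose s k := (zK (Z_of_int c) * t k ^+ e)^-1.
pose vc (v : seq zpoly) k : 'cV[K]_n.+1 := \col_i peval (nth [::] v i) (t k).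
pose D_ (i : 'I_n.+1) := nth ([::], [::], [::]) D i.
pose u k : tensor K n.+1 := \sum_(i < n.+1) (simple_tensor (s k *: vc (D_ i).1.1 k) (vc (D_ i).1.2 k) (vc (D_ i).2 k) : {ffun 'I_n.+1 * 'I_n.+1 * 'I_n.+1 -> K}).
exists u; split=> [k|[[i j] l]].
  by exists (fun i => s k *: vc (D_ i).1.1 k), (fun i => vc (D_ i).1.2 k), (fun i => vc (D_ i).2 k).
have [z0 zc] := entry i j l (ltn_ord i) (ltn_ord j) (ltn_ord l).
have uE k : u k (i, j, l) = s k * peval (dec_entry D i j l) (t k).
  rewrite sum_ffunE; under eq_bigr do rewrite ffunE /= !mxE -!mulrA.
  rewrite -mulr_sumr; congr (_ * _).
  pose H (x : seq zpoly * seq zpoly * seq zpoly) := peval (nth [::] x.1.1 i) (t k) *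
    (peval (nth [::] x.1.2 j) (t k) * peval (nth [::] x.2 l) (t k)).
  have -> : \sum_(q < n.+1) H (D_ q) = \sum_(q < size D) H (nth ([::], [::], [::]) D q) by rewrite sD.
  rewrite -(big_mkord xpredT (fun q => H (nth ([::], [::], [::]) D q))) -(big_nth ([::], [::], [::]) xpredT H).
  rewrite /dec_entry; elim: (D) => [|x D1 IH] /=; first by rewrite big_nil.
  by rewrite big_cons IH peval_add !peval_mul /H !mulrA.
have {}uE k : u k (i, j, l) = zK (slice_coef (nth [::] E i) j l) +
    (zK (Z_of_int c))^-1 * (t k * peval (drop e.+1 (dec_entry D i j l)) (t k)).
  rewrite uE (peval_drop _ z0) (peval_nth e) zc zKM /s.
  have tk : t k ^+ e != 0 by rewrite expf_neq0.
  move: (peval _ _) (t k ^+ e) (zK (Z_of_int c)) tk c0 (zK (slice_coef _ _ _)) => P q C q0 C0 S.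
  by field; rewrite q0 C0.
under eq_fun do rewrite uE.
rewrite ffunE /= slice_mx_coef.
have [L cL] := cvg_peval (drop e.+1 (dec_entry D i j l)) t0.
suff : (fun k => zK (slice_coef (nth [::] E i) j l) + (zK (Z_of_int c))^-1 * (t k * peval (drop e.+1 (dec_entry D i j l)) (t k))) @ \oo -->
    zK (slice_coef (nth [::] E i) j l) + (zK (Z_of_int c))^-1 * (0 * L) by rewrite mul0r mulr0 addr0.
by apply: cvgD; [exact: cvg_cst|apply: cvgM; [exact: cvg_cst|apply: cvgM]].
Qed.

(** Two certificates: each slice has a position where its entry is 1 and all other slices have 0;
    and the slices with a diagonal entry, which are the units of the blocks, add up to the identity.
    The one-element list binds the coefficients w once. *)
Definition check_concise (m : nat) (E : model) : bool :=
  let w i := if has (fun d => slice_coef (nth [::] E i) d d != BinNums.Z0) (iota 0 m) then 1%R else 0%R : Z in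
  all (fun i => has (fun j => has (fun k => all (fun l => slice_coef (nth [::] E l) j k == (l == i)%:R)
     (iota 0 m)) (iota 0 m)) (iota 0 m)) (iota 0 m) &&
  has (fun w => all (fun j => all (fun k =>
     foldr (fun i r => BinInt.Z.add (BinInt.Z.mul (nth BinNums.Z0 w i) (slice_coef (nth [::] E i) j k)) r) BinNums.Z0 (iota 0 m) == (j == k)%:R)
     (iota 0 m)) (iota 0 m)) [:: [seq w i | i <- iota 0 m]].

(** If f0 contracts T to the identity, then f is recovered from [contractB T f] or [contractC T f]
    by contracting further with f0, so these are injective. For T_A the private positions of the
    slices are used. *)
Lemma concise_of_check n (E : model) : check_concise n.+1 E ->
  concise (tens K n E) /\ oneA_generic (tens K n E).
Proof.
rewrite /check_concise; cbv zeta => /andP[cA /hasP[w _ cw]].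
have mi k : (k < n.+1)%N -> k \in iota 0 n.+1 by rewrite mem_iota.
pose f0 : 'rV[K]_n.+1 := \row_i zK (nth BinNums.Z0 w i).
have f01 : contractA (tens K n E) f0 = 1%:M.
  apply/matrixP => j k; rewrite !mxE.
  have /eqP h := allP (allP cw j (mi _ (ltn_ord j))) k (mi _ (ltn_ord k)).
  have -> : (j == k)%:R = zK ((j == k :> nat)%:R : Z) by rewrite val_eqE; case: (j == k).
  rewrite -h; under eq_bigr do rewrite ffunE /= mxE slice_mx_coef -zKM.
  rewrite -(big_mkord xpredT (fun i => zK (BinInt.Z.mul (nth BinNums.Z0 w i) (slice_coef (nth [::] E i) j k)))).
  rewrite /index_iota subn0; elim: (iota 0 n.+1) => [|x r IH] /=; first by rewrite big_nil.
  by rewrite big_cons IH zKD.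
have inj0 (g : 'rV[K]_n.+1 -> 'M[K]_n.+1) : (forall a b, g (a - b) = g a - g b) -> (forall f, g f = 0 -> f = 0) -> injective g.
  by move=> gB g0 a b e; apply/eqP; rewrite -subr_eq0; apply/eqP/g0; rewrite gB e subrr.
split; last by exists f0; rewrite f01 mxrank1.
split; apply: inj0.
- by move=> a b; apply/matrixP => j k; rewrite !mxE -sumrB; apply: eq_bigr => i _; rewrite !mxE mulrBl.
- move=> f; rewrite contractA_tens => e; apply/rowP => i; rewrite [RHS]mxE.
  have /hasP[j + /hasP[k + /allP h]] := allP cA i (mi _ (ltn_ord i)).
  rewrite !mem_iota /= !add0n => jn kn.
  have := congr1 (fun M : 'M[K]_n.+1 => M (Ordinal jn) (Ordinal kn)) e; rewrite summxE mxE => <-.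
  rewrite (bigD1 i) //= big1 => [|l li]; rewrite mxE slice_mx_coef (eqP (h _ (mi _ (ltn_ord _)))) /=.
    by rewrite eqxx /zK mulr1 addr0.
  by rewrite val_eqE (negPf li) zK0 mulr0.
- by move=> a b; apply/matrixP => j k; rewrite !mxE -sumrB; apply: eq_bigr => i _; rewrite !mxE mulrBl.
- move=> f e; apply/rowP => k; rewrite [RHS]mxE.
  transitivity (\sum_i f0 0 i * contractB (tens K n E) f i k).
    transitivity (\sum_j f 0 j * contractA (tens K n E) f0 j k).
      rewrite f01 (bigD1 k) //= big1 => [|j jk]; rewrite mxE; first by rewrite eqxx mulr1 addr0.
      by rewrite (negPf jk) mulr0.
    under eq_bigr do rewrite mxE mulr_sumr; rewrite exchange_big; apply: eq_bigr => i _ /=.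
    by rewrite [contractB _ _ _ _]mxE mulr_sumr; apply: eq_bigr => j _; rewrite mulrCA.
  by rewrite e big1 // => i _; rewrite [X in _ * X]mxE mulr0.
- by move=> a b; apply/matrixP => j k; rewrite !mxE -sumrB; apply: eq_bigr => i _; rewrite !mxE mulrBl.
move=> f e; apply/rowP => j; rewrite [RHS]mxE.
transitivity (\sum_i f0 0 i * contractC (tens K n E) f i j).
  transitivity (\sum_k f 0 k * contractA (tens K n E) f0 j k).
    rewrite f01 (bigD1 j) //= big1 => [|k jk]; rewrite mxE; first by rewrite eqxx mulr1 addr0.
    by rewrite eq_sym (negPf jk) mulr0.
  under eq_bigr do rewrite mxE mulr_sumr; rewrite exchange_big; apply: eq_bigr => i _ /=.
  by rewrite [contractC _ _ _ _]mxE mulr_sumr; apply: eq_bigr => k _; rewrite mulrCA.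
by rewrite e big1 // => i _; rewrite [X in _ * X]mxE mulr0.
Qed.

Lemma minimal_of_check n (E : model) d (t : nat -> K) : (forall k, t k != 0) -> t @ \oo --> 0 ->
  check_dec n.+1 E d -> check_concise n.+1 E ->
  minimal_border_rank (tens K n E) /\ one_star_generic (tens K n E).
Proof.
move=> tn t0 cd /concise_of_check[cc g1]; split; last by constructor 1.
split=> //; apply/border_rankP; split; first exact: border_le_dec tn t0 cd.
by move=> k; apply: border_le_concise; case: cc.
Qed.
End Eval.

(** The regular models are limits of algebras of functions on m distinct points that shrink to the
    origin. The first two vectors of a term are the values of the basis monomials at a point, the
    third is the indicator function of that point in this basis, with denominators cleared. *)
Definition dec_pow1 : border_dec := (0%N, 1,
  [:: ([:: [:: 1]], [:: [:: 1]], [:: [:: 1]])]).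
Definition dec_pow2 : border_dec := (1%N, 1,
  [:: ([:: [:: 1]; [::]], [:: [:: 1]; [::]], [:: [:: 0; 1]; [:: - 1]]);
      ([:: [:: 1]; [:: 0; 1]], [:: [:: 1]; [:: 0; 1]], [:: [::]; [:: 1]])]).
Definition dec_pow3 : border_dec := (2%N, 2,
  [:: ([:: [:: 1]; [::]; [::]], [:: [:: 1]; [::]; [::]], [:: [:: 0; 0; 2]; [::]; [:: - 2]]);
      ([:: [:: 1]; [:: 0; 1]; [:: 0; 0; 1]], [:: [:: 1]; [:: 0; 1]; [:: 0; 0; 1]], [:: [::]; [:: 0; 1]; [:: 1]]);
      ([:: [:: 1]; [:: 0; - 1]; [:: 0; 0; 1]], [:: [:: 1]; [:: 0; - 1]; [:: 0; 0; 1]], [:: [::]; [:: 0; - 1]; [:: 1]])]).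
Definition dec_sq2 : border_dec := (1%N, 1,
  [:: ([:: [:: 1]; [::]; [::]], [:: [:: 1]; [::]; [::]], [:: [:: 0; 1]; [:: - 1]; [:: - 1]]);
      ([:: [:: 1]; [:: 0; 1]; [::]], [:: [:: 1]; [:: 0; 1]; [::]], [:: [::]; [:: 1]; [::]]);
      ([:: [:: 1]; [::]; [:: 0; 1]], [:: [:: 1]; [::]; [:: 0; 1]], [:: [::]; [::]; [:: 1]])]).
Definition dec_pow4 : border_dec := (3%N, 6,
  [:: ([:: [:: 1]; [::]; [::]; [::]], [:: [:: 1]; [::]; [::]; [::]], [:: [:: 0; 0; 0; 6]; [:: 0; 0; - 3]; [:: 0; - 6]; [:: 3]]);
      ([:: [:: 1]; [:: 0; 1]; [:: 0; 0; 1]; [:: 0; 0; 0; 1]], [:: [:: 1]; [:: 0; 1]; [:: 0; 0; 1]; [:: 0; 0; 0; 1]], [:: [::]; [:: 0; 0; 6]; [:: 0; 3]; [:: - 3]]);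
      ([:: [:: 1]; [:: 0; - 1]; [:: 0; 0; 1]; [:: 0; 0; 0; - 1]], [:: [:: 1]; [:: 0; - 1]; [:: 0; 0; 1]; [:: 0; 0; 0; - 1]], [:: [::]; [:: 0; 0; - 2]; [:: 0; 3]; [:: - 1]]);
      ([:: [:: 1]; [:: 0; 2]; [:: 0; 0; 4]; [:: 0; 0; 0; 8]], [:: [:: 1]; [:: 0; 2]; [:: 0; 0; 4]; [:: 0; 0; 0; 8]], [:: [::]; [:: 0; 0; - 1]; [::]; [:: 1]])]).
Definition dec_gor2 : border_dec := (2%N, 24,
  [:: ([:: [:: 1]; [:: 0; 2]; [:: 0; 0; 4]; [::]], [:: [:: 1]; [:: 0; 2]; [:: 0; 0; 4]; [::]], [:: [::]; [:: 0; 6]; [:: 3]; [::]]);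
      ([:: [:: 1]; [:: 0; - 2]; [:: 0; 0; 4]; [::]], [:: [:: 1]; [:: 0; - 2]; [:: 0; 0; 4]; [::]], [:: [::]; [:: 0; - 6]; [:: 3]; [::]]);
      ([:: [:: 1]; [::]; [::]; [:: 0; 1]], [:: [:: 1]; [::]; [::]; [:: 0; 1]], [:: [:: 0; 0; 32]; [::]; [:: - 8]; [:: 0; - 8]]);
      ([:: [:: 1]; [::]; [::]; [:: 0; 4]], [:: [:: 1]; [::]; [::]; [:: 0; 4]], [:: [:: 0; 0; - 8]; [::]; [:: 2]; [:: 0; 8]])]).
Definition dec_hook2 : border_dec := (2%N, 2,
  [:: ([:: [:: 1]; [::]; [::]; [::]], [:: [:: 1]; [::]; [::]; [::]], [:: [:: 0; 0; 2]; [::]; [:: - 2]; [:: 0; - 2]]);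
      ([:: [:: 1]; [:: 0; 1]; [:: 0; 0; 1]; [::]], [:: [:: 1]; [:: 0; 1]; [:: 0; 0; 1]; [::]], [:: [::]; [:: 0; 1]; [:: 1]; [::]]);
      ([:: [:: 1]; [:: 0; - 1]; [:: 0; 0; 1]; [::]], [:: [:: 1]; [:: 0; - 1]; [:: 0; 0; 1]; [::]], [:: [::]; [:: 0; - 1]; [:: 1]; [::]]);
      ([:: [:: 1]; [::]; [::]; [:: 0; 1]], [:: [:: 1]; [::]; [::]; [:: 0; 1]], [:: [::]; [::]; [::]; [:: 0; 2]])]).
Definition dec_sq3 : border_dec := (1%N, 1,
  [:: ([:: [:: 1]; [::]; [::]; [::]], [:: [:: 1]; [::]; [::]; [::]], [:: [:: 0; 1]; [:: - 1]; [:: - 1]; [:: - 1]]);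
      ([:: [:: 1]; [:: 0; 1]; [::]; [::]], [:: [:: 1]; [:: 0; 1]; [::]; [::]], [:: [::]; [:: 1]; [::]; [::]]);
      ([:: [:: 1]; [::]; [:: 0; 1]; [::]], [:: [:: 1]; [::]; [:: 0; 1]; [::]], [:: [::]; [::]; [:: 1]; [::]]);
      ([:: [:: 1]; [::]; [::]; [:: 0; 1]], [:: [:: 1]; [::]; [::]; [:: 0; 1]], [:: [::]; [::]; [::]; [:: 1]])]).
(** For the models that are not regular representations the first two vectors of a term differ. The
    second ones are common eigenvectors of commuting diagonalizable matrices that converge to those
    of the model. *)
Definition dec_4a : border_dec := (1%N, 1,
  [:: ([:: [:: 1]; [:: 0; 1]; [:: 0; 1]; [:: 0; - 1]], [:: [:: 1]; [::]; [:: 0; - 1]; [:: 0; 1]], [:: [:: 0; 1]; [:: 0; - 1]; [::]; [:: 1]]);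
      ([:: [:: - 1]; [::]; [:: 0; - 1]; [:: 0; 1]], [:: [:: 1]; [:: 1]; [::]; [::]], [:: [::]; [:: 0; - 1]; [::]; [:: 1]]);
      ([:: [:: 1]; [::]; [:: 0; 1]; [::]], [:: [::]; [:: 1]; [:: 0; 1]; [::]], [:: [::]; [::]; [:: 1]; [:: 1]]);
      ([:: [:: - 1]; [::]; [::]; [::]], [:: [::]; [:: 1]; [::]; [::]], [:: [::]; [::]; [:: 1]; [::]])]).
Definition dec_4b : border_dec := (1%N, 4,
  [:: ([:: [:: - 2]; [:: 0; - 1]; [:: 0; 1]; [::]], [:: [:: 2]; [::]; [::]; [:: 0; - 1]], [:: [:: 0; - 1]; [::]; [::]; [:: 2]]);
      ([:: [:: 2]; [:: 0; 1]; [::]; [:: 0; 1]], [:: [::]; [:: 2]; [:: 0; 1]; [::]], [:: [::]; [:: 0; 1]; [:: 2]; [::]]);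
      ([:: [:: 1]; [:: 0; 1]; [::]; [::]], [:: [:: 1]; [:: - 1]; [::]; [::]], [:: [::]; [::]; [:: 4]; [:: 4]]);
      ([:: [:: - 1]; [::]; [::]; [::]], [:: [:: 1]; [:: 1]; [::]; [::]], [:: [::]; [::]; [:: 4]; [:: - 4]])]).
Definition dec_pow5 : border_dec := (4%N, 24,
  [:: ([:: [:: 1]; [::]; [::]; [::]; [::]], [:: [:: 1]; [::]; [::]; [::]; [::]], [:: [:: 0; 0; 0; 0; 24]; [::]; [:: 0; 0; - 30]; [::]; [:: 6]]);
      ([:: [:: 1]; [:: 0; 1]; [:: 0; 0; 1]; [:: 0; 0; 0; 1]; [:: 0; 0; 0; 0; 1]], [:: [:: 1]; [:: 0; 1]; [:: 0; 0; 1]; [:: 0; 0; 0; 1]; [:: 0; 0; 0; 0; 1]], [:: [::]; [:: 0; 0; 0; 16]; [:: 0; 0; 16]; [:: 0; - 4]; [:: - 4]]);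
      ([:: [:: 1]; [:: 0; - 1]; [:: 0; 0; 1]; [:: 0; 0; 0; - 1]; [:: 0; 0; 0; 0; 1]], [:: [:: 1]; [:: 0; - 1]; [:: 0; 0; 1]; [:: 0; 0; 0; - 1]; [:: 0; 0; 0; 0; 1]], [:: [::]; [:: 0; 0; 0; - 16]; [:: 0; 0; 16]; [:: 0; 4]; [:: - 4]]);
      ([:: [:: 1]; [:: 0; 2]; [:: 0; 0; 4]; [:: 0; 0; 0; 8]; [:: 0; 0; 0; 0; 16]], [:: [:: 1]; [:: 0; 2]; [:: 0; 0; 4]; [:: 0; 0; 0; 8]; [:: 0; 0; 0; 0; 16]], [:: [::]; [:: 0; 0; 0; - 2]; [:: 0; 0; - 1]; [:: 0; 2]; [:: 1]]);
      ([:: [:: 1]; [:: 0; - 2]; [:: 0; 0; 4]; [:: 0; 0; 0; - 8]; [:: 0; 0; 0; 0; 16]], [:: [:: 1]; [:: 0; - 2]; [:: 0; 0; 4]; [:: 0; 0; 0; - 8]; [:: 0; 0; 0; 0; 16]], [:: [::]; [:: 0; 0; 0; 2]; [:: 0; 0; - 1]; [:: 0; - 2]; [:: 1]])]).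
Definition dec_gor3 : border_dec := (6%N, 6,
  [:: ([:: [:: 1]; [:: 0; 0; 1]; [:: 0; 0; 0; 0; 1]; [:: 0; 0; 0; 0; 0; 0; 1]; [::]], [:: [:: 1]; [:: 0; 0; 1]; [:: 0; 0; 0; 0; 1]; [:: 0; 0; 0; 0; 0; 0; 1]; [::]], [:: [::]; [:: 0; 0; 0; 0; 18]; [:: 0; 0; - 15]; [:: 3]; [::]]);
      ([:: [:: 1]; [:: 0; 0; 2]; [:: 0; 0; 0; 0; 4]; [:: 0; 0; 0; 0; 0; 0; 8]; [::]], [:: [:: 1]; [:: 0; 0; 2]; [:: 0; 0; 0; 0; 4]; [:: 0; 0; 0; 0; 0; 0; 8]; [::]], [:: [::]; [:: 0; 0; 0; 0; - 9]; [:: 0; 0; 12]; [:: - 3]; [::]]);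
      ([:: [:: 1]; [:: 0; 0; 3]; [:: 0; 0; 0; 0; 9]; [:: 0; 0; 0; 0; 0; 0; 27]; [::]], [:: [:: 1]; [:: 0; 0; 3]; [:: 0; 0; 0; 0; 9]; [:: 0; 0; 0; 0; 0; 0; 27]; [::]], [:: [::]; [:: 0; 0; 0; 0; 2]; [:: 0; 0; - 3]; [:: 1]; [::]]);
      ([:: [:: 1]; [::]; [::]; [::]; [:: 0; 0; 0; 2]], [:: [:: 1]; [::]; [::]; [::]; [:: 0; 0; 0; 2]], [:: [:: 0; 0; 0; 0; 0; 0; 18]; [:: 0; 0; 0; 0; - 33]; [:: 0; 0; 18]; [:: - 3]; [:: 0; 0; 0; - 6]]);
      ([:: [:: 1]; [::]; [::]; [::]; [:: 0; 0; 0; 3]], [:: [:: 1]; [::]; [::]; [::]; [:: 0; 0; 0; 3]], [:: [:: 0; 0; 0; 0; 0; 0; - 12]; [:: 0; 0; 0; 0; 22]; [:: 0; 0; - 12]; [:: 2]; [:: 0; 0; 0; 6]])]).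
Definition dec_hook3 : border_dec := (3%N, 6,
  [:: ([:: [:: 1]; [::]; [::]; [::]; [::]], [:: [:: 1]; [::]; [::]; [::]; [::]], [:: [:: 0; 0; 0; 6]; [:: 0; 0; - 3]; [:: 0; - 6]; [:: 3]; [:: 0; 0; - 6]]);
      ([:: [:: 1]; [:: 0; 1]; [:: 0; 0; 1]; [:: 0; 0; 0; 1]; [::]], [:: [:: 1]; [:: 0; 1]; [:: 0; 0; 1]; [:: 0; 0; 0; 1]; [::]], [:: [::]; [:: 0; 0; 6]; [:: 0; 3]; [:: - 3]; [::]]);
      ([:: [:: 1]; [:: 0; - 1]; [:: 0; 0; 1]; [:: 0; 0; 0; - 1]; [::]], [:: [:: 1]; [:: 0; - 1]; [:: 0; 0; 1]; [:: 0; 0; 0; - 1]; [::]], [:: [::]; [:: 0; 0; - 2]; [:: 0; 3]; [:: - 1]; [::]]);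
      ([:: [:: 1]; [:: 0; 2]; [:: 0; 0; 4]; [:: 0; 0; 0; 8]; [::]], [:: [:: 1]; [:: 0; 2]; [:: 0; 0; 4]; [:: 0; 0; 0; 8]; [::]], [:: [::]; [:: 0; 0; - 1]; [::]; [:: 1]; [::]]);
      ([:: [:: 1]; [::]; [::]; [::]; [:: 0; 1]], [:: [:: 1]; [::]; [::]; [::]; [:: 0; 1]], [:: [::]; [::]; [::]; [::]; [:: 0; 0; 6]])]).
Definition dec_xy : border_dec := (2%N, 2,
  [:: ([:: [:: 1]; [::]; [::]; [::]; [::]], [:: [:: 1]; [::]; [::]; [::]; [::]], [:: [:: 0; 0; 2]; [::]; [:: - 2]; [::]; [:: - 2]]);
      ([:: [:: 1]; [:: 0; 1]; [:: 0; 0; 1]; [::]; [::]], [:: [:: 1]; [:: 0; 1]; [:: 0; 0; 1]; [::]; [::]], [:: [::]; [:: 0; 1]; [:: 1]; [::]; [::]]);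
      ([:: [:: 1]; [:: 0; - 1]; [:: 0; 0; 1]; [::]; [::]], [:: [:: 1]; [:: 0; - 1]; [:: 0; 0; 1]; [::]; [::]], [:: [::]; [:: 0; - 1]; [:: 1]; [::]; [::]]);
      ([:: [:: 1]; [::]; [::]; [:: 0; 1]; [:: 0; 0; 1]], [:: [:: 1]; [::]; [::]; [:: 0; 1]; [:: 0; 0; 1]], [:: [::]; [::]; [::]; [:: 0; 1]; [:: 1]]);
      ([:: [:: 1]; [::]; [::]; [:: 0; - 1]; [:: 0; 0; 1]], [:: [:: 1]; [::]; [::]; [:: 0; - 1]; [:: 0; 0; 1]], [:: [::]; [::]; [::]; [:: 0; - 1]; [:: 1]])]).
Definition dec_yy : border_dec := (2%N, 2,
  [:: ([:: [:: 1]; [::]; [::]; [::]; [::]], [:: [:: 1]; [::]; [::]; [::]; [::]], [:: [:: 0; 0; 2]; [::]; [:: - 2]; [:: 0; - 2]; [:: 2]]);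
      ([:: [:: 1]; [:: 0; 1]; [:: 0; 0; 1]; [::]; [::]], [:: [:: 1]; [:: 0; 1]; [:: 0; 0; 1]; [::]; [::]], [:: [::]; [:: 0; 1]; [:: 1]; [::]; [:: - 2]]);
      ([:: [:: 1]; [:: 0; - 1]; [:: 0; 0; 1]; [::]; [::]], [:: [:: 1]; [:: 0; - 1]; [:: 0; 0; 1]; [::]; [::]], [:: [::]; [:: 0; - 1]; [:: 1]; [::]; [::]]);
      ([:: [:: 1]; [::]; [::]; [:: 0; 1]; [::]], [:: [:: 1]; [::]; [::]; [:: 0; 1]; [::]], [:: [::]; [::]; [::]; [:: 0; 2]; [:: - 2]]);
      ([:: [:: 1]; [:: 0; 1]; [:: 0; 0; 1]; [:: 0; 1]; [:: 0; 0; 1]], [:: [:: 1]; [:: 0; 1]; [:: 0; 0; 1]; [:: 0; 1]; [:: 0; 0; 1]], [:: [::]; [::]; [::]; [::]; [:: 2]])]).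
Definition dec_q3 : border_dec := (2%N, 4,
  [:: ([:: [:: 1]; [::]; [::]; [::]; [::]], [:: [:: 1]; [::]; [::]; [::]; [::]], [:: [:: 0; 0; 4]; [::]; [:: - 4]; [::]; [::]]);
      ([:: [:: 1]; [:: 0; 1]; [:: 0; 0; 1]; [:: 0; 1]; [:: 0; 1]], [:: [:: 1]; [:: 0; 1]; [:: 0; 0; 1]; [:: 0; 1]; [:: 0; 1]], [:: [::]; [:: 0; 1]; [:: 1]; [:: 0; 1]; [:: 0; 1]]);
      ([:: [:: 1]; [:: 0; 1]; [:: 0; 0; 1]; [:: 0; - 1]; [:: 0; - 1]], [:: [:: 1]; [:: 0; 1]; [:: 0; 0; 1]; [:: 0; - 1]; [:: 0; - 1]], [:: [::]; [:: 0; 1]; [:: 1]; [:: 0; - 1]; [:: 0; - 1]]);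
      ([:: [:: 1]; [:: 0; - 1]; [:: 0; 0; 1]; [:: 0; 1]; [:: 0; - 1]], [:: [:: 1]; [:: 0; - 1]; [:: 0; 0; 1]; [:: 0; 1]; [:: 0; - 1]], [:: [::]; [:: 0; - 1]; [:: 1]; [:: 0; 1]; [:: 0; - 1]]);
      ([:: [:: 1]; [:: 0; - 1]; [:: 0; 0; 1]; [:: 0; - 1]; [:: 0; 1]], [:: [:: 1]; [:: 0; - 1]; [:: 0; 0; 1]; [:: 0; - 1]; [:: 0; 1]], [:: [::]; [:: 0; - 1]; [:: 1]; [:: 0; - 1]; [:: 0; 1]])]).
Definition dec_q2 : border_dec := (2%N, 24,
  [:: ([:: [:: 1]; [:: 0; 2]; [:: 0; 0; 4]; [::]; [::]], [:: [:: 1]; [:: 0; 2]; [:: 0; 0; 4]; [::]; [::]], [:: [::]; [:: 0; 6]; [:: 3]; [::]; [::]]);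
      ([:: [:: 1]; [:: 0; - 2]; [:: 0; 0; 4]; [::]; [::]], [:: [:: 1]; [:: 0; - 2]; [:: 0; 0; 4]; [::]; [::]], [:: [::]; [:: 0; - 6]; [:: 3]; [::]; [::]]);
      ([:: [:: 1]; [::]; [::]; [:: 0; 1]; [::]], [:: [:: 1]; [::]; [::]; [:: 0; 1]; [::]], [:: [:: 0; 0; 32]; [::]; [:: - 8]; [:: 0; - 8]; [:: 0; - 32]]);
      ([:: [:: 1]; [::]; [::]; [:: 0; 4]; [::]], [:: [:: 1]; [::]; [::]; [:: 0; 4]; [::]], [:: [:: 0; 0; - 8]; [::]; [:: 2]; [:: 0; 8]; [:: 0; 8]]);
      ([:: [:: 1]; [::]; [::]; [::]; [:: 0; 1]], [:: [:: 1]; [::]; [::]; [::]; [:: 0; 1]], [:: [::]; [::]; [::]; [::]; [:: 0; 24]])]).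
Definition dec_q1 : border_dec := (2%N, 2,
  [:: ([:: [:: 1]; [::]; [::]; [::]; [::]], [:: [:: 1]; [::]; [::]; [::]; [::]], [:: [:: 0; 0; 2]; [::]; [:: - 2]; [:: 0; - 2]; [:: 0; - 2]]);
      ([:: [:: 1]; [:: 0; 1]; [:: 0; 0; 1]; [::]; [::]], [:: [:: 1]; [:: 0; 1]; [:: 0; 0; 1]; [::]; [::]], [:: [::]; [:: 0; 1]; [:: 1]; [::]; [::]]);
      ([:: [:: 1]; [:: 0; - 1]; [:: 0; 0; 1]; [::]; [::]], [:: [:: 1]; [:: 0; - 1]; [:: 0; 0; 1]; [::]; [::]], [:: [::]; [:: 0; - 1]; [:: 1]; [::]; [::]]);
      ([:: [:: 1]; [::]; [::]; [:: 0; 1]; [::]], [:: [:: 1]; [::]; [::]; [:: 0; 1]; [::]], [:: [::]; [::]; [::]; [:: 0; 2]; [::]]);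
      ([:: [:: 1]; [::]; [::]; [::]; [:: 0; 1]], [:: [:: 1]; [::]; [::]; [::]; [:: 0; 1]], [:: [::]; [::]; [::]; [::]; [:: 0; 2]])]).
Definition dec_n1 : border_dec := (4%N, 1,
  [:: ([:: [:: 1]; [:: 0; 0; 0; - 1]; [::]; [:: 0; 0; 0; 1]; [:: 0; 0; 0; 0; - 1]], [:: [:: 1]; [:: 0; 0; 0; - 1]; [::]; [:: 0; 0; 0; 1]; [::]], [:: [:: 0; 0; 0; 0; 1]; [::]; [:: 0; 0; - 1]; [:: 0; 1]; [:: 0; 0; 0; 0; - 1]]);
      ([:: [:: - 1]; [:: 0; 0; 0; 1]; [::]; [::]; [:: 0; 0; 0; 0; 1]], [:: [:: 1]; [:: 0; 0; 0; - 1]; [::]; [::]; [::]], [:: [::]; [:: 0; 1]; [:: - 1]; [:: 0; 1]; [::]]);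
      ([:: [:: 1]; [::]; [::]; [::]; [:: 0; 0; 0; 0; - 1]], [:: [:: 1]; [::]; [::]; [::]; [:: 1]], [:: [::]; [:: 0; 1]; [:: - 1]; [::]; [:: 0; 0; 0; 0; 1]]);
      ([:: [:: - 1]; [::]; [::]; [::]; [::]], [:: [::]; [::]; [::]; [::]; [:: 1]], [:: [::]; [:: 0; 1]; [:: - 1]; [::]; [::]]);
      ([:: [:: 1]; [:: 0; 1]; [:: 0; 0; 1]; [::]; [::]], [:: [:: 1]; [:: 0; 1]; [:: 0; 0; 1]; [::]; [::]], [:: [::]; [::]; [:: 0; 0; 1]; [::]; [::]])]).
Definition dec_n2 : border_dec := (4%N, 1,
  [:: ([:: [:: 1]; [:: 0; 0; 0; 1]; [::]; [:: 0; 0; 0; 0; 1]; [:: 0; 0; 0; 1]], [:: [:: 1]; [:: 0; 0; 0; 1]; [::]; [:: 0; 0; 0; - 1]; [::]], [:: [:: 0; 0; 0; 0; 1]; [:: 0; 1]; [:: - 1; 0; - 1]; [::]; [:: 0; 0; 0; 0; - 1]]);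
      ([:: [:: - 1]; [::]; [::]; [:: 0; 0; 0; 0; - 1]; [:: 0; 0; 0; - 1]], [:: [:: 1]; [::]; [::]; [::]; [:: 1]], [:: [::]; [:: 0; 1]; [:: - 1]; [::]; [:: 0; 0; 0; 0; - 1]]);
      ([:: [:: 1]; [::]; [::]; [::]; [:: 0; 0; 0; 1]], [:: [::]; [::]; [::]; [:: 0; 0; 0; 1]; [:: 1]], [:: [::]; [:: 0; 1]; [:: - 1]; [:: 0; 1]; [::]]);
      ([:: [:: - 1]; [::]; [::]; [::]; [::]], [:: [::]; [::]; [::]; [::]; [:: 1]], [:: [::]; [::]; [::]; [:: 0; 1]; [::]]);
      ([:: [:: 1]; [:: 0; 1]; [:: 0; 0; 1]; [::]; [::]], [:: [:: 1]; [:: 0; 1]; [:: 0; 0; 1]; [::]; [::]], [:: [::]; [::]; [:: 0; 0; 1]; [::]; [::]])]).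
Definition dec_n3 : border_dec := (4%N, 4,
  [:: ([:: [:: - 2]; [:: 0; 0; 0; 1]; [::]; [:: 0; 0; 0; - 1]; [::]], [:: [:: 2]; [:: 0; 0; 0; - 1]; [::]; [::]; [::]], [:: [:: 0; 0; 0; 0; - 1]; [:: 0; 2]; [:: - 2; 0; 1]; [::]; [::]]);
      ([:: [:: 2]; [::]; [::]; [:: 0; 0; 0; 1]; [:: 0; 0; 1]], [:: [::]; [::]; [::]; [:: 0; 0; 1]; [:: 2]], [:: [::]; [::]; [::]; [:: 0; 0; 2]; [:: 0; 0; 0; 0; 1]]);
      ([:: [:: 1]; [::]; [::]; [:: 0; 0; 0; 1]; [::]], [:: [:: 1]; [::]; [::]; [::]; [:: 0; - 1]], [:: [::]; [:: 0; 4]; [:: - 4]; [:: 0; 4]; [::]]);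
      ([:: [:: 1]; [::]; [::]; [::]; [::]], [:: [:: 1]; [::]; [::]; [::]; [:: 0; 1]], [:: [::]; [:: 0; 4]; [:: - 4]; [:: 0; - 4]; [::]]);
      ([:: [:: 1]; [:: 0; 1]; [:: 0; 0; 1]; [::]; [::]], [:: [:: 1]; [:: 0; 1]; [:: 0; 0; 1]; [::]; [::]], [:: [::]; [::]; [:: 0; 0; 4]; [::]; [::]])]).
Definition dec_n4 : border_dec := (4%N, 4,
  [:: ([:: [:: - 2]; [:: 0; 0; 0; - 1]; [::]; [:: 0; 0; 0; 0; - 1]; [::]], [:: [::]; [:: 0; 0; 0; - 1]; [::]; [:: 2]; [::]], [:: [::]; [:: 0; 2]; [:: - 2]; [:: 0; 0; 0; 0; - 1]; [::]]);
      ([:: [:: - 2]; [:: 0; 0; 0; - 1]; [::]; [::]; [:: 0; 0; 0; 1]], [:: [:: 2]; [::]; [::]; [::]; [:: 0; 0; 0; - 1]], [:: [:: 0; 0; 0; 0; - 1]; [::]; [:: 0; 0; 1]; [::]; [:: 0; 2]]);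
      ([:: [:: 1]; [:: 0; 0; 0; 1]; [::]; [::]; [::]], [:: [:: 1]; [::]; [::]; [:: 1]; [::]], [:: [::]; [:: 0; 4]; [:: - 4]; [::]; [:: 0; 4]]);
      ([:: [:: 1]; [::]; [::]; [::]; [::]], [:: [:: - 1]; [::]; [::]; [:: 1]; [::]], [:: [::]; [:: 0; 4]; [:: - 4]; [::]; [:: 0; - 4]]);
      ([:: [:: 1]; [:: 0; 1]; [:: 0; 0; 1]; [::]; [::]], [:: [:: 1]; [:: 0; 1]; [:: 0; 0; 1]; [::]; [::]], [:: [::]; [::]; [:: 0; 0; 4]; [::]; [::]])]).
Definition dec_sq4 : border_dec := (1%N, 1,
  [:: ([:: [:: 1]; [::]; [::]; [::]; [::]], [:: [:: 1]; [::]; [::]; [::]; [::]], [:: [:: 0; 1]; [:: - 1]; [:: - 1]; [:: - 1]; [:: - 1]]);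
      ([:: [:: 1]; [:: 0; 1]; [::]; [::]; [::]], [:: [:: 1]; [:: 0; 1]; [::]; [::]; [::]], [:: [::]; [:: 1]; [::]; [::]; [::]]);
      ([:: [:: 1]; [::]; [:: 0; 1]; [::]; [::]], [:: [:: 1]; [::]; [:: 0; 1]; [::]; [::]], [:: [::]; [::]; [:: 1]; [::]; [::]]);
      ([:: [:: 1]; [::]; [::]; [:: 0; 1]; [::]], [:: [:: 1]; [::]; [::]; [:: 0; 1]; [::]], [:: [::]; [::]; [::]; [:: 1]; [::]]);
      ([:: [:: 1]; [::]; [::]; [::]; [:: 0; 1]], [:: [:: 1]; [::]; [::]; [::]; [:: 0; 1]], [:: [::]; [::]; [::]; [::]; [:: 1]])]).
Definition dec_p1 : border_dec := (2%N, 6,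
  [:: ([:: [:: 1]; [::]; [:: 0; 0; 1]; [:: 0; 0; - 1]; [::]], [:: [:: 1]; [:: 1]; [::]; [:: 0; 0; - 1]; [:: 0; 0; 1]], [:: [:: 0; 0; 12]; [:: 0; 0; - 6]; [:: 0; - 3]; [:: 6]; [:: 12]]);
      ([:: [:: - 3]; [:: 0; 0; 2]; [:: 0; 0; - 1]; [:: 0; 0; 2]; [:: 0; 0; - 1]], [:: [:: 3]; [:: 3]; [:: 0; 2]; [:: 0; 0; - 4]; [:: 0; 0; 2]], [:: [::]; [::]; [::]; [:: 1]; [:: 1]]);
      ([:: [:: - 2]; [:: 0; 0; - 1]; [:: 0; 0; - 1]; [:: 0; 0; 1]; [:: 0; 0; 1]], [:: [:: 1]; [:: 2]; [::]; [::]; [::]], [:: [:: 0; 0; 3]; [:: 0; 0; - 3]; [:: 0; 2]; [:: 2]; [:: 4]]);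
      ([:: [:: 1]; [:: 0; 0; 2]; [:: 0; 0; - 1]; [:: 0; 0; - 2]; [:: 0; 0; 1]], [:: [:: 1]; [:: - 1]; [::]; [::]; [::]], [:: [::]; [::]; [:: 0; 1]; [:: 1]; [:: - 1]]);
      ([:: [:: 1]; [::]; [::]; [::]; [::]], [:: [:: 1]; [:: 2]; [:: 0; 1]; [::]; [::]], [:: [::]; [::]; [:: 0; 6]; [:: 6]; [:: 6]])]).
Definition dec_p2 : border_dec := (1%N, 1,
  [:: ([:: [:: 1]; [:: 0; 1]; [::]; [:: 0; - 1]; [:: 0; - 1]], [:: [:: 1]; [::]; [::]; [:: 0; 1]; [:: 0; 1]], [:: [:: 0; 1]; [:: 0; - 1]; [::]; [::]; [:: 1]]);
      ([:: [:: - 1]; [::]; [::]; [:: 0; 1]; [:: 0; 1]], [:: [:: 1]; [:: 1]; [::]; [::]; [::]], [:: [::]; [:: 0; - 1]; [::]; [::]; [:: 1]]);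
      ([:: [:: 1]; [::]; [::]; [:: 0; - 1]; [::]], [:: [::]; [:: 1]; [::]; [:: 0; - 1]; [::]], [:: [::]; [::]; [:: - 1]; [:: - 1]; [:: 1]]);
      ([:: [:: 1]; [::]; [:: 0; 1]; [:: 0; - 1]; [::]], [:: [::]; [:: 1]; [:: 0; 1]; [:: 0; - 1]; [::]], [:: [::]; [::]; [:: 1]; [::]; [::]]);
      ([:: [:: 1]; [::]; [::]; [::]; [::]], [:: [::]; [:: 1]; [::]; [::]; [::]], [:: [::]; [::]; [::]; [:: 1]; [::]])]).
Definition dec_p3 : border_dec := (1%N, 1,
  [:: ([:: [:: 1]; [:: 0; 1]; [:: 0; - 1]; [:: 0; - 1]; [:: 0; 1]], [:: [:: 1]; [::]; [:: 0; 1]; [:: 0; 1]; [:: 0; - 1]], [:: [:: 0; 1]; [:: 0; - 1]; [::]; [:: 1]; [::]]);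
      ([:: [:: - 1]; [::]; [:: 0; 1]; [:: 0; 1]; [:: 0; - 1]], [:: [:: 1]; [::]; [:: 0; 1]; [::]; [:: 0; - 1]], [:: [::]; [::]; [::]; [:: 1]; [:: 1]]);
      ([:: [:: 1]; [::]; [::]; [:: 0; - 1]; [:: 0; 1]], [:: [:: 1]; [:: 1]; [::]; [::]; [::]], [:: [::]; [:: 0; 1]; [::]; [::]; [:: 1]]);
      ([:: [:: - 1]; [::]; [::]; [:: 0; 1]; [::]], [:: [::]; [:: 1]; [:: 0; - 1]; [::]; [::]], [:: [::]; [::]; [:: 1]; [::]; [:: 1]]);
      ([:: [:: 1]; [::]; [::]; [::]; [::]], [:: [::]; [:: 1]; [::]; [::]; [::]], [:: [::]; [::]; [:: 1]; [::]; [::]])]).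
Definition dec_p4 : border_dec := (3%N, 4,
  [:: ([:: [:: - 1]; [:: 0; 0; 1]; [::]; [::]; [:: 0; 0; 1]], [:: [:: 1]; [:: 0; - 1]; [::]; [:: 0; 0; 0; - 1]; [:: 0; 0; 0; 1]], [:: [::]; [:: 0; 0; 4]; [:: 0; 4]; [:: 4]; [::]]);
      ([:: [:: 2]; [:: 0; 0; - 1]; [:: 0; 0; 0; 1]; [::]; [:: 0; 0; - 2]], [:: [:: 2]; [:: 0; - 2]; [:: 0; 0; 1]; [:: 0; 0; 0; - 1]; [:: 0; 0; 0; 2]], [:: [::]; [::]; [:: 0; 1]; [:: 1]; [:: 1]]);
      ([:: [:: - 2]; [:: 0; 0; 1]; [:: 0; 0; 0; - 1]; [:: 0; 0; 0; 1]; [:: 0; 0; 1]], [:: [:: 1]; [::]; [::]; [::]; [::]], [:: [:: 0; 0; 0; - 2]; [:: 0; 0; - 2]; [::]; [::]; [:: 4]]);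
      ([:: [:: 2]; [:: 0; 0; - 1]; [:: 0; 0; 0; 1]; [::]; [::]], [:: [:: 2]; [:: 0; 2]; [:: 0; 0; - 1]; [:: 0; 0; 0; 1]; [::]], [:: [::]; [::]; [:: 0; - 1]; [:: 1]; [:: 1]]);
      ([:: [:: - 1]; [::]; [::]; [::]; [::]], [:: [:: 1]; [:: 0; 1]; [::]; [::]; [::]], [:: [::]; [::]; [:: 0; - 4]; [:: 4]; [::]])]).
Definition dec_p5 : border_dec := (1%N, 2,
  [:: ([:: [:: 1]; [::]; [:: 0; - 1]; [:: 0; 1]; [:: 0; - 1]], [:: [:: 1]; [::]; [:: 0; 1]; [:: 0; - 1]; [:: 0; 1]], [:: [:: 0; 2]; [:: 0; 2]; [::]; [::]; [:: 2]]);
      ([:: [:: - 1]; [::]; [:: 0; 1]; [::]; [:: 0; 1]], [:: [:: 1]; [::]; [:: 0; 1]; [:: 0; - 1]; [::]], [:: [::]; [::]; [::]; [:: 2]; [:: 2]]);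
      ([:: [:: 1]; [:: 0; 1]; [::]; [::]; [:: 0; - 1]], [:: [:: 1]; [:: - 1]; [:: 0; 2]; [::]; [::]], [:: [::]; [:: 0; - 2]; [:: 1]; [:: 1]; [::]]);
      ([:: [:: - 1]; [:: 0; 1]; [::]; [::]; [:: 0; 1]], [:: [:: 1]; [:: 1]; [::]; [::]; [::]], [:: [::]; [::]; [:: 1]; [:: - 1]; [::]]);
      ([:: [:: 1]; [::]; [::]; [::]; [::]], [:: [::]; [:: 1]; [::]; [::]; [::]], [:: [::]; [::]; [:: 2]; [::]; [::]])]).
Definition dec_p6 : border_dec := (1%N, 6,
  [:: ([:: [:: - 1]; [:: 0; - 2]; [:: 0; 1]; [:: 0; 2]; [:: 0; 1]], [:: [:: 1]; [::]; [:: 0; 2]; [::]; [:: 0; - 2]], [:: [:: 0; - 6]; [:: 0; 6]; [::]; [::]; [:: 3]]);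
      ([:: [:: 1]; [:: 0; 1]; [:: 0; - 2]; [::]; [:: 0; - 1]], [:: [:: 1]; [:: 1]; [:: 0; 1]; [:: 0; - 1]; [::]], [:: [::]; [:: 0; 6]; [:: 3]; [:: - 3]; [:: 3]]);
      ([:: [:: 1]; [:: 0; 3]; [:: 0; 2]; [::]; [:: 0; - 1]], [:: [:: 1]; [:: - 1]; [:: 0; 3]; [:: 0; 3]; [::]], [:: [::]; [::]; [:: 1]; [:: 1]; [:: 1]]);
      ([:: [:: - 1]; [::]; [:: 0; 1]; [::]; [:: 0; 1]], [:: [:: 1]; [:: 2]; [::]; [::]; [::]], [:: [::]; [::]; [:: 4]; [:: - 2]; [:: 1]]);
      ([:: [:: 1]; [::]; [::]; [::]; [::]], [:: [::]; [:: 1]; [::]; [::]; [::]], [:: [::]; [::]; [:: 6]; [::]; [::]])]).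

(** The first vectors of each summand are multiplied by the leading factor c t^k of the other
    summand, so that both parts have the same leading factor. *)
Definition dec_sum (r s : nat) (d1 d2 : border_dec) : border_dec :=
  let pad n := nseq n [::] in
  let sc (k : nat) (c : int) (v : seq (seq int)) := [seq nseq k 0 ++ [seq c * x | x <- p] | p <- v] in
  ((d1.1.1 + d2.1.1)%N, d1.1.2 * d2.1.2,
   [seq (sc d2.1.1 d2.1.2 x.1.1 ++ pad s, x.1.2 ++ pad s, x.2 ++ pad s) | x <- d1.2] ++
   [seq (pad r ++ sc d1.1.1 d1.1.2 x.1.1, pad r ++ x.1.2, pad r ++ x.2) | x <- d2.2]).

Definition decs1 := [:: dec_pow1].
Definition decs2 := dec_pow2 :: [seq dec_sum 1 1 d dec_pow1 | d <- decs1].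
Definition decs_loc3 := [:: dec_pow3; dec_sq2].
Definition decs3 := decs_loc3 ++ [seq dec_sum 2 1 d dec_pow1 | d <- decs2].
Definition decs4 := [:: dec_pow4; dec_gor2; dec_hook2; dec_sq3; dec_4a; dec_4b] ++
  [seq dec_sum 3 1 d dec_pow1 | d <- decs3] ++ [:: dec_sum 2 2 dec_pow2 dec_pow2].
Definition decs5 := [:: dec_pow5; dec_gor3; dec_hook3; dec_xy; dec_yy; dec_q3; dec_q2; dec_q1; dec_n1; dec_n2;
    dec_n3; dec_n4; dec_sq4; dec_p1; dec_p2; dec_p3; dec_p4; dec_p5; dec_p6] ++
  [seq dec_sum 4 1 d dec_pow1 | d <- decs4] ++ [seq dec_sum 3 2 d dec_pow2 | d <- decs_loc3].

Lemma check1 : all2 (check_dec 1) models1 decs1 && all (check_concise 1) models1.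
Proof. by vm_compute. Qed.
Lemma check2 : all2 (check_dec 2) models2 decs2 && all (check_concise 2) models2.
Proof. by vm_compute. Qed.
Lemma check3 : all2 (check_dec 3) models3 decs3 && all (check_concise 3) models3.
Proof. by vm_compute. Qed.
Lemma check4 : all2 (check_dec 4) models4 decs4 && all (check_concise 4) models4.
Proof. by vm_compute. Qed.
Lemma check5 : all2 (check_dec 5) models5 decs5 && all (check_concise 5) models5.
Proof. by vm_compute. Qed.

(** * Invariants of the annihilator algebra *)

(** Triples of indices serve for both spaces: (factor, row, column) in gl(A) x gl(B) x gl(C), and
    the coordinates of a tensor. *)
Definition key := (nat * nat * nat)%type.
Definition sparse := seq (key * Z).

Fixpoint sp_add1 (k : key) (z : Z) (v : sparse) : sparse :=
  if v is (k', z') :: v' then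
    if k == k' then
      let s := BinInt.Z.add z z' in if s == BinNums.Z0 then v' else (k, s) :: v'
    else (k', z') :: sp_add1 k z v'
  else [:: (k, z)].
Definition sp_norm (v : sparse) : sparse := foldr (fun e r => sp_add1 e.1 e.2 r) [::] v.
Definition sp_comb (a : Z) (u : sparse) (b : Z) (v : sparse) : sparse :=
  foldr (fun e r => sp_add1 e.1 (BinInt.Z.mul b e.2) r) [seq (e.1, BinInt.Z.mul a e.2) | e <- u] v.
Definition sp_coef (k : key) (v : sparse) : Z :=
  foldr (fun e r => if e.1 == k then BinInt.Z.add e.2 r else r) BinNums.Z0 v.
(** Elimination without fractions: v is multiplied by the pivot before a multiple of the basis
    vector is subtracted, so the result represents v only up to a nonzero factor. *)
Definition sp_reduce (B : seq (key * sparse)) (v : sparse) : sparse :=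
  foldl (fun v pb => let c := sp_coef pb.1 v in
    if c == BinNums.Z0 then v else sp_comb (sp_coef pb.1 pb.2) v (BinInt.Z.opp c) pb.2) v B.
(* Testing that the pivots of B vanish on v' spares the proof that the reduction kills them; a failed
   test gives None. *)
Definition sp_insert (valid : pred key) (B : option (seq (key * sparse))) (v : sparse) :=
  if B is Some B then
    let v' := sp_reduce B v in
    if v' is (k, _) :: _ then
      if [&& valid k, sp_coef k v' != BinNums.Z0 & all (fun pb => sp_coef pb.1 v' == BinNums.Z0) B]
      then Some (rcons B (k, v')) else None
    else Some B
  else None.
Definition sp_elim (valid : pred key) (S : seq sparse) := foldl (sp_insert valid) (Some [::]) S.

Section Elim.
Variables (K : numClosedFieldType) (I : finType) (code : I -> key) (valid : pred key).
Hypotheses (codeI : injective code) (validP : forall k, valid k -> exists i, code i = k).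
Notation vT := {ffun I -> K^o}.

Definition sp_base (k : key) : vT := [ffun i => (code i == k)%:R].
Definition sp_vec (v : sparse) : vT := \sum_(e <- v) zK K e.2 *: sp_base e.1.

Lemma sp_vec_add1 k z v : sp_vec (sp_add1 k z v) = zK K z *: sp_base k + sp_vec v.
Proof.
elim: v => [|[k' z'] v IH] /=; first by rewrite /sp_vec !big_cons big_nil.
case: eqP => [<-|_]; last by rewrite /sp_vec !big_cons -!/(sp_vec _) IH addrCA.
case: eqP => e; rewrite /sp_vec !big_cons -!/(sp_vec _) /= addrA -scalerDl -zKD.
  by rewrite e zK0 scale0r add0r.
by [].
Qed.

Lemma sp_vec_norm v : sp_vec (sp_norm v) = sp_vec v.
Proof. by elim: v => [|e v IH] //=; rewrite sp_vec_add1 IH /sp_vec big_cons. Qed.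

Lemma sp_vec_comb a u b v : sp_vec (sp_comb a u b v) = zK K a *: sp_vec u + zK K b *: sp_vec v.
Proof.
elim: v => [|e v IH] /=.
  rewrite [sp_vec [::]]big_nil scaler0 addr0 /sp_vec big_map scaler_sumr.
  by apply: eq_bigr => e _; rewrite zKM scalerA.
by rewrite sp_vec_add1 IH [in RHS]/sp_vec big_cons -/(sp_vec v) zKM scalerDr scalerA addrCA.
Qed.

Lemma sp_coefE i v : sp_vec v i = zK K (sp_coef (code i) v).
Proof.
rewrite /sp_vec sum_ffunE; elim: v => [|e v IH] /=; first by rewrite big_nil zK0.
rewrite big_cons IH !ffunE eq_sym /=; case: eqP => _; last by rewrite /= scaler0 add0r.
by rewrite zKD; congr (_ + _); exact: mulr1.
Qed.

Lemma sp_reduceE B v : all (fun pb => sp_coef pb.1 pb.2 != BinNums.Z0) B ->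
  exists2 a, a != 0 & sp_vec (sp_reduce B v) - a *: sp_vec v \in <<[seq sp_vec pb.2 | pb <- B]>>%VS.
Proof.
elim: B v => [|[p b] B IH] v /=; first by exists 1; rewrite ?oner_neq0 // scale1r subrr mem0v.
move=> /andP[bp /IH{}IH]; rewrite span_cons; case: ifP => _.
  by have [a a0 h] := IH v; exists a => //; rewrite -[X in X \in _]add0r memv_add // mem0v.
have [a a0 h] := IH (sp_comb (sp_coef p b) v (BinInt.Z.opp (sp_coef p v)) b).
exists (a * zK K (sp_coef p b)); first by rewrite mulf_neq0 // zK_eq0.
rewrite sp_vec_comb scalerDr scalerA opprD addrA in h.
rewrite -[X in X \in _](subrK (a *: (zK K (BinInt.Z.opp (sp_coef p v)) *: sp_vec b))) addrC memv_add //.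
by rewrite scalerA memvZ // memv_line.
Qed.

(** By the last clause a vector of the span is determined by its coordinates at the pivots; a new
    vector that vanishes there without being zero is thus independent of the others. *)
Definition echelon (B : seq (key * sparse)) :=
  [/\ all (fun pb => sp_coef pb.1 pb.2 != BinNums.Z0) B, all (fun pb => valid pb.1) B,
      free [seq sp_vec pb.2 | pb <- B] &
      forall w, w \in <<[seq sp_vec pb.2 | pb <- B]>>%VS ->
        (forall i, code i \in [seq pb.1 | pb <- B] -> w i = 0) -> w = 0].

Lemma sp_insertP B B' v : echelon B -> sp_insert valid (Some B) v = Some B' ->
  echelon B' /\ <<[seq sp_vec pb.2 | pb <- B']>>%VS = (<[sp_vec v]> + <<[seq sp_vec pb.2 | pb <- B]>>)%VS.
Proof.
move=> [nz vB fB eB]; have [a a0] := sp_reduceE v nz; rewrite /sp_insert.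
set U := <<_>>%VS; move: (sp_reduce B v) => v' red.
have UE : (<[sp_vec v']> + U)%VS = (<[sp_vec v]> + U)%VS.
  apply/eqP; rewrite eqEsubv !subv_add !addvSr !andbT -!memvE; apply/andP; split.
    by rewrite -(subrK (a *: sp_vec v) (sp_vec v')) addrC memv_add // memvZ // memv_line.
  have h : a *: sp_vec v \in (<[sp_vec v']> + U)%VS.
    have -> : a *: sp_vec v = sp_vec v' + - (sp_vec v' - a *: sp_vec v) by rewrite opprB addrC subrK.
    by apply: memv_add; [exact: memv_line | rewrite memvN].
  by have := memvZ a^-1 h; rewrite scalerA mulVf // scale1r.
case: v' red UE => [|[k z] v0] red UE.
  move=> [<-]; split=> //; rewrite -UE /sp_vec big_nil.
  by apply/esym/addv_idPr; rewrite -memvE mem0v.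
move: ((k, z) :: v0) red UE => v' red UE; case: ifP => // /and3P[vk ck /allP cB] [<-].
have [i0 ci0] := validP vk.
have vB0 i : code i \in [seq pb.1 | pb <- B] -> sp_vec v' i = 0.
  by move=> /mapP[pb pbB ci]; rewrite sp_coefE ci (eqP (cB _ pbB)) zK0.
have v'i0 : sp_vec v' i0 != 0 by rewrite sp_coefE ci0 zK_eq0.
have sE : <<[seq sp_vec pb.2 | pb <- rcons B (k, v')]>>%VS = (<[sp_vec v']> + U)%VS.
  by rewrite map_rcons -cats1 span_cat span_seq1 addvC.
split; last by rewrite sE.
split; rewrite ?all_rcons /= ?ck ?vk //.
  have pe : perm_eq (rcons [seq sp_vec pb.2 | pb <- B] (sp_vec v')) (sp_vec v' :: [seq sp_vec pb.2 | pb <- B]).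
    by rewrite perm_rcons.
  rewrite map_rcons (perm_free pe) free_cons fB andbT.
  by apply: contraNN v'i0 => /eB/(_ vB0)->; rewrite ffunE.
rewrite sE => w /memv_addP[_ /vlineP[c ->] [u uU ->]] wp.
have u0 : u = 0.
  apply: eB => // i iB; have := wp i; rewrite map_rcons mem_rcons inE iB orbT => /(_ isT).
  by rewrite !ffunE vB0 // scaler0 add0r.
have := wp i0; rewrite map_rcons mem_rcons inE ci0 eqxx => /(_ isT).
rewrite u0 addr0 ffunE => /eqP; rewrite mulf_eq0 (negPf v'i0) orbF => /eqP->.
by rewrite scale0r.
Qed.

Lemma sp_elimP S B : sp_elim valid S = Some B ->
  <<[seq sp_vec pb.2 | pb <- B]>>%VS = <<[seq sp_vec v | v <- S]>>%VS /\
  \dim <<[seq sp_vec v | v <- S]>> = size B.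
Proof.
have none T : foldl (sp_insert valid) None T = None by elim: T.
have H T B0 : echelon B0 -> foldl (sp_insert valid) (Some B0) T = Some B -> echelon B /\
    <<[seq sp_vec pb.2 | pb <- B]>>%VS = (<<[seq sp_vec v | v <- T]>> + <<[seq sp_vec pb.2 | pb <- B0]>>)%VS.
  elim: T B0 => [|v T IH] B0 e0 /=.
    by move=> [<-]; split=> //; rewrite span_nil add0v.
  case e1 : (sp_insert valid (Some B0) v) => [B1|]; last by rewrite -/(sp_insert _ (Some B0) v) e1 none.
  rewrite -/(sp_insert _ (Some B0) v) e1; have [e2 s2] := sp_insertP e0 e1 => /(IH _ e2)[eB ->].
  by rewrite s2 span_cons addvA [(<<_>> + <[_]>)%VS]addvC.
have e0 : echelon [::].
  by split=> // [|w]; rewrite /= ?nil_free // span_nil memv0 => /eqP.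
move=> /(H _ _ e0)[[_ _ fB _] sE]; rewrite span_nil addv0 in sE.
by split=> //; rewrite -sE; move: fB; rewrite /free => /eqP ->; rewrite size_map.
Qed.
End Elim.

(** * Componentwise product and infinitesimal action *)

Definition sp_mul (m : nat) (u v : sparse) : sparse := sp_norm
  [seq ((x.1.1.1.1, x.1.1.1.2, x.2.1.2), BinInt.Z.mul x.1.2 x.2.2) |
    x <- [seq (a, b) | a <- u, b <- v] &
    [&& x.1.1.1.1 == x.2.1.1.1, x.1.1.2 == x.2.1.1.2 & (x.1.1.2 < m)%N]].
Definition key_get (k : key) (s : nat) : nat :=
  match s with 0 => k.1.1 | 1 => k.1.2 | _ => k.2 end.
Definition key_set (k : key) (s p : nat) : key :=
  match s with 0 => (p, k.1.2, k.2) | 1 => (k.1.1, p, k.2) | _ => (k.1.1, k.1.2, p) end.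
Definition sp_lie (m : nat) (u v : sparse) : sparse := sp_norm
  [seq (key_set x.2.1 x.1.1.1.1 x.1.1.1.2, BinInt.Z.mul x.1.2 x.2.2) |
    x <- [seq (a, b) | a <- u, b <- v] &
    [&& (x.1.1.1.1 < 3)%N, key_get x.2.1 x.1.1.1.1 == x.1.1.2 & (x.1.1.2 < m)%N]].
Definition sp_tens (m : nat) (E : model) : sparse :=
  flatten [seq [seq ((i, e.1.1, e.1.2), Z_of_int e.2) | e <- nth [::] E i] | i <- iota 0 m].
Definition all_keys (m : nat) : seq key := [seq (s, i) | s <- [seq (s, i) | s <- iota 0 3, i <- iota 0 m], i <- iota 0 m].

Section Lie.
Variables (K : numClosedFieldType) (m : nat).
Notation I3 := ('I_3 * 'I_m * 'I_m)%type.
Notation J3 := ('I_m * 'I_m * 'I_m)%type.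
Notation W := {ffun I3 -> K^o}.
Notation TT := {ffun J3 -> K^o}.
Implicit Types (x y : W) (T : TT).

Definition codeW (i : I3) : key := (val i.1.1, val i.1.2, val i.2).
Definition codeT (i : J3) : key := (val i.1.1, val i.1.2, val i.2).
Definition validW (k : key) := [&& (k.1.1 < 3)%N, (k.1.2 < m)%N & (k.2 < m)%N].
Definition validT (k : key) := [&& (k.1.1 < m)%N, (k.1.2 < m)%N & (k.2 < m)%N].

Lemma codeW_inj : injective codeW.
Proof. by move=> [[a b] c] [[a' b'] c'] [] /val_inj-> /val_inj-> /val_inj->. Qed.
Lemma validWP k : validW k -> exists i, codeW i = k.
Proof. by case: k => -[a b] c /and3P[/= h1 h2 h3]; exists (Ordinal h1, Ordinal h2, Ordinal h3). Qed.
Lemma validTP k : validT k -> exists i, codeT i = k.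
Proof. by case: k => -[a b] c /and3P[/= h1 h2 h3]; exists (Ordinal h1, Ordinal h2, Ordinal h3). Qed.

Definition wmul x y : W := [ffun i => \sum_(j < m) x (i.1.1, i.1.2, j) * y (i.1.1, j, i.2)].
(** The derivative at the identity of the action of GL(A) x GL(B) x GL(C) on T. *)
Definition lie x T : TT := [ffun i => \sum_(p < m) x (0, i.1.1, p) * T (p, i.1.2, i.2) +
  (\sum_(p < m) x (1, i.1.2, p) * T (i.1.1, p, i.2) + \sum_(p < m) x (2, i.2, p) * T (i.1.1, i.1.2, p))].

Lemma scaleo (a : K) (b : K^o) : a *: b = a * (b : K). Proof. by []. Qed.

Lemma wmulDl a x x' y : wmul (a *: x + x') y = a *: wmul x y + wmul x' y.
Proof.
apply/ffunP => i; rewrite !ffunE /= scaleo mulr_sumr -big_split; apply: eq_bigr => j _ /=.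
by rewrite !ffunE scaleo mulrDl -mulrA.
Qed.
Lemma wmulDr a x y y' : wmul x (a *: y + y') = a *: wmul x y + wmul x y'.
Proof.
apply/ffunP => i; rewrite !ffunE /= scaleo mulr_sumr -big_split; apply: eq_bigr => j _ /=.
by rewrite !ffunE scaleo mulrDr mulrCA.
Qed.
Lemma lieDl a x x' T : lie (a *: x + x') T = a *: lie x T + lie x' T.
Proof.
apply/ffunP => i; rewrite !ffunE scaleo !mulrDr !mulr_sumr.
by rewrite [RHS]addrACA [X in _ = _ + X]addrACA; congr (_ + (_ + _)); rewrite -big_split; apply: eq_bigr => p _;
  rewrite !ffunE scaleo mulrDl -mulrA.
Qed.
Lemma lieDr a x T T' : lie x (a *: T + T') = a *: lie x T + lie x T'.
Proof.
apply/ffunP => i; rewrite !ffunE scaleo !mulrDr !mulr_sumr.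
by rewrite [RHS]addrACA [X in _ = _ + X]addrACA; congr (_ + (_ + _)); rewrite -big_split; apply: eq_bigr => p _;
  rewrite !ffunE scaleo mulrDr mulrCA.
Qed.

Lemma bilin_sum (U1 U2 U3 : lmodType K) (f : U1 -> U2 -> U3) :
  (forall a (x x' : U1) (y : U2), f (a *: x + x') y = a *: f x y + f x' y) ->
  (forall a (x : U1) (y y' : U2), f x (a *: y + y') = a *: f x y + f x y') ->
  forall A B (u : seq A) (v : seq B) (cu : A -> K) (cv : B -> K) (bu : A -> U1) (bv : B -> U2),
  f (\sum_(a <- u) cu a *: bu a) (\sum_(b <- v) cv b *: bv b) =
  \sum_(x <- [seq (a, b) | a <- u, b <- v]) (cu x.1 * cv x.2) *: f (bu x.1) (bv x.2).
Proof.
move=> fl fr A B u v cu cv bu bv.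
have f0r (x : U1) : f x 0 = 0 by have := fr 1 x 0 0; rewrite !scale1r addr0 => /eqP; rewrite -subr_eq subrr eq_sym => /eqP.
have f0l (y : U2) : f 0 y = 0 by have := fl 1 0 0 y; rewrite !scale1r addr0 => /eqP; rewrite -subr_eq subrr eq_sym => /eqP.
elim: u => [|a u IH] /=; first by rewrite !big_nil.
rewrite big_cons fl IH big_cat big_map /=; congr (_ + _).
elim: v {IH} => [|b v IH]; first by rewrite !big_nil f0r scaler0.
by rewrite !big_cons fr scalerDr IH scalerA.
Qed.

Lemma sum_delta (n : nat) (F : 'I_n -> K) (p : nat) (G : K) :
  (forall q : 'I_n, F q = (val q == p)%:R * G) -> \sum_(q < n) F q = (p < n)%:R * G.
Proof.
move=> FE; under eq_bigr do rewrite FE; case: ltnP => pn.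
  rewrite (bigD1 (Ordinal pn)) //= eqxx big1 ?addr0 // => q /negPf qp.
  by move: qp; rewrite -val_eqE /= => ->; rewrite mul0r.
rewrite big1 ?mul0r // => q _; case: eqP => [e|_]; last by rewrite mul0r.
by move: pn; rewrite -e leqNgt ltn_ord.
Qed.

Lemma wmul_base k k' : wmul (sp_base K codeW k) (sp_base K codeW k') =
  ([&& k.1.1 == k'.1.1, k.2 == k'.1.2 & (k.2 < m)%N])%:R *: sp_base K codeW (k.1.1, k.1.2, k'.2).
Proof.
case: k => -[s i] j; case: k' => -[s' j'] l; apply/ffunP => -[[a b] c].
rewrite !ffunE /= (@sum_delta _ _ j (((val a == s) && (val b == i) && (val a == s') && (j == j') && (val c == l))%:R)).
  rewrite -[RHS]/(_ * _) /codeW /= !xpair_eqE -!natrM !mulnb; congr (_%:R).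
  by case: (val a =P s) => [->|_]; rewrite ?andbF //=; case: (s == s'); case: (val b == i); case: (val c == l); case: (j == j'); rewrite ?andbF ?andbT.
move=> q; rewrite !ffunE /codeW /= !xpair_eqE -!natrM !mulnb; congr (_%:R).
case: (val q =P j) => [->|_]; last by rewrite ?andbF.
by case: (val a == s); case: (val b == i); case: (val a == s'); case: (j == j'); case: (val c == l).
Qed.

Lemma sp_mulE u v : sp_vec K codeW (sp_mul m u v) = wmul (sp_vec K codeW u) (sp_vec K codeW v).
Proof.
rewrite sp_vec_norm /sp_vec (bilin_sum wmulDl wmulDr) big_map big_filter big_mkcond.
apply: eq_bigr => -[[k z] [k' z']] _ /=; rewrite wmul_base scalerA zKM; case: ifP => _.
  by rewrite mulr1.
by rewrite mulr0 scale0r.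
Qed.

Lemma lie_base k k' : lie (sp_base K codeW k) (sp_base K codeT k') =
  ([&& (k.1.1 < 3)%N, key_get k' k.1.1 == k.2 & (k.2 < m)%N])%:R *: sp_base K codeT (key_set k' k.1.1 k.1.2).
Proof.
case: k => -[s p] q; case: k' => -[i j] l; apply/ffunP => -[[a b] c].
have h0 : \sum_(r < m) sp_base K codeW (s, p, q) (0, a, r) * sp_base K codeT (i, j, l) (r, b, c) =
    (q < m)%:R * ((s == 0)%N && (val a == p) && (q == i) && (val b == j) && (val c == l))%:R.
  apply: sum_delta => r; rewrite !ffunE /codeW /codeT /= !xpair_eqE -!natrM !mulnb; congr (_%:R).
  by case: (val r =P q) => [->|_]; rewrite ?andbF // eq_sym; case: (s == 0%N); case: (val a == p); case: (q == i); case: (val b == j); case: (val c == l).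
have h1 : \sum_(r < m) sp_base K codeW (s, p, q) (1, b, r) * sp_base K codeT (i, j, l) (a, r, c) =
    (q < m)%:R * ((s == 1)%N && (val b == p) && (q == j) && (val a == i) && (val c == l))%:R.
  apply: sum_delta => r; rewrite !ffunE /codeW /codeT /= !xpair_eqE -!natrM !mulnb; congr (_%:R).
  by case: (val r =P q) => [->|_]; rewrite ?andbF // eq_sym; case: (s == 1%N); case: (val b == p); case: (q == j); case: (val a == i); case: (val c == l).
have h2 : \sum_(r < m) sp_base K codeW (s, p, q) (2, c, r) * sp_base K codeT (i, j, l) (a, b, r) =
    (q < m)%:R * ((s == 2)%N && (val c == p) && (q == l) && (val a == i) && (val b == j))%:R.
  apply: sum_delta => r; rewrite !ffunE /codeW /codeT /= !xpair_eqE -!natrM !mulnb; congr (_%:R).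
  by case: (val r =P q) => [->|_]; rewrite ?andbF // eq_sym; case: (s == 2%N); case: (val c == p); case: (q == l); case: (val a == i); case: (val b == j).
rewrite ffunE /= h0 h1 h2 [RHS]ffunE scaleo ffunE /codeT -!natrM -!natrD; congr (_%:R).
rewrite ![key_get _ _]/= ![key_set _ _ _]/=.
case: s {h0 h1 h2} => [|[|[|s]]] /=; rewrite ?xpair_eqE ?muln0 ?addn0 ?add0n ?mulnb; rewrite 1?[q == _]eq_sym.
- by case: (q < m)%N; case: (i == q); case: (val a == p); case: (val b == j); case: (val c == l).
- by case: (q < m)%N; case: (j == q); case: (val a == i); case: (val b == p); case: (val c == l).
- by case: (q < m)%N; case: (l == q); case: (val a == i); case: (val b == j); case: (val c == p).
by case: (q < m)%N.
Qed.

Lemma sp_lieE u v : sp_vec K codeT (sp_lie m u v) = lie (sp_vec K codeW u) (sp_vec K codeT v).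
Proof.
rewrite sp_vec_norm /sp_vec (bilin_sum lieDl lieDr) big_map big_filter big_mkcond.
apply: eq_bigr => -[[k z] [k' z']] _ /=; rewrite lie_base scalerA zKM; case: ifP => _.
  by rewrite mulr1.
by rewrite mulr0 scale0r.
Qed.
End Lie.

(** * The annihilator of a tensor and its invariants *)

Section Annihilator.
Variables (K : numClosedFieldType) (m : nat).
Notation W := {ffun 'I_3 * 'I_m * 'I_m -> K^o}.
Notation TT := {ffun 'I_m * 'I_m * 'I_m -> K^o}.
Implicit Types (x y : W) (T : tensor K m) (U V : {vspace W}).

Definition lieL (T : TT) (x : W) : TT := lie x T.
Lemma lieL_lin T : linear (lieL T). Proof. by move=> a x y; exact: lieDl. Qed.
HB.instance Definition _ T := GRing.isLinear.Build K W TT _ (lieL T) (lieL_lin T).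

Definition ann T : {vspace W} := lker (linfun (lieL T)).
Lemma mem_ann T x : (x \in ann T) = (lie x (T : TT) == 0).
Proof. by rewrite memv_ker lfunE. Qed.

(** The annihilator is a Lie algebra and need not be closed under products: the scalar triple (1,
    -1, 0) kills every tensor and its square does not. So the spans of products carry further
    information. *)
Definition mulv U V : {vspace W} := <<[seq wmul x y | x <- vbasis U, y <- vbasis V]>>%VS.

Lemma wmul_span (s t : seq W) x y : x \in << s >>%VS -> y \in << t >>%VS ->
  wmul x y \in <<[seq wmul a b | a <- s, b <- t]>>%VS.
Proof.
move=> /mem_spanP[a ->] /mem_spanP[b ->]; rewrite (bilin_sum (@wmulDl K m) (@wmulDr K m)).
apply: memv_suml => -[i j] _; rewrite memvZ // memv_span //.
by apply: allpairs_f; rewrite mem_nth.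
Qed.

Lemma mem_mulv U V x y : x \in U -> y \in V -> wmul x y \in mulv U V.
Proof. by move=> xU yV; apply: wmul_span; rewrite (span_basis (vbasisP _)). Qed.

Lemma mulv_sub U V (Z : {vspace W}) : (forall x y, x \in U -> y \in V -> wmul x y \in Z) -> (mulv U V <= Z)%VS.
Proof.
move=> H; apply/span_subvP => _ /allpairsP[[x y] [/= xU yV ->]].
by apply: H; exact: vbasis_mem.
Qed.

Lemma mulv_span (s t : seq W) : mulv << s >>%VS << t >>%VS = <<[seq wmul a b | a <- s, b <- t]>>%VS.
Proof.
apply/eqP; rewrite eqEsubv; apply/andP; split.
  by apply: mulv_sub => x y; exact: wmul_span.
apply/span_subvP => _ /allpairsP[[x y] [/= xs yt ->]].
by apply: mem_mulv; exact: memv_span.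
Qed.

(** One-sided, because an injective linear map that preserves products and sends one annihilator
    into the other yields inequalities; equalities follow from the symmetry of the orbit
    relation. *)
Definition inv_le T T' := [/\ (\dim (ann T) <= \dim (ann T'))%N,
  (\dim (mulv (ann T) (ann T)) <= \dim (mulv (ann T') (ann T')))%N &
  (\dim (mulv (mulv (ann T) (ann T)) (ann T)) <= \dim (mulv (mulv (ann T') (ann T')) (ann T')))%N].

Lemma inv_le_phi T T' (phi : W -> W) : linear phi -> injective phi ->
  (forall x y, phi (wmul x y) = wmul (phi x) (phi y)) ->
  (forall x, x \in ann T -> phi x \in ann T') -> inv_le T T'.
Proof.
move=> lphi iphi mphi aphi.
pose f := linfun (HB.pack phi (GRing.isLinear.Build _ _ _ _ phi lphi) : {linear W -> W}).
have fE x : f x = phi x by rewrite lfunE.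
have df U : \dim (f @: U) = \dim U.
  apply: limg_dim_eq; apply/eqP; rewrite -subv0; apply/subvP => x.
  rewrite memv_cap memv_ker fE memv0 => /andP[_ /eqP h]; apply/eqP/iphi.
  by rewrite h -fE linear0.
have fA : (f @: ann T <= ann T')%VS.
  by apply/subvP => _ /memv_imgP[x xA ->]; rewrite fE aphi.
have fM U V U' V' : (f @: U <= U')%VS -> (f @: V <= V')%VS -> (f @: mulv U V <= mulv U' V')%VS.
  move=> /subvP fU /subvP fV; rewrite limg_span; apply/span_subvP => _ /mapP[_ /allpairsP[[x y] [/= xU yV ->]] ->].
  by rewrite fE mphi -!fE mem_mulv // ?fU ?fV // memv_img // vbasis_mem.
split; rewrite -df dimvS //; first by apply: (fM).
by apply: (fM _ _ _ _ (fM _ _ _ _ _ _)).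
Qed.

Lemma inv_le_trans T T' T'' : inv_le T T' -> inv_le T' T'' -> inv_le T T''.
Proof. by move=> [a b c] [a' b' c']; split; [exact: leq_trans a'|exact: leq_trans b'|exact: leq_trans c']. Qed.

Definition wmx x (s : 'I_3) : 'M[K]_m := \matrix_(i, j) x (s, i, j).
Lemma wmx_inj x y : (forall s, wmx x s = wmx y s) -> x = y.
Proof. by move=> H; apply/ffunP => -[[s i] j]; have /matrixP/(_ i j) := H s; rewrite !mxE. Qed.
Lemma wmx_mul x y s : wmx (wmul x y) s = wmx x s *m wmx y s.
Proof. by apply/matrixP => i j; rewrite !mxE ffunE /=; apply: eq_bigr => k _; rewrite !mxE. Qed.
Lemma wmx_lin a x y s : wmx (a *: x + y) s = a *: wmx x s + wmx y s.
Proof. by apply/matrixP => i j; rewrite !mxE !ffunE. Qed.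

Lemma contractA_lie x T f : contractA (lie x (T : TT) : tensor K m) f =
  contractA T (f *m wmx x 0) + (wmx x 1 *m contractA T f + contractA T f *m (wmx x 2)^T).
Proof.
apply/matrixP => j k; rewrite !mxE; under eq_bigr do rewrite ffunE /= !mulrDr.
rewrite !big_split /=; congr (_ + (_ + _)).
- under eq_bigr do rewrite mulr_sumr; rewrite exchange_big; apply: eq_bigr => p _ /=.
  by rewrite mxE mulr_suml; apply: eq_bigr => i _; rewrite mxE mulrA.
- under eq_bigr do rewrite mulr_sumr; rewrite exchange_big; apply: eq_bigr => p _ /=.
  by rewrite !mxE mulr_sumr; apply: eq_bigr => i _; rewrite mulrCA.
under eq_bigr do rewrite mulr_sumr; rewrite exchange_big; apply: eq_bigr => p _ /=.
by rewrite !mxE mulr_suml; apply: eq_bigr => i _; rewrite mulrCA [RHS]mulrC.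
Qed.

Lemma mem_annP x T : x \in ann T <-> forall f,
  contractA T (f *m wmx x 0) + (wmx x 1 *m contractA T f + contractA T f *m (wmx x 2)^T) = 0.
Proof.
rewrite mem_ann; split=> [/eqP e f|H].
  by rewrite -contractA_lie e; apply/matrixP => j k; rewrite !mxE big1 // => i _; rewrite ffunE mulr0.
apply/eqP; apply: (@contractA_inj K m) => f; rewrite contractA_lie H.
by apply/matrixP => j k; rewrite !mxE big1 // => i _; rewrite ffunE mulr0.
Qed.

Lemma inv_le_gl g h k T : g \in unitmx -> h \in unitmx -> k \in unitmx -> inv_le T (gl_act g h k T).
Proof.
move=> gU hU kU; pose G (s : 'I_3) := if s == 0 then g else if s == 1 then h else k.
have GU s : G s \in unitmx by rewrite /G; case: ifP => // _; case: ifP.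
pose phi x : W := [ffun i => (G i.1.1 *m wmx x i.1.1 *m invmx (G i.1.1)) i.1.2 i.2].
have phiE x s : wmx (phi x) s = G s *m wmx x s *m invmx (G s).
  by apply/matrixP => i j; rewrite mxE ffunE.
apply: (@inv_le_phi _ _ phi).
- move=> a x y; apply: wmx_inj => s; rewrite wmx_lin !phiE wmx_lin.
  by rewrite mulmxDr mulmxDl -scalemxAr -scalemxAl.
- move=> x y e; apply: wmx_inj => s; have := congr1 (wmx^~ s) e; rewrite !phiE => h'.
  have GV : invmx (G s) \in unitmx by rewrite unitmx_inv.
  by move/(can_inj (mulmxK GV)): h' => /(can_inj (mulKmx (GU s))).
- by move=> x y; apply: wmx_inj => s; rewrite phiE !wmx_mul !phiE !mulmxA mulmxKV.
move=> x /mem_annP H; apply/mem_annP => f; rewrite !contractA_act !phiE /G /=.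
have e0 : f *m (g *m wmx x 0 *m invmx g) *m g = (f *m g) *m wmx x 0 by rewrite !mulmxA mulmxKV.
have e1 : h *m wmx x 1 *m invmx h *m (h *m contractA T (f *m g) *m k^T) =
   h *m (wmx x 1 *m contractA T (f *m g)) *m k^T by rewrite !mulmxA mulmxKV.
have e2 : h *m contractA T (f *m g) *m k^T *m (k *m wmx x 2 *m invmx k)^T =
   h *m (contractA T (f *m g) *m (wmx x 2)^T) *m k^T.
  rewrite !trmx_mul !mulmxA trmx_inv; congr (_ *m _); rewrite mulmxK // unitmx_tr //.
rewrite e0 e1 e2 -!mulmxDl -!mulmxDr H mulmx0 mul0mx //.
Qed.

Lemma inv_le_perm s T : inv_le (perm_factors s T) T.
Proof.
pose phi x : W := [ffun i => x (s i.1.1, i.1.2, i.2)].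
apply: (@inv_le_phi _ _ phi).
- by move=> a x y; apply/ffunP => i; rewrite !ffunE.
- move=> x y /ffunP e; apply/ffunP => -[[t i] j]; have := e (s^-1%g t, i, j).
  by rewrite !ffunE /= permKV.
- by move=> x y; apply/ffunP => i; rewrite !ffunE /=; apply: eq_bigr => j _; rewrite !ffunE.
move=> x; rewrite !mem_ann => /eqP/ffunP e; apply/eqP/ffunP => -[[a b] c].
rewrite ffunE [RHS]ffunE /=.
have p0 (i : 'I_m) j : phi x (0, i, j) = x (s 0, i, j) by rewrite ffunE.
have p1 (i : 'I_m) j : phi x (1, i, j) = x (s 1, i, j) by rewrite ffunE.
have p2 (i : 'I_m) j : phi x (2, i, j) = x (s 2, i, j) by rewrite ffunE.
under eq_bigr do rewrite p0; under [X in _ + (X + _)]eq_bigr do rewrite p1.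
under [X in _ + (_ + X)]eq_bigr do rewrite p2.
case: (S3_cases s) => -[] [e0 e1 e2]; rewrite e0 e1 e2.
- have := e (a, b, c); rewrite [lie _ _ _]ffunE [X in _ = X]ffunE /= => h; rewrite -[RHS]h.
  by congr (_ + (_ + _)); apply: eq_bigr => p _; rewrite perm_factors_val e0 e1 e2.
- have := e (a, c, b); rewrite [lie _ _ _]ffunE [X in _ = X]ffunE /= => h; rewrite -[RHS]h; rewrite [X in _ = _ + X]addrC.
  by congr (_ + (_ + _)); apply: eq_bigr => p _; rewrite perm_factors_val e0 e1 e2.
- have := e (b, a, c); rewrite [lie _ _ _]ffunE [X in _ = X]ffunE /= => h; rewrite -[RHS]h; rewrite [RHS]addrCA.
  by congr (_ + (_ + _)); apply: eq_bigr => p _; rewrite perm_factors_val e0 e1 e2.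
- have := e (c, a, b); rewrite [lie _ _ _]ffunE [X in _ = X]ffunE /= => h; rewrite -[RHS]h; rewrite [RHS]addrC -addrA.
  by congr (_ + (_ + _)); apply: eq_bigr => p _; rewrite perm_factors_val e0 e1 e2.
- have := e (b, c, a); rewrite [lie _ _ _]ffunE [X in _ = X]ffunE /= => h; rewrite -[RHS]h; rewrite [RHS]addrA [RHS]addrC.
  by congr (_ + (_ + _)); apply: eq_bigr => p _; rewrite perm_factors_val e0 e1 e2.
have := e (c, b, a); rewrite [lie _ _ _]ffunE [X in _ = X]ffunE /= => h; rewrite -[RHS]h; rewrite [RHS]addrC -addrA [RHS]addrCA.
by congr (_ + (_ + _)); apply: eq_bigr => p _; rewrite perm_factors_val e0 e1 e2.
Qed.

Lemma orbit_inv_le T T' : tensor_orbit T T' -> inv_le T' T.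
Proof.
move=> [s [g [h [k [gU hU kU ->]]]]]; apply: inv_le_trans (inv_le_perm s T).
have := @inv_le_gl (invmx g) (invmx h) (invmx k) (gl_act g h k (perm_factors s T)).
rewrite !unitmx_inv gl_act_comp !mulVmx // gl_act1; exact.
Qed.
End Annihilator.

(** * Computation of the invariants *)

Definition sp_images (m : nat) (E : model) : seq sparse :=
  [seq sp_lie m [:: (k, BinNums.Zpos BinNums.xH)] (sp_tens m E) | k <- all_keys m].
(* Row reduction of the matrix of [lie] augmented by the identity, whose columns are the keys
   shifted by 10: the rows that vanish on the left block give candidates for a basis of the kernel. *)
Definition sp_kernel (m : nat) (E : model) : seq sparse :=
  (foldl (fun (st : seq (key * sparse) * seq sparse) v =>
     let v' := sp_reduce st.1 v in
     if [seq e.1 | e <- v' & (e.1.1.1 < 10)%N] is k :: _ then (rcons st.1 (k, v'), st.2)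
     else (st.1, [seq (((e.1.1.1 - 10)%N, e.1.1.2, e.1.2), e.2) | e <- v'] :: st.2))
   ([::], [::])
   [seq sp_lie m [:: (k, BinNums.Zpos BinNums.xH)] (sp_tens m E) ++
        [:: (((k.1.1 + 10)%N, k.1.2, k.2), BinNums.Zpos BinNums.xH)] | k <- all_keys m]).2.
Definition sp_prods (m : nat) (us vs : seq sparse) := [seq sp_mul m u v | u <- us, v <- vs].
(** The result of [sp_kernel] is certified afterwards: the candidates kill the tensor, they are
    independent, and their number plus the rank of [lie] is 3 m^2, so by rank and nullity they form
    a basis of the annihilator. The second component spans the products. *)
Definition lie_data (m : nat) (E : model) : option (seq sparse * seq sparse) :=
  let t := sp_tens m E in
  let ks := sp_kernel m E in
  if sp_elim (validT m) (sp_images m E) is Some R then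
    if sp_elim (validW m) ks is Some B1 then
      if [&& size B1 == size ks, (size ks + size R == 3 * m * m)%N &
             all (fun u => sp_lie m u t == [::]) ks] then
        if sp_elim (validW m) (sp_prods m ks ks) is Some B2
        then Some (ks, [seq pb.2 | pb <- B2]) else None
      else None
    else None
  else None.
(** Kept out of [lie_data] because triple products are only needed for pairs of models whose first
    two dimensions agree. *)
Definition cube_size (m : nat) (d : seq sparse * seq sparse) : option nat :=
  omap size (sp_elim (validW m) (sp_prods m d.2 d.1)).

Section Data.
Variables (K : numClosedFieldType) (n : nat).
Notation m := n.+1.
Notation W := {ffun 'I_3 * 'I_m * 'I_m -> K^o}.
Notation TT := {ffun 'I_m * 'I_m * 'I_m -> K^o}.
Notation vecW := (sp_vec K (@codeW m)).
Notation vecT := (sp_vec K (@codeT m)).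

Lemma sp_coef_cat k u v : sp_coef k (u ++ v) = BinInt.Z.add (sp_coef k u) (sp_coef k v).
Proof. by elim: u => //= e u ->; case: ifP => // _; rewrite BinInt.Z.add_assoc. Qed.

Lemma sp_tensE (E : model) : vecT (sp_tens m E) = (tens K n E : TT).
Proof.
apply/ffunP => -[[i j] k]; rewrite sp_coefE ffunE slice_mx_coef; congr zK.
rewrite /sp_tens /codeT /=.
have blk i' l : sp_coef (val i, val j, val k) [seq ((i', e.1.1, e.1.2), Z_of_int e.2) | e <- l] =
    if i' == i :> nat then slice_coef l j k else BinNums.Z0.
  elim: l => [|e l IH] /=; first by case: ifP.
  rewrite IH !xpair_eqE -andbA; case: (i' == i :> nat) => //=.
have H r : uniq r -> sp_coef (val i, val j, val k) (flatten [seq [seq ((i', e.1.1, e.1.2), Z_of_int e.2) | e <- nth [::] E i'] | i' <- r]) =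
    if val i \in r then slice_coef (nth [::] E i) j k else BinNums.Z0.
  elim: r => [|i' r IH] //= /andP[ir /IH{}IH]; rewrite sp_coef_cat blk IH inE eq_sym.
  case: (val i =P i') => [e|_] /=; last by case: (_ \in r).
  by rewrite -e in ir *; rewrite (negPf ir) BinInt.Z.add_0_r.
have hi : val i \in iota 0 m by rewrite mem_iota ltn_ord.
by have := H _ (iota_uniq 0 m); rewrite hi => ->.
Qed.

Lemma lie_dataP (E : model) ks bs (A := ann (tens K n E)) : lie_data m E = Some (ks, bs) ->
  [/\ A = <<[seq vecW u | u <- ks]>>%VS, \dim A = size ks,
      mulv A A = <<[seq vecW u | u <- bs]>>%VS & \dim (mulv A A) = size bs].
Proof.
rewrite /lie_data; case eR : (sp_elim _ _) => [R|//]; case eB1 : (sp_elim _ _) => [B1|//].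
case: ifP => // /and3P[/eqP s1 /eqP sR /allP ck]; case eB2 : (sp_elim _ _) => [B2|//] [ksE <-].
rewrite ksE in eB1 s1 sR ck eB2; set kk := ks in eB1 s1 sR ck eB2 *.
have [_ dR] := sp_elimP K (@validTP m) eR.
have [_ dK] := sp_elimP K (@validWP m) eB1.
have [sB2 dB2] := sp_elimP K (@validWP m) eB2.
have full : (fullv : {vspace W}) = <<[seq sp_base K (@codeW m) k | k <- all_keys m]>>%VS.
  apply/eqP; rewrite eqEsubv subvf andbT; apply/subvP => x _.
  have -> : x = \sum_i x i *: sp_base K (@codeW m) (codeW i).
    apply/ffunP => i; rewrite sum_ffunE (bigD1 i) //= big1 => [|j ji].
      by rewrite !ffunE eqxx addr0 scaleo mulr1.
    by rewrite !ffunE (inj_eq (@codeW_inj m)) eq_sym (negPf ji) scaler0.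
  apply: memv_suml => -[[s i] j] _; rewrite memvZ // memv_span // map_f //.
  have io (k N : nat) : (k < N)%N -> k \in iota 0 N by rewrite mem_iota.
  apply/allpairsP; exists ((val s, val i), val j); split; [ | exact: io (ltn_ord j) | by []].
  by apply/allpairsP; exists (val s, val i); split; [exact: io (ltn_ord s) | exact: io (ltn_ord i) | by []].
have img : (linfun (lieL (tens K n E : TT)) @: fullv)%VS = <<[seq vecT v | v <- sp_images m E]>>%VS.
  rewrite full limg_span; congr span; rewrite /sp_images -!map_comp; apply: eq_map => k /=.
  rewrite lfunE /= sp_lieE sp_tensE /lieL; congr lie.
  by rewrite /sp_vec big_seq1 scale1r.
have dA : \dim A = size ks.
  have := limg_ker_dim (linfun (lieL (tens K n E : TT))) fullv.
  rewrite capfv -/(ann (tens K n E)) img dR dimvf /dim /= !card_prod !card_ord muln1 => e.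
  by apply/eqP; rewrite -(eqn_add2r (size R)) sR; apply/eqP.
have AE : A = <<[seq vecW u | u <- ks]>>%VS.
  apply/esym/eqP; rewrite eqEdim dA dK s1 leqnn andbT; apply/span_subvP => _ /mapP[u uk ->].
  rewrite mem_ann -sp_tensE -sp_lieE; have /eqP -> := ck u uk.
  by rewrite /sp_vec big_nil.
have mE us vs : mulv <<[seq vecW u | u <- us]>>%VS <<[seq vecW u | u <- vs]>>%VS =
    <<[seq vecW u | u <- sp_prods m us vs]>>%VS.
  rewrite mulv_span; congr span; rewrite /sp_prods map_allpairs allpairs_mapl allpairs_mapr.
  by apply: eq_allpairs => u v; rewrite sp_mulE.
split=> //; first by rewrite AE mE -sB2 -map_comp.
by rewrite AE mE dB2 size_map.
Qed.

Lemma cube_sizeP (E : model) d c (A := ann (tens K n E)) : lie_data m E = Some d -> cube_size m d = Some c ->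
  \dim (mulv (mulv A A) A) = c.
Proof.
case: d => ks bs /lie_dataP[AE _ AAE _]; rewrite /cube_size /=; case eB : (sp_elim _ _) => [B|//] [<-].
have [_ dB] := sp_elimP K (@validWP m) eB.
rewrite /A AAE AE mulv_span -dB; congr (\dim (span _)).
rewrite /sp_prods map_allpairs allpairs_mapl allpairs_mapr.
by apply: eq_allpairs => u v; rewrite sp_mulE.
Qed.

Definition data_neq (d d' : option (seq sparse * seq sparse)) : bool :=
  if d is Some d then if d' is Some d' then
    if (size d.1, size d.2) == (size d'.1, size d'.2) then
      if cube_size m d is Some c then if cube_size m d' is Some c' then c != c' else false else false
    else true
  else false else false.

Lemma orbit_data_neq (E E' : model) : data_neq (lie_data m E) (lie_data m E') ->
  tensor_orbit (tens K n E) <> tensor_orbit (tens K n E').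
Proof.
move=> h e; have o : tensor_orbit (tens K n E) (tens K n E') by rewrite e; exact: orbit_refl.
have [l1 l2 l3] := orbit_inv_le o; have [g1 g2 g3] := orbit_inv_le (orbit_sym o).
move: h; rewrite /data_neq; case eD : (lie_data m E) => [[ks bs]|//]; case eD' : (lie_data m E') => [[ks' bs']|//] /=.
have [_ d1 _ d2] := lie_dataP eD; have [_ d1' _ d2'] := lie_dataP eD'.
have -> : size ks = size ks' by rewrite -d1 -d1'; apply/eqP; rewrite eqn_leq l1 g1.
have -> : size bs = size bs' by rewrite -d2 -d2'; apply/eqP; rewrite eqn_leq l2 g2.
rewrite eqxx; case eC : (cube_size _ _) => [c|//]; case eC' : (cube_size _ _) => [c'|//] /eqP; apply.
by rewrite -(cube_sizeP eD eC) -(cube_sizeP eD' eC'); apply/eqP; rewrite eqn_leq l3 g3.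
Qed.
End Data.

Definition separated (n : nat) (T : seq model) : bool :=
  pairwise (data_neq n) [seq lie_data n.+1 E | E <- T].

Lemma separated1 : separated 0 models1. Proof. by vm_compute. Qed.
Lemma separated2 : separated 1 models2. Proof. by vm_compute. Qed.
Lemma separated3 : separated 2 models3. Proof. by vm_compute. Qed.
Lemma separated4 : separated 3 models4. Proof. by vm_compute. Qed.
Lemma separated5 : separated 4 models5. Proof. by vm_compute. Qed.

(** * Counting the orbits *)

Definition complex_field (R : realType) : numClosedFieldType := R[i]%C.

(** The values given to the parameter t of the degenerations. *)
Definition harmonicC (R : realType) (k : nat) : complex_field R := (k.+1%:R^-1)%:C%C.

Lemma harmonicC_cvg0 (R : realType) : @harmonicC R @ \oo --> 0.
Proof.
apply/cvgrPdist_lt => e e0.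
(* In the order of R[i] a positive element is real, which reduces the claim to the real harmonic
   sequence. *)
have re : e = (complex.Re e)%:C%C by case: e e0 => a b; rewrite ltcE /= => /andP[/eqP-> _].
have e0' : 0 < complex.Re e by move: e0; rewrite {1}re ltcE /= eqxx.
have /cvgrPdist_lt/(_ _ e0') := @cvg_harmonic R.
move=> H; near=> k; have : `|0 - harmonic k| < complex.Re e by near: k; exact: H.
rewrite !sub0r !normrN {2}re /harmonicC normc_def /= expr0n /= addr0 sqrtr_sqr ltcR.
exact.
Unshelve. all: by end_near. Qed.

Lemma card_orbits (R : realType) (n : nat) (T : seq model) (D : seq border_dec) :
  (forall V : {vspace 'M[R[i]%C]_n.+1}, comm_subalg V -> \dim V = n.+1 -> fits_one V T) ->
  wf_models n.+1 T -> all2 (check_dec n.+1) T D && all (check_concise n.+1) T ->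
  separated n T -> min_br_one_star_orbits R[i]%C n.+1 #= `I_(size T).
Proof.
move=> cls wT /andP[cD /allP cC] sT.
pose F j := tensor_orbit (tens R[i]%C n (nth [::] T j)).
have min j : (j < size T)%N -> minimal_border_rank (tens R[i]%C n (nth [::] T j)) /\
    one_star_generic (tens R[i]%C n (nth [::] T j)).
  move=> jT; have t0 k : harmonicC R k != 0.
    by rewrite /harmonicC eq_complex /= eqxx andbT invr_eq0 pnatr_eq0.
  apply: (minimal_of_check (d := nth (0%N, 0, [::]) D j) t0 (@harmonicC_cvg0 R)).
    move: cD; rewrite all2E => /andP[/eqP sD /allP h].
    apply: (h (nth [::] T j, nth (0%N, 0, [::]) D j)).
    by rewrite -nth_zip // mem_nth // size_zip -sD minnn.
  by apply: cC; exact: mem_nth.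
have -> : min_br_one_star_orbits R[i]%C n.+1 = F @` `I_(size T).
  apply/seteqP; split=> [_ [S [mS gS] <-]|_ [j /= jT <-]]; last first.
    by exists (tens R[i]%C n (nth [::] T j)) => //; exact: min.
  have [E ET o] := minimal_border_orbit mS gS cls wT.
  exists (index E T); first by rewrite /= index_mem.
  by rewrite /F nth_index //; apply/esym/orbit_eq.
apply: inj_card_eq => j k; rewrite !inE /= => jT kT e.
have neq j' k' : (j' < k')%N -> (k' < size T)%N -> F j' <> F k'.
  move=> jk kT'; apply: orbit_data_neq; have jT' := ltn_trans jk kT'.
  move: sT; rewrite /separated => /(pairwiseP None)/(_ j' k'); rewrite !inE size_map.
  by move=> /(_ jT' kT' jk); rewrite !(nth_map [::]).
case: (ltngtP j k) => // h; first by case: (neq _ _ h kT).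
by case: (neq _ _ h jT).
Qed.

Local Close Scope ring_scope.

Theorem theorem1p2 (R : realType) :
  [/\ min_br_one_star_orbits R[i]%C 1 #= `I_1,
      min_br_one_star_orbits R[i]%C 2 #= `I_2,
      min_br_one_star_orbits R[i]%C 3 #= `I_4,
      min_br_one_star_orbits R[i]%C 4 #= `I_11
    & min_br_one_star_orbits R[i]%C 5 #= `I_32].
Proof.
split.
- exact: card_orbits (@class1 _) wf_models1 check1 separated1.
- exact: card_orbits (@class2 _) wf_models2 check2 separated2.
- exact: card_orbits (@class3 _) wf_models3 check3 separated3.
- exact: card_orbits (@class4 _) wf_models4 check4 separated4.
exact: card_orbits (@class5 _) wf_models5 check5 separated5.
Qed.
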